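(* Assume the uniform minorization condition, the uniform drift condition and the Lipschitz perturbation condition, and that $g\in\mathscr{L}_{V^{r}}$ for some $r\in[0,\tfrac12)$. Consider the SMC algorithm without resampling with $N$ particles in dimension $d$ and $d$ bridging steps, and $$\mathrm{ESS}_{(0,d)}(N)=\frac{\big(\sum_{i=1}^N w_d(X^i_{0:d-1})\big)^2}{\sum_{i=1}^N w_d(X^i_{0:d-1})^2},\qquad w_d(X^i_{0:d-1})=\exp\Big\{\frac{1-\phi_0}{d}\sum_{j=1}^d\sum_{n=1}^d g(X^i_{n-1,j})\Big\}.$$ Then for any fixed $N>1$, as $d\to\infty$, $\mathrm{ESS}_{(0,d)}(N)$ converges in distribution to $$\varepsilon_N:=\frac{[\sum_{i=1}^N e^{X_i}]^2}{\sum_{i=1}^N e^{2X_i}},$$ where $X_1,\dots,X_N$ are i.i.d. $\mathcal N(0,\sigma^2_\star)$ with $$\sigma^2_\star=(1-\phi_0)\int_{\phi_0}^{1}\pi_u\big(\widehat g_u^{\,2}-k_u(\widehat g_u)^2\big)\,du .$$ In particular, $$\lim_{d\to\infty}\mathbb E\big[\mathrm{ESS}_{(0,d)}(N)\big]=\mathbb E\bigg[\frac{[\sum_{i=1}^N e^{X_i}]^2}{\sum_{i=1}^N e^{2X_i}}\bigg].$$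
   Context: Setting. $g:\mathbb R\to\mathbb R$ is measurable and bounded above, and $\pi(x)=e^{g(x)}$ is a probability density on $\mathbb R$ (Lebesgue measure). $\phi_0\in(0,1)$ is fixed. For $s\in[\phi_0,1]$, $\pi_s$ is the probability density $\pi_s(x)\propto e^{s\,g(x)}$ (assumed normalizable; the same symbol denotes the measure). For $s\in(\phi_0,1]$, $k_s$ is a Markov kernel on $(\mathbb R,\mathscr B(\mathbb R))$ with $\pi_sk_s=\pi_s$; by convention $k_{\phi_0}(x,\cdot)=\pi_{\phi_0}(\cdot)$. For $d\ge1$ and $0\le n\le d$: $\phi_n=\phi_{n,d}=\phi_0+n(1-\phi_0)/d$, $\pi_n:=\pi_{\phi_n}$, $k_n:=k_{\phi_n}$ (all depending on $d$). SMC without resampling. The target is $\prod_{j=1}^d\pi(x_j)$ on $\mathbb R^d$. There are $N$ particles $X^i_n=(X^i_{n,1},\dots,X^i_{n,d})$, $0\le n\le d$. The $Nd$ scalar chains $\{X^i_{n,j}\}_{n=0}^d$ are independent, each with $X^i_{0,j}\sim\pi_{\phi_0}$ and $X^i_{n,j}\mid X^i_{n-1,j}=x\sim k_n(x,\cdot)$. Notation. $P(f)(x)=\int P(x,dy)f(y)$ and $\mu(f)=\int f\,d\mu$. For $V:\mathbb R\to[1,\infty)$: $|f|_V=\sup_x|f(x)|/V(x)$, $\mathscr L_V=\{f:|f|_V<\infty\}$, and $|||P-Q|||_V=\sup_x V(x)^{-1}\sup_{|f|\le V}|P(f)(x)-Q(f)(x)|$. $\widehat g_u=\sum_{l\ge0}[k_u^l-\pi_u](g)$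 is the solution of the Poisson equation $g-\pi_u(g)=\widehat g_u-k_u(\widehat g_u)$. Uniform minorization condition: there are a Borel set $C$, $\theta\in(0,1)$ and a probability $\nu$ on $\mathbb R$ with $k_s(x,A)\ge\theta\,\nu(A)$ for all $s\in(\phi_0,1]$, $x\in C$ and Borel $A$. Uniform drift condition: there are $V:\mathbb R\to[1,\infty)$ with $\lim_{|x|\to\infty}V(x)=\infty$, $\lambda<1$, $b<\infty$ such that, with the same $C$, $k_s(V)(x)\le\lambda V(x)+b\,\mathbb I_C(x)$ for all $x\in\mathbb R$, $s\in(\phi_0,1]$; moreover $\pi_{\phi_0}(V)<\infty$. Lipschitz perturbation condition: there is $M<\infty$ with $|||k_s-k_t|||_V\le M|s-t|$ for all $s,t\in(\phi_0,1]$ (same $V$). *)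

(* Defs.v *)
From mathcomp Require Import all_boot all_order all_algebra.
From mathcomp Require Import all_classical all_reals all_analysis.

Set Implicit Arguments.
Unset Strict Implicit.
Unset Printing Implicit Defensive.

Import Order.TTheory GRing.Theory Num.Theory.
Import numFieldNormedType.Exports.

Local Open Scope classical_set_scope.
Local Open Scope ring_scope.

Section kernels_on_the_line.
Context {R : realType}.
Local Notation RR := (measurableTypeR R).
Implicit Types (g V f : R -> R) (pi : R -> probability RR R).
Implicit Types (k : R -> R.-pker RR ~> RR).

(* [pi s] is the probability with Lebesgue density proportional to
   [expR (s * g x)], for [s] in [[phi0, 1]]. *)
Definition tempered_family (phi0 : R) g pi :=
  forall s, phi0 <= s <= 1 ->
    lebesgue_measure.-integrable [set: R] (fun x => (expR (s * g x))%:E) /\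
    forall A, measurable A ->
      pi s A = (\int[lebesgue_measure]_(x in A)
        (expR (s * g x) / (\int[lebesgue_measure]_y expR (s * g y))%R)%:E)%E.

Definition invariant_law (mu : probability RR R) (K : R.-pker RR ~> RR) :=
  forall A, measurable A -> (\int[mu]_x K x A)%E = mu A.

(* Bridging temperatures [phi_n = phi0 + n (1 - phi0) / d]. *)
Definition temperature (phi0 : R) (d n : nat) : R :=
  phi0 + n%:R * (1 - phi0) / d%:R.

Definition kop (K : R.-pker RR ~> RR) f : R -> R :=
  fun x => (\int[K x]_y f y)%R.

Definition weighted_norm V f : \bar R :=
  ereal_sup [set (`|f x| / V x)%:E | x in [set: R]].

Definition L_weighted V f := (weighted_norm V f < +oo)%E.

(* As always for kernels acting on functions, the inner supremum is over
   measurable functions. *)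
Definition kernel_dist V (K L : R.-pker RR ~> RR) : \bar R :=
  ereal_sup [set ((V x)^-1%:E *
    ereal_sup [set `|\int[K x]_y (f y)%:E - \int[L x]_y (f y)%:E|
              | f in [set f : R -> R | measurable_fun [set: RR] f /\
                              forall y, (`|f y| <= V y)%R]])%E
  | x in [set: R]].

Definition uniform_minorization (phi0 : R) k
    (C : set RR) (theta : R) (nu : probability RR R) :=
  [/\ measurable C, 0 < theta < 1 &
    forall s x A, phi0 < s <= 1 -> C x -> measurable A ->
      (theta%:E * nu A <= k s x A)%E].

Definition uniform_drift (phi0 : R) pi k
    (C : set RR) V (lambda b : R) :=
  [/\ measurable_fun [set: RR] V,
      (forall x, 1 <= V x),
      (V x @[x --> +oo] --> +oo /\ V x @[x --> -oo] --> +oo),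
      lambda < 1 &
      (forall s x, phi0 < s <= 1 ->
        (\int[k s x]_y (V y)%:E <= (lambda * V x + b * \1_C x)%:E)%E) /\
      (\int[pi phi0]_x (V x)%:E < +oo)%E].

Definition lipschitz_perturbation (phi0 : R) k V (M : R) :=
  forall s t, phi0 < s <= 1 -> phi0 < t <= 1 ->
    (kernel_dist V (k s) (k t) <= (M * `|s - t|)%:E)%E.

(* [sum_(l >= 0) (k_u^l - pi_u)(g)], as a pointwise limit of partial sums. *)
Definition poisson_solution g pi k (u : R) : R -> R := fun x =>
  limn (series (fun l : nat => iter l (kop (k u)) g x - (\int[pi u]_y g y)%R)).

Definition sigma2_star (phi0 : R) g pi k : R :=
  (1 - phi0) *
  (\int[lebesgue_measure]_(u in `[phi0, 1])
    (\int[pi u]_x (poisson_solution g pi k u x ^+ 2 -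
                   kop (k u) (poisson_solution g pi k u) x ^+ 2))%R)%R.

(* The centered normal law of variance [v].  The library's [normal_prob] takes
   the standard deviation and is the uniform law on [[0, 1]] when the latter is
   0, whereas N(0, 0) is the Dirac mass at 0. *)
Definition centered_normal (v : R) : set RR -> \bar R :=
  if v == 0 then \d_(0 : RR) else normal_prob 0 (Num.sqrt v).

End kernels_on_the_line.

Section random_variables.
Context {R : realType}.
Local Notation RR := (measurableTypeR R).

Definition sigma_rv d (Om : measurableType d) (P : probability Om R)
    (Y : {RV P >-> RR}) : set (set Om) :=
  [set Y @^-1` B | B in measurable].

(* The sigma-algebra generated by the [Y n] with [n] in [D]. *)
Definition sigma_process d (Om : measurableType d) (P : probability Om R)
    (D : set nat) (Y : nat -> {RV P >-> RR}) : set (set Om) :=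
  <<s \bigcup_(n in D) sigma_rv (Y n) >>.

Definition mutually_independent d (Om : measurableType d)
    (P : probability Om R) (I : finType) (F : I -> set (set Om)) :=
  forall (J : {set I}) (E : I -> set Om), (forall i, i \in J -> F i (E i)) ->
    P (\bigcap_(i in [set` J]) E i) = (\prod_(i in J) P (E i))%E.

(* [Y 0, ..., Y d] is a Markov chain with initial law [mu] and transition
   kernel [K n] from time [n - 1] to time [n]. *)
Definition markov_chain d0 (Om : measurableType d0) (P : probability Om R)
    (d : nat) (mu : probability RR R) (K : nat -> R.-pker RR ~> RR)
    (Y : nat -> {RV P >-> RR}) :=
  (forall A, measurable A -> distribution P (Y 0%N) A = mu A) /\
  (forall n, (0 < n <= d)%N ->
    forall E, sigma_process [set m | (m < n)%N] Y E ->
    forall B, measurable B ->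
      P (E `&` Y n @^-1` B) = (\int[P]_(w in E) K n (Y n.-1 w) B)%E).

(* [X i j n] is the coordinate [j] of the particle [i] at time [n]; only the
   times [n <= d] matter. *)
Definition smc_no_resampling d0 (Om : measurableType d0)
    (P : probability Om R) (N d : nat) (phi0 : R)
    (pi : R -> probability RR R) (k : R -> R.-pker RR ~> RR)
    (X : 'I_N -> 'I_d -> nat -> {RV P >-> RR}) :=
  (forall i j, markov_chain d (pi phi0)
                 (fun n => k (temperature phi0 d n)) (X i j)) /\
  mutually_independent P
    (fun ij : 'I_N * 'I_d =>
       sigma_process [set n | (n <= d)%N] (X ij.1 ij.2)).

Definition smc_weight d0 (Om : measurableType d0)
    (P : probability Om R) (N d : nat) (phi0 : R) (g : R -> R)
    (X : 'I_N -> 'I_d -> nat -> {RV P >-> RR}) (i : 'I_N) (w : Om) : R :=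
  expR ((1 - phi0) / d%:R *
        \sum_(j < d) \sum_(1 <= n < d.+1) g (X i j n.-1 w)).

Definition ESS d0 (Om : measurableType d0)
    (P : probability Om R) (N d : nat) (phi0 : R) (g : R -> R)
    (X : 'I_N -> 'I_d -> nat -> {RV P >-> RR}) (w : Om) : R :=
  (\sum_(i < N) smc_weight phi0 g X i w) ^+ 2 /
  \sum_(i < N) smc_weight phi0 g X i w ^+ 2.

Definition iid_centered_normal d (Om : measurableType d)
    (P : probability Om R) (N : nat) (v : R)
    (Z : 'I_N -> {RV P >-> RR}) :=
  (forall i A, measurable A -> distribution P (Z i) A = centered_normal v A) /\
  mutually_independent P (fun i => sigma_rv (Z i)).

Definition limit_ESS d (Om : measurableType d)
    (P : probability Om R) (N : nat) (Z : 'I_N -> {RV P >-> RR})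
    (w : Om) : R :=
  (\sum_(i < N) expR (Z i w)) ^+ 2 / \sum_(i < N) expR (2 * Z i w).

(* The variables may live on different probability spaces. *)
Definition cvg_in_distribution (dn : nat -> measure_display)
    (Om : forall n, measurableType (dn n)) (P : forall n, probability (Om n) R)
    (Y : forall n, Om n -> R)
    (d : measure_display) (Om' : measurableType d) (P' : probability Om' R)
    (Z : Om' -> R) :=
  forall f : R -> R, continuous f -> (exists B : R, forall x, `|f x| <= B) ->
    ('E_(P n)[f \o Y n] @[n --> \oo] --> 'E_P'[f \o Z])%E.

End random_variables.

(* Main.v *)
Require Import Defs.
From mathcomp Require Import all_boot all_order all_algebra.
From mathcomp Require Import all_classical all_reals all_analysis.
From mathcomp Require Import measurable_realfun ring lra.

(* Along one coordinate the score [sum_(n<d) g (X_n)] of an inhomogeneous Markov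
   chain is, up to the solution [h_s] of the Poisson equation of [k_s], a
   martingale: minorization and drift make the residual kernel
   [k_s - theta nu 1_C] a contraction in the weighted norm, [h_s] is its Neumann
   series, and the Lipschitz condition lets [h_s] be followed from one temperature
   to the next.  The variance of the centered score is therefore a Riemann sum of
   [s |-> pi_s (h_s^2 - (k_s h_s)^2)], which is continuous, and its fourth order
   tail is negligible.  The [d] coordinates being independent, Lindeberg's theorem
   (here by Stein's method) gives normal limits for the log-weights of the [N]
   particles jointly, and the ESS is a bounded uniformly continuous function of
   the log-weights, invariant under a common shift.

   The series defining the Poisson solution in the statement only converges when
   [k_s^n h_s] does, which fails if [k_s] is periodic.  This is excluded for
   all but countably many [s]: the cyclic classes of [k_s] persist for nearby
   parameters with the same period (Lipschitz condition), and stationarity of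
   their masses along [s |-> pi_s], whose derivative is
   [f |-> pi_s ((g - pi_s g) f)], makes [g] orthogonal to the class functions, so
   that the oscillation of [k_s^n h_s] vanishes at every parameter approached
   from the right by parameters of the same period.  Countably many exceptions do
   not change the integral. *)

Set Implicit Arguments.
Unset Strict Implicit.
Unset Printing Implicit Defensive.

Import Order.TTheory GRing.Theory Num.Theory.
Import numFieldNormedType.Exports.

Local Open Scope classical_set_scope.
Local Open Scope ring_scope.

(** * Positive operators and weighted norms *)

(** The chain is analysed through positive linear operators on functions bounded by a multiple of a
    weight [W], where series are controlled by geometric tails. This weight is [V] plus a constant,
    chosen so that [theta nu] of the constant pays for the term of the drift on [C]: the residual
    kernel then contracts on the whole line, with no separate treatment of [C]. The exponent
    [r < 1/2] enters twice. Squares of the Poisson solution grow like W^(2p) with 2p < 1, so they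
    are at most a small multiple of [W] plus a constant; and Lipschitz bounds in [W] interpolate
    with the growth W^p to make these squares continuous in the parameter. Fourth moments need not
    exist, so the Lindeberg condition is propagated along the martingale by the smooth function
    [quad_tail] instead of x^4. The chain is not stationary in general: its law is compared with
    [pi] through a second Poisson equation, that of the variance function [ws]. Parameters are
    approached from the right because [g] is bounded above only, so that pi_t <= C0 pi_u is
    available for t >= u and not conversely. *)

Lemma cvgn_unique {R : realType} (u : nat -> R) (a b : R) :
  u @ \oo --> a -> u @ \oo --> b -> a = b.
Proof.
by move=> ua ub; rewrite -(cvg_lim (@Rhausdorff R) ua) (cvg_lim (@Rhausdorff R) ub).
Qed.

Lemma eq_cvgn {R : realType} (u v : nat -> R) (l : R) :
  u =1 v -> u @ \oo --> l -> v @ \oo --> l.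
Proof. by move=> /funext ->. Qed.

Section positive_functionals.
Context {R : realType}.
Implicit Types (W w f g : R -> R) (I : (R -> R) -> R).

Definition wbounded W f :=
  measurable_fun [set: R] f /\ exists c, forall x, `|f x| <= c * W x.

Lemma wbounded_meas W f : wbounded W f -> measurable_fun [set: R] f.
Proof. by case. Qed.

Lemma wboundedP W f : (forall x, 0 <= W x) -> wbounded W f ->
  exists2 c, 0 <= c & forall x, `|f x| <= c * W x.
Proof.
move=> W0 [_ [c fc]]; exists `|c| => // x; apply: le_trans (fc x) _.
by rewrite ler_wpM2r// ler_norm.
Qed.

Lemma wboundedD W f g : wbounded W f -> wbounded W g -> wbounded W (f + g).
Proof.
move=> [mf [c fc]] [mg [c' gc]]; split; first exact: measurable_funD.
exists (c + c') => x; rewrite mulrDl; apply: le_trans (ler_normD _ _) _.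
exact: lerD.
Qed.

Lemma wboundedZ W a f : wbounded W f -> wbounded W (a *: f).
Proof.
move=> [mf [c fc]]; split.
  by apply: measurable_funM => //; exact: measurable_cst.
exists (`|a| * c) => x.
rewrite (_ : (a *: f) x = a * f x)//.
by rewrite normrM -mulrA ler_wpM2l.
Qed.

Lemma wboundedN W f : wbounded W f -> wbounded W (- f).
Proof. by rewrite -scaleN1r; exact: wboundedZ. Qed.

Lemma wboundedB W f g : wbounded W f -> wbounded W g -> wbounded W (f - g).
Proof. by move=> Lf Lg; apply: wboundedD Lf _; exact: wboundedN. Qed.

Lemma wbounded_le W c f : measurable_fun [set: R] f ->
  (forall x, `|f x| <= c * W x) -> wbounded W f.
Proof. by split => //; exists c. Qed.

Lemma wbounded_sum W (n : nat) (F : nat -> R -> R) : (forall x, 0 <= W x) ->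
  (forall i, (i < n)%N -> wbounded W (F i)) ->
  wbounded W (\sum_(i < n) F i).
Proof.
move=> W0; elim: n => [|n IH] LF.
  rewrite big_ord0; split; first exact: measurable_cst.
  by exists 0 => x; rewrite normr0 mul0r.
rewrite big_ord_recr; apply: wboundedD; last exact: LF.
by apply: IH => i lin; apply: LF; rewrite (ltn_trans lin).
Qed.

Lemma wbounded_mono W f g : wbounded W g -> measurable_fun [set: R] f ->
  (forall x, `|f x| <= `|g x|) -> wbounded W f.
Proof.
move=> [_ [c gc]] mf fg; apply: (@wbounded_le _ c) => // x.
exact: le_trans (fg x) (gc x).
Qed.

Lemma wbounded_self W : measurable_fun [set: R] W -> (forall x, 0 <= W x) ->
  wbounded W W.
Proof.
by move=> mW W0; apply: (@wbounded_le _ 1) => // x; rewrite mul1r ger0_norm.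
Qed.

Lemma wbounded_cst W a : (forall x, 1 <= W x) -> wbounded W (cst a).
Proof.
move=> W1; apply: (@wbounded_le _ `|a|); first exact: measurable_cst.
by move=> x; rewrite ler_peMr.
Qed.

Lemma wbounded_bounded W f c : (forall x, 1 <= W x) ->
  measurable_fun [set: R] f -> (forall x, `|f x| <= c) -> wbounded W f.
Proof.
move=> W1 mf fc; apply: (@wbounded_le _ c) => // x; apply: le_trans (fc x) _.
by rewrite ler_peMr// (le_trans _ (fc x)).
Qed.

Lemma wbounded_indic W A : (forall x, 1 <= W x) -> measurable A ->
  wbounded W (\1_A : R -> R).
Proof.
move=> W1 mA; apply: (@wbounded_bounded _ _ 1) => // x.
by rewrite indicE; case: (_ \in _); rewrite ?normr1 ?normr0.
Qed.

(** No countable additivity is asked for. Integration against a law, evaluation of a kernel at a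
    point and their iterates are all instances; series are exchanged with [I] through geometric
    bounds. *)
Definition positive_linear W I := [/\
  forall f g, wbounded W f -> wbounded W g -> I (f + g) = I f + I g,
  forall a f, wbounded W f -> I (a *: f) = a * I f &
  forall f, wbounded W f -> (forall x, 0 <= f x) -> 0 <= I f].

Section properties.
Variables (W : R -> R) (I : (R -> R) -> R).
Hypotheses (W0 : forall x, 0 <= W x) (pI : positive_linear W I).

Lemma plD f g : wbounded W f -> wbounded W g -> I (f + g) = I f + I g.
Proof. by case: pI => + _ _; apply. Qed.

Lemma plZ a f : wbounded W f -> I (a *: f) = a * I f.
Proof. by case: pI => _ + _; apply. Qed.

Lemma pl_ge0 f : wbounded W f -> (forall x, 0 <= f x) -> 0 <= I f.
Proof. by case: pI => _ _; apply. Qed.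

Lemma plN f : wbounded W f -> I (- f) = - I f.
Proof. by move=> Lf; rewrite -scaleN1r plZ// mulN1r. Qed.

Lemma plB f g : wbounded W f -> wbounded W g -> I (f - g) = I f - I g.
Proof. by move=> Lf Lg; rewrite plD ?plN//; exact: wboundedN. Qed.

Lemma pl_le f g : wbounded W f -> wbounded W g -> (forall x, f x <= g x) ->
  I f <= I g.
Proof.
move=> Lf Lg fg; rewrite -subr_ge0 -plB//; apply: pl_ge0; first exact: wboundedB.
by move=> x; rewrite subr_ge0.
Qed.

Lemma pl_norm f g : wbounded W f -> wbounded W g -> (forall x, `|f x| <= g x) ->
  `|I f| <= I g.
Proof.
move=> Lf Lg fg; rewrite ler_norml -plN//; apply/andP; split; apply: pl_le => //.
- exact: wboundedN.
- by move=> x; have := fg x; rewrite ler_norml => /andP[].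
- by move=> x; have := fg x; rewrite ler_norml => /andP[].
Qed.

Lemma pl0 : I 0 = 0.
Proof.
have -> : (0 : R -> R) = 0 *: (0 : R -> R) by rewrite scaler0.
rewrite plZ ?mul0r//; apply: (@wbounded_le _ 0); first exact: measurable_cst.
by move=> x; rewrite normr0 mul0r.
Qed.

Lemma pl_sum (n : nat) (F : nat -> R -> R) :
  (forall i, (i < n)%N -> wbounded W (F i)) ->
  I (\sum_(i < n) F i) = \sum_(i < n) I (F i).
Proof.
elim: n => [|n IH] LF; first by rewrite !big_ord0 pl0.
have LF' i : (i < n)%N -> wbounded W (F i).
  by move=> lin; apply: LF; rewrite (ltn_trans lin).
by rewrite !big_ord_recr/= plD ?IH//; [exact: wbounded_sum|exact: LF].
Qed.

End properties.

Definition positive_operator W (T : (R -> R) -> R -> R) :=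
  (forall x, positive_linear W (T^~ x)) /\
  (forall f, wbounded W f -> wbounded W (T f)).

Section operators.
Variables (W : R -> R) (T : (R -> R) -> R -> R).
Hypotheses (W0 : forall x, 0 <= W x) (pT : positive_operator W T).

Lemma po_pl x : positive_linear W (T^~ x).
Proof. by case: pT. Qed.

Lemma po_wb f : wbounded W f -> wbounded W (T f).
Proof. by case: pT => _; apply. Qed.

Lemma poD f g : wbounded W f -> wbounded W g -> T (f + g) = T f + T g.
Proof. by move=> Lf Lg; apply/funext => x; exact: (plD (po_pl x)). Qed.

Lemma poZ a f : wbounded W f -> T (a *: f) = a *: T f.
Proof. by move=> Lf; apply/funext => x; exact: (plZ (po_pl x)). Qed.

Lemma poB f g : wbounded W f -> wbounded W g -> T (f - g) = T f - T g.
Proof. by move=> Lf Lg; apply/funext => x; exact: (plB (po_pl x)). Qed.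

Lemma po_sum (n : nat) (F : nat -> R -> R) :
  (forall i, (i < n)%N -> wbounded W (F i)) ->
  T (\sum_(i < n) F i) = \sum_(i < n) T (F i).
Proof.
move=> LF; apply/funext => x; rewrite (fct_sumE _ _ (fun i : 'I_n => T (F i))).
exact: (pl_sum W0 (po_pl x)).
Qed.

Lemma po_iter_wb n f : wbounded W f -> wbounded W (iter n T f).
Proof. by move=> Lf; elim: n => //= n; exact: po_wb. Qed.

Lemma po_iterD n f g : wbounded W f -> wbounded W g ->
  iter n T (f + g) = iter n T f + iter n T g.
Proof.
by move=> Lf Lg; elim: n => //= n ->; rewrite poD//; exact: po_iter_wb.
Qed.

Lemma po_iterZ n a f : wbounded W f -> iter n T (a *: f) = a *: iter n T f.
Proof. by move=> Lf; elim: n => //= n ->; rewrite poZ//; exact: po_iter_wb. Qed.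

Lemma po_iterB n f g : wbounded W f -> wbounded W g ->
  iter n T (f - g) = iter n T f - iter n T g.
Proof.
by move=> Lf Lg; elim: n => //= n ->; rewrite poB//; exact: po_iter_wb.
Qed.

Lemma po_ge0 f : wbounded W f -> (forall x, 0 <= f x) -> forall x, 0 <= T f x.
Proof. by move=> Lf f0 x; exact: (pl_ge0 (po_pl x)). Qed.

Lemma po_iter_ge0 n f : wbounded W f -> (forall x, 0 <= f x) ->
  forall x, 0 <= iter n T f x.
Proof.
by move=> Lf f0; elim: n => //= n IH; apply: po_ge0 => //; exact: po_iter_wb.
Qed.

(** The contracted weight [w] may differ from the weight [W] of the domain; this is what allows
    powers of [W]. *)
Lemma po_iter_contract (w : R -> R) (k c : R) n f :
  wbounded W w -> (forall x, T w x <= k * w x) -> 0 <= k -> 0 <= c ->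
  wbounded W f -> (forall x, `|f x| <= c * w x) ->
  forall x, `|iter n T f x| <= c * k ^+ n * w x.
Proof.
move=> Lw Tw k0 c0 Lf fc; elim: n => [|n IH] x; first by rewrite expr0 mulr1.
rewrite iterS; have Ln := @po_iter_wb n f Lf.
apply: (@le_trans _ _ (T ((c * k ^+ n) *: w) x)).
  by apply: (pl_norm (po_pl x)) => //; exact: wboundedZ.
rewrite poZ// exprSr mulrA -[leRHS]mulrA.
by rewrite [leLHS](_ : _ = c * k ^+ n * T w x)// ler_wpM2l// mulr_ge0// exprn_ge0.
Qed.

Variable rho : R.
Hypotheses (rho_itv : 0 <= rho < 1) (mW : measurable_fun [set: R] W).
Hypothesis TW : forall x, T W x <= rho * W x.

Definition neumann f : R -> R :=
  fun x => limn (series (fun n => iter n T f x)).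

Let rho0 : 0 <= rho. Proof. by case/andP: rho_itv. Qed.
Let rho1 : rho < 1. Proof. by case/andP: rho_itv. Qed.

Lemma neumann_cvg f x : wbounded W f ->
  series (fun n => iter n T f x) @ \oo --> neumann f x.
Proof.
move=> Lf; have [c c0 fc] := wboundedP W0 Lf.
suff : cvgn (series (fun n => iter n T f x)) by [].
apply: normed_cvg; apply: (@series_le_cvg _ _ (geometric (c * W x) rho)).
- by move=> n; exact: normr_ge0.
- by move=> n; apply: mulr_ge0; [exact: mulr_ge0|exact: exprn_ge0].
- move=> n /=; rewrite -mulrA (mulrC (W x)) mulrA.
  by apply: po_iter_contract => //; exact: wbounded_self.
- by apply: is_cvg_geometric_series; rewrite ger0_norm.
Qed.

(** Convergence is known in the weight [W], but the tail may be measured in any contracted weight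
    [w]; a function of growth W^p therefore has a Neumann series of the same growth. *)
Lemma neumann_tail (w : R -> R) (k c : R) f n :
  wbounded W w -> (forall x, 0 <= w x) ->
  (forall x, T w x <= k * w x) -> 0 <= k < 1 -> 0 <= c ->
  wbounded W f -> (forall x, `|f x| <= c * w x) ->
  forall x, `|neumann f x - \sum_(i < n) iter i T f x|
            <= c * k ^+ n / (1 - k) * w x.
Proof.
move=> Lw w0 Tw /andP[k0 k1] c0 Lf fc x.
have cv := @neumann_cvg f x Lf.
have cv' : (fun m => `|series (fun n => iter n T f x) m
             - \sum_(i < n) iter i T f x|) @ \oo -->
           `|neumann f x - \sum_(i < n) iter i T f x|.
  by apply: cvg_norm; apply: cvgB => //; exact: cvg_cst.
apply: (cvgr_to_le cv').
near=> m; have nm : (n <= m)%N by near: m; exact: nbhs_infty_ge.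
rewrite /series/= -(big_mkord xpredT (fun i => iter i T f x)).
rewrite (big_cat_nat (n := n))//= addrAC subrr add0r.
apply: le_trans (ler_norm_sum _ _ _) _.
apply: (@le_trans _ _ (\sum_(n <= i < m) c * w x * k ^+ i)).
  by apply: ler_sum => i _; rewrite mulrAC; exact: po_iter_contract.
rewrite -mulr_sumr.
have -> : \sum_(n <= i < m) k ^+ i = k ^+ n * \sum_(0 <= i < m - n) k ^+ i.
  rewrite -{1}[n]add0n big_addn mulr_sumr; apply: eq_bigr => i _.
  by rewrite exprD mulrC.
rewrite [leRHS]mulrAC (mulrAC c) -!mulrA ler_wpM2l//.
rewrite ler_wpM2l ?exprn_ge0// [leLHS]mulrC ler_wpM2l//.
have k1' : 0 < 1 - k by rewrite subr_gt0.
rewrite -[leRHS]div1r ler_pdivlMr//.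
have := subrX1 k (m - n); rewrite -(big_mkord xpredT (fun i => k ^+ i)) => E.
rewrite mulrC -[1 - k]opprB mulNr -E opprB lerBlDr lerDl exprn_ge0//.
Unshelve. all: by end_near.
Qed.

Lemma neumann_le (w : R -> R) (k c : R) f :
  wbounded W w -> (forall x, 0 <= w x) ->
  (forall x, T w x <= k * w x) -> 0 <= k < 1 -> 0 <= c ->
  wbounded W f -> (forall x, `|f x| <= c * w x) ->
  forall x, `|neumann f x| <= c / (1 - k) * w x.
Proof.
move=> Lw w0 Tw k01 c0 Lf fc x.
have := @neumann_tail w k c f 0 Lw w0 Tw k01 c0 Lf fc x.
by rewrite big_ord0 subr0 expr0 mulr1.
Qed.

Lemma neumann_wb f : wbounded W f -> wbounded W (neumann f).
Proof.
move=> Lf; have [c c0 fc] := wboundedP W0 Lf.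
apply: (@wbounded_le _ (c / (1 - rho))).
  apply: (@measurable_fun_cvg _ _ _ _
    (fun m x => series (fun n => iter n T f x) m)).
    move=> m; rewrite /series/=; apply: measurable_sum => i.
    exact: (wbounded_meas (@po_iter_wb i f Lf)).
  by move=> x _; exact: neumann_cvg.
by apply: neumann_le => //; exact: wbounded_self.
Qed.

(** The remainder after n terms is at most a constant times [rho ^+ n] times [W], and [I] is
    monotone. This replaces dominated convergence. *)
Lemma neumann_tail_fun I f : positive_linear W I -> wbounded W f ->
  series (fun n => I (iter n T f)) @ \oo --> I (neumann f).
Proof.
move=> pI Lf; have [c c0 fc] := wboundedP W0 Lf.
have LW := wbounded_self mW W0.
have IW0 : 0 <= I W by exact: (pl_ge0 pI).
apply/cvgrPdist_le => e e0.
have : (fun n => c / (1 - rho) * I W * rho ^+ n) @ \oo --> 0.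
  rewrite -(mulr0 (c / (1 - rho) * I W)); apply: cvgM; first exact: cvg_cst.
  by apply: cvg_expr; rewrite ger0_norm.
move=> /cvgr0_norm_le /(_ _ e0); apply: filterS => n le.
have Ls : wbounded W (\sum_(i < n) iter i T f).
  by apply: (@wbounded_sum _ n (fun i => iter i T f)) => // i _; exact: po_iter_wb.
rewrite /series/= big_mkord -(pl_sum W0 pI (n := n) (F := fun i => iter i T f));
  last by move=> i _; exact: po_iter_wb.
rewrite -(plB pI)//; last exact: neumann_wb.
apply: (@le_trans _ _ (I ((c * rho ^+ n / (1 - rho)) *: W))).
  apply: (pl_norm pI).
  - by apply: wboundedB => //; exact: neumann_wb.
  - exact: wboundedZ.
  - move=> x; have := @neumann_tail W rho c f n LW W0 TW rho_itv c0 Lf fc x.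
    rewrite (_ : (neumann f - _) x =
      neumann f x - \sum_(i < n) iter i T f x)// fctE.
    by rewrite fct_sumE.
rewrite (plZ pI)//; apply: le_trans le.
by apply: le_trans (ler_norm _); rewrite le_eqVlt; apply/orP; left; apply/eqP; ring.
Qed.

(** Evaluation of [T] at a point is a positive functional, so [T] may be applied term by term; what
    comes out is the series without its first term. *)
Lemma neumann_eq f : wbounded W f -> T (neumann f) = neumann f - f.
Proof.
move=> Lf; apply/funext => x.
apply: (@cvgn_unique _ (series (fun n => iter n.+1 T f x))).
- have := neumann_tail_fun (po_pl x) Lf.
  by [].
- have h := @neumann_cvg f x Lf.
  have : (fun n => series (fun n => iter n T f x) n.+1 - f x) @ \oo -->
         neumann f x - f x.
    apply: cvgB; last exact: cvg_cst.
    by rewrite (cvg_shiftS (series (fun n => iter n T f x))).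
  rewrite (eq_cvg _ (g := series (fun n => iter n.+1 T f x)))// => n.
  by rewrite /series/= big_nat_recl//= addrAC subrr add0r.
Qed.

End operators.

End positive_functionals.

Section powers.
Context {R : realType}.

(** Concavity: the right side is the tangent at [a] of the power function. It is Young's inequality
    with exponents 1/q and 1/(1 - q), one factor being 1; [q = 1] is treated apart. *)
Lemma powR_tangent (q a y : R) : 0 < q <= 1 -> 0 < a -> 0 <= y ->
  y `^ q <= a `^ q * (q * (y / a) + (1 - q)).
Proof.
move=> /andP[q0 q1] a0 y0.
have u0 : 0 <= y / a by rewrite divr_ge0// ltW.
have -> : y `^ q = a `^ q * (y / a) `^ q.
  by rewrite -powRM ?(ltW a0)// mulrC divfK// gt_eqF.
rewrite ler_wpM2l ?powR_ge0//.
have [->|q1'] := eqVneq q 1; first by rewrite powRr1// mul1r subrr addr0.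
have q1'' : 0 < 1 - q by rewrite subr_gt0 lt_neqAle q1'.
have h1 : 0 < q^-1 by rewrite invr_gt0.
have h2 : 0 < (1 - q)^-1 by rewrite invr_gt0.
have h3 : q^-1^-1 + (1 - q)^-1^-1 = 1 by rewrite !invrK addrC subrK.
have := conjugate_powR (powR_ge0 (y / a) q) ler01 h1 h2 h3.
by rewrite mulr1 -powRrM divff ?gt_eqF// powRr1// powR1 div1r !invrK (mulrC q).
Qed.

Lemma powR_le_self (w q : R) : 1 <= w -> q <= 1 -> w `^ q <= w.
Proof.
by move=> w1 q1; rewrite -[leRHS]powRr1 ?(le_trans _ w1)// ler_powR.
Qed.

Lemma powR_ge1 (w q : R) : 1 <= w -> 0 <= q -> 1 <= w `^ q.
Proof. by move=> w1 q0; rewrite -(powRr0 w) ler_powR. Qed.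

End powers.

(** * The Poisson equation of one kernel under minorization and drift *)

Section split_kernel.
Context {R : realType}.
Variables (W : R -> R) (K : (R -> R) -> R -> R) (nu pi : (R -> R) -> R).
Variables (C : set R) (theta rho Cpi : R).
Hypotheses (mW : measurable_fun [set: R] W) (W1 : forall x, 1 <= W x).
Hypotheses (pK : positive_operator W K) (K1 : K (cst 1) = cst 1).
Hypotheses (pnu : positive_linear W nu) (nu1 : nu (cst 1) = 1).
Hypotheses (ppi : positive_linear W pi) (pi1 : pi (cst 1) = 1).
Hypothesis piK : forall f, wbounded W f -> pi (K f) = pi f.
Hypotheses (piW : pi W <= Cpi) (mC : measurable C).
Hypotheses (theta0 : 0 < theta) (rho_itv : 0 < rho < 1).

(** The sub-Markov kernel of Nummelin's split chain before regeneration: from [C], with probability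
    [theta], the chain restarts from [nu], and this possibility is removed. *)
Definition residual (f : R -> R) : R -> R := K f - (theta * nu f) *: \1_C.

Local Notation Q := residual.
Hypothesis Q0 : forall f, wbounded W f -> (forall x, 0 <= f x) ->
  forall x, 0 <= Q f x.
Hypothesis QW : forall x, Q W x <= rho * W x.

Let W0 x : 0 <= W x. Proof. exact: le_trans (W1 x). Qed.
Let LW : wbounded W W. Proof. exact: wbounded_self. Qed.
Let LC : wbounded W (\1_C : R -> R). Proof. exact: wbounded_indic. Qed.
Let Lc a : wbounded W (cst a). Proof. exact: wbounded_cst. Qed.
Let rho_itv' : 0 <= rho < 1.
Proof. by case/andP: rho_itv => /ltW -> ->. Qed.

Lemma residual_pos : positive_operator W Q.
Proof.
split=> [x|f Lf]; last first.
  by apply: wboundedB; [exact: po_wb pK _ Lf|exact: wboundedZ].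
split=> [f g Lf Lg|a f Lf|f Lf f0]; last exact: Q0.
- by rewrite /Q (poD pK)// (plD pnu)// mulrDr !fctE/= /GRing.scale/=; ring.
- by rewrite /Q (poZ pK)// (plZ pnu)// !fctE/= /GRing.scale/=; ring.
Qed.

Lemma residual1 : Q (cst 1) = cst 1 - theta *: \1_C.
Proof. by rewrite /Q K1 nu1 mulr1. Qed.

Lemma residual1_le x : Q (cst 1) x <= 1.
Proof.
rewrite residual1 !fctE /GRing.scale/= gerBl mulr_ge0 ?(ltW theta0)//.
Qed.

Lemma kernel_residual f : K f = Q f + (theta * nu f) *: \1_C.
Proof. by rewrite /Q subrK. Qed.

Lemma pi_residual f : wbounded W f ->
  pi (Q f) = pi f - theta * nu f * pi \1_C.
Proof.
move=> Lf; rewrite /Q (plB ppi) ?(plZ ppi) ?piK//; first exact: po_wb pK _ Lf.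
exact: wboundedZ.
Qed.

Lemma piW_ge1 : 1 <= pi W.
Proof. by rewrite -pi1; apply: (pl_le ppi). Qed.

(** If [pi] gave no mass to [C], it would be invariant under the residual kernel, so that pi(W) <=
    rho pi(W), against 1 <= pi(W). *)
Lemma pi_small_gt0 : 0 < pi \1_C.
Proof.
have p0 : 0 <= pi \1_C by apply: (pl_ge0 ppi) => // x; rewrite indicE.
rewrite lt_neqAle p0 andbT; apply/eqP => p0'.
have := pi_residual LW; rewrite -p0' mulr0 subr0 => E.
have : pi (Q W) <= pi (rho *: W).
  apply: (pl_le ppi) => //; first exact: po_wb residual_pos _ LW.
  exact: wboundedZ.
rewrite (plZ ppi)// E; have := piW_ge1; case/andP: rho_itv => r0 r1; nra.
Qed.

(** Jensen's inequality for a sub-Markov kernel: integrate the tangent of the power at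
    [a = rho * W x]. The constant term of this tangent is nonnegative, so that Q 1 <= 1 is
    enough. *)
Lemma residual_powR q : 0 < q <= 1 -> forall x,
  Q (fun y => W y `^ q) x <= rho `^ q * W x `^ q.
Proof.
move=> q01 x; have /andP[q0 q1] := q01; have /andP[r0 r1] := rho_itv.
have Wx0 : 0 < W x by exact: lt_le_trans (W1 x).
set a := rho * W x; have a0 : 0 < a by rewrite mulr_gt0.
rewrite -powRM// ?(ltW r0)// -/a.
have mq : measurable_fun [set: R] (fun y => W y `^ q).
  exact: (measurableT_comp (measurable_powR q) mW).
have Lq : wbounded W (fun y => W y `^ q).
  apply: (wbounded_mono LW) => // y.
  by rewrite !ger0_norm ?powR_ge0// powR_le_self.
have pQ := po_pl residual_pos x.
have : Q (fun y => W y `^ q) x <=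
       Q ((a `^ q * q / a) *: W + (a `^ q * (1 - q)) *: cst 1) x.
  apply: (pl_le pQ) => //.
    by apply: wboundedD; exact: wboundedZ.
  move=> y; apply: le_trans (powR_tangent q01 a0 (W0 y)) _.
  by rewrite !fctE /GRing.scale/= le_eqVlt; apply/orP; left; apply/eqP; ring.
move=> /le_trans; apply.
rewrite (plD pQ) ?(plZ pQ)//; try exact: wboundedZ.
have aq := powR_gt0 q a0.
apply: (@le_trans _ _ (a `^ q * q / a * a + a `^ q * (1 - q) * 1)).
  apply: lerD; apply: ler_wpM2l.
  - by rewrite !mulr_ge0 ?invr_ge0// ltW.
  - exact: QW.
  - by rewrite !mulr_ge0 ?subr_ge0// ltW.
  - exact: residual1_le.
by rewrite divfK ?gt_eqF// mulr1 -mulrDr addrC subrK mulr1.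
Qed.

(** Built from the residual kernel, this series converges whatever the period of [K], unlike the sum
    over the iterates of [K]. It solves the equation of [K] itself because [nu] integrates it to
    0. *)
Definition poisson f : R -> R := neumann Q (f - cst (pi f)).

Lemma center_wb f : wbounded W f -> wbounded W (f - cst (pi f)).
Proof. by move=> Lf; exact: wboundedB. Qed.

Lemma poisson_wb f : wbounded W f -> wbounded W (poisson f).
Proof.
move=> Lf; apply: (neumann_wb W0 residual_pos rho_itv' mW QW).
exact: center_wb.
Qed.

(** Integrate Q h = h - (f - pi f) against [pi]: by invariance the left side is pi(h) - theta nu(h)
    pi(1_C), while the centered function integrates to 0. As theta pi(1_C) > 0, nu(h) = 0. *)
Lemma nu_poisson f : wbounded W f -> nu (poisson f) = 0.
Proof.
move=> Lf; have Lh := poisson_wb Lf; have Lf' := center_wb Lf.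
have E := neumann_eq W0 residual_pos rho_itv' mW QW Lf'.
have := pi_residual Lh; rewrite {1}/poisson E -/(poisson f).
rewrite (plB ppi)// (plB ppi)// -(mulr1 (pi f)) -pi1.
have -> : cst (pi f * pi (cst 1)) = pi f *: cst 1 :> (R -> R).
  by rewrite pi1 mulr1; apply/funext => x; rewrite !fctE /GRing.scale/= mulr1.
rewrite (plZ ppi)// subrr subr0 => /eqP.
rewrite -subr_eq0 opprB addrC subrK mulf_eq0 (gt_eqF pi_small_gt0) orbF.
by rewrite mulf_eq0 (gt_eqF theta0)/= => /eqP.
Qed.

Lemma poisson_eq f : wbounded W f ->
  K (poisson f) = poisson f - (f - cst (pi f)).
Proof.
move=> Lf; rewrite kernel_residual nu_poisson// mulr0 scale0r addr0.
exact: (neumann_eq W0 residual_pos rho_itv' mW QW (center_wb Lf)).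
Qed.

Lemma center_le (w : R -> R) c f : wbounded W f -> 0 <= c ->
  (forall x, 1 <= w x <= W x) -> measurable_fun [set: R] w ->
  (forall x, `|f x| <= c * w x) ->
  forall x, `|(f - cst (pi f)) x| <= c * (1 + Cpi) * w x.
Proof.
move=> Lf c0 w1W mw fc x.
have piw : pi f <= c * Cpi /\ - pi f <= c * Cpi.
  have : `|pi f| <= pi (c *: W).
    apply: (pl_norm ppi) => //; first exact: wboundedZ.
    move=> y; apply: le_trans (fc y) _; rewrite ler_wpM2l//.
    by case/andP: (w1W y).
  rewrite (plZ ppi)// => h; split; apply: le_trans (ler_wpM2l c0 piW);
    apply: le_trans h.
    exact: ler_norm.
  by rewrite -normrN ler_norm.
rewrite !fctE/=; apply: le_trans (ler_normB _ _) _.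
rewrite mulrDr mulr1 mulrDl; apply: lerD => //.
have Cpi0 : 0 <= Cpi by apply: le_trans piW; apply: le_trans piW_ge1.
have /andP[w1 _] := w1W x.
apply: (@le_trans _ _ (c * Cpi)); last by rewrite ler_peMr// mulr_ge0.
by rewrite ler_norml lerNl; case: piw => -> ->.
Qed.

Lemma poisson_le (w : R -> R) (k c : R) f :
  wbounded W f -> 0 <= c -> (forall x, 1 <= w x <= W x) ->
  measurable_fun [set: R] w -> (forall x, Q w x <= k * w x) -> 0 <= k < 1 ->
  (forall x, `|f x| <= c * w x) ->
  forall x, `|poisson f x| <= c * (1 + Cpi) / (1 - k) * w x.
Proof.
move=> Lf c0 w1W mw Qw k01 fc; have Cpi0 : 0 <= Cpi.
  by apply: le_trans piW; apply: le_trans piW_ge1.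
have w0 x : 0 <= w x by have /andP[w1 _] := w1W x; exact: le_trans w1.
apply: (neumann_le W0 residual_pos rho_itv' mW QW) => //.
- apply: (wbounded_mono LW) => // x.
  by rewrite !ger0_norm//; have /andP[] := w1W x.
- by rewrite mulr_ge0// addr_ge0.
- exact: center_wb.
- exact: center_le.
Qed.

(** Iterating the fixed point equation, the partial sums of the series equal [e] minus the n-th
    iterate of the residual kernel at [e], which decays geometrically. *)
Lemma neumann_unique f e : wbounded W f -> wbounded W e -> e = f + Q e ->
  e = neumann Q f.
Proof.
move=> Lf Le ef; have fE : e - Q e = f by apply/eqP; rewrite subr_eq -ef.
apply/funext => x; apply: (@cvgn_unique _ (fun n => \sum_(i < n) iter i Q f x)).
  have [c c0 ec] := wboundedP W0 Le.
  have -> : (fun n => \sum_(i < n) iter i Q f x) = (fun n => e x - iter n Q e x).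
    apply/funext; elim=> [|n IH]; first by rewrite big_ord0 subrr.
    rewrite big_ord_recr/= IH.
    have -> : iter n Q f = iter n Q e - iter n Q (Q e).
      by rewrite -(po_iterB residual_pos)// ?fE//; exact: po_wb residual_pos _ Le.
    by rewrite -iterSr !fctE iterS; ring.
  rewrite -[X in _ --> X]subr0; apply: cvgB; first exact: cvg_cst.
  apply/cvgr0Pnorm_le => eps eps0.
  have : (fun n => c * W x * rho ^+ n) @ \oo --> 0.
    rewrite -(mulr0 (c * W x)); apply: cvgM; first exact: cvg_cst.
    by apply: cvg_expr; have /andP[? ?] := rho_itv'; rewrite ger0_norm.
  move=> /cvgr0_norm_le /(_ _ eps0); apply: filterS => n.
  apply: le_trans; apply: le_trans (ler_norm _).
  have := po_iter_contract residual_pos n LW QW _ c0 Le ec x.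
  have /andP[-> _] := rho_itv'; move=> /(_ isT) /le_trans; apply.
  by rewrite le_eqVlt; apply/orP; left; apply/eqP; ring.
have := neumann_cvg W0 residual_pos rho_itv' mW QW (x := x) Lf.
by rewrite /series/=; under eq_fun do rewrite big_mkord.
Qed.


End split_kernel.

(** * Lipschitz dependence on the parameter *)

Section kernel_family.
Context {R : realType}.
Variables (W : R -> R) (S : set R).
Variables (K : R -> (R -> R) -> R -> R) (nu : (R -> R) -> R).
Variables (pi : R -> (R -> R) -> R).
Variables (C : set R) (theta rho Cpi M : R).
Hypotheses (mW : measurable_fun [set: R] W) (W1 : forall x, 1 <= W x).
Hypothesis pK : forall s, S s -> positive_operator W (K s).
Hypothesis K1 : forall s, S s -> K s (cst 1) = cst 1.
Hypotheses (pnu : positive_linear W nu) (nu1 : nu (cst 1) = 1).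
Hypothesis ppi : forall s, S s -> positive_linear W (pi s).
Hypothesis pi1 : forall s, S s -> pi s (cst 1) = 1.
Hypothesis piK : forall s, S s ->
  forall f, wbounded W f -> pi s (K s f) = pi s f.
Hypothesis piW : forall s, S s -> pi s W <= Cpi.
Hypotheses (mC : measurable C) (theta0 : 0 < theta) (rho_itv : 0 < rho < 1).

Local Notation Q s := (residual (K s) nu C theta).
Hypothesis Q0 : forall s, S s -> forall f, wbounded W f ->
  (forall x, 0 <= f x) -> forall x, 0 <= Q s f x.
Hypothesis QW : forall s, S s -> forall x, Q s W x <= rho * W x.
Hypothesis M0 : 0 <= M.
Hypothesis Klip : forall s t, S s -> S t -> forall f c, wbounded W f ->
  0 <= c -> (forall x, `|f x| <= c * W x) ->
  forall x, `|K s f x - K t f x| <= M * c * `|s - t| * W x.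

Let W0 x : 0 <= W x. Proof. exact: le_trans (W1 x). Qed.
Let LW : wbounded W W. Proof. exact: wbounded_self. Qed.
Let rho_itv' : 0 <= rho < 1.
Proof. by case/andP: rho_itv => /ltW -> ->. Qed.
Let pQ s : S s -> positive_operator W (Q s).
Proof. by move=> Ss; apply: residual_pos => //; [exact: pK|exact: Q0]. Qed.

Local Notation h s f := (poisson (K s) nu (pi s) C theta f).
Local Notation G s f := (neumann (Q s) f).

Lemma Cpi_ge1 s : S s -> 1 <= Cpi.
Proof. by move=> Ss; apply: le_trans (piW Ss); apply: (piW_ge1 mW W1 (ppi Ss) (pi1 Ss)). Qed.

(** With h the Poisson solution of f at [t], pi_s(f) - pi_t(f) = pi_s((K_s - K_t) h): invariance of
    pi_s handles the first kernel and the Poisson equation the second. Regularity of the laws is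
    thus deduced from that of the kernels. *)
Lemma pi_lipschitz s t f c : S s -> S t -> wbounded W f -> 0 <= c ->
  (forall x, `|f x| <= c * W x) ->
  `|pi s f - pi t f| <= M * (c * (1 + Cpi) / (1 - rho)) * Cpi * `|s - t|.
Proof.
move=> Ss St Lf c0 fc; have Cpi1 := Cpi_ge1 Ss.
have Lh : wbounded W (h t f).
  exact: (poisson_wb (pi t) mW W1 (pK St) pnu mC rho_itv (Q0 St) (QW St)).
set c' := c * (1 + Cpi) / (1 - rho).
have c'0 : 0 <= c'.
  rewrite !mulr_ge0 ?invr_ge0//; last by rewrite subr_ge0 ltW; case/andP: rho_itv.
  by rewrite addr_ge0// (le_trans _ Cpi1).
have hc : forall x, `|h t f x| <= c' * W x.
  apply: (poisson_le mW W1 (pK St) pnu (ppi St) (pi1 St) (piW St) mC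
    rho_itv (Q0 St) (QW St)) => //.
  - by move=> x; rewrite W1 lexx.
  - exact: QW.
have -> : pi s f - pi t f = pi s (K s (h t f) - K t (h t f)).
  rewrite (plB (ppi Ss)) ?piK//; try exact: po_wb (pK _) _ Lh.
  rewrite (poisson_eq mW W1 (pK St) pnu (ppi St) (pi1 St) (piK St) mC theta0
    rho_itv (Q0 St) (QW St))//.
  have Lc a : wbounded W (cst a) by exact: wbounded_cst.
  have -> : cst (pi t f) = pi t f *: cst 1 :> (R -> R).
    by apply/funext => x; rewrite !fctE /GRing.scale/= mulr1.
  rewrite (plB (ppi Ss))// ?(plB (ppi Ss))// ?(plZ (ppi Ss)) ?pi1//.
  - by rewrite mulr1; ring.
  - exact: wboundedZ.
  - by apply: wboundedB => //; exact: wboundedZ.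
apply: (@le_trans _ _ (pi s ((M * c' * `|s - t|) *: W))).
  apply: (pl_norm (ppi Ss)).
  - by apply: wboundedB; exact: po_wb (pK _) _ Lh.
  - exact: wboundedZ.
  - by move=> x; exact: Klip.
rewrite (plZ (ppi Ss))// mulrAC ler_wpM2r// ler_wpM2l ?piW//.
by rewrite mulr_ge0.
Qed.

(** Second resolvent identity: the difference is G_s applied to (K_s - K_t) G_t f. The rank-one
    parts of the two residual kernels are the same and cancel in Q_s - Q_t. *)
Lemma neumann_lipschitz s t f c : S s -> S t -> wbounded W f -> 0 <= c ->
  (forall x, `|f x| <= c * W x) ->
  forall x, `|G s f x - G t f x| <=
            M * (c / (1 - rho)) / (1 - rho) * `|s - t| * W x.
Proof.
move=> Ss St Lf c0 fc x.
have Lu : wbounded W (G t f) by exact: (neumann_wb W0 (pQ St) rho_itv' mW (QW St)).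
have Lv : wbounded W (G s f) by exact: (neumann_wb W0 (pQ Ss) rho_itv' mW (QW Ss)).
have r1 : 0 <= (1 - rho)^-1.
  by rewrite invr_ge0 subr_ge0 ltW//; case/andP: rho_itv.
have uc : forall y, `|G t f y| <= c / (1 - rho) * W y.
  by apply: (neumann_le W0 (pQ St) rho_itv' mW (QW St)) => //; exact: QW.
set d := K s (G t f) - K t (G t f).
have Ld : wbounded W d by apply: wboundedB; exact: po_wb (pK _) _ Lu.
have Le : wbounded W (G s f - G t f) by exact: wboundedB.
have -> : G s f x - G t f x = G s d x.
  rewrite -[LHS]/((G s f - G t f) x); congr (_ x).
  apply: (neumann_unique mW W1 (pK Ss) pnu mC rho_itv (Q0 Ss) (QW Ss)) => //.
  rewrite (poB (pQ Ss))// (neumann_eq W0 (pQ Ss) rho_itv' mW (QW Ss) Lf).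
  have -> : d = Q s (G t f) - Q t (G t f).
    by rewrite /d /residual; apply/funext => y; rewrite !fctE; ring.
  rewrite (neumann_eq W0 (pQ St) rho_itv' mW (QW St) Lf).
  by apply/funext => y; rewrite !fctE; ring.
rewrite mulrAC.
have -> : M * (c / (1 - rho)) / (1 - rho) * W x * `|s - t| =
  M * (c / (1 - rho)) * `|s - t| / (1 - rho) * W x by ring.
apply: (neumann_le W0 (pQ Ss) rho_itv' mW (QW Ss)) => //.
- exact: QW.
- by rewrite !mulr_ge0.
- by move=> y; apply: Klip => //; rewrite mulr_ge0.
Qed.

(** Three things move: the resolvent, the centering constant and the function itself. The last one
    is needed later for the Poisson solution of [ws], whose right-hand side depends on the
    parameter. *)
Lemma poisson_lipschitz s t f f' c e : S s -> S t ->
  wbounded W f -> wbounded W f' -> 0 <= c -> 0 <= e ->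
  (forall x, `|f x| <= c * W x) -> (forall x, `|f x - f' x| <= e * W x) ->
  forall x, `|h s f x - h t f' x| <=
    (M * (c * (1 + Cpi) / (1 - rho)) / (1 - rho) * `|s - t| +
     (M * (c * (1 + Cpi) / (1 - rho)) * Cpi * `|s - t| + e * (1 + Cpi)) /
     (1 - rho)) * W x.
Proof.
move=> Ss St Lf Lf' c0 e0 fc fe x; have Cpi1 := Cpi_ge1 Ss.
have Lc a : wbounded W (cst a) by exact: wbounded_cst.
have Ls : wbounded W (f - cst (pi s f)) by exact: wboundedB.
have Lt : wbounded W (f' - cst (pi t f')) by exact: wboundedB.
have -> : h s f x - h t f' x = (G s (f - cst (pi s f)) x - G t (f - cst (pi s f)) x)
    + G t ((f - cst (pi s f)) - (f' - cst (pi t f'))) x.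
  have E := po_iterB (pQ St).
  have -> : G t ((f - cst (pi s f)) - (f' - cst (pi t f'))) x =
    G t (f - cst (pi s f)) x - G t (f' - cst (pi t f')) x.
    apply: cvgn_unique; first by
      apply: (neumann_cvg W0 (pQ St) rho_itv' mW (QW St)); exact: wboundedB.
    apply: eq_cvgn
      (cvgB (neumann_cvg W0 (pQ St) rho_itv' mW (QW St) (x := x) Ls)
            (neumann_cvg W0 (pQ St) rho_itv' mW (QW St) (x := x) Lt)) => n.
    rewrite -[LHS]/(series _ n - series _ n) /series/= -sumrB.
    apply: eq_bigr => i _.
    rewrite [in RHS](_ : iter i _ _ = iter i (Q t) (f - cst (pi s f)) -
      iter i (Q t) (f' - cst (pi t f')))//.
    by rewrite -E.
  by rewrite /poisson; ring.
apply: le_trans (ler_normD _ _) _; rewrite mulrDl; apply: lerD.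
  apply: neumann_lipschitz => //; first by rewrite mulr_ge0// addr_ge0// (le_trans _ Cpi1).
  apply: (center_le (w := W) mW W1 (ppi Ss) (pi1 Ss) (piW Ss)) => //.
  by move=> y; rewrite W1 lexx.
apply: (neumann_le W0 (pQ St) rho_itv' mW (QW St)) => //.
- exact: QW.
- rewrite addr_ge0// ?mulr_ge0 ?invr_ge0 ?subr_ge0 ?addr_ge0//;
    try by rewrite (le_trans _ Cpi1).
  by rewrite ltW//; case/andP: rho_itv.
- exact: wboundedB.
- move=> y.
  have -> : (f - cst (pi s f) - (f' - cst (pi t f'))) y =
    - (pi s f - pi t f) + ((f y - f' y) - pi t (f - f')).
    by rewrite (plB (ppi St))// !fctE; ring.
  rewrite mulrDl; apply: le_trans (ler_normD _ _) _; apply: lerD.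
    rewrite normrN; apply: le_trans (pi_lipschitz Ss St Lf c0 fc) _.
    rewrite ler_peMr//.
    rewrite !mulr_ge0 ?invr_ge0 ?subr_ge0 ?addr_ge0//;
    try by rewrite (le_trans _ Cpi1).
    by rewrite ltW//; case/andP: rho_itv.
  apply: (center_le (w := W) mW W1 (ppi St) (pi1 St) (piW St) (f := f - f')) => //.
  - exact: wboundedB.
  - by move=> z; rewrite W1 lexx.
Qed.

End kernel_family.

(** * The Stein equation *)

Section uniform_continuity.
Context {R : realType}.
Implicit Types f : R -> R.

Definition unif_cont f := forall e : R, 0 < e -> exists2 d : R, 0 < d &
  forall x y, `|x - y| <= d -> `|f x - f y| <= e.

(** Only [x] is confined to the segment while [y] may leave it, so that the segment may be reduced
    to one point. *)
Lemma continuous_unif_segment f (a b e : R) : continuous f -> 0 < e ->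
  exists2 d : R, 0 < d &
  forall x y, a <= x <= b -> `|x - y| <= d -> `|f x - f y| <= e.
Proof.
move=> cf e0; have /compact_near_coveringP cpt := @segment_compact R a b.
have := cpt R (0^'+) (fun d x => forall y, `|x - y| <= d -> `|f x - f y| <= e).
case=> [x _|A A0 hA].
  have e20 : 0 < e / 2 by rewrite divr_gt0.
  have /cvgrPdist_le/(_ _ e20)[/= d d0 hd] := cf x.
  have d2 : 0 < d / 2 by rewrite divr_gt0.
  near=> z d' => /= y zy.
  have xz : `|x - z| < d / 2 by near: z; exact: (@nbhsx_ballx _ _ x _ d2).
  have d'd : d' <= d / 2 by near: d'; apply: nbhs_right_le.
  have -> : f z - f y = (f x - f y) - (f x - f z) by ring.
  apply: le_trans (ler_normB _ _) _; rewrite [leRHS](splitr e).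
  apply: lerD; apply: hd => /=.
    have -> : x - y = (x - z) + (z - y) by ring.
    apply: le_lt_trans (ler_normD _ _) _; rewrite [ltRHS](splitr d).
    by apply: ltr_leD => //; exact: le_trans zy d'd.
  by apply: lt_trans xz _; rewrite ltr_pdivrMr// ltr_pMr// ltr1n.
exists (A / 2) => [|x y xab xy]; first by rewrite divr_gt0.
apply: (hA (A / 2)) => //=; last by rewrite divr_gt0.
by rewrite /= sub0r normrN gtr0_norm ?divr_gt0// ltr_pdivrMr// ltr_pMr// ltr1n.
Unshelve. all: by end_near.
Qed.

Lemma continuous_bounded_segment f (a b : R) : continuous f ->
  exists2 B : R, 0 <= B & forall x, a <= x <= b -> `|f x| <= B.
Proof.
move=> cf; have [ab|ba] := leP a b; last first.
  by exists 0 => // x /andP[ax xb]; have := le_lt_trans (le_trans ax xb) ba; rewrite ltxx.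
have cf' : {within `[a, b], continuous (fun x => `|f x|)}.
  apply: continuous_subspaceT => x; apply: (continuous_comp (cf x)).
  exact: norm_continuous.
have [c cab hc] := EVT_max ab cf'.
by exists `|f c| => // x xab; apply: hc; rewrite in_itv.
Qed.

Lemma vanishing_bounded f (A K : R) : continuous f -> 0 <= K ->
  (forall x, A <= `|x| -> `|f x| <= K / x ^+ 2) ->
  exists2 B : R, 0 <= B & forall x, `|f x| <= B.
Proof.
move=> cf K0 fK; pose L := Num.max A 1.
have [B B0 hB] := @continuous_bounded_segment f (- L) L cf.
exists (B + K) => [|x]; first exact: addr_ge0.
have [xL|Lx] := leP `|x| L.
  by apply: le_trans (hB x _) _; [rewrite -ler_norml|rewrite lerDl].
have L1 : 1 <= L by rewrite le_max lexx orbT.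
have x1 : 1 <= `|x| by rewrite (le_trans L1)// ltW.
apply: le_trans (fK x _) _.
  by apply: le_trans (ltW Lx); rewrite le_max lexx.
apply: (@le_trans _ _ K); last by rewrite lerDr.
rewrite -(real_normK (num_real x)) ler_pdivrMr ?exprn_gt0 ?(lt_le_trans _ x1)//.
by rewrite ler_peMr// exprn_ege1.
Qed.

Lemma vanishing_unif_cont f (A K : R) : continuous f -> 0 <= K ->
  (forall x, A <= `|x| -> `|f x| <= K / x ^+ 2) -> unif_cont f.
Proof.
move=> cf K0 fK e e0.
pose L := Num.max (Num.max A 1) (2 * K / e).
have L1 : 1 <= L by rewrite !le_max lexx orbT.
have LA : A <= L by rewrite !le_max lexx.
have LK : 2 * K / e <= L by rewrite le_max lexx orbT.
have small x : L <= `|x| -> `|f x| <= e / 2.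
  move=> Lx; apply: le_trans (fK x (le_trans LA Lx)) _.
  have x1 := le_trans L1 Lx; have x0 : 0 < `|x| by exact: lt_le_trans x1.
  rewrite ler_pdivrMr; last by rewrite -real_normK ?num_real// exprn_gt0.
  have : 2 * K / e <= `|x| by exact: le_trans Lx.
  rewrite ler_pdivrMr// -real_normK ?num_real// => h.
  have : e * `|x| <= e * `|x| ^+ 2 by rewrite (ler_pM2l e0) expr2 ler_peMr// ltW.
  by move: h; lra.
have [d d0 hd] := @continuous_unif_segment f (- (L + 1)) (L + 1) e cf e0.
exists (Num.min d 1) => [|x y]; first by rewrite lt_min d0/=.
rewrite le_min => /andP[xyd xy1].
have [xL|Lx] := leP `|x| (L + 1).
  by apply: hd => //; rewrite -ler_norml.
have Ly : L <= `|y|.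
  have : `|x| <= `|x - y| + `|y| by rewrite -{1}(subrK y x) ler_normD.
  by move: Lx xy1; lra.
apply: le_trans (ler_normB _ _) _; rewrite [leRHS](splitr e).
apply: lerD; apply: small => //.
by apply: ltW; apply: lt_trans Lx; rewrite ltrDl.
Qed.

End uniform_continuity.

Section stein.
Context {R : realType}.
Local Notation mu := (@lebesgue_measure R).
Variable sigma : R.
Hypothesis sigma0 : 0 < sigma.
Local Notation ga := (normal_pdf 0 sigma).

Let s0 : sigma != 0. Proof. exact: lt0r_neq0. Qed.

Lemma normal_pdf0E x :
  ga x = normal_peak sigma * expR (- x ^+ 2 / (sigma ^+ 2 *+ 2)).
Proof. by rewrite normal_pdfE// /normal_fun subr0. Qed.

Lemma normal_pdf_gt0 x : 0 < ga x.
Proof. by rewrite normal_pdf0E mulr_gt0 ?expR_gt0// normal_peak_gt0. Qed.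

Lemma normal_pdf_even x : ga (- x) = ga x.
Proof. by rewrite !normal_pdf0E sqrrN. Qed.

Lemma normal_pdf_derive x : is_derive x (1 : R) ga (- x / sigma ^+ 2 * ga x).
Proof.
have -> : ga = (fun y => normal_peak sigma * expR (- y ^+ 2 / (sigma ^+ 2 *+ 2))).
  by apply/funext => y; rewrite normal_pdf0E.
apply: is_derive_eq.
set e := expR _; rewrite /GRing.scale/=.
by field.
Qed.

Lemma cvg_pinfty_le_inv (u : R -> R) (K : R) :
  (forall x, 1 <= x -> `|u x| <= K / x) -> u x @[x --> +oo] --> 0.
Proof.
move=> uK; apply/cvgrPdist_le => e e0; near=> x.
have x1 : 1 <= x by near: x; exact: nbhs_pinfty_ge.
have xK : K / e <= x by near: x; apply: nbhs_pinfty_ge; exact: num_real.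
rewrite sub0r normrN; apply: le_trans (uK x x1) _.
have x0 : 0 < x by exact: lt_le_trans x1.
by rewrite ler_pdivrMr// mulrC -ler_pdivrMr.
Unshelve. all: by end_near.
Qed.

Lemma normal_pdf_le_inv x : 1 <= x -> `|ga x| <= normal_peak sigma * (2 * sigma ^+ 2) / x.
Proof.
move=> x1; have x0 : 0 < x by exact: lt_le_trans x1.
rewrite ger0_norm ?normal_pdf_ge0// normal_pdf0E -mulrA ler_wpM2l ?normal_peak_ge0//.
rewrite mulNr expRN.
have ss : 0 < sigma ^+ 2 by rewrite exprn_gt0.
have h : x / (2 * sigma ^+ 2) <= expR (x ^+ 2 / (sigma ^+ 2 *+ 2)).
  apply: le_trans (expR_ge1Dx _).
  apply: (@le_trans _ _ (x ^+ 2 / (2 * sigma ^+ 2))).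
    by apply: ler_wpM2r; [rewrite invr_ge0 mulr_ge0 ?(ltW ss)|rewrite expr2 ler_peMr// ltW].
  have -> : sigma ^+ 2 *+ 2 = 2 * sigma ^+ 2 by ring.
  by rewrite lerDr.
rewrite -[leRHS]invf_div lef_pV2// ?posrE ?expR_gt0//.
by rewrite divr_gt0// mulr_gt0.
Qed.

Definition gauss_tail x := (\int[mu]_(t in `[x, +oo[) ga t)%R.

Let iga D : measurable D -> mu.-integrable D (EFin \o ga).
Proof.
move=> mD; apply: (integrableS measurableT) => //.
exact: integrable_normal_pdf.
Qed.

Let cga : continuous ga. Proof. exact: continuous_normal_pdf. Qed.

(** Upper Mills bound: t / x is at least 1 on the half-line, and (t / sigma^2) ga(t) has the
    primitive - ga(t), which vanishes at infinity. *)
Lemma gauss_tail_le x : 0 < x -> gauss_tail x <= sigma ^+ 2 * ga x / x.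
Proof.
move=> x0; have ss : 0 < sigma ^+ 2 by rewrite exprn_gt0.
have ct : continuous (fun t : R => t / sigma ^+ 2 * ga t).
  move=> t; apply: cvgM; last exact: cga.
  by apply: cvgM; [exact: cvg_id|exact: cvg_cst].
have dn (t : R) : is_derive t 1 (- ga) (t / sigma ^+ 2 * ga t).
  apply: is_derive_eq; first exact: (is_deriveN (normal_pdf_derive t)).
  by rewrite mulNr mulNr opprK.
have E : (\int[mu]_(t in `[x, +oo[) (t / sigma ^+ 2 * ga t) = ga x)%R.
  rewrite (@Rintegral_ge0_continuous_FTC2y _ _ (- ga) x 0).
  - by rewrite sub0r opprK.
  - move=> t xt; rewrite mulr_ge0 ?normal_pdf_ge0// divr_ge0 ?(ltW ss)//.
    by apply: le_trans xt; exact: ltW.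
  - exact: continuous_subspaceT.
  - have : (- ga) t @[t --> +oo] --> (- 0 : R).
      by apply: cvgN; apply: cvg_pinfty_le_inv; exact: normal_pdf_le_inv.
    by rewrite [X in _ --> X -> _]oppr0.
  - by move=> t _; exact: (@ex_derive _ _ _ _ _ _ _ (dn t)).
  - by apply: cvg_at_right_filter; apply: continuousN; exact: cga.
  - by move=> t _; rewrite derive1E (@derive_val _ _ _ _ _ _ _ (dn t)).
have it : mu.-integrable `[x, +oo[ (EFin \o (fun t : R => t / sigma ^+ 2 * ga t)).
  apply/integrableP; split.
    apply/measurable_EFinP; apply: measurable_funTS.
    exact: continuous_measurable_fun.
  have -> : (\int[mu]_(t in `[x, +oo[) `|((fun t : R => t / sigma ^+ 2 * ga t)%R t)%:E| =
    \int[mu]_(t in `[x, +oo[) (t / sigma ^+ 2 * ga t)%:E)%E.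
    apply: eq_integral => t; rewrite inE/= in_itv/= andbT => xt.
    rewrite /= ger0_norm// mulr_ge0 ?normal_pdf_ge0// divr_ge0 ?(ltW ss)//.
    by apply: le_trans xt; exact: ltW.
  rewrite (@ge0_continuous_FTC2y _ _ (- ga) x 0).
  - by rewrite sub0e; exact: ltry.
  - move=> t xt; rewrite mulr_ge0 ?normal_pdf_ge0// divr_ge0 ?(ltW ss)//.
    by apply: le_trans xt; exact: ltW.
  - exact: continuous_subspaceT.
  - have : (- ga) t @[t --> +oo] --> (- 0 : R).
      by apply: cvgN; apply: cvg_pinfty_le_inv; exact: normal_pdf_le_inv.
    by rewrite [X in _ --> X -> _]oppr0.
  - by move=> t _; exact: (@ex_derive _ _ _ _ _ _ _ (dn t)).
  - by apply: cvg_at_right_filter; apply: continuousN; exact: cga.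
  - by move=> t _; rewrite derive1E (@derive_val _ _ _ _ _ _ _ (dn t)).
have -> : sigma ^+ 2 * ga x / x = (sigma ^+ 2 / x) * ga x by ring.
rewrite -E -RintegralZl//=.
apply: le_Rintegral => //.
- exact: iga.
- by apply: (integrableZl _ (sigma ^+ 2 / x) it).
- move=> t /=; rewrite in_itv/= andbT => xt.
  rewrite mulrA ler_peMl ?normal_pdf_ge0//.
  have -> : sigma ^+ 2 / x * (t / sigma ^+ 2) = t / x.
    by field; rewrite s0 gt_eqF.
  by rewrite ler_pdivlMr// mul1r.
Qed.

(** Lower Mills bound: - ga(t) / t is a primitive of (sigma^-2 + t^-2) ga(t), whose first factor is
    largest at t = x. *)
Lemma gauss_tail_ge x : 0 < x ->
  ga x / x <= (sigma ^- 2 + x ^- 2) * gauss_tail x.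
Proof.
move=> x0; have ss : 0 < sigma ^+ 2 by rewrite exprn_gt0.
pose q t := ga t / t; pose dq t := (sigma ^- 2 + t ^- 2) * ga t.
have dn (t : R) : x <= t -> is_derive t 1 (- q) (dq t).
  move=> xt; have t0 : t != 0 by rewrite gt_eqF// (lt_le_trans x0).
  have ti : is_derive t 1 (fun y : R => y^-1) (- t ^- 2).
    apply: is_derive_eq; first exact: is_deriveV.
    by rewrite /GRing.scale/= mulr1.
  apply: is_derive_eq.
    apply: is_deriveN; exact: (is_deriveM (normal_pdf_derive t) ti).
  rewrite /dq /GRing.scale/=; field.
  by rewrite s0 t0.
have dq0 t : x <= t -> 0 <= dq t.
  by move=> xt; rewrite mulr_ge0 ?normal_pdf_ge0// addr_ge0// invr_ge0 sqr_ge0.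
have cdq t : x <= t -> {for t, continuous dq}.
  move=> xt; have t0 : t != 0 by rewrite gt_eqF// (lt_le_trans x0).
  apply: cvgM; last exact: cga.
  apply: cvgD; first exact: cvg_cst.
  by apply: cvgV; [rewrite expf_neq0|exact: exprn_continuous].
have E : (\int[mu]_(t in `[x, +oo[) (dq t)%:E = (q x)%:E)%E.
  rewrite (@ge0_continuous_FTC2y _ _ (- q) x 0).
  - by rewrite sub0e -EFinN opprK.
  - exact: dq0.
  - apply: continuous_in_subspaceT => t; rewrite inE/= in_itv/= andbT => xt.
    exact: cdq.
  - suff /cvgN : q t @[t --> +oo] --> 0 by rewrite oppr0.
    apply: (@cvg_pinfty_le_inv _ (normal_peak sigma)) => t t1.
    have t0 : 0 < t by exact: lt_le_trans t1.
    rewrite ger0_norm ?divr_ge0 ?normal_pdf_ge0 ?(ltW t0)//.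
    by rewrite ler_wpM2r ?invr_ge0 ?(ltW t0)// normal_pdf_ub.
  - by move=> t xt; exact: (@ex_derive _ _ _ _ _ _ _ (dn t (ltW xt))).
  - apply: cvg_at_right_filter; apply: continuousN.
    apply: cvgM; first exact: cga.
    by apply: cvgV; [rewrite gt_eqF|exact: cvg_id].
  - move=> t; rewrite in_itv/= andbT => xt.
    by rewrite derive1E (@derive_val _ _ _ _ _ _ _ (dn t (ltW xt))).
have it : mu.-integrable `[x, +oo[ (EFin \o dq).
  apply/integrableP; split.
    apply/measurable_EFinP; apply: subspace_continuous_measurable_fun => //.
    apply: continuous_in_subspaceT => t; rewrite inE/= in_itv/= andbT => xt.
    exact: cdq.
  have -> : (\int[mu]_(t in `[x, +oo[) `|(EFin \o dq) t| =
    \int[mu]_(t in `[x, +oo[) (dq t)%:E)%E.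
    apply: eq_integral => t; rewrite inE/= in_itv/= andbT => xt.
    by rewrite /= ger0_norm// dq0.
  by rewrite E ltry.
rewrite -RintegralZl//=; last exact: iga.
have -> : ga x / x = (\int[mu]_(t in `[x, +oo[) dq t)%R by rewrite /Rintegral E.
apply: le_Rintegral => //.
- by apply: (integrableZl _ (sigma ^- 2 + x ^- 2) (iga _)).
- move=> t /=; rewrite in_itv/= andbT => xt.
  have t0 : 0 < t by exact: lt_le_trans xt.
  rewrite ler_wpM2r ?normal_pdf_ge0// lerD2l lef_pV2 ?posrE ?exprn_gt0//.
  by rewrite lerXn2r// nnegrE ltW.
Qed.


Lemma gauss_tailN x : (\int[mu]_(t in `]-oo, x]) ga t)%R = gauss_tail (- x).
Proof.
rewrite /gauss_tail /Rintegral; congr fine.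
have := @ge0_integration_by_substitutionNy R ga (- x); rewrite opprK => ->.
- by apply: eq_integral => t _; rewrite /= normal_pdf_even.
- exact: continuous_subspaceT.
- by move=> t _; exact: normal_pdf_ge0.
Qed.

Lemma is_derive_ray_integral (q : R -> R) (x : R) : continuous q ->
  lebesgue_measure.-integrable [set: R] (EFin \o q) ->
  is_derive x (1 : R) (fun x => \int[lebesgue_measure]_(t in `]-oo, x]) q t)%R (q x).
Proof.
move=> cq iq; have x1 : x < x + 1 by rewrite ltrDl.
have iqx : lebesgue_measure.-integrable [set` Interval -oo%O (BRight (x + 1))] (EFin \o q).
  by apply: integrableS iq => //; exact: measurableT.
have [] := @continuous_FTC1 R q -oo%O x (x + 1) x1 iqx _ (cq x); first by rewrite /Order.lt/=.
move=> h1; rewrite derive1E => h2.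
exact: (DeriveDef h1 h2).
Qed.

Section solution.
Variables (psi : R -> R) (L : R).
Hypotheses (cpsi : continuous psi) (psi0 : forall x, L <= `|x| -> psi x = 0).

Let c := (\int[mu]_x (psi x * ga x))%R.
Let q x := (psi x - c) * ga x.
Let F x := (\int[mu]_(t in `]-oo, x]) q t)%R.

Let cq : continuous q.
Proof.
move=> x; apply: cvgM; last exact: cga.
by apply: cvgB; [exact: cpsi|exact: cvg_cst].
Qed.

Let psi_bnd : exists2 B : R, 0 <= B & forall x, `|psi x| <= B.
Proof.
have [B B0 hB] := @continuous_bounded_segment _ psi (- L) L cpsi.
exists B => // x; have [xL|Lx] := leP `|x| L; first by apply: hB; rewrite -ler_norml.
by rewrite psi0 ?normr0// ltW.
Qed.

Let ipsi D : measurable D -> mu.-integrable D (EFin \o (fun x => psi x * ga x)).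
Proof.
move=> mD; apply: (integrableS measurableT) => //.
have [B B0 hB] := psi_bnd.
apply: (@le_integrable _ _ _ mu setT _ _ (fun x => (B * ga x)%:E)) => //.
- apply/measurable_EFinP; apply: measurable_funM.
    exact: continuous_measurable_fun.
  exact: measurable_normal_pdf.
- move=> x _; rewrite lee_fin !normrM (ger0_norm B0).
  by rewrite ler_wpM2r.
- exact: (integrableZl _ B (iga measurableT)).
Qed.

Let iq D : measurable D -> mu.-integrable D (EFin \o q).
Proof.
move=> mD; have -> : EFin \o q = (fun x => (psi x * ga x)%:E - (c * ga x)%:E)%E.
  by apply/funext => x; rewrite /q /= -EFinB mulrBl.
apply: integrableB => //; first exact: ipsi.
exact: (integrableZl _ c (iga mD)).
Qed.

Let int_ga : (\int[mu]_x ga x)%R = 1.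
Proof. by rewrite /Rintegral integral_normal_pdf. Qed.

Let int_q : (\int[mu]_x q x)%R = 0.
Proof.
have -> : q = (fun x => psi x * ga x - c * ga x).
  by apply/funext => x; rewrite /q mulrBl.
rewrite RintegralB//; last exact: (integrableZl _ c (iga measurableT)).
- by rewrite RintegralZl ?int_ga ?mulr1 ?subrr//; exact: iga.
- exact: ipsi.
Qed.

Let dF x : is_derive x (1 : R) F (q x).
Proof.
have h := is_derive_ray_integral x cq (iq measurableT).
exact h.
Qed.

(** As [q] has integral 0, [F] is minus its integral over the right half-line, where [psi] vanishes
    and only [c] times the Gaussian tail is left. *)
Let F_right x : L <= x -> 0 <= x -> F x = c * gauss_tail x.
Proof.
move=> Lx x0.
have iqT : mu.-integrable [set` `]-oo, +oo[] (EFin \o q) by rewrite set_itvNyy; exact: iq.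
have := @Rintegral_itvB R q -oo%O +oo%O x iqT isT isT.
rewrite -/(F x) set_itvNyy int_q sub0r => /eqP; rewrite eqr_oppLR => /eqP ->.
rewrite Rintegral_itv_obnd_cbnd; last exact: iq.
rewrite -RintegralZl//; last exact: iga.
rewrite -mulN1r -RintegralZl//; last exact: iq.
rewrite /Rintegral; congr fine; apply: eq_integral => t.
rewrite inE/= in_itv/= andbT => xt.
by rewrite /q psi0 ?sub0r; [congr EFin; ring|rewrite ger0_norm ?(le_trans Lx)// (le_trans x0)].
Qed.

Let F_left x : L <= - x -> 0 <= - x -> F x = - c * gauss_tail (- x).
Proof.
move=> Lx x0; rewrite -gauss_tailN -RintegralZl//; last exact: iga.
rewrite /F /Rintegral; congr fine; apply: eq_integral => t.
rewrite inE/= in_itv/= => tx.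
have tx' : - x <= - t by rewrite lerN2.
by rewrite /q psi0 ?sub0r// -normrN ger0_norm ?(le_trans Lx)// (le_trans x0).
Qed.

(** Variation of constants for sigma^2 f' - x f = psi - c, with integrating factor [ga]. *)
Let f x := F x / (sigma ^+ 2 * ga x).
Let df x := (x * f x + psi x - c) / sigma ^+ 2.

Let dfE x : is_derive x (1 : R) f (df x).
Proof.
have gn : ga x != 0 by rewrite gt_eqF// normal_pdf_gt0.
have d1 : is_derive x (1 : R) (fun y => sigma ^+ 2 * ga y) (- x * ga x).
  apply: is_derive_eq; first exact: (is_deriveZ (sigma ^+ 2) (normal_pdf_derive x)).
  by rewrite /GRing.scale/=; field.
have d2 : is_derive x (1 : R) (fun y => (sigma ^+ 2 * ga y)^-1)
   (x * ga x / (sigma ^+ 2 * ga x) ^+ 2).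
  apply: is_derive_eq; first by apply: is_deriveV; rewrite mulf_neq0// expf_neq0.
  by rewrite /GRing.scale/=; field; rewrite s0 gn.
apply: is_derive_eq; first exact: (is_deriveM (dF x) d2).
by rewrite /GRing.scale/= /df /f /q; field; rewrite s0 gn.
Qed.

Let cf : continuous f.
Proof.
move=> x; apply: differentiable_continuous; apply/derivable1_diffP.
exact: (@ex_derive _ _ _ _ _ _ _ (dfE x)).
Qed.

Let cdf : continuous df.
Proof.
move=> x; apply: cvgM; last exact: cvg_cst.
apply: cvgB; last exact: cvg_cst.
by apply: cvgD; [apply: cvgM; [exact: cvg_id|exact: cf]|exact: cpsi].
Qed.

(* Both Mills bounds are used: they give |x f(x) - c| <= |c| sigma^2 / x^2. *)
Let df_right x : L <= x -> 1 <= x -> `|df x| <= `|c| / x ^+ 2.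
Proof.
move=> Lx x1; have x0 : 0 < x by exact: lt_le_trans x1.
have xn : x != 0 by rewrite gt_eqF.
have gn : 0 < ga x by exact: normal_pdf_gt0.
have gn' : ga x != 0 by rewrite gt_eqF.
have -> : df x = - c * (sigma ^- 2 * (1 - x * gauss_tail x / (sigma ^+ 2 * ga x))).
  rewrite /df /f F_right ?(ltW x0)// psi0 ?ger0_norm ?(ltW x0)//.
  by field; rewrite s0 gn'.
rewrite normrM normrN ler_wpM2l//.
have ss : 0 < sigma ^+ 2 by rewrite exprn_gt0.
have h1 := gauss_tail_le x0; have h2 := gauss_tail_ge x0.
set T := gauss_tail x in h1 h2 *.
have u1 : x * T / (sigma ^+ 2 * ga x) <= 1.
  rewrite ler_pdivrMr ?mul1r ?mulr_gt0//.
  by move: h1; rewrite ler_pdivlMr// mulrC.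
set u := x * T / (sigma ^+ 2 * ga x) in u1 *.
rewrite ger0_norm; last by rewrite mulr_ge0 ?invr_ge0 ?(ltW ss)// subr_ge0.
have h3 : 1 <= u + sigma ^+ 2 * x ^- 2 * u.
  have -> : 1 = ga x / x * (x / ga x) by field; rewrite gn' xn.
  have -> : u + sigma ^+ 2 * x ^- 2 * u = (sigma ^- 2 + x ^- 2) * T * (x / ga x).
    by rewrite /u; field; rewrite s0 gn' xn.
  by rewrite ler_wpM2r// divr_ge0// ltW.
rewrite mulrC ler_pdivrMr// mulrC lerBlDl; apply: le_trans h3 _.
by rewrite lerD2l ler_piMr// mulr_ge0 ?(ltW ss)// invr_ge0 sqr_ge0.
Qed.

Let df_left x : L <= - x -> 1 <= - x -> `|df x| <= `|c| / x ^+ 2.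
Proof.
move=> Lx x1; have x0 : 0 < - x by exact: lt_le_trans x1.
have xn : x != 0 by rewrite lt_eqF// -oppr_gt0.
have gn : 0 < ga x by exact: normal_pdf_gt0.
have gn' : ga x != 0 by rewrite gt_eqF.
have gE := normal_pdf_even x.
have -> : df x = - c * (sigma ^- 2 * (1 - (- x) * gauss_tail (- x) / (sigma ^+ 2 * ga x))).
  have px : psi x = 0 by apply: psi0; rewrite -normrN ger0_norm// ltW.
  rewrite /df /f F_left ?(ltW x0)// px.
  by field; rewrite s0 gn'.
have px : psi (- x) = 0 by apply: psi0; rewrite ger0_norm// ltW.
have := df_right Lx x1; rewrite /df /f F_right ?(ltW x0)// px.
rewrite gE sqrrN; congr (`|_| <= _); field.
by rewrite s0 gn'.
Qed.

(** Since [psi] vanishes near infinity, the solution there is an explicit multiple of a Mills ratio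
    and its derivative is O(1/x^2); a continuous function with this decay is bounded and uniformly
    continuous. The uniform modulus stands for the bound on a second derivative, which would ask for
    more than continuity of [psi]. *)
Lemma stein_solution : exists f df : R -> R, [/\ forall x, is_derive x (1 : R) f (df x),
  forall x, sigma ^+ 2 * df x - x * f x =
            psi x - (\int[mu]_x (psi x * ga x))%R,
  exists2 B : R, 0 <= B & forall x, `|df x| <= B & unif_cont df].
Proof.
exists f, df.
have hdf x : Num.max L 1 <= `|x| -> `|df x| <= `|c| / x ^+ 2.
  rewrite ge_max => /andP[Lx x1]; have [x0|x0] := leP 0 x.
    by apply: df_right; rewrite -(ger0_norm x0).
  by apply: df_left; rewrite -(ltr0_norm x0).
split.
- exact: dfE.
- by move=> x; rewrite /df -/c; field.
- exact: vanishing_bounded cdf (normr_ge0 c) hdf.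
- exact: vanishing_unif_cont cdf (normr_ge0 c) hdf.
Qed.

End solution.

End stein.

(** * Integration of nonnegative functions, means *)

Section ge0_functional.
Context {R : realType} d (T : measurableType d).
Import HBNNSimple.
Implicit Types (L : (T -> R) -> \bar R) (f g : T -> R).

(* Integration against a measure, as seen by the monotone class argument. *)
Definition ge0_functional L := [/\
  forall f g, measurable_fun [set: T] f -> measurable_fun [set: T] g ->
    (forall x, 0 <= f x) -> (forall x, 0 <= g x) ->
    L (fun x => f x + g x) = (L f + L g)%E,
  forall a f, 0 <= a -> measurable_fun [set: T] f -> (forall x, 0 <= f x) ->
    L (fun x => a * f x) = (a%:E * L f)%E &
  forall (f_ : nat -> T -> R) f,
    (forall n, measurable_fun [set: T] (f_ n)) -> (forall n x, 0 <= f_ n x) ->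
    (forall x, nondecreasing_seq (f_ ^~ x)) ->
    measurable_fun [set: T] f -> (forall x, f_ ^~ x @ \oo --> f x) ->
    (fun n => L (f_ n)) @ \oo --> L f].

(** Indicators determine simple functions by linearity, and nonnegative functions by increasing
    limits. Transfer formulas, densities, independence and the Markov property are all reduced to
    sets in this way. *)
Lemma ge0_functional_eq L1 L2 : ge0_functional L1 -> ge0_functional L2 ->
  (forall B, measurable B -> L1 (\1_B) = L2 (\1_B)) ->
  forall f, measurable_fun [set: T] f -> (forall x, 0 <= f x) -> L1 f = L2 f.
Proof.
move=> [D1 Z1 M1] [D2 Z2 M2] LI f mf f0.
have L0 L : (forall a f, 0 <= a -> measurable_fun [set: T] f ->
    (forall x, 0 <= f x) -> L (fun x => a * f x) = (a%:E * L f)%E) ->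
    L (cst 0) = 0%E.
  move=> ZL; rewrite -(mul0e (L (cst 0))) -ZL//.
  by congr L; apply/funext => x; rewrite mul0r.
have Ls (s : seq R) (A : R -> set T) : all (fun y => 0 <= y) s ->
    (forall y, measurable (A y)) ->
    L1 (fun x => \sum_(y <- s) (y * \1_(A y) x)) =
    L2 (fun x => \sum_(y <- s) (y * \1_(A y) x)).
  move=> + mA; elim: s => [_|y s IH /= /andP[y0 s0]].
    under eq_fun do rewrite big_nil.
    by rewrite (L0 L1)// (L0 L2).
  have m1 : measurable_fun [set: T] (fun x => y * \1_(A y) x : R).
    by apply: measurable_funM => //; exact: measurable_indic.
  have p1 x : 0 <= y * \1_(A y) x :> R by rewrite mulr_ge0.
  have m2 : measurable_fun [set: T] (fun x => \sum_(y <- s) (y * \1_(A y) x) : R).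
    apply: measurable_sum => z; apply: measurable_funM => //; exact: measurable_indic.
  have p2 x : 0 <= \sum_(y <- s) (y * \1_(A y) x) :> R.
    by rewrite big_seq sumr_ge0// => z zs; rewrite mulr_ge0// (allP s0).
  under eq_fun do rewrite big_cons.
  by rewrite D1// D2// IH// Z1// Z2// LI.
have mf' : measurable_fun [set: T] (EFin \o f) by exact/measurable_EFinP.
pose f_ n : T -> R := nnsfun_approx measurableT mf' n.
have Lf_ n : L1 (f_ n) = L2 (f_ n).
  rewrite /f_; set h := nnsfun_approx _ _ _.
  have [s0 hs0] : exists s : seq R, range h = [set` s].
    by apply/finite_seqP; exact: (@fimfunP _ _ h).
  have hs : range h = [set` undup s0].
    by rewrite hs0; apply/seteqP; split => y /=; rewrite mem_undup.
  have -> : (h : T -> R) = (fun x => \sum_(y <- undup s0) (y * \1_(h @^-1` [set y]) x)).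
    by apply/funext => x; rewrite fimfunE hs -fsbig_seq// undup_uniq.
  apply: Ls => //.
  apply/allP => y ys; have : [set` undup s0] y by [].
  by rewrite -hs => -[x _ <-].
have nf x : nondecreasing_seq (f_ ^~ x).
  by move=> m n mn; have /lefP := nd_nnsfun_approx measurableT mf' mn; apply.
have cf x : f_ ^~ x @ \oo --> f x.
  have f0' y : [set: T] y -> (0 <= (EFin \o f) y)%E by rewrite lee_fin.
  by have /fine_cvgP[_] := cvg_nnsfun_approx measurableT mf' f0' (x := x) I.
have f_0 n x : 0 <= f_ n x by [].
have mf_ n : measurable_fun [set: T] (f_ n) by exact: measurable_funPT.
have := M1 f_ f mf_ f_0 nf mf cf => /(cvg_lim (@ereal_hausdorff R)) <-.
have := M2 f_ f mf_ f_0 nf mf cf => /(cvg_lim (@ereal_hausdorff R)) <-.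
by congr (lim (_ @ \oo)); apply/funext.
Qed.

End ge0_functional.

Section ge0_functional_examples.
Context {R : realType}.

Lemma ge0_integral_cvg d (T : measurableType d) (m : {measure set T -> \bar R})
    (D : set T) (g_ : nat -> T -> \bar R) (g : T -> \bar R) : measurable D ->
  (forall n, measurable_fun D (g_ n)) -> (forall n x, D x -> (0 <= g_ n x)%E) ->
  (forall x, D x -> nondecreasing_seq (g_ ^~ x)) ->
  (forall x, D x -> g_ ^~ x @ \oo --> g x) ->
  (fun n => \int[m]_(x in D) g_ n x)%E @ \oo --> (\int[m]_(x in D) g x)%E.
Proof.
move=> mD mg g0 ng cg.
have <- : (\int[m]_(x in D) limn (g_ ^~ x) = \int[m]_(x in D) g x)%E.
  apply: eq_integral => x; rewrite inE => Dx.
  by apply/(cvg_lim (@ereal_hausdorff R)); exact: cg.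
exact: cvg_monotone_convergence.
Qed.

Lemma ge0_functional_weighted d d' (Om : measurableType d)
    (T : measurableType d') (m : {measure set Om -> \bar R}) (A : Om -> T)
    (F : Om -> R) : measurable_fun [set: Om] A -> measurable_fun [set: Om] F ->
  (forall w, 0 <= F w) ->
  ge0_functional (fun f : T -> R => \int[m]_w (f (A w) * F w)%:E)%E.
Proof.
move=> mA mF F0.
have mAf (f : T -> R) : measurable_fun [set: T] f ->
    measurable_fun [set: Om] (fun w => (f (A w) * F w)%:E).
  move=> mf; apply/measurable_EFinP; apply: measurable_funM => //.
  exact: measurableT_comp.
split=> [f g mf mg f0 g0|a f a0 mf f0|f_ f mf_ f_0 nf mf cf].
- under eq_integral do rewrite mulrDl EFinD.
  rewrite ge0_integralD//; try exact: mAf.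
    by move=> w _; rewrite lee_fin mulr_ge0.
  by move=> w _; rewrite lee_fin mulr_ge0.
- under eq_integral do rewrite -mulrA EFinM.
  rewrite ge0_integralZl//; first exact: mAf.
  by move=> w _; rewrite lee_fin mulr_ge0.
- apply: ge0_integral_cvg => //.
  + by move=> n; exact: mAf.
  + by move=> n w _; rewrite lee_fin mulr_ge0.
  + by move=> w _ i j ij; rewrite lee_fin ler_wpM2r// nf.
  + move=> w _; apply: cvg_EFin; first by near=> n.
    by apply: cvgM; [exact: cf|exact: cvg_cst].
Unshelve. all: by end_near.
Qed.

Lemma ge0_functional_kernel d d' d'' (Om : measurableType d)
    (T : measurableType d') (U : measurableType d'')
    (m : {measure set Om -> \bar R}) (E : set Om)
    (A : Om -> U) (K : R.-ker U ~> T) : measurable E ->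
  measurable_fun [set: Om] A ->
  ge0_functional (fun f : T -> R => \int[m]_(w in E) \int[K (A w)]_y (f y)%:E)%E.
Proof.
move=> mE mA.
have mK (f : T -> R) : measurable_fun [set: T] f -> (forall y, 0 <= f y) ->
    measurable_fun E (fun w => \int[K (A w)]_y (f y)%:E)%E.
  move=> mf f0; apply: measurable_funTS.
  apply: (measurableT_comp (f := fun u => \int[K u]_y (f y)%:E)%E) => //.
  apply: measurable_fun_integral_kernel.
  - by move=> V mV; exact: measurable_kernel.
  - by move=> y; rewrite lee_fin.
  - exact/measurable_EFinP.
have K0 (f : T -> R) w : (forall y, 0 <= f y) -> (0 <= \int[K (A w)]_y (f y)%:E)%E.
  by move=> f0; apply: integral_ge0 => y _; rewrite lee_fin.
split=> [f g mf mg f0 g0|a f a0 mf f0|f_ f mf_ f_0 nf mf cf].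
- rewrite -ge0_integralD//; try exact: mK; try (by move=> w _; exact: K0).
  apply: eq_integral => w _; under eq_integral do rewrite EFinD.
  rewrite ge0_integralD//; try exact/measurable_EFinP.
  - by move=> y _; rewrite lee_fin.
  - by move=> y _; rewrite lee_fin.
- rewrite -ge0_integralZl//; try exact: mK; try (by move=> w _; exact: K0).
  apply: eq_integral => w _; under eq_integral do rewrite EFinM.
  rewrite ge0_integralZl//; first exact/measurable_EFinP.
  by move=> y _; rewrite lee_fin.
- apply: ge0_integral_cvg => //.
  + by move=> n; exact: mK.
  + by move=> n w _; exact: K0.
  + move=> w _ i j ij; apply: ge0_le_integral => //.
    * by move=> y _; rewrite lee_fin.
    * exact/measurable_EFinP.
    * exact/measurable_EFinP.
    * by move=> y _; rewrite lee_fin nf.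
  + move=> w _; apply: ge0_integral_cvg => //.
    * by move=> n; exact/measurable_EFinP.
    * by move=> n y _; rewrite lee_fin.
    * by move=> y _ i j ij; rewrite lee_fin nf.
    * by move=> y _; apply: cvg_EFin; [near=> n|exact: cf].
Unshelve. all: by end_near.
Qed.

End ge0_functional_examples.

Section integrable_functions.
Context {R : realType} d (Om : measurableType d) (P : probability Om R).
Implicit Types X Y : Om -> R.

Definition integ X := P.-integrable [set: Om] (EFin \o X).

(** Measurability is listed apart because integrability of the square does not imply it. *)
Definition sqinteg X := measurable_fun [set: Om] X /\ integ (fun w => X w ^+ 2).

Definition mean X := (\int[P]_w X w)%R.

Lemma integ_meas X : integ X -> measurable_fun [set: Om] X.
Proof. by move=> /measurable_int /measurable_EFinP. Qed.

Lemma integ_le X Y : integ Y -> measurable_fun [set: Om] X ->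
  (forall w, `|X w| <= Y w) -> integ X.
Proof.
move=> iY mX XY; apply: (le_integrable measurableT _ _ iY).
  exact/measurable_EFinP.
by move=> w _; rewrite lee_fin (le_trans (XY w))// ler_norm.
Qed.

Lemma integD X Y : integ X -> integ Y -> integ (fun w => X w + Y w).
Proof.
move=> iX iY; have := integrableD measurableT iX iY.
by apply: eq_integrable => // w _.
Qed.

Lemma integZ a X : integ X -> integ (fun w => a * X w).
Proof.
move=> iX; have := integrableZl measurableT a iX.
by apply: eq_integrable => // w _.
Qed.

Lemma integB X Y : integ X -> integ Y -> integ (fun w => X w - Y w).
Proof.
move=> iX iY; have := integrableB measurableT iX iY.
by apply: eq_integrable => // w _.
Qed.

Lemma integ_cst a : integ (fun=> a).
Proof. exact: finite_measure_integrable_cst. Qed.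

Lemma integ_bounded X c : measurable_fun [set: Om] X ->
  (forall w, `|X w| <= c) -> integ X.
Proof. by move=> mX; apply: integ_le => //; exact: integ_cst. Qed.

Lemma integ_sum I (s : seq I) (F : I -> Om -> R) : (forall i, integ (F i)) ->
  integ (fun w => \sum_(i <- s) F i w).
Proof.
move=> iF; elim: s => [|i s IH].
  by under eq_fun do rewrite big_nil; exact: integ_cst.
by under eq_fun do rewrite big_cons; exact: integD.
Qed.

Lemma meanD X Y : integ X -> integ Y -> mean (fun w => X w + Y w) = mean X + mean Y.
Proof. by move=> iX iY; rewrite /mean RintegralD. Qed.

Lemma meanB X Y : integ X -> integ Y -> mean (fun w => X w - Y w) = mean X - mean Y.
Proof. by move=> iX iY; rewrite /mean RintegralB. Qed.

Lemma meanZ a X : integ X -> mean (fun w => a * X w) = a * mean X.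
Proof. by move=> iX; rewrite /mean RintegralZl. Qed.

Lemma meancst a : mean (fun=> a) = a.
Proof.
rewrite /mean Rintegral_cst// -[RHS]mulr1; congr (_ * _).
by rewrite [X in fine X](_ : _ = 1%E)//; exact: probability_setT.
Qed.

Lemma mean_sum I (s : seq I) (F : I -> Om -> R) : (forall i, integ (F i)) ->
  mean (fun w => \sum_(i <- s) F i w) = \sum_(i <- s) mean (F i).
Proof.
move=> iF; elim: s => [|i s IH].
  by rewrite big_nil -[RHS](meancst 0); congr mean; apply/funext => w; rewrite big_nil.
have -> : (fun w => \sum_(j <- i :: s) F j w) = (fun w => F i w + \sum_(j <- s) F j w).
  by apply/funext => w; rewrite big_cons.
rewrite big_cons.
by rewrite -IH -meanD//; exact: integ_sum.
Qed.

Lemma mean_ge0 X : (forall w, 0 <= X w) -> 0 <= mean X.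
Proof. by move=> X0; apply: Rintegral_ge0. Qed.

Lemma mean_le X Y : integ X -> integ Y -> (forall w, X w <= Y w) -> mean X <= mean Y.
Proof. by move=> iX iY XY; apply: le_Rintegral. Qed.

Lemma mean_norm_le X Y : integ X -> integ Y -> (forall w, `|X w| <= Y w) ->
  `|mean X| <= mean Y.
Proof.
move=> iX iY XY; apply: le_trans (le_normr_Rintegral measurableT iX) _.
apply: mean_le => //; apply: integ_le iY _ _ => [|w]; last by rewrite normr_id.
by apply: measurableT_comp => //; exact: integ_meas.
Qed.

Lemma mean_fineK X : integ X -> (\int[P]_w (X w)%:E)%E = (mean X)%:E.
Proof. by move=> iX; rewrite /mean /Rintegral fineK//; exact: integrable_fin_num. Qed.

Lemma sqinteg_meas X : sqinteg X -> measurable_fun [set: Om] X.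
Proof. by case. Qed.

Lemma sqintegM X Y : sqinteg X -> sqinteg Y -> integ (fun w => X w * Y w).
Proof.
move=> [mX iX] [mY iY]; apply: (integ_le (integD iX iY)).
  exact: measurable_funM.
move=> w; rewrite normrM -(real_normK (num_real (X w))).
rewrite -(real_normK (num_real (Y w))).
have := sqr_ge0 (`|X w| - `|Y w|); have := sqr_ge0 (`|X w| + `|Y w|).
by rewrite sqrrB sqrrD; lra.
Qed.

Lemma sqinteg_integ X : sqinteg X -> integ X.
Proof.
move=> sX; have [mX _] := sX.
have s1 : sqinteg (fun=> 1 : R) by split; [exact: measurable_cst|exact: integ_cst].
by have := sqintegM sX s1; under eq_fun do rewrite mulr1.
Qed.

Lemma sqintegD X Y : sqinteg X -> sqinteg Y -> sqinteg (fun w => X w + Y w).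
Proof.
move=> sX sY; have [mX iX] := sX; have [mY iY] := sY.
split; first exact: measurable_funD.
have -> : (fun w => (X w + Y w) ^+ 2) =
  (fun w => X w ^+ 2 + (2 * (X w * Y w)) + Y w ^+ 2).
  by apply/funext => w; ring.
by apply: integD => //; apply: integD => //; apply: integZ; exact: sqintegM.
Qed.

Lemma sqintegZ a X : sqinteg X -> sqinteg (fun w => a * X w).
Proof.
move=> [mX iX]; split; first exact: measurable_funM.
by under eq_fun do rewrite exprMn; exact: integZ.
Qed.

Lemma sqintegB X Y : sqinteg X -> sqinteg Y -> sqinteg (fun w => X w - Y w).
Proof.
move=> sX sY; have := sqintegD sX (sqintegZ (- 1) sY).
by under eq_fun do rewrite mulN1r.
Qed.

Lemma sqinteg_cst a : sqinteg (fun=> a).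
Proof. by split; [exact: measurable_cst|exact: integ_cst]. Qed.

Lemma sqinteg_sum I (s : seq I) (F : I -> Om -> R) : (forall i, sqinteg (F i)) ->
  sqinteg (fun w => \sum_(i <- s) F i w).
Proof.
move=> iF; elim: s => [|i s IH].
  by under eq_fun do rewrite big_nil; exact: sqinteg_cst.
by under eq_fun do rewrite big_cons; exact: sqintegD.
Qed.

Lemma sqinteg_le X Y : sqinteg Y -> measurable_fun [set: Om] X ->
  (forall w, `|X w| <= `|Y w|) -> sqinteg X.
Proof.
move=> [mY iY] mX XY; split => //; apply: (integ_le iY).
  exact: measurable_funX.
by move=> w; rewrite normrX -(real_normK (num_real (Y w))) lerXn2r ?nnegrE.
Qed.

Lemma sqinteg_bounded X c : measurable_fun [set: Om] X ->
  (forall w, `|X w| <= c) -> sqinteg X.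
Proof.
move=> mX Xc; apply: (sqinteg_le (sqinteg_cst c)) => // w.
by apply: le_trans (Xc w) _; rewrite ler_norm.
Qed.

End integrable_functions.

(** * Markov property and independence *)

Section independence.
Context {R : realType} d (Om : measurableType d) (P : probability Om R).
Implicit Types X Y : Om -> R.

Definition indep_rv X Y := forall B B' : set R, measurable B -> measurable B' ->
  P (X @^-1` B `&` Y @^-1` B') = (P (X @^-1` B) * P (Y @^-1` B'))%E.

Lemma indep_rv_comp X Y (f g : R -> R) : measurable_fun [set: R] f ->
  measurable_fun [set: R] g -> indep_rv X Y -> indep_rv (f \o X) (g \o Y).
Proof.
move=> mf mg XY B B' mB mB'; apply: (XY (f @^-1` B) (g @^-1` B')).
  by have := mf measurableT _ mB; rewrite setTI.
by have := mg measurableT _ mB'; rewrite setTI.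
Qed.

Lemma mean_indic X (B : set R) : measurable_fun [set: Om] X -> measurable B ->
  (\int[P]_w (\1_B (X w))%:E)%E = P (X @^-1` B).
Proof.
move=> mX mB; have mXB : measurable (X @^-1` B).
  by have := mX measurableT _ mB; rewrite setTI.
by rewrite -[in RHS](setIT (X @^-1` B)) -integral_indic.
Qed.

Lemma ge0_integral_scale (T : measurableType d) (m : {measure set T -> \bar R})
    (X : T -> R) (c : R) : measurable_fun [set: T] X -> (forall w, 0 <= X w) ->
  0 <= c -> (\int[m]_w (X w * c)%:E = \int[m]_w (X w)%:E * c%:E)%E.
Proof.
move=> mX X0 c0; under eq_integral do rewrite EFinM.
rewrite ge0_integralZr//.
- exact/measurable_EFinP.
- by move=> w _; rewrite lee_fin.
Qed.

Lemma indep_mean_ge0 X Y : integ P X -> integ P Y ->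
  (forall w, 0 <= X w) -> (forall w, 0 <= Y w) -> indep_rv X Y ->
  (\int[P]_w (X w * Y w)%:E)%E = (mean P X * mean P Y)%:E.
Proof.
move=> iX iY X0 Y0 XY; have mX := integ_meas iX; have mY := integ_meas iY.
(* The monotone class argument asks for functions nonnegative on all of R, while [X] and [Y] are so
   only through their values; there [f] is the identity. *)
pose f (x : R) := Num.max x 0.
have mf : measurable_fun [set: R] f.
  by apply: measurable_maxr => //; exact: measurable_cst.
have f0 x : 0 <= f x by rewrite le_max lexx orbT.
have fX w : f (X w) = X w by exact/max_idPl.
have fY w : f (Y w) = Y w by exact/max_idPl.
have step1 (B' : set R) : measurable B' ->
    (\int[P]_w (X w * \1_B' (Y w))%:E)%E = (\int[P]_w (X w * fine (P (Y @^-1` B')))%:E)%E.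
  move=> mB'.
  have mYB : measurable (Y @^-1` B') by have := mY measurableT _ mB'; rewrite setTI.
  under eq_integral do rewrite -fX; under [RHS]eq_integral do rewrite -fX.
  apply: (ge0_functional_eq
    (@ge0_functional_weighted _ _ _ _ _ P X (fun w => \1_B' (Y w)) mX _ _)
    (@ge0_functional_weighted _ _ _ _ _ P X (fun=> fine (P (Y @^-1` B'))) mX _ _)) => //.
  - by apply: measurableT_comp => //; exact: measurable_indic.
  - by move=> w; exact: fine_ge0.
  move=> B mB; have mXB : measurable (X @^-1` B) by have := mX measurableT _ mB; rewrite setTI.
  under eq_integral.
    move=> w _.
    rewrite (_ : \1_B (X w) * \1_B' (Y w) = \1_(X @^-1` B `&` Y @^-1` B') w); last first.
      by rewrite indicI.
    over.
  rewrite integral_indic ?setIT//; last exact: measurableI.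
  rewrite ge0_integral_scale ?fine_ge0//; last first.
    by apply: measurableT_comp => //; exact: measurable_indic.
  rewrite mean_indic// fineK; last exact: fin_num_measure.
  exact: XY.
under eq_integral do rewrite mulrC -fY.
transitivity (\int[P]_w (f (Y w) * mean P X)%:E)%E; last first.
  under eq_integral do rewrite fY.
  rewrite ge0_integral_scale//; last exact: mean_ge0.
  by rewrite mean_fineK// -EFinM mulrC.
apply: (ge0_functional_eq
    (@ge0_functional_weighted _ _ _ _ _ P Y X mY mX X0)
    (@ge0_functional_weighted _ _ _ _ _ P Y (fun=> mean P X) mY _ _)) => //.
- by move=> w; exact: mean_ge0.
move=> B' mB'; have mYB : measurable (Y @^-1` B') by have := mY measurableT _ mB'; rewrite setTI.
under eq_integral do rewrite mulrC; rewrite step1//.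
have mB1 : measurable_fun [set: Om] (fun w => \1_B' (Y w) : R).
  by apply: measurableT_comp => //; exact: measurable_indic.
rewrite (ge0_integral_scale P mX X0 (fine_ge0 (measure_ge0 _ _))).
rewrite (ge0_integral_scale P mB1 (fun=> ler0n _ _) (mean_ge0 _ X0)).
have fP : P (Y @^-1` B') \is a fin_num by exact: fin_num_measure.
by rewrite (mean_indic mY mB') (mean_fineK iX) (fineK fP) muleC.
Qed.

Lemma indep_mean X Y : sqinteg P X -> sqinteg P Y -> indep_rv X Y ->
  mean P (fun w => X w * Y w) = mean P X * mean P Y.
Proof.
move=> sX sY XY.
have mX := sqinteg_meas sX; have mY := sqinteg_meas sY.
(* x is the difference of the nonnegative functions x + |x| and |x|, which preserve measurability
   and square integrability. *)
pose p (x : R) := x + `|x|; pose n (x : R) := `|x|.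
have mn : measurable_fun [set: R] n by exact: normr_measurable.
have mp : measurable_fun [set: R] p by exact: measurable_funD.
have n0 x : 0 <= n x by rewrite /n normr_ge0.
have p0 x : 0 <= p x by rewrite /p addrC -lerBlDr sub0r -normrN ler_norm.
have sn Z : sqinteg P Z -> sqinteg P (n \o Z).
  move=> sZ; apply: (sqinteg_le sZ); last by move=> w; rewrite /= normr_id.
  by apply: measurableT_comp => //; exact: sqinteg_meas sZ.
have sp Z : sqinteg P Z -> sqinteg P (p \o Z).
  by move=> sZ; apply: sqintegD => //; exact: sn.
have key (f g : R -> R) : measurable_fun [set: R] f -> measurable_fun [set: R] g ->
    (forall x, 0 <= f x) -> (forall x, 0 <= g x) ->
    sqinteg P (f \o X) -> sqinteg P (g \o Y) ->
    mean P (fun w => f (X w) * g (Y w)) = mean P (f \o X) * mean P (g \o Y).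
  move=> mf mg f0 g0 sf sg.
  have := indep_mean_ge0 (sqinteg_integ sf) (sqinteg_integ sg) (fun w => f0 _)
    (fun w => g0 _) (indep_rv_comp mf mg XY).
  by rewrite mean_fineK; [case|exact: sqintegM].
have E (Z : Om -> R) : Z = (fun w => p (Z w) - n (Z w)).
  by apply/funext => w; rewrite /p /n addrK.
have iM (f g : R -> R) : sqinteg P (f \o X) -> sqinteg P (g \o Y) ->
   integ P (fun w => f (X w) * g (Y w)) by exact: sqintegM.
have -> : (fun w => X w * Y w) =
  (fun w => (p (X w) * p (Y w) - p (X w) * n (Y w)) -
            (n (X w) * p (Y w) - n (X w) * n (Y w))).
  by apply/funext => w; rewrite /p /n; ring.
have spX := sp _ sX; have snX := sn _ sX; have spY := sp _ sY; have snY := sn _ sY.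
rewrite !meanB ?key//; try (exact: iM); try (by apply: integB; exact: iM).
rewrite [in RHS](E X) [in RHS](E Y) !meanB; try exact: sqinteg_integ.
by rewrite -/(p \o X) -/(p \o Y) -/(n \o X) -/(n \o Y); ring.
Qed.

End independence.

Section markov.
Context {R : realType} d (Om : measurableType d) (P : probability Om R).
Local Notation RR := (measurableTypeR R).
Variables (G : set (set Om)) (Y Y' : Om -> RR) (K : R.-pker RR ~> RR).
Hypotheses (mY : measurable_fun [set: Om] Y) (mY' : measurable_fun [set: Om] Y').
Hypothesis GK : forall E, G E -> forall B : set RR, measurable B ->
  P (E `&` Y' @^-1` B) = (\int[P]_(w in E) K (Y w) B)%E.

Lemma kop_fineK (f : R -> R) x : (K x).-integrable [set: R] (EFin \o f) ->
  (\int[K x]_y (f y)%:E)%E = (kop K f x)%:E.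
Proof. by move=> iF; rewrite /kop /Rintegral fineK//; exact: integrable_fin_num. Qed.

Lemma kop_meas_ge0 (f : R -> R) : measurable_fun [set: R] f ->
  (forall x, 0 <= f x) -> measurable_fun [set: RR] (kop K f).
Proof.
move=> mf f0; apply: measurableT_comp => //.
apply: (@measurable_fun_integral_kernel _ _ RR RR R K) => //.
- by move=> V mV; exact: measurable_kernel.
- exact/measurable_EFinP.
Qed.

(** Two monotone class arguments: the first, in [phi], reduces to an event of the past; the second,
    in [f], reduces to an indicator, for which the identity is the Markov property [GK]. *)
Lemma markov_ge0 (A : Om -> R) (phi f : R -> R) :
  measurable_fun [set: Om] A -> (forall B : set R, measurable B -> G (A @^-1` B)) ->
  measurable_fun [set: R] phi -> (forall x, 0 <= phi x) ->
  measurable_fun [set: R] f -> (forall x, 0 <= f x) ->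
  (forall x, (K x).-integrable [set: R] (EFin \o f)) ->
  (\int[P]_w (phi (A w) * f (Y' w))%:E)%E =
  (\int[P]_w (phi (A w) * kop K f (Y w))%:E)%E.
Proof.
move=> mA GA mphi phi0 mf f0 iF.
have mfY' : measurable_fun [set: Om] (fun w => f (Y' w)) by exact: measurableT_comp.
have mKY : measurable_fun [set: Om] (fun w => kop K f (Y w)).
  by apply: measurableT_comp => //; exact: kop_meas_ge0.
have kf0 x : 0 <= kop K f x by apply: Rintegral_ge0.
apply: (ge0_functional_eq
    (@ge0_functional_weighted _ _ _ _ _ P A (fun w => f (Y' w)) mA _ _)
    (@ge0_functional_weighted _ _ _ _ _ P A (fun w => kop K f (Y w)) mA _ _)) => //.
move=> B mB; have mE : measurable (A @^-1` B) by have := mA measurableT _ mB; rewrite setTI.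
set E := A @^-1` B in mE *.
have eqE (h : Om -> R) : (\int[P]_w (\1_B (A w) * h w)%:E = \int[P]_(w in E) (h w)%:E)%E.
  rewrite [RHS]integral_mkcond; apply: eq_integral => w _.
  rewrite patchE (_ : (w \in E) = (A w \in B)); last by apply/idP/idP; rewrite !inE.
  by rewrite indicE; case: (A w \in B); rewrite ?mul1r ?mul0r.
rewrite !eqE.
under [RHS]eq_integral do rewrite -kop_fineK//.
transitivity (\int[P]_w (f (Y' w) * \1_E w)%:E)%E.
  by rewrite -eqE; apply: eq_integral => w _; rewrite mulrC.
apply: (ge0_functional_eq
    (@ge0_functional_weighted _ _ _ _ _ P Y' (fun w => \1_E w) mY' _ _)
    (@ge0_functional_kernel _ _ _ _ _ _ _ P E Y K mE mY)) => //.
  exact: measurable_indic.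
move=> B' mB'; have mYB : measurable (Y' @^-1` B') by have := mY' measurableT mB'; rewrite setTI.
transitivity (P (E `&` Y' @^-1` B')).
  rewrite -[in RHS](setIT (E `&` _)) -integral_indic//; last exact: measurableI.
  by apply: eq_integral => w _; rewrite mulrC indicI.
rewrite GK//; last exact: GA.
apply: eq_integral => w _.
by rewrite integral_indic// setIT.
Qed.

Hypotheses (GT : G setT) (G0 : G set0).

Let integ_mono (X Z : Om -> R) : measurable_fun [set: Om] X ->
  (forall w, 0 <= X w) -> integ P Z ->
  (\int[P]_w (X w)%:E)%E = (\int[P]_w (Z w)%:E)%E -> integ P X.
Proof.
move=> mX X0 iZ E; apply/integrableP; split; first exact/measurable_EFinP.
under eq_integral do rewrite /= ger0_norm//.
by rewrite E mean_fineK// ltry.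
Qed.

Lemma markov_integ (f : R -> R) : measurable_fun [set: R] f ->
  (forall x, 0 <= f x) -> (forall x, (K x).-integrable [set: R] (EFin \o f)) ->
  integ P (fun w => f (Y' w)) ->
  integ P (fun w => kop K f (Y w)) /\
  mean P (fun w => kop K f (Y w)) = mean P (fun w => f (Y' w)).
Proof.
move=> mf f0 iK iF.
have E : (\int[P]_w (kop K f (Y w))%:E)%E = (\int[P]_w (f (Y' w))%:E)%E.
  have := @markov_ge0 (cst 0) (cst 1) f.
  under eq_integral do rewrite mul1r; under [RHS]eq_integral do rewrite mul1r.
  by move=> <-// B mB; rewrite preimage_cst; case: ifPn.
have iK' : integ P (fun w => kop K f (Y w)).
  apply: (integ_mono _ _ iF) => //.
    by apply: measurableT_comp => //; exact: kop_meas_ge0.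
  by move=> w; apply: Rintegral_ge0.
split => //; have := E; rewrite !mean_fineK//; by case.
Qed.


Lemma kopD (f g : R -> R) x : (K x).-integrable [set: R] (EFin \o f) ->
  (K x).-integrable [set: R] (EFin \o g) ->
  kop K (fun y => f y + g y) x = kop K f x + kop K g x.
Proof. by move=> iF iG; rewrite /kop RintegralD. Qed.

Lemma kopB (f g : R -> R) x : (K x).-integrable [set: R] (EFin \o f) ->
  (K x).-integrable [set: R] (EFin \o g) ->
  kop K (fun y => f y - g y) x = kop K f x - kop K g x.
Proof. by move=> iF iG; rewrite /kop RintegralB. Qed.

(* Jensen's inequality, from the positivity of [K ((f - K f x) ^ 2)]. *)
Lemma kop_sqr_le (f : R -> R) x : (K x).-integrable [set: R] (EFin \o f) ->
  (K x).-integrable [set: R] (EFin \o (fun y => f y ^+ 2)) ->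
  kop K f x ^+ 2 <= kop K (fun y => f y ^+ 2) x.
Proof.
move=> iF iF2; set a := kop K f x.
have ic c : (K x).-integrable [set: R] (EFin \o (fun=> c)).
  apply/integrableP; split; first exact/measurable_EFinP/measurable_cst.
  rewrite integral_cst//= [X in (_ * X)%E](_ : _ = 1%E) ?mule1 ?ltry//.
  exact: prob_kernel.
have iaf : (K x).-integrable [set: R] (EFin \o (fun y => 2 * a * f y)).
  by have := integrableZl measurableT (2 * a) iF; apply: eq_integrable.
have : 0 <= kop K (fun y => (f y ^+ 2 - 2 * a * f y) + a ^+ 2) x.
  apply: Rintegral_ge0 => y _.
  by rewrite (_ : _ + _ = (f y - a) ^+ 2) ?sqr_ge0//; ring.
rewrite kopD//; last first.
  have := integrableB measurableT iF2 iaf; exact: eq_integrable.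
rewrite kopB//.
have -> : kop K (fun y => 2 * a * f y) x = 2 * a * a by rewrite /kop RintegralZl.
have -> : kop K (fun=> a ^+ 2) x = a ^+ 2.
  rewrite /kop Rintegral_cst// -[RHS]mulr1; congr (_ * _).
  by rewrite [X in fine X](_ : _ = 1%E)//; exact: prob_kernel.
by lra.
Qed.

Lemma kop_meas (f : R -> R) : measurable_fun [set: R] f ->
  (forall x, (K x).-integrable [set: R] (EFin \o f)) ->
  measurable_fun [set: RR] (kop K f).
Proof.
move=> mf iF.
have iN x : (K x).-integrable [set: R] (EFin \o (fun y => `|f y|)) by exact: integrable_norm.
have mn : measurable_fun [set: R] (fun y => `|f y|) by exact: measurableT_comp.
have -> : kop K f = (fun x => kop K (fun y => f y + `|f y|) x - kop K (fun y => `|f y|) x).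
  by apply/funext => x; rewrite kopD// addrK.
apply: measurable_funB; apply: kop_meas_ge0 => //.
  exact: measurable_funD.
by move=> x; rewrite addrC -lerBlDr sub0r -normrN ler_norm.
Qed.

Lemma markov_sqinteg (f : R -> R) : measurable_fun [set: R] f ->
  (forall x, (K x).-integrable [set: R] (EFin \o f)) ->
  (forall x, (K x).-integrable [set: R] (EFin \o (fun y => f y ^+ 2))) ->
  sqinteg P (fun w => f (Y' w)) -> sqinteg P (fun w => kop K f (Y w)).
Proof.
move=> mf iF iF2 [mfY iF2Y].
have mkY : measurable_fun [set: Om] (fun w => kop K f (Y w)).
  by apply: (measurableT_comp (f := kop K f)) => //; exact: kop_meas.
split => //.
have [ik _] := @markov_integ (fun y => f y ^+ 2) (measurable_funX 2 mf)
  (fun x => sqr_ge0 _) iF2 iF2Y.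
apply: (integ_le ik); first exact: measurable_funX.
by move=> w; rewrite ger0_norm ?sqr_ge0// kop_sqr_le.
Qed.

(** Both functions are written as differences of nonnegative ones; square integrability of the
    pieces, preserved by the kernel through Jensen's inequality, allows the subtraction. *)
Lemma markov_mean (A : Om -> R) (phi f : R -> R) :
  measurable_fun [set: Om] A -> (forall B : set R, measurable B -> G (A @^-1` B)) ->
  measurable_fun [set: R] phi -> measurable_fun [set: R] f ->
  (forall x, (K x).-integrable [set: R] (EFin \o f)) ->
  (forall x, (K x).-integrable [set: R] (EFin \o (fun y => f y ^+ 2))) ->
  sqinteg P (fun w => phi (A w)) -> sqinteg P (fun w => f (Y' w)) ->
  mean P (fun w => phi (A w) * f (Y' w)) =
  mean P (fun w => phi (A w) * kop K f (Y w)).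
Proof.
move=> mA GA mphi mf iF iF2 sphi sf.
pose n (h : R -> R) x := `|h x|; pose p (h : R -> R) x := h x + `|h x|.
have mn (h : R -> R) : measurable_fun [set: R] h -> measurable_fun [set: R] (n h).
  by move=> mh; exact: measurableT_comp.
have mp (h : R -> R) : measurable_fun [set: R] h -> measurable_fun [set: R] (p h).
  by move=> mh; apply: measurable_funD => //; exact: mn.
have n0 (h : R -> R) x : 0 <= n h x by rewrite /n normr_ge0.
have p0 (h : R -> R) x : 0 <= p h x by rewrite /p addrC -lerBlDr sub0r -normrN ler_norm.
have sn (h : R -> R) (Z : Om -> R) : measurable_fun [set: R] h ->
    sqinteg P (fun w => h (Z w)) -> sqinteg P (fun w => n h (Z w)).
  move=> mh sZ; apply: (sqinteg_le sZ); last by move=> w; rewrite /n normr_id.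
  have mhZ := sqinteg_meas sZ.
  by have := measurableT_comp (@normr_measurable R setT) mhZ.
have sp (h : R -> R) (Z : Om -> R) : measurable_fun [set: R] h ->
    sqinteg P (fun w => h (Z w)) -> sqinteg P (fun w => p h (Z w)).
  by move=> mh sZ; apply: sqintegD => //; exact: sn.
have iN x : (K x).-integrable [set: R] (EFin \o n f) by exact: integrable_norm.
have iP x : (K x).-integrable [set: R] (EFin \o p f).
  by have := integrableD measurableT (iF x) (iN x); apply: eq_integrable.
have iN2 x : (K x).-integrable [set: R] (EFin \o (fun y => n f y ^+ 2)).
  apply: eq_integrable (iF2 x) => // y _.
  by rewrite /n /= real_normK// num_real.
have iP2 x : (K x).-integrable [set: R] (EFin \o (fun y => p f y ^+ 2)).
  apply: (le_integrable measurableT _ _ (integrableZl measurableT 4 (iF2 x))).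
    by apply/measurable_EFinP; apply: measurable_funX; exact: mp.
  move=> y _; rewrite lee_fin (ger0_norm (sqr_ge0 _)) (ger0_norm (mulr_ge0 (ler0n _ 4)
    (sqr_ge0 _))).
  have h : p f y <= 2 * `|f y| by rewrite /p mulr_natl mulr2n lerD2r ler_norm.
  rewrite (_ : 4 * f y ^+ 2 = (2 * `|f y|) ^+ 2); last first.
    by rewrite exprMn real_normK ?num_real//; congr (_ * _); ring.
  by rewrite lerXn2r ?nnegrE ?mulr_ge0.
have key (q h : R -> R) : measurable_fun [set: R] q -> measurable_fun [set: R] h ->
    (forall x, 0 <= q x) -> (forall x, 0 <= h x) ->
    (forall x, (K x).-integrable [set: R] (EFin \o h)) ->
    (forall x, (K x).-integrable [set: R] (EFin \o (fun y => h y ^+ 2))) ->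
    sqinteg P (fun w => q (A w)) -> sqinteg P (fun w => h (Y' w)) ->
    mean P (fun w => q (A w) * h (Y' w)) = mean P (fun w => q (A w) * kop K h (Y w)).
  move=> mq mh q0 h0 ih ih2 sq sh.
  have := markov_ge0 mA GA mq q0 mh h0 ih.
  rewrite !mean_fineK; first by case.
  - by apply: sqintegM => //; exact: markov_sqinteg.
  - exact: sqintegM.
have kE x : kop K f x = kop K (p f) x - kop K (n f) x.
  by rewrite /p kopD// addrK.
have -> : (fun w => phi (A w) * f (Y' w)) =
  (fun w => (p phi (A w) * p f (Y' w) - p phi (A w) * n f (Y' w)) -
            (n phi (A w) * p f (Y' w) - n phi (A w) * n f (Y' w))).
  by apply/funext => w; rewrite /p /n; ring.
have -> : (fun w => phi (A w) * kop K f (Y w)) =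
  (fun w => (p phi (A w) * kop K (p f) (Y w) - p phi (A w) * kop K (n f) (Y w)) -
            (n phi (A w) * kop K (p f) (Y w) - n phi (A w) * kop K (n f) (Y w))).
  by apply/funext => w; rewrite kE /p /n; ring.
have spA := sp _ _ mphi sphi; have snA := sn _ _ mphi sphi.
have spY := sp _ _ mf sf; have snY := sn _ _ mf sf.
have skp := markov_sqinteg (mp _ mf) iP iP2 spY.
have skn := markov_sqinteg (mn _ mf) iN iN2 snY.
rewrite !meanB; try (by apply: sqintegM); try (by apply: integB; apply: sqintegM).
by rewrite !key//; [exact: mn|exact: mn|exact: mn|exact: mp|exact: mp|exact: mn|exact: mp|exact:
  mp].
Qed.

End markov.

Section adapted.
Context {R : realType} d (Om : measurableType d).
Implicit Types (G : set (set Om)) (X Y : Om -> R).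

Definition adapted G X := forall B : set R, measurable B -> <<s G >> (X @^-1` B).

Lemma adaptedP G X :
  adapted G X <-> measurable_fun [set: g_sigma_algebraType G] (X : g_sigma_algebraType G -> R).
Proof.
split=> [aX _ B mB|mX B mB]; first by rewrite setTI; exact: aX.
by have := mX measurableT B mB; rewrite setTI.
Qed.

Lemma adapted_sub G G' X : G `<=` <<s G' >> -> adapted G X -> adapted G' X.
Proof.
move=> GG' aX B mB; have := aX B mB; exact: smallest_sub.
Qed.

Lemma adaptedS G G' X : G `<=` G' -> adapted G X -> adapted G' X.
Proof. by move=> GG'; apply: adapted_sub => E /GG'; exact: sub_sigma_algebra. Qed.

Lemma adapted_meas G X : G `<=` measurable -> adapted G X ->
  measurable_fun [set: Om] X.
Proof.
move=> Gm aX _ B mB; rewrite setTI; have := aX B mB.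
by apply: smallest_sub => //; exact: sigma_algebra_measurable.
Qed.

Lemma adapted_comp G X (f : R -> R) : measurable_fun [set: R] f ->
  adapted G X -> adapted G (fun w => f (X w)).
Proof. by move=> mf /adaptedP aX; apply/adaptedP; exact: measurableT_comp. Qed.

Lemma adaptedD G X Y : adapted G X -> adapted G Y -> adapted G (fun w => X w + Y w).
Proof. by move=> /adaptedP aX /adaptedP aY; apply/adaptedP; exact: measurable_funD. Qed.

Lemma adaptedM G X Y : adapted G X -> adapted G Y -> adapted G (fun w => X w * Y w).
Proof. by move=> /adaptedP aX /adaptedP aY; apply/adaptedP; exact: measurable_funM. Qed.

Lemma adaptedB G X Y : adapted G X -> adapted G Y -> adapted G (fun w => X w - Y w).
Proof. by move=> /adaptedP aX /adaptedP aY; apply/adaptedP; exact: measurable_funB. Qed.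

Lemma adapted_cst G (c : R) : adapted G (fun=> c).
Proof. by apply/adaptedP; exact: measurable_cst. Qed.

Lemma adapted_sum G (I : Type) (s : seq I) (p : pred I) (F : I -> Om -> R) :
  (forall i, p i -> adapted G (F i)) -> adapted G (fun w => \sum_(i <- s | p i) F i w).
Proof.
move=> aF; elim: s => [|i s IH].
  by under eq_fun do rewrite big_nil; exact: adapted_cst.
case/boolP: (p i) => pi; last by under eq_fun do rewrite big_cons (negbTE pi).
by under eq_fun do rewrite big_cons pi; apply: adaptedD => //; exact: aF.
Qed.

Lemma adapted_prod G (I : Type) (s : seq I) (p : pred I) (F : I -> Om -> R) :
  (forall i, p i -> adapted G (F i)) -> adapted G (fun w => \prod_(i <- s | p i) F i w).
Proof.
move=> aF; elim: s => [|i s IH].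
  by under eq_fun do rewrite big_nil; exact: adapted_cst.
case/boolP: (p i) => pi; last by under eq_fun do rewrite big_cons (negbTE pi).
by under eq_fun do rewrite big_cons pi; apply: adaptedM => //; exact: aF.
Qed.

End adapted.

(** * Independence of disjoint blocks of an independent family *)

Section independent_groups.
Context {R : realType} d (Om : measurableType d) (P : probability Om R).
Variables (I : finType) (F : I -> set (set Om)).
Hypotheses (FT : forall i, F i setT) (FI : forall i, setI_closed (F i)).
Hypotheses (Fm : forall i, F i `<=` measurable) (indF : mutually_independent P F).

(** These cylinders form a pi-system generating the sigma-algebra of the block [J], and for them
    independence of disjoint blocks is read off the product formula. *)
Let cyl (J : {set I}) : set (set Om) := [set E | exists e : I -> set Om,
  (forall i, i \in J -> F i (e i)) /\ E = \bigcap_(i in [set` J]) e i].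

Let cylI J : setI_closed (cyl J).
Proof.
move=> _ _ [e [He ->]] [e' [He' ->]]; exists (fun i => e i `&` e' i).
split=> [i iJ|]; first by apply: FI; [exact: He|exact: He'].
by rewrite bigcapI.
Qed.

Let cyl_sub (J : {set I}) i : i \in J -> F i `<=` cyl J.
Proof.
move=> iJ E FE; exists (fun k => if k == i then E else setT); split.
  by move=> k kJ; case: eqP => [->//|_]; exact: FT.
apply/seteqP; split=> [w Ew k /= _|w /(_ i iJ)]; last by rewrite eqxx.
by case: eqP.
Qed.

Let cyl_meas J : cyl J `<=` measurable.
Proof.
move=> _ [e [He ->]]; apply: fin_bigcap_measurable => [|i iJ].
  exact: finite_finset.
by apply: Fm (He _ iJ).
Qed.

Let cyl_indep (J1 J2 : {set I}) E1 E2 : (forall i, i \in J1 -> i \notin J2) ->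
  cyl J1 E1 -> cyl J2 E2 -> P (E1 `&` E2) = (P E1 * P E2)%E.
Proof.
move=> J12 [e1 [He1 ->]] [e2 [He2 ->]].
pose e i := if i \in J1 then e1 i else e2 i.
have n2 i : i \in J2 -> i \in J1 = false.
  by move=> iJ2; apply/negbTE; apply/negP => /J12; rewrite iJ2.
have e1E i : i \in J1 -> e i = e1 i by rewrite /e => ->.
have e2E i : i \in J2 -> e i = e2 i by move=> /n2 h; rewrite /e h.
have -> : \bigcap_(i in [set` J1]) e1 i `&` \bigcap_(i in [set` J2]) e2 i =
          \bigcap_(i in [set` J1 :|: J2]) e i.
  apply/seteqP; split=> [w [h1 h2] i /=|w h].
    rewrite finset.in_setU => /orP[iJ|iJ]; first by rewrite e1E//; exact: h1.
    by rewrite e2E//; exact: h2.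
  split=> i iJ; first by rewrite -e1E//; apply: h; rewrite /= finset.in_setU (iJ : i \in J1).
  by rewrite -e2E//; apply: h; rewrite /= finset.in_setU (iJ : i \in J2) orbT.
rewrite indF; last first.
  move=> i; rewrite finset.in_setU => /orP[iJ|iJ]; first by rewrite e1E//; exact: He1.
  by rewrite e2E//; exact: He2.
rewrite (indF He1) (indF He2).
rewrite (bigID (mem J1))/=; congr (_ * _)%E; apply: eq_big => i.
- by rewrite finset.in_setU; case: (i \in J1); rewrite ?andbF.
- by case/andP => _ iJ; rewrite e1E.
- by rewrite finset.in_setU; case/boolP: (i \in J1) => [/J12/negbTE ->|]; rewrite ?andbT.
- by case/andP => _ /negbTE iJ; rewrite /e iJ.
Qed.

Let dynkin_indep E2 : measurable E2 ->
  dynkin [set E | measurable E /\ P (E `&` E2) = (P E * P E2)%E].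
Proof.
move=> mE2; split.
- split => //; have -> := @probability_setT _ _ _ P.
  by rewrite setTI mul1e.
- move=> A [mA hA]; split; first exact: measurableC.
  rewrite probability_setC//.
  have -> : ~` A `&` E2 = E2 `\` (A `&` E2).
    by rewrite setDIr setDv setU0 setDE setIC.
  rewrite measureD//; last 2 first.
  - exact: measurableI.
  - by rewrite ltey_eq fin_num_measure.
  rewrite (_ : E2 `&` _ = A `&` E2); last by rewrite setIC -setIA setIid.
  have fE2 : P E2 \is a fin_num by exact: fin_num_measure.
  have fA : P A \is a fin_num by exact: fin_num_measure.
  by rewrite muleBl// ?fin_num_adde_defr// mul1e; congr (_ - _)%E.
- move=> A tA hA; have mA n : measurable (A n) by have [] := hA n.
  split; first exact: bigcupT_measurable.
  rewrite setI_bigcupl measure_bigcup//; last 2 first.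
  - by move=> n _; exact: measurableI.
  - by apply: trivIset_setIr.
  have fE2 : P E2 \is a fin_num by exact: fin_num_measure.
  rewrite measure_bigcup// -(fineK fE2) muleC -nneseriesZl//.
  apply: eq_eseriesr => n _; have [_ hAn] := hA n.
  by rewrite (fineK fE2) muleC -hAn.
Qed.

(** The pi-lambda theorem used twice: in the first event with the second one fixed, then in the
    second event with the first one a cylinder. *)
Lemma indep_groups (J1 J2 : {set I}) E1 E2 : (forall i, i \in J1 -> i \notin J2) ->
  <<s \bigcup_(i in [set` J1]) F i >> E1 -> <<s \bigcup_(i in [set` J2]) F i >> E2 ->
  P (E1 `&` E2) = (P E1 * P E2)%E.
Proof.
move=> J12.
have sub (J : {set I}) (H : set (set Om)) : dynkin H -> cyl J `<=` H ->
    <<s \bigcup_(i in [set` J]) F i >> `<=` H.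
  move=> dH cH; apply: (@subset_trans _ <<s cyl J >>).
    apply: smallest_sub; first exact: smallest_sigma_algebra.
    by move=> E [i iJ FE]; apply: sub_sigma_algebra; exact: cyl_sub FE.
  rewrite -setI_closed_g_dynkin_g_sigma_algebra; last exact: cylI.
  exact: smallest_sub.
have sJ2 : <<s \bigcup_(i in [set` J2]) F i >> `<=` measurable.
  apply: smallest_sub; first exact: sigma_algebra_measurable.
  by move=> E [i _]; exact: Fm.
move=> h1 h2; have mE2 := sJ2 _ h2.
suff : [set E | measurable E /\ P (E `&` E2) = (P E * P E2)%E] E1 by case.
apply: (sub J1 _ (dynkin_indep mE2)) h1 => E cE; split; first exact: cyl_meas cE.
have mE := cyl_meas cE.
suff : [set E' | measurable E' /\ P (E' `&` E) = (P E' * P E)%E] E2.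
  by case=> _; rewrite setIC muleC.
apply: (sub J2 _ (dynkin_indep mE)) h2 => E' cE'; split; first exact: cyl_meas cE'.
by rewrite setIC (cyl_indep J12 cE cE') muleC.
Qed.

Lemma adapted_indep (J1 J2 : {set I}) (X Y : Om -> R) : (forall i, i \in J1 -> i \notin J2) ->
  adapted (\bigcup_(i in [set` J1]) F i) X ->
  adapted (\bigcup_(i in [set` J2]) F i) Y -> indep_rv P X Y.
Proof.
by move=> J12 aX aY B B' mB mB'; apply: (indep_groups J12); [exact: aX|exact: aY].
Qed.

Lemma mean_prod_indep n (g : 'I_n -> {set I}) (X : 'I_n -> Om -> R) (c : R) :
  (forall i j, i != j -> forall k, k \in g i -> k \notin g j) ->
  (forall i, adapted (\bigcup_(k in [set` g i]) F k) (X i)) ->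
  (forall i w, `|X i w| <= c) ->
  mean P (fun w => \prod_(i < n) X i w) = \prod_(i < n) mean P (X i).
Proof.
move=> dg aX bX.
have mG J : \bigcup_(k in J) F k `<=` measurable by move=> E [i _]; exact: Fm.
have mX i : measurable_fun [set: Om] (X i) by exact: adapted_meas (aX i).
have sp (s : seq 'I_n) : sqinteg P (fun w => \prod_(i <- s) X i w).
  apply: (@sqinteg_bounded _ _ _ _ _ (\prod_(i <- s) c)).
    by apply: measurable_prod => i _.
  move=> w; rewrite normr_prod; apply: ler_prod => i _.
  by rewrite normr_ge0 bX.
suff h (s : seq 'I_n) : uniq s ->
    mean P (fun w => \prod_(i <- s) X i w) = \prod_(i <- s) mean P (X i).
  by apply: h; exact: index_enum_uniq.
elim: s => [_|i s IH /= /andP[nis us]].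
  rewrite big_nil -[RHS](meancst P 1); congr mean.
  by apply/funext => w; rewrite big_nil.
rewrite big_cons -IH//.
have -> : (fun w => \prod_(j <- i :: s) X j w) = (fun w => X i w * \prod_(j <- s) X j w).
  by apply/funext => w; rewrite big_cons.
apply: indep_mean => //.
  by have := sp [:: i]; under eq_fun do rewrite big_seq1.
(* The union of the groups of the remaining factors; it is disjoint from the group of [i]. *)
pose J : {set I} := finset (fun k => has (fun j => k \in g j) s).
have JP k : k \in J = has (fun j => k \in g j) s by rewrite finset.in_set.
apply: (@adapted_indep (g i) J) => //.
  move=> k ki; rewrite JP; apply/hasPn => j js.
  have ij : i != j by apply: contraNneq nis => ->.
  exact: dg ki.
have -> : (fun w => \prod_(j <- s) X j w) = (fun w => \prod_(j <- s | j \in s) X j w).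
  by apply/funext => w; rewrite big_seq.
apply: adapted_prod => j js; apply: adaptedS (aX j) => E [k kj FE].
by exists k => //=; rewrite JP; apply/hasP; exists j.
Qed.

End independent_groups.

(** * Lindeberg's theorem *)

Section lindeberg.
Context {R : realType}.

(* Comparable to min(x^2, x^4); as x^2 - 1 + 1/(1 + x^2) it is smooth with a
   bounded second derivative vanishing at 0. *)
Definition quad_tail (x : R) := x ^+ 4 / (1 + x ^+ 2).

Lemma quad_tail_ge0 x : 0 <= quad_tail x.
Proof. by rewrite divr_ge0 ?addr_ge0 ?sqr_ge0//; rewrite (exprM x 2 2) sqr_ge0. Qed.

Lemma mul_frac_le (K a : R) : 0 <= K -> 0 <= a -> K * (a / (K + 1)) <= a.
Proof.
by move=> K0 a0; rewrite mulrCA ler_piMr// ler_pdivrMr ?mul1r ?lerDl// ltr_wpDl.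
Qed.

Lemma onep_sqr_gt0 (x : R) : 0 < 1 + x ^+ 2.
Proof. by rewrite ltr_wpDr ?sqr_ge0. Qed.

Lemma quad_tail_le x : quad_tail x <= x ^+ 2.
Proof.
rewrite ler_pdivrMr ?onep_sqr_gt0// mulrDr mulr1 -exprD lerDr.
by rewrite sqr_ge0.
Qed.

Lemma quad_tailM x : x ^+ 2 * (x ^+ 2 / (1 + x ^+ 2)) = quad_tail x.
Proof. by rewrite /quad_tail mulrA -exprD. Qed.

Lemma measurable_quad_tail : measurable_fun [set: R] quad_tail.
Proof.
apply: continuous_measurable_fun => x; apply: cvgM; first exact: exprn_continuous.
apply: cvgV; first by rewrite gt_eqF// onep_sqr_gt0.
by apply: cvgD; [exact: cvg_cst|exact: exprn_continuous].
Qed.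

Section one_sum.
Context d (Om : measurableType d) (P : probability Om R).
Variables (n : nat) (xi : 'I_n -> Om -> R).
Hypotheses (sxi : forall j, sqinteg P (xi j)) (xi0 : forall j, mean P (xi j) = 0).

Let W w := \sum_(j < n) xi j w.
Let Wj j w := \sum_(l < n | l != j) xi l w.
Hypothesis indep : forall j, indep_rv P (xi j) (Wj j).

Let WE j w : W w = xi j w + Wj j w.
Proof. by rewrite /W (bigD1 j). Qed.

Let sW : sqinteg P W. Proof. exact: sqinteg_sum. Qed.

Let sWj j : sqinteg P (Wj j).
Proof.
have -> : Wj j = (fun w => W w - xi j w) by apply/funext => w; rewrite (WE j) addrC addKr.
exact: sqintegB.
Qed.

Let s j := mean P (fun w => xi j w ^+ 2).
Let S := \sum_(j < n) s j.
Let H := \sum_(j < n) mean P (fun w => quad_tail (xi j w)).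

Let s_ge0 j : 0 <= s j. Proof. by apply: mean_ge0 => w; exact: sqr_ge0. Qed.

Let ixi2 j : integ P (fun w => xi j w ^+ 2). Proof. by case: (sxi j). Qed.

Let iH j : integ P (fun w => quad_tail (xi j w)).
Proof.
apply: (integ_le (ixi2 j)).
  apply: (measurableT_comp measurable_quad_tail); exact: sqinteg_meas (sxi j).
by move=> w; rewrite ger0_norm ?quad_tail_ge0// quad_tail_le.
Qed.

(** Independence of each term from the sum of the others suffices, since the cross term is [xi j]
    times exactly that sum. *)
Lemma mean_sum_sqr : mean P (fun w => W w ^+ 2) = S.
Proof.
have -> : (fun w => W w ^+ 2) = (fun w => \sum_(j < n) xi j w * W w).
  by apply/funext => w; rewrite -mulr_suml.
rewrite (@mean_sum _ _ _ P _ _ (fun j w => xi j w * W w)); last by move=> j; exact: sqintegM.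
apply: eq_bigr => j _.
have -> : (fun w => xi j w * W w) = (fun w => xi j w ^+ 2 + xi j w * Wj j w).
  by apply/funext => w; rewrite (WE j) mulrDr.
by rewrite meanD//; [rewrite indep_mean// xi0 mul0r addr0|exact: sqintegM].
Qed.

Section with_solution.
Variables (f df : R -> R) (B e K : R).
Hypotheses (dff : forall x, is_derive x (1 : R) f (df x)) (cdf : continuous df).
Hypotheses (B0 : 0 <= B) (dfB : forall x, `|df x| <= B).
Hypotheses (e0 : 0 <= e) (K0 : 0 <= K).
Hypothesis df_mod : forall x t : R, `|df (x + t) - df x| <= e + K * (t ^+ 2 / (1 + t ^+ 2)).

Let cf : continuous f.
Proof.
move=> x; apply: differentiable_continuous; apply/derivable1_diffP.
exact: (@ex_derive _ _ _ _ _ _ _ (dff x)).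
Qed.

Let f_mvt x y : exists2 c, `|c - x| <= `|y - x| & f y - f x = df c * (y - x).
Proof.
have wc a b : {within `[a, b], continuous f} by exact: continuous_subspaceT.
have [xy|yx] := leP x y.
  have [c] := @MVT_segment R f df x y xy (fun z _ => dff z) (wc _ _).
  rewrite in_itv/= => /andP[xc cy] E; exists c => //.
  by rewrite !ger0_norm ?subr_ge0// lerD2r.
have [c] := @MVT_segment R f df y x (ltW yx) (fun z _ => dff z) (wc _ _).
rewrite in_itv/= => /andP[yc cx] E; exists c; last by rewrite -opprB E -mulrN opprB.
by rewrite distrC (distrC y) !ger0_norm ?subr_ge0// ?(ltW yx)// lerD2l lerN2.
Qed.

Let mod_mono (x y : R) : `|x| <= `|y| -> x ^+ 2 / (1 + x ^+ 2) <= y ^+ 2 / (1 + y ^+ 2).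
Proof.
move=> xy; have xy2 : x ^+ 2 <= y ^+ 2.
  by rewrite -(real_normK (num_real x)) -(real_normK (num_real y)) lerXn2r ?nnegrE.
have h z : z ^+ 2 / (1 + z ^+ 2) = 1 - (1 + z ^+ 2)^-1 :> R.
  by field; rewrite gt_eqF// onep_sqr_gt0.
by rewrite !h lerB// lef_pV2 ?posrE ?onep_sqr_gt0// lerD2l.
Qed.

(** By the mean value theorem the increment of [f] is a value of [df] within |t| of [x], and the
    modulus is monotone in |t|; the factor t^2 turns t^2 / (1 + t^2) into [quad_tail]. *)
Let taylor x t : `|t * (f (x + t) - f x) - t ^+ 2 * df x| <= e * t ^+ 2 + K * quad_tail t.
Proof.
have [c ct E] := f_mvt x (x + t).
move: ct; rewrite E (_ : x + t - x = t); last by ring.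
move=> ct.
have -> : t * (df c * t) - t ^+ 2 * df x = t ^+ 2 * (df (x + (c - x)) - df x).
  by rewrite (addrC x) subrK; ring.
rewrite normrM ger0_norm ?sqr_ge0// -quad_tailM.
have := df_mod x (c - x) => /(le_trans _) h.
have -> : e * t ^+ 2 + K * (t ^+ 2 * (t ^+ 2 / (1 + t ^+ 2))) =
  t ^+ 2 * (e + K * (t ^+ 2 / (1 + t ^+ 2))) by ring.
rewrite ler_wpM2l ?sqr_ge0//; apply: le_trans (df_mod _ _) _.
by rewrite lerD2l ler_wpM2l// mod_mono.
Qed.

Let mf : measurable_fun [set: R] f. Proof. exact: continuous_measurable_fun. Qed.
Let mdf : measurable_fun [set: R] df. Proof. exact: continuous_measurable_fun. Qed.

Let sf X : sqinteg P X -> sqinteg P (fun w => f (X w)).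
Proof.
move=> sX.
have sN : sqinteg P (fun w => `|X w|).
  apply: (sqinteg_le sX) => [|w]; last by rewrite normr_id.
  by have mX := sqinteg_meas sX; exact: measurableT_comp.
apply: (sqinteg_le (sqintegD (sqinteg_cst P `|f 0|) (sqintegZ B sN))).
  by apply: measurableT_comp => //; exact: sqinteg_meas sX.
move=> w; rewrite [leRHS]ger0_norm ?addr_ge0 ?mulr_ge0//.
have [c _] := f_mvt 0 (X w); rewrite subr0 => E.
have -> : f (X w) = f 0 + df c * X w by rewrite -E addrC subrK.
by apply: le_trans (ler_normD _ _) _; rewrite lerD2l normrM ler_wpM2r.
Qed.

Let idf X : measurable_fun [set: Om] X -> sqinteg P (fun w => df (X w)).
Proof. by move=> mX; apply: (@sqinteg_bounded _ _ _ _ _ B) => //; exact: measurableT_comp. Qed.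

Let indep_sqr j : mean P (fun w => xi j w ^+ 2 * df (Wj j w)) =
  s j * mean P (fun w => df (Wj j w)).
Proof.
have mWj := sqinteg_meas (sWj j); have mxi := sqinteg_meas (sxi j).
have iprod (h : R -> R) c : measurable_fun [set: R] h -> (forall x, `|h x| <= c) ->
    integ P (fun w => xi j w ^+ 2 * h (Wj j w)).
  move=> mh hc; apply: (integ_le (integZ c (ixi2 j))).
    by apply: measurable_funM; [exact: measurable_funX|exact: measurableT_comp].
  move=> w; rewrite normrM ger0_norm ?sqr_ge0// mulrC ler_wpM2r ?sqr_ge0//.
have mdB : measurable_fun [set: R] (fun x => df x + B).
  by apply: measurable_funD => //; exact: measurable_cst.
have dB0 x : 0 <= df x + B by rewrite -lerBlDr sub0r lerNl (le_trans _ (dfB x))// -normrN ler_norm.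
have iB : integ P (fun w => df (Wj j w) + B).
  by apply: integD; [exact: sqinteg_integ (idf mWj)|exact: integ_cst].
have := indep_mean_ge0 (ixi2 j) iB (fun w => sqr_ge0 _) (fun w => dB0 _)
  (indep_rv_comp (measurable_funX 2 (@measurable_id _ _ setT)) mdB (indep j)).
have i1 := iprod df B mdf dfB.
have E : (fun w => xi j w ^+ 2 * (df (Wj j w) + B)) =
         (fun w => xi j w ^+ 2 * df (Wj j w) + B * xi j w ^+ 2).
  by apply/funext => w; rewrite mulrDr (mulrC B).
rewrite mean_fineK; last by rewrite E; apply: integD => //; exact: integZ.
rewrite E => -[]; rewrite (meanD i1 (integZ B (ixi2 j))).
rewrite meanZ// (meanD _ (integ_cst P B)); last exact: sqinteg_integ (idf mWj).
by rewrite meancst -/(s j) mulrDr (mulrC B) => /addIr.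
Qed.

(** Leave one out: [Wj j] is independent of [xi j], so E[xi_j f(W_j)] = 0 and the first-order term
    of f(W) around W_j has mean s_j E[df(W_j)]. Returning from df(W_j) to df(W) costs the modulus
    once more, whence the factor 2 and the term in s_j^2. *)
Lemma stein_term j :
  `|s j * mean P (fun w => df (W w)) - mean P (fun w => xi j w * f (W w))| <=
  2 * e * s j + K * mean P (fun w => quad_tail (xi j w)) + K * s j ^+ 2.
Proof.
have mW := sqinteg_meas sW; have mWj := sqinteg_meas (sWj j).
have mxi := sqinteg_meas (sxi j).
have i1 : integ P (fun w => xi j w * f (W w)) by apply: sqintegM => //; exact: sf.
have i2 : integ P (fun w => xi j w * f (Wj j w)) by apply: sqintegM => //; exact: sf.
have i3 : integ P (fun w => xi j w ^+ 2 * df (Wj j w)).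
  apply: (integ_le (integZ B (ixi2 j))).
    by apply: measurable_funM; [exact: measurable_funX|exact: measurableT_comp].
  by move=> w; rewrite normrM ger0_norm ?sqr_ge0// mulrC ler_wpM2r ?sqr_ge0.
have z : mean P (fun w => xi j w * f (Wj j w)) = 0.
  rewrite indep_mean ?xi0 ?mul0r//; first exact: sf.
  by apply: (@indep_rv_comp _ _ _ _ (xi j) (Wj j) id f) => //; exact: measurable_id.
have b1 : `|mean P (fun w => xi j w * f (W w)) - s j * mean P (fun w => df (Wj j w))| <=
    e * s j + K * mean P (fun w => quad_tail (xi j w)).
  rewrite -indep_sqr -[X in `|X - _|]subr0 -z -(meanB i1 i2) -meanB//; last exact: integB.
  rewrite -meanZ// -meanZ// -meanD; [|exact: integZ|exact: integZ].
  apply: mean_norm_le.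
  - by apply: integB => //; exact: integB.
  - by apply: integD; exact: integZ.
  - move=> w; rewrite (WE j) (addrC (xi j w)) -mulrBr; exact: taylor.
have b2 : `|mean P (fun w => df (W w)) - mean P (fun w => df (Wj j w))| <= e + K * s j.
  rewrite -meanB; [|exact: sqinteg_integ (idf mW)|exact: sqinteg_integ (idf mWj)].
  have -> : e + K * s j = mean P (fun w => e + K * xi j w ^+ 2).
    by rewrite (meanD (integ_cst P e)) ?meancst ?meanZ//; exact: integZ.
  apply: mean_norm_le.
  - by apply: integB; [exact: sqinteg_integ (idf mW)|exact: sqinteg_integ (idf mWj)].
  - by apply: integD; [exact: integ_cst|exact: integZ].
  - move=> w; rewrite (WE j) (addrC (xi j w)); apply: le_trans (df_mod _ _) _.
    rewrite lerD2l ler_wpM2l// ler_pdivrMr ?onep_sqr_gt0//.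
    by rewrite mulrDr mulr1 lerDl mulr_ge0 ?sqr_ge0.
have -> : s j * mean P (fun w => df (W w)) - mean P (fun w => xi j w * f (W w)) =
   s j * (mean P (fun w => df (W w)) - mean P (fun w => df (Wj j w))) -
   (mean P (fun w => xi j w * f (W w)) - s j * mean P (fun w => df (Wj j w))) by ring.
apply: le_trans (ler_normB _ _) _; rewrite normrM (ger0_norm (s_ge0 j)).
have := ler_wpM2l (s_ge0 j) b2; move: b1; lra.
Qed.

Lemma stein_bound (v m : R) : (forall j, s j <= m) ->
  `|v * mean P (fun w => df (W w)) - mean P (fun w => W w * f (W w))| <=
  B * `|v - S| + (2 * e + K * m) * S + K * H.
Proof.
move=> sm; have mW := sqinteg_meas sW.
have iWf : integ P (fun w => W w * f (W w)) by apply: sqintegM => //; exact: sf.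
have -> : mean P (fun w => W w * f (W w)) = \sum_(j < n) mean P (fun w => xi j w * f (W w)).
  have -> : (fun w => W w * f (W w)) = (fun w => \sum_(j < n) xi j w * f (W w)).
    by apply/funext => w; rewrite mulr_suml.
  rewrite (@mean_sum _ _ _ P _ _ (fun j w => xi j w * f (W w)))// => j.
  by apply: sqintegM => //; exact: sf.
set a := mean P (fun w => df (W w)).
have aB : `|a| <= B.
  rewrite -(meancst P B); apply: mean_norm_le => //; last exact: integ_cst.
  exact: sqinteg_integ (idf mW).
have -> : v * a - \sum_(j < n) mean P (fun w => xi j w * f (W w)) =
  (v - S) * a + \sum_(j < n) (s j * a - mean P (fun w => xi j w * f (W w))).
  by rewrite sumrB -mulr_suml -/S; ring.
apply: le_trans (ler_normD _ _) _; rewrite -addrA; apply: lerD.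
  by rewrite normrM mulrC ler_wpM2r.
apply: le_trans (ler_norm_sum _ _ _) _.
rewrite /S /H !mulr_sumr -big_split/=; apply: ler_sum => j _.
apply: le_trans (stein_term j) _.
have := s_ge0 j; have := ler_wpM2l (s_ge0 j) (sm j).
have := ler_wpM2l K0 (ler_wpM2l (s_ge0 j) (sm j)); rewrite expr2; lra.
Qed.

End with_solution.

(** For a limit of variance 0, where the Stein equation degenerates: the mean of W^2 tends to 0 and
    [psi (W w)] concentrates at [psi 0]. *)
Lemma chebyshev_bound (psi : R -> R) (e K : R) : measurable_fun [set: R] psi ->
  0 <= K -> (forall x, `|psi x - psi 0| <= e + K * x ^+ 2) ->
  `|mean P (fun w => psi (W w)) - psi 0| <= e + K * S.
Proof.
move=> mpsi K0 h; have [mW iW2] := sW; rewrite -mean_sum_sqr.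
have iB : integ P (fun w => e + K * W w ^+ 2).
  by apply: integD; [exact: integ_cst|exact: integZ].
have mp : measurable_fun [set: Om] (fun w => psi (W w)) by exact: measurableT_comp.
have ip : integ P (fun w => psi (W w) - psi 0).
  by apply: (integ_le iB) => [|w]; [apply: measurable_funB|exact: h].
have ip' : integ P (fun w => psi (W w)).
  have := integD ip (integ_cst P (psi 0)).
  by under eq_fun do rewrite subrK.
have -> : e + K * mean P (fun w => W w ^+ 2) = mean P (fun w => e + K * W w ^+ 2).
  by rewrite (meanD (integ_cst P e)) ?meancst ?meanZ//; exact: integZ.
rewrite -[X in _ - X](meancst P (psi 0)) -meanB//; last exact: integ_cst.
exact: mean_norm_le.
Qed.

End one_sum.

(** For |t| > d the ratio t^2 / (1 + t^2) is at least d^2 / (1 + d^2), and the chosen [K] makes the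
    second term exceed the trivial bound [2 * B]. *)
Lemma unif_cont_mod (df : R -> R) (B e : R) : unif_cont df -> 0 <= B ->
  (forall x, `|df x| <= B) -> 0 < e -> exists2 K : R, 0 <= K &
  forall x t, `|df (x + t) - df x| <= e + K * (t ^+ 2 / (1 + t ^+ 2)).
Proof.
move=> udf B0 dfB e0; have [d d0 hd] := udf e e0.
have d20 : 0 < d ^+ 2 by rewrite exprn_gt0.
exists (2 * B * (1 + d ^+ 2) / d ^+ 2).
  by rewrite !mulr_ge0 ?invr_ge0 ?addr_ge0 ?(ltW d20).
move=> x t; have q0 : 0 <= t ^+ 2 / (1 + t ^+ 2).
  by rewrite divr_ge0 ?sqr_ge0// ltW// onep_sqr_gt0.
have [td|td] := leP `|t| d.
  apply: le_trans (hd _ _ _) _; first by rewrite addrC addKr.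
  by rewrite lerDl mulr_ge0// !mulr_ge0 ?invr_ge0 ?addr_ge0 ?(ltW d20).
apply: (@le_trans _ _ (2 * B)).
  apply: le_trans (ler_normB _ _) _.
  by rewrite mulr_natl mulr2n lerD.
apply: (@le_trans _ _ (2 * B * (1 + d ^+ 2) / d ^+ 2 * (t ^+ 2 / (1 + t ^+ 2)))); last first.
  by rewrite lerDr ltW.
have dt : d ^+ 2 <= t ^+ 2.
  by rewrite -(real_normK (num_real t)) lerXn2r ?nnegrE ?(ltW d0)// ltW.
have -> : 2 * B * (1 + d ^+ 2) / d ^+ 2 * (t ^+ 2 / (1 + t ^+ 2)) =
  2 * B * ((1 + d ^+ 2) / d ^+ 2 * (t ^+ 2 / (1 + t ^+ 2))) by ring.
rewrite ler_peMr ?mulr_ge0// mulrA ler_pdivlMr ?onep_sqr_gt0// mul1r mulrAC.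
by rewrite ler_pdivlMr// mulrDl mul1r mulrDl mul1r lerD// mulrC.
Qed.

(** The variance 0 is set apart in agreement with [centered_normal], which is then a Dirac mass. *)
Definition gauss_mean (v : R) (psi : R -> R) : R :=
  if v == 0 then psi 0
  else (\int[lebesgue_measure]_x (psi x * normal_pdf 0 (Num.sqrt v) x))%R.

Section triangular_array.
Variables (disp : nat -> measure_display) (Om : forall n, measurableType (disp n)).
Variables (P : forall n, probability (Om n) R).
Variables (xi : forall n, 'I_n -> Om n -> R) (v : R) (m : nat -> R).
Hypotheses (sxi : forall n j, (0 < n)%N -> sqinteg (P n) (@xi n j)).
Hypotheses (xi0 : forall n j, (0 < n)%N -> mean (P n) (@xi n j) = 0).
Hypothesis indep : forall n j, (0 < n)%N ->
  indep_rv (P n) (@xi n j) (fun w => \sum_(l < n | l != j) xi l w).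
Let S n := \sum_(j < n) mean (P n) (fun w => @xi n j w ^+ 2).
Let H n := \sum_(j < n) mean (P n) (fun w => quad_tail (@xi n j w)).
Hypotheses (Sv : S @ \oo --> v) (H0 : H @ \oo --> 0) (m0 : m @ \oo --> 0).
Hypothesis sm : forall n j, (0 < n)%N -> mean (P n) (fun w => @xi n j w ^+ 2) <= m n.

Let v_ge0 : 0 <= v.
Proof.
apply: (cvgr_to_ge Sv); near=> n; apply: sumr_ge0 => j _.
by apply: mean_ge0 => w; exact: sqr_ge0.
Unshelve. all: by end_near.
Qed.

(** For positive variance, the Stein equation makes E psi(W) - c the left side of [stein_bound]; on
    the right side the variance gap, the Lindeberg sum [H] and the bound [m] on individual variances
    all vanish in the limit. *)
Lemma lindeberg_clt (psi : R -> R) (L : R) : continuous psi ->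
  (forall x, L <= `|x| -> psi x = 0) ->
  (fun n => mean (P n) (fun w => psi (\sum_(j < n) @xi n j w))) @ \oo -->
  gauss_mean v psi.
Proof.
move=> cpsi psiL.
have [Bp Bp0 hBp] := @continuous_bounded_segment _ psi (- L) L cpsi.
have psiB x : `|psi x| <= Bp.
  have [xL|Lx] := leP `|x| L; first by apply: hBp; rewrite -ler_norml.
  by rewrite psiL ?normr0// ltW.
have mpsi : measurable_fun [set: R] psi by exact: continuous_measurable_fun.
apply/cvgrPdistC_le => e e0; rewrite /gauss_mean; have [v0|v0] := eqVneq v 0.
  have e20 : 0 < e / 2 by rewrite divr_gt0.
  have [d d0 hd] := @continuous_unif_segment _ psi 0 0 (e / 2) cpsi e20.
  have dd : 0 < d ^+ 2 by rewrite exprn_gt0.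
  pose K := 2 * Bp / d ^+ 2.
  have K0 : 0 <= K by rewrite !mulr_ge0// invr_ge0 ltW.
  have hK x : `|psi x - psi 0| <= e / 2 + K * x ^+ 2.
    have [xd|dx] := leP `|x| d.
      rewrite distrC; apply: le_trans (hd _ _ _ _) _; first by rewrite lexx.
        by rewrite sub0r normrN.
      by rewrite lerDl mulr_ge0// sqr_ge0.
    apply: (@le_trans _ _ (2 * Bp)).
      by apply: le_trans (ler_normB _ _) _; rewrite mulr_natl mulr2n lerD.
    apply: (@le_trans _ _ (K * x ^+ 2)); last by rewrite lerDr ltW.
    rewrite /K mulrAC ler_pdivlMr// ler_wpM2l ?mulr_ge0//.
    by rewrite -(real_normK (num_real x)) lerXn2r ?nnegrE ?(ltW d0)// ltW.
  have Ke : 0 < e / 2 / (K + 1) by rewrite divr_gt0// ltr_wpDl.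
  near=> n; have n0 : (0 < n)%N by near: n; exact: nbhs_infty_gt.
  apply: le_trans (chebyshev_bound (fun j => sxi j n0) (fun j => xi0 j n0)
    (fun j => indep j n0) mpsi K0 hK) _.
  rewrite [leRHS](splitr e) lerD2l.
  have : `|S n - v| <= e / 2 / (K + 1) by near: n; move/cvgrPdistC_le: Sv; apply.
  rewrite v0 subr0 => /(le_trans (ler_norm _)) => h.
  apply: (@le_trans _ _ (K * (e / 2 / (K + 1)))); first by rewrite ler_wpM2l.
  by rewrite mul_frac_le// ltW.
have vpos : 0 < v by rewrite lt_neqAle eq_sym v0 v_ge0.
have sig0 : 0 < Num.sqrt v by rewrite sqrtr_gt0.
have [f [df [dff stein [B B0 dfB] udf]]] := stein_solution sig0 cpsi psiL.
rewrite sqr_sqrtr ?ltW// in stein.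
have cdf : continuous df.
  move=> x; apply/cvgrPdist_le => eps eps0; have [d d0 hd] := udf _ eps0.
  exists d => //= y xy; apply: hd; exact: ltW.
(* Eventually K m_n <= e1 and S_n <= v + 1, so (2 e1 + K m_n) S_n <= 3 e1 (v + 1) = 3 e / 8; the two
   other terms receive e / 4 each. *)
pose e1 := e / (8 * (v + 1)).
have v1 : 0 < v + 1 by rewrite ltr_wpDl.
have e10 : 0 < e1 by rewrite divr_gt0// mulr_gt0.
have [K K0 hK] := unif_cont_mod udf B0 dfB e10.
have e4 : 0 < e / 4 by rewrite divr_gt0.
have eB : 0 < e / 4 / (B + 1) by rewrite divr_gt0// ltr_wpDl.
have eK : 0 < e / 4 / (K + 1) by rewrite divr_gt0// ltr_wpDl.
have em : 0 < e1 / (K + 1) by rewrite divr_gt0// ltr_wpDl.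
near=> n; have n0 : (0 < n)%N by near: n; exact: nbhs_infty_gt.
have sxin j := sxi j n0; have xi0n j := xi0 j n0; have indn j := indep j n0.
pose W w := \sum_(j < n) @xi n j w.
have sW : sqinteg (P n) W by exact: sqinteg_sum.
have mW := sqinteg_meas sW.
have bnd : `|v * mean (P n) (fun w => df (W w)) - mean (P n) (fun w => W w * f (W w))| <=
    B * `|v - S n| + (2 * e1 + K * m n) * S n + K * H n.
  by apply: (stein_bound sxin xi0n indn dff cdf (B := B) (e := e1)) => //;
    do ?[exact: ltW|by move=> j; exact: sm].
set c := (\int[_]__ _)%R.
have cf : continuous f.
  move=> x; apply: differentiable_continuous; apply/derivable1_diffP.
  exact: (@ex_derive _ _ _ _ _ _ _ (dff x)).
have mdf : measurable_fun [set: R] df by exact: continuous_measurable_fun.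
have idf : integ (P n) (fun w => df (W w)).
  by apply: (@integ_bounded _ _ _ _ _ B) => //; exact: measurableT_comp.
have ipsi : integ (P n) (fun w => psi (W w)).
  by apply: (@integ_bounded _ _ _ _ _ Bp) => //; exact: measurableT_comp.
have iWf : integ (P n) (fun w => W w * f (W w)).
  have -> : (fun w => W w * f (W w)) = (fun w => v * df (W w) - (psi (W w) - c)).
    by apply/funext => w; rewrite -stein; ring.
  by apply: integB; [exact: integZ|apply: integB => //; exact: integ_cst].
have -> : mean (P n) (fun w => psi (W w)) - c =
   v * mean (P n) (fun w => df (W w)) - mean (P n) (fun w => W w * f (W w)).
  rewrite -meanZ// -meanB//; last exact: integZ.
  rewrite -[X in _ - X](meancst (P n) c) -meanB//; last exact: integ_cst.
  by congr mean; apply/funext => w; rewrite stein.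
apply: le_trans bnd _; rewrite -/(S n) -/(H n).
have SB : `|v - S n| <= e / 4 / (B + 1) by near: n; move/cvgrPdist_le: Sv; apply.
have S1 : `|v - S n| <= 1 by near: n; move/cvgrPdist_le: Sv; apply.
have HK : `|H n| <= e / 4 / (K + 1) by near: n; move/cvgr0Pnorm_le: H0; apply.
have mK : `|m n| <= e1 / (K + 1) by near: n; move/cvgr0Pnorm_le: m0; apply.
have h1 : B * `|v - S n| <= e / 4.
  apply: (@le_trans _ _ (B * (e / 4 / (B + 1)))); first by rewrite ler_wpM2l.
  by rewrite mul_frac_le// ltW.
have h2 : K * H n <= e / 4.
  apply: (@le_trans _ _ (K * (e / 4 / (K + 1)))).
    by rewrite ler_wpM2l// (le_trans (ler_norm _)).
  by rewrite mul_frac_le// ltW.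
have h3 : K * m n <= e1.
  apply: (@le_trans _ _ (K * (e1 / (K + 1)))).
    by rewrite ler_wpM2l// (le_trans (ler_norm _)).
  by rewrite mul_frac_le// ltW.
have S0 : 0 <= S n by apply: sumr_ge0 => j _; apply: mean_ge0 => w; exact: sqr_ge0.
have S2 : S n <= v + 1.
  by move: S1; rewrite ler_norml => /andP[]; lra.
have h4 : (2 * e1 + K * m n) * S n <= 3 * e / 8.
  apply: (@le_trans _ _ (3 * e1 * (v + 1))).
    apply: ler_pM => //; last lra.
    have m0n : 0 <= m n.
      by apply: le_trans (sm (Ordinal n0) n0); apply: mean_ge0 => w; exact: sqr_ge0.
    by apply: addr_ge0; apply: mulr_ge0 => //; exact: ltW.
  rewrite /e1 le_eqVlt; apply/orP; left; apply/eqP; field.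
  by rewrite gt_eqF.
lra.
Unshelve. all: by end_near.
Qed.

End triangular_array.

End lindeberg.

(** * Joint convergence *)

Section hat_functions.
Context {R : realType}.

Definition ramp (t : R) : R := Num.max 0 (Num.min 1 t).

Lemma ramp_itv t : 0 <= ramp t <= 1.
Proof. by rewrite /ramp le_max lexx ge_max ler01 ge_min lexx. Qed.

Lemma ramp0 t : t <= 0 -> ramp t = 0.
Proof.
by move=> t0; rewrite /ramp; apply/max_idPl; rewrite ge_min t0 orbT.
Qed.

Lemma ramp1 t : 1 <= t -> ramp t = 1.
Proof. by move=> t1; rewrite /ramp min_l// max_r. Qed.

Lemma ramp_homo s t : s <= t -> ramp s <= ramp t.
Proof.
move=> st; rewrite /ramp ge_max le_max lexx/= le_max; apply/orP; right.
by rewrite le_min ge_min lexx/= ge_min st orbT.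
Qed.

Lemma continuous_ramp : continuous ramp.
Proof.
move=> t; apply: continuous_max; first exact: cvg_cst.
by apply: continuous_min; [exact: cvg_cst|exact: cvg_id].
Qed.

(* The hat function centered at the integer [k - K]. *)
Definition hat (h : R) (K k : nat) (x : R) : R :=
  ramp (x / h + K%:R - k%:R + 1) - ramp (x / h + K%:R - k%:R).

Definition node (h : R) (K k : nat) : R := (k%:R - K%:R) * h.

Lemma hat_ge0 h K k x : 0 <= hat h K k x.
Proof. by rewrite subr_ge0 ramp_homo// lerDl. Qed.

(** Consecutive hats share a ramp, so the sum telescopes. With 2K + 1 hats this is a partition of
    unity on [- K h, K h], and a sum at most 1 elsewhere. *)
Lemma sum_hat h K n x :
  \sum_(k < n) hat h K k x = ramp (x / h + K%:R + 1) - ramp (x / h + K%:R - n%:R + 1).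
Proof.
elim: n => [|n IH]; first by rewrite big_ord0 subr0 subrr.
rewrite big_ord_recr/= IH /hat.
have -> : x / h + K%:R - n.+1%:R + 1 = x / h + K%:R - n%:R by rewrite -natr1; ring.
by ring.
Qed.

Lemma sum_hat_le1 h K n x : \sum_(k < n) hat h K k x <= 1.
Proof.
rewrite sum_hat; have /andP[_ a1] := ramp_itv (x / h + K%:R + 1).
by have /andP[b0 _] := ramp_itv (x / h + K%:R - n%:R + 1); lra.
Qed.

Lemma sum_hat_eq1 h K x : 0 < h -> `|x| <= K%:R * h ->
  \sum_(k < K.*2.+1) hat h K k x = 1.
Proof.
move=> h0; rewrite -ler_pdivrMr// => xK.
have : `|x / h| <= K%:R by rewrite normrM normfV (gtr0_norm h0).
rewrite ler_norml => /andP[h1 h2].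
rewrite sum_hat ramp1 ?ramp0 ?subr0//; first by rewrite -natr1 -addnn natrD; lra.
by lra.
Qed.

Lemma hat_support h K k x : 0 < h -> h <= `|x - node h K k| -> hat h K k x = 0.
Proof.
move=> h0 hx; rewrite /hat.
have E : x / h + K%:R - k%:R = (x - node h K k) / h.
  by rewrite /node; field; rewrite gt_eqF.
rewrite E; set t := (x - _) / h.
have : 1 <= `|t| by rewrite /t normrM normfV (gtr0_norm h0) ler_pdivlMr// mul1r.
rewrite ler_normr => /orP[t1|t1].
  by rewrite !ramp1 ?subrr// ltW// (le_lt_trans t1)// ltrDl.
by rewrite !ramp0 ?subrr//; lra.
Qed.

Lemma continuous_hat h K k : continuous (hat h K k).
Proof.
have c b : continuous (fun x : R => ramp (x / h + K%:R - k%:R + b)).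
  move=> x; apply: (continuous_comp (f := fun x : R => x / h + K%:R - k%:R + b) (g := ramp));
    last exact: continuous_ramp.
  apply: cvgD; last exact: cvg_cst.
  apply: cvgB; last exact: cvg_cst.
  apply: cvgD; last exact: cvg_cst.
  by apply: cvgM; [exact: cvg_id|exact: cvg_cst].
move=> x; apply: cvgB; first exact: (c 1 x).
have := c 0 x; have -> : (fun x : R => ramp (x / h + K%:R - k%:R + 0)) =
  (fun x : R => ramp (x / h + K%:R - k%:R)) by apply/funext => y; rewrite addr0.
by rewrite /continuous_at; apply.
Qed.

Lemma hat_vanish h K k : 0 < h -> exists L, forall x, L <= `|x| -> hat h K k x = 0.
Proof.
move=> h0; exists (`|node h K k| + h) => x hx; apply: hat_support => //.
have : `|x| <= `|x - node h K k| + `|node h K k|.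
  by rewrite -{1}(subrK (node h K k) x) ler_normD.
by lra.
Qed.

End hat_functions.

(** * From product test functions to bounded uniformly continuous functions *)

Section product_limit.
Context {R : realType}.
Variables (N : nat) (disp : nat -> measure_display).
Variables (Om : forall n, measurableType (disp n)) (P : forall n, probability (Om n) R).
Variables (W : forall n, 'I_N -> Om n -> R).
Variables (d' : measure_display) (Om' : measurableType d') (P' : probability Om' R).
Variable (Z : 'I_N -> Om' -> R).
Variables (F : ('I_N -> R) -> R) (CF Cv : R).

Hypothesis sW : forall n i, (0 < n)%N -> sqinteg (P n) (@W n i).
Hypothesis vW : forall n i, (0 < n)%N -> mean (P n) (fun w => @W n i w ^+ 2) <= Cv.
Hypothesis mZ : forall i, measurable_fun [set: Om'] (Z i).
Hypothesis prod_cvg : forall psi : 'I_N -> R -> R, (forall i, continuous (psi i)) ->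
  (forall i, exists L, forall x, L <= `|x| -> psi i x = 0) ->
  (fun n => mean (P n) (fun w => \prod_(i < N) psi i (@W n i w))) @ \oo -->
  mean P' (fun w => \prod_(i < N) psi i (Z i w)).
Hypothesis mFW : forall n, (0 < n)%N -> measurable_fun [set: Om n] (fun w => F (fun i => @W n i w)).
Hypothesis mFZ : measurable_fun [set: Om'] (fun w => F (fun i => Z i w)).
Hypothesis FC : forall x, `|F x| <= CF.
Hypothesis Funif : forall e : R, 0 < e -> exists2 h : R, 0 < h &
  forall x y, (forall i, `|x i - y i| <= h) -> `|F x - F y| <= e.

Section approximation.
Variables (e h : R) (K : nat).
Hypotheses (h0 : 0 < h) (K0 : (0 < K)%N).
Hypothesis Fh : forall x y, (forall i, `|x i - y i| <= h) -> `|F x - F y| <= e.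
Local Notation M := (K.*2.+1).
Local Notation index := {ffun 'I_N -> 'I_M}.

Let tensor (k : index) (x : 'I_N -> R) : R := \prod_(i < N) hat h K (k i) (x i).
Let mass (x : 'I_N -> R) : R := \sum_(k : index) tensor k x.
Let approx (x : 'I_N -> R) : R :=
  \sum_(k : index) F (fun i => node h K (k i)) * tensor k x.

Let CF0 : 0 <= CF. Proof. exact: le_trans (normr_ge0 _) (FC (fun=> 0)). Qed.

Let tensor_ge0 k x : 0 <= tensor k x.
Proof. by apply: prodr_ge0 => i _; exact: hat_ge0. Qed.

Let massE x : mass x = \prod_(i < N) \sum_(k < M) hat h K k (x i).
Proof. by rewrite /mass /tensor bigA_distr_bigA. Qed.

Let mass_le1 x : mass x <= 1.
Proof.
rewrite massE; apply: prodr_ile1 => i _; rewrite sum_hat_le1 andbT.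
by apply: sumr_ge0 => k _; exact: hat_ge0.
Qed.

(** Chebyshev's inequality before integration: either all coordinates lie in the box, where the mass
    is 1, or one of the quotients already exceeds 1. *)
Let mass_ge x : 1 - \sum_(i < N) (x i) ^+ 2 / (K%:R * h) ^+ 2 <= mass x.
Proof.
have Kh : 0 < K%:R * h by rewrite mulr_gt0// ltr0n.
have q0 i : 0 <= (x i) ^+ 2 / (K%:R * h) ^+ 2 by rewrite divr_ge0 ?sqr_ge0.
have [/forallP xK|/forallPn[i]] := boolP [forall i, `|x i| <= K%:R * h].
  have -> : mass x = 1.
    by rewrite massE; apply: big1 => i _; apply: sum_hat_eq1 => //; exact: xK.
  by rewrite lerBlDr lerDl sumr_ge0.
rewrite -ltNge => xi.
apply: (@le_trans _ _ 0); last by apply: sumr_ge0 => k _; exact: tensor_ge0.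
rewrite subr_le0 (bigD1 i)//= ler_wpDr ?sumr_ge0//.
rewrite ler_pdivlMr ?exprn_gt0// mul1r -(real_normK (num_real (x i))).
by rewrite lerXn2r ?nnegrE ?(ltW Kh)// ltW.
Qed.

(** A tensor of hats that does not vanish at [x] has its node within [h] in each coordinate, so [F]
    at the node is [e]-close to [F x]; the missing mass is weighted by [CF]. *)
Let approx_err x : `|F x - approx x| <= e + CF * (1 - mass x).
Proof.
have e0 : 0 <= e.
  by apply: le_trans (Fh (x := x) (y := x) _) => // i; rewrite subrr normr0 ltW.
have -> : F x - approx x = F x * (1 - mass x) +
    \sum_(k : index) (F x - F (fun i => node h K (k i))) * tensor k x.
  under eq_bigr do rewrite mulrBl.
  by rewrite sumrB -mulr_sumr -/(mass x) /approx; ring.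
rewrite addrC; apply: le_trans (ler_normD _ _) _; apply: lerD.
  apply: le_trans (ler_norm_sum _ _ _) _.
  apply: (@le_trans _ _ (e * mass x)); last by rewrite ler_piMr// mass_le1.
  rewrite mulr_sumr; apply: ler_sum => k _.
  have [/forallP xk|/forallPn[i]] := boolP [forall i, `|x i - node h K (k i)| <= h].
    by rewrite normrM (ger0_norm (tensor_ge0 _ _)) ler_wpM2r// Fh.
  rewrite -ltNge => xi.
  have -> : tensor k x = 0 by rewrite /tensor (bigD1 i)//= hat_support ?mul0r// ltW.
  by rewrite !mulr0 normr0.
have m1 : 0 <= 1 - mass x by rewrite subr_ge0.
by rewrite normrM (ger0_norm m1) ler_wpM2r.
Qed.

Section expectations.
Context d (Q : measurableType d) (mu : probability Q R).
Variable X : 'I_N -> Q -> R.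
Hypothesis mX : forall i, measurable_fun [set: Q] (X i).
Hypothesis mFX : measurable_fun [set: Q] (fun w => F (fun i => X i w)).

Let mt k : measurable_fun [set: Q] (fun w => tensor k (X^~ w)).
Proof.
apply: measurable_prod => i _; apply: measurableT_comp; last exact: mX.
by apply: continuous_measurable_fun; exact: continuous_hat.
Qed.

Let it k : integ mu (fun w => tensor k (X^~ w)).
Proof.
apply: (@integ_bounded _ _ _ _ _ 1) => // w; rewrite ger0_norm//.
apply: le_trans (mass_le1 (X^~ w)); rewrite /mass (bigD1 k)//= lerDl.
by apply: sumr_ge0 => k' _; exact: tensor_ge0.
Qed.

Lemma mean_mass : mean mu (fun w => mass (X^~ w)) =
  \sum_(k : index) mean mu (fun w => tensor k (X^~ w)).
Proof. by rewrite (@mean_sum _ _ _ mu _ _ (fun (k : index) w => tensor k (X^~ w))). Qed.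

Lemma mean_approx : mean mu (fun w => approx (X^~ w)) =
  \sum_(k : index) F (fun i => node h K (k i)) * mean mu (fun w => tensor k (X^~ w)).
Proof.
rewrite (@mean_sum _ _ _ mu _ _ (fun (k : index) w => F (fun i =>
  node h K (k i)) * tensor k (X^~ w))).
  by apply: eq_bigr => k _; rewrite meanZ.
by move=> k; exact: integZ.
Qed.

Lemma mean_approx_err :
  `|mean mu (fun w => F (X^~ w)) - mean mu (fun w => approx (X^~ w))| <=
  e + CF * (1 - mean mu (fun w => mass (X^~ w))).
Proof.
have iF : integ mu (fun w => F (X^~ w)) by exact: (@integ_bounded _ _ _ _ _ CF).
have im : integ mu (fun w => mass (X^~ w)) by exact: integ_sum.
have ia : integ mu (fun w => approx (X^~ w)).
  by apply: integ_sum => k; exact: integZ.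
rewrite -meanB//.
have i1 : integ mu (fun w => 1 - mass (X^~ w)).
  by apply: integB => //; exact: integ_cst.
have -> : e + CF * (1 - mean mu (fun w => mass (X^~ w))) =
   mean mu (fun w => e + CF * (1 - mass (X^~ w))).
  rewrite (meanD (integ_cst mu e)) ?meancst; last exact: integZ.
  by rewrite meanZ// (meanB (integ_cst mu 1))// meancst.
apply: mean_norm_le => [||w]; last exact: approx_err.
- exact: integB.
- by apply: integD; [exact: integ_cst|exact: integZ].
Qed.

Lemma mean_mass_ge : (forall i, sqinteg mu (X i)) ->
  1 - \sum_(i < N) mean mu (fun w => X i w ^+ 2) / (K%:R * h) ^+ 2 <=
  mean mu (fun w => mass (X^~ w)).
Proof.
move=> sX.
have i2 i : integ mu (fun w => X i w ^+ 2 / (K%:R * h) ^+ 2).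
  by have [_ /(integZ ((K%:R * h) ^+ 2)^-1)] := sX i; under eq_fun do rewrite mulrC.
have -> : 1 - \sum_(i < N) mean mu (fun w => X i w ^+ 2) / (K%:R * h) ^+ 2 =
   mean mu (fun w => 1 - \sum_(i < N) X i w ^+ 2 / (K%:R * h) ^+ 2).
  rewrite (meanB (integ_cst mu 1)) ?meancst; last exact: integ_sum.
  rewrite (@mean_sum _ _ _ mu _ _ (fun i w => X i w ^+ 2 / (K%:R * h) ^+ 2))//.
  congr (_ - _); apply: eq_bigr => i _; rewrite mulrC -meanZ; last by case: (sX i).
  by congr mean; apply/funext => w; rewrite mulrC.
apply: mean_le.
- by apply: integB; [exact: integ_cst|exact: integ_sum].
- exact: integ_sum.
- by move=> w; exact: mass_ge.
Qed.

End expectations.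

Let tensor_cvg k : (fun n => mean (P n) (fun w => tensor k ((@W n)^~ w))) @ \oo -->
  mean P' (fun w => tensor k (Z^~ w)).
Proof.
apply: (prod_cvg (psi := fun i => hat h K (k i))) => i.
- exact: continuous_hat.
- exact: hat_vanish.
Qed.

Let cvg_finsum (I : finType) (u : I -> nat -> R) (l : I -> R) :
  (forall i, u i @ \oo --> l i) -> (fun n => \sum_i u i n) @ \oo --> \sum_i l i.
Proof.
move=> ul; elim: (index_enum I) => [|i s IH].
  by under eq_fun do rewrite big_nil; rewrite big_nil; exact: cvg_cst.
by under eq_fun do rewrite big_cons; rewrite big_cons; exact: cvgD.
Qed.

(** The error is 2 e for replacing [F] by hats along the sequence, 2 e for doing so at the limit,
    and e for the convergence of finitely many product expectations. *)
Lemma product_limit_err : 0 < e -> N%:R * Cv * CF <= e * (K%:R * h) ^+ 2 ->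
  \forall n \near \oo, `|mean (P n) (fun w => F ((@W n)^~ w)) -
    mean P' (fun w => F (Z^~ w))| <= 5 * e.
Proof.
move=> e0 Ke.
have mc : (fun n => mean (P n) (fun w => mass ((@W n)^~ w))) @ \oo -->
    mean P' (fun w => mass (Z^~ w)).
  rewrite mean_mass//.
  have := @cvg_finsum _ (fun (k : index) n => mean (P n) (fun w => tensor k ((@W n)^~ w)))
    (fun (k : index) => mean P' (fun w => tensor k (Z^~ w))) tensor_cvg.
  apply: cvg_trans; apply: near_eq_cvg; near=> n.
  have n0 : (0 < n)%N by near: n; exact: nbhs_infty_gt.
  by rewrite mean_mass// => i; exact: sqinteg_meas (sW i n0).
have ac : (fun n => mean (P n) (fun w => approx ((@W n)^~ w))) @ \oo -->
    mean P' (fun w => approx (Z^~ w)).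
  rewrite mean_approx//.
  have : (fun n => \sum_(k : index) F (fun i => node h K (k i)) *
      mean (P n) (fun w => tensor k ((@W n)^~ w))) @ \oo -->
      \sum_(k : index) F (fun i => node h K (k i)) * mean P' (fun w => tensor k (Z^~ w)).
    by apply: cvg_finsum => k; apply: cvgM; [exact: cvg_cst|exact: tensor_cvg].
  apply: cvg_trans.
  apply: near_eq_cvg; near=> n.
  have n0 : (0 < n)%N by near: n; exact: nbhs_infty_gt.
  by rewrite mean_approx// => i; exact: sqinteg_meas (sW i n0).
have Kh : 0 < (K%:R * h) ^+ 2 by rewrite exprn_gt0// mulr_gt0// ltr0n.
have mW n : (0 < n)%N -> CF * (1 - mean (P n) (fun w => mass ((@W n)^~ w))) <= e.
  move=> n0; have := @mean_mass_ge _ _ (P n) (@W n) (fun i => sqinteg_meas (sW i n0)) (fun i =>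
    sW i n0).
  move=> hm; apply: (@le_trans _ _ (CF * (N%:R * Cv / (K%:R * h) ^+ 2))).
    rewrite ler_wpM2l// lerBlDr -lerBlDl; apply: le_trans hm; rewrite lerD2l lerN2.
    rewrite -mulr_suml ler_wpM2r ?invr_ge0 ?(ltW Kh)//.
    rewrite mulr_natl -[X in _ *+ X](card_ord N) -sumr_const; apply: ler_sum => i _.
    exact: vW.
  by rewrite mulrA ler_pdivrMr// mulrC.
(* No moment of [Z] is available; the bound on its missing mass is the limit of the bounds along the
   sequence. *)
have mZ' : CF * (1 - mean P' (fun w => mass (Z^~ w))) <= e.
  have : (fun n => CF * (1 - mean (P n) (fun w => mass ((@W n)^~ w)))) @ \oo -->
         CF * (1 - mean P' (fun w => mass (Z^~ w))).
    by apply: cvgM; [exact: cvg_cst|apply: cvgB => //; exact: cvg_cst].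
  move=> /cvgr_to_le; apply; near=> n; apply: mW.
  by near: n; exact: nbhs_infty_gt.
near=> n; have n0 : (0 < n)%N by near: n; exact: nbhs_infty_gt.
have a1 := mean_approx_err (P n) (fun i => sqinteg_meas (sW i n0)) (mFW n0).
have a2 := mean_approx_err P' mZ mFZ.
have a3 : `|mean (P n) (fun w => approx ((@W n)^~ w)) - mean P' (fun w => approx (Z^~ w))| <= e.
  by near: n; move/cvgrPdistC_le: ac; apply.
have a4 := mW n n0.
move: a1 a2 a3; rewrite !ler_norml => /andP[? ?] /andP[? ?] /andP[? ?].
by apply/andP; split; lra.
Unshelve. all: by end_near.
Qed.

End approximation.

Lemma product_limit : (fun n => mean (P n) (fun w => F ((@W n)^~ w))) @ \oo -->
  mean P' (fun w => F (Z^~ w)).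
Proof.
apply/cvgrPdistC_le => e e0.
have e5 : 0 < e / 5 by rewrite divr_gt0.
have [h h0 Fh] := Funif e5.
(* The half-width K h of the box must satisfy N Cv CF <= (e / 5) (K h)^2; since K >= 1, K >= B gives
   K^2 >= B. *)
pose B := N%:R * Cv * CF / (e / 5) / h ^+ 2.
have h20 : 0 < h ^+ 2 by rewrite exprn_gt0.
pose K := (Num.truncn `|B|).+1.
have KB : B <= K%:R by apply: le_trans (ler_norm _) _; rewrite ltW// truncnS_gt.
have KB2 : B <= K%:R ^+ 2.
  by apply: le_trans KB _; rewrite expr2 ler_peMr// ler1n.
have -> : e = 5 * (e / 5) by field.
apply: (@product_limit_err (e / 5) h K) => //.
move: KB2; rewrite /B !ler_pdivrMr//= => KB2; apply: le_trans KB2 _.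
by rewrite exprMn mulrC.
Unshelve. all: by end_near.
Qed.

End product_limit.

(** * The effective sample size as a function of the log-weights *)

Section effective_sample_size.
Context {R : realType}.
Variable N : nat.
Implicit Types x y : 'I_N -> R.

Definition ess x : R := (\sum_(i < N) expR (x i)) ^+ 2 / \sum_(i < N) expR (x i) ^+ 2.

Lemma ess_ge0 x : 0 <= ess x.
Proof. by rewrite divr_ge0 ?sqr_ge0// sumr_ge0// => i _; exact: sqr_ge0. Qed.

(** A common factor of the weights cancels. This removes the mean of the log-weights, which is the
    same for all particles and need not stay bounded in the dimension. *)
Lemma ess_shift c x : ess (fun i => x i + c) = ess x.
Proof.
rewrite /ess; under eq_bigr do rewrite expRD.
under [X in _ / X]eq_bigr do rewrite expRD exprMn.
rewrite -!mulr_suml exprMn -mulf_div divff ?mulr1//.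
by rewrite gt_eqF// exprn_gt0 ?expR_gt0.
Qed.

Hypothesis N0 : (0 < N)%N.

Lemma sum_expR_sqr_gt0 x : 0 < \sum_(i < N) expR (x i) ^+ 2.
Proof.
rewrite (bigD1 (Ordinal N0))//= ltr_pwDl ?exprn_gt0 ?expR_gt0//.
by apply: sumr_ge0 => i _; exact: sqr_ge0.
Qed.

(** The Cauchy-Schwarz inequality, in the form of a nonnegative empirical variance of the
    weights. *)
Lemma ess_le x : ess x <= N%:R.
Proof.
have n0 : 0 < N%:R :> R by rewrite ltr0n.
rewrite ler_pdivrMr ?sum_expR_sqr_gt0//.
set S := \sum_(i < N) expR (x i).
have : 0 <= \sum_(i < N) (expR (x i) - S / N%:R) ^+ 2.
  by apply: sumr_ge0 => i _; exact: sqr_ge0.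
have -> : \sum_(i < N) (expR (x i) - S / N%:R) ^+ 2 =
    \sum_(i < N) expR (x i) ^+ 2 - S ^+ 2 / N%:R.
  have E i : (expR (x i) - S / N%:R) ^+ 2 =
    expR (x i) ^+ 2 - (2 * (S / N%:R) * expR (x i) - (S / N%:R) ^+ 2) by ring.
  under eq_bigr do rewrite E.
  rewrite sumrB [X in _ - X]sumrB -mulr_sumr sumr_const card_ord -/S -mulr_natl.
  by congr (_ - _); field; rewrite gt_eqF.
by rewrite subr_ge0 ler_pdivrMr// mulrC.
Qed.

(** Each exponential changes by a factor at most exp(h), so numerator and denominator change by at
    most exp(2h) each; [ess_le] turns the relative bound into an absolute one. *)
Lemma ess_lipschitz h x y : (forall i, `|x i - y i| <= h) ->
  `|ess x - ess y| <= (expR (4 * h) - 1) * N%:R.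
Proof.
have half x' y' : (forall i, `|x' i - y' i| <= h) -> ess x' - ess y' <= (expR (4 * h) - 1) * N%:R.
  move=> xy.
  have h0 : 0 <= h by apply: le_trans (xy (Ordinal N0)).
  have e1 i : expR (x' i) <= expR h * expR (y' i).
    by rewrite -expRD ler_expR; have := xy i; rewrite ler_norml => /andP[_ ?]; lra.
  have e2 i : expR (y' i) <= expR h * expR (x' i).
    by rewrite -expRD ler_expR; have := xy i; rewrite ler_norml => /andP[? _]; lra.
  have s1 : (\sum_(i < N) expR (x' i)) ^+ 2 <= expR (2 * h) * (\sum_(i < N) expR (y' i)) ^+ 2.
    rewrite expRM_natl -exprMn lerXn2r ?nnegrE//.
    - by apply: sumr_ge0 => i _; exact: expR_ge0.
    - by rewrite mulr_ge0 ?expR_ge0//; apply: sumr_ge0 => i _; exact: expR_ge0.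
    - by rewrite mulr_sumr; apply: ler_sum => i _; exact: e1.
  have s2 : \sum_(i < N) expR (y' i) ^+ 2 <= expR (2 * h) * \sum_(i < N) expR (x' i) ^+ 2.
    rewrite mulr_sumr; apply: ler_sum => i _.
    by rewrite expRM_natl -exprMn lerXn2r ?nnegrE ?mulr_ge0 ?expR_ge0.
  have le : ess x' <= expR (4 * h) * ess y'.
    rewrite /ess ler_pdivrMr ?sum_expR_sqr_gt0//.
    rewrite mulrA mulrAC ler_pdivlMr ?sum_expR_sqr_gt0//.
    have -> : expR (4 * h) = expR (2 * h) * expR (2 * h) by rewrite -expRD; congr expR; ring.
    apply: le_trans (ler_pM _ _ s1 s2) _; rewrite ?sqr_ge0//.
      exact/ltW/sum_expR_sqr_gt0.
    by rewrite le_eqVlt; apply/orP; left; apply/eqP; ring.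
  apply: (@le_trans _ _ ((expR (4 * h) - 1) * ess y')); first by rewrite mulrBl mul1r lerB.
  by rewrite ler_wpM2l ?ess_le// subr_ge0 -expR0 ler_expR mulr_ge0.
move=> xy; rewrite ler_norml half// andbT lerNl opprB half// => i.
by rewrite distrC.
Qed.

Lemma ess_unif_cont (f : R -> R) (e : R) : continuous f -> 0 < e ->
  exists2 h : R, 0 < h &
  forall x y, (forall i, `|x i - y i| <= h) -> `|f (ess x) - f (ess y)| <= e.
Proof.
move=> cf e0.
have [d d0 hd] := @continuous_unif_segment _ f 0 N%:R e cf e0.
have n0 : 0 < N%:R :> R by rewrite ltr0n.
have l0 : 0 < ln (1 + d / N%:R) by rewrite ln_gt0// ltrDl divr_gt0.
(* This [h] solves (exp(4h) - 1) N = d. *)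
exists (ln (1 + d / N%:R) / 4); first by rewrite divr_gt0.
move=> x y xy; apply: hd; first by rewrite ess_ge0 ess_le.
apply: le_trans (ess_lipschitz xy) _.
rewrite (mulrC 4) divfK ?pnatr_eq0// lnK ?posrE ?addr_gt0 ?divr_gt0//.
by rewrite addrAC subrr add0r divfK ?gt_eqF.
Qed.

Lemma measurable_ess d (T : measurableType d) (X : 'I_N -> T -> R) :
  (forall i, measurable_fun [set: T] (X i)) ->
  measurable_fun [set: T] (fun w => ess (X^~ w)).
Proof.
move=> mX.
have mE i : measurable_fun [set: T] (fun w => expR (X i w)).
  by apply: measurableT_comp (mX i).
(* The sum of squares being positive, its inverse is exp(- ln), and only compositions of measurable
   maps remain. *)
have -> : (fun w => ess (X^~ w)) = (fun w => (\sum_(i < N) expR (X i w)) ^+ 2 *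
    expR (- ln (\sum_(i < N) expR (X i w) ^+ 2))).
  by apply/funext => w; rewrite /ess expRN lnK// posrE sum_expR_sqr_gt0.
apply: measurable_funM.
  by apply: measurable_funX; apply: measurable_sum.
apply: measurableT_comp => //; apply: measurableT_comp => //.
apply: measurableT_comp => //.
by apply: measurable_sum => i; exact: measurable_funX.
Qed.

End effective_sample_size.

(** * The Poisson equation along the tempering path *)

Section powR_domination.
Context {R : realType}.

Lemma powR_absorb (p q e : R) : p < q -> 0 < e ->
  exists2 A : R, 1 <= A & forall w, A <= w -> w `^ p <= e * w `^ q.
Proof.
move=> pq e0; have qp : 0 < q - p by rewrite subr_gt0.
exists (Num.max 1 (e^-1 `^ (q - p)^-1)); first by rewrite le_max lexx.
move=> w; rewrite ge_max => /andP[w1 Aw].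
have w0 : 0 < w by exact: lt_le_trans w1.
have ewq : e^-1 <= w `^ (q - p).
  have := ge0_ler_powR (ltW qp) (powR_ge0 _ _) (ltW w0) Aw.
  by rewrite -powRrM mulVf ?gt_eqF// powRr1 ?invr_ge0 ?(ltW e0).
rewrite -(subrK p q) powRD ?(gt_eqF w0) ?implybT// mulrA.
rewrite ler_peMl ?powR_ge0// mulrC -ler_pdivrMr// div1r//.
Qed.

(** For large [w] the gap between the exponents makes c w^p small against w^q; for w < A the bound h
    w is at most e. Smallness in the full weight is thus converted into smallness in a power of it,
    given a growth bound in a lower power. *)
Lemma powR_interpolate (p q c e : R) : p < q -> 0 <= q -> 0 <= c -> 0 < e ->
  exists2 h : R, 0 < h & forall w u : R, 1 <= w -> `|u| <= c * w `^ p ->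
    `|u| <= h * w -> `|u| <= e * w `^ q.
Proof.
move=> pq q0 c0 e0; have c1 : 0 < c + 1 by rewrite ltr_wpDl.
have [A A1 hA] := powR_absorb pq (divr_gt0 e0 c1).
have A0 : 0 < A by exact: lt_le_trans A1.
exists (e / A) => [|w u w1 up uw]; first exact: divr_gt0.
have [Aw|wA] := leP A w.
  apply: le_trans up _; apply: le_trans (ler_wpM2l c0 (hA _ Aw)) _.
  rewrite mulrA ler_wpM2r ?powR_ge0// mulrCA ler_piMr ?(ltW e0)//.
  by rewrite ler_pdivrMr// mul1r lerDl.
apply: le_trans uw _; apply: (@le_trans _ _ e).
  by rewrite mulrAC ler_pdivrMr// ler_wpM2l ?(ltW e0)// ltW.
by rewrite ler_peMr ?(ltW e0)// powR_ge1.
Qed.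

End powR_domination.

Lemma abel_sum {R : realType} (A : nat -> nat -> R) d :
  \sum_(n < d.+1) (A n n.+1 - A n.+1 n.+1) =
  A 0%N 1%N - A d.+1 d.+1 + \sum_(n < d) (A n.+1 n.+2 - A n.+1 n.+1).
Proof.
elim: d => [|d IH]; first by rewrite big_ord1 big_ord0 addr0.
by rewrite big_ord_recr IH [in RHS]big_ord_recr/=; ring.
Qed.

(** The interface between the probabilistic hypotheses and the analysis: kernels and laws appear
    only as positive operators and functionals, for parameters in ]phi0, 1]. The field [rf_drift] is
    a contraction on the whole line, without a term on [C]. *)
Record regular_family {R : realType} (W : R -> R) (phi0 : R)
    (K : R -> (R -> R) -> R -> R) (nu : (R -> R) -> R) (pi : R -> (R -> R) -> R)
    (C : set R) (theta rho Cpi M : R) : Prop := RegularFamily {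
  rf_phi0 : 0 < phi0 < 1;
  rf_meas : measurable_fun [set: R] W;
  rf_ge1 : forall x, 1 <= W x;
  rf_pos : forall s, phi0 < s <= 1 -> positive_operator W (K s);
  rf_cst : forall s, phi0 < s <= 1 -> K s (cst 1) = cst 1;
  rf_nu : positive_linear W nu;
  rf_nu1 : nu (cst 1) = 1;
  rf_pi : forall s, phi0 < s <= 1 -> positive_linear W (pi s);
  rf_pi1 : forall s, phi0 < s <= 1 -> pi s (cst 1) = 1;
  rf_inv : forall s, phi0 < s <= 1 ->
    forall f, wbounded W f -> pi s (K s f) = pi s f;
  rf_piW : forall s, phi0 < s <= 1 -> pi s W <= Cpi;
  rf_C : measurable C;
  rf_theta : 0 < theta;
  rf_rho : 0 < rho < 1;
  rf_res : forall s, phi0 < s <= 1 -> forall f, wbounded W f ->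
    (forall x, 0 <= f x) -> forall x, 0 <= residual (K s) nu C theta f x;
  rf_drift : forall s, phi0 < s <= 1 ->
    forall x, residual (K s) nu C theta W x <= rho * W x;
  rf_M : 0 <= M;
  rf_lip : forall s t, phi0 < s <= 1 -> phi0 < t <= 1 ->
    forall f c, wbounded W f -> 0 <= c -> (forall x, `|f x| <= c * W x) ->
    forall x, `|K s f x - K t f x| <= M * c * `|s - t| * W x }.

Section tempering_path.
Context {R : realType}.
Variables (W : R -> R) (phi0 : R).
Variables (K : R -> (R -> R) -> R -> R) (nu : (R -> R) -> R).
Variables (pi : R -> (R -> R) -> R).
Variables (C : set R) (theta rho Cpi M : R).
Hypothesis rf : regular_family W phi0 K nu pi C theta rho Cpi M.
Variables (g : R -> R) (p cg : R).
Hypotheses (p_itv : 0 < p < 2^-1) (mg : measurable_fun [set: R] g) (cg0 : 0 <= cg).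
Hypothesis gW : forall x, `|g x| <= cg * W x `^ p.

Local Notation S := (fun s => (phi0 < s <= 1) : Prop).
Local Notation Q s := (residual (K s) nu C theta).

Let phi01 := rf_phi0 rf.
Let mW := rf_meas rf.
Let W1 := rf_ge1 rf.
Let pnu := rf_nu rf.
Let theta0 := rf_theta rf.
Let rho_itv := rf_rho rf.
Let W0 x : 0 <= W x. Proof. exact: le_trans (W1 x). Qed.
Let LW : wbounded W W. Proof. exact: wbounded_self. Qed.
Let rho0 : 0 < rho. Proof. by case/andP: rho_itv. Qed.
Let rho1 : rho < 1. Proof. by case/andP: rho_itv. Qed.
Let rho1' : 0 < 1 - rho. Proof. by rewrite subr_gt0. Qed.
Let p0 : 0 < p. Proof. by case/andP: p_itv. Qed.
Let p2 : p < 2^-1. Proof. by case/andP: p_itv. Qed.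
Let p1 : p < 1. Proof. by apply: lt_trans p2 _; lra. Qed.

Lemma temperature_itv d n : (n < d)%N -> phi0 < temperature phi0 d n.+1 <= 1.
Proof.
move=> nd; have /andP[f0 f1] := phi01; rewrite /temperature.
have d0 : 0 < d%:R :> R by rewrite ltr0n (leq_ltn_trans _ nd).
have q0 : 0 < 1 - phi0 by rewrite subr_gt0.
apply/andP; split; first by rewrite ltrDl divr_gt0 ?mulr_gt0.
rewrite -lerBrDl ler_pdivrMr//.
by rewrite mulrC ler_wpM2l ?(ltW q0)// ler_nat.
Qed.

Lemma temperature_step d n : (0 < d)%N ->
  `|temperature phi0 d n.+1 - temperature phi0 d n| = (1 - phi0) / d%:R.
Proof.
move=> d0; have /andP[f0 f1] := phi01.
have -> : temperature phi0 d n.+1 - temperature phi0 d n = (1 - phi0) / d%:R.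
  by rewrite /temperature -natr1; field; rewrite pnatr_eq0 -lt0n.
by rewrite ger0_norm// divr_ge0// subr_ge0 ltW.
Qed.

Lemma near_step (h : R) : 0 < h -> exists2 D, (0 < D)%N &
  forall d, (D <= d)%N -> (1 - phi0) / d%:R <= h.
Proof.
move=> h0; exists (Num.truncn ((1 - phi0) / h)).+1 => // d Dd.
have d0 : 0 < d%:R :> R by rewrite ltr0n (leq_ltn_trans _ Dd).
rewrite ler_pdivrMr// mulrC -ler_pdivrMr//; apply: ltW.
by apply: (lt_le_trans (truncnS_gt _)); rewrite ler_nat.
Qed.

Definition op d n := K (temperature phi0 d n).

(** The marginal laws of the chain, seen as functionals. Mass and bound on [W] are asked at time 0
    only; the kernels propagate them. *)
Definition law_sequence d (mu : nat -> (R -> R) -> R) :=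
  [/\ forall n, (n <= d)%N -> positive_linear W (mu n),
      mu 0%N (cst 1) = 1, mu 0%N W <= Cpi &
      forall n f, (n < d)%N -> wbounded W f -> mu n.+1 f = mu n (op d n.+1 f)].

(** Bounds the mean of [W] at all times: the second term is the fixed point of x -> rho x + theta
    nu(W), and [Cpi] covers the initial law. *)
Definition Cmu := Cpi + theta * nu W / (1 - rho).

Let S1 : S 1. Proof. by rewrite /= lexx andbT; case/andP: phi01. Qed.

Lemma Cpi1 : 1 <= Cpi.
Proof. exact: (Cpi_ge1 mW W1 (rf_pi rf) (rf_pi1 rf) (rf_piW rf) S1). Qed.

Lemma nuW1 : 1 <= nu W.
Proof. by rewrite -(rf_nu1 rf); apply: (pl_le pnu) => //; exact: wbounded_cst. Qed.

Let nuW0 : 0 <= theta * nu W.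
Proof. by rewrite mulr_ge0 ?(ltW theta0)// (le_trans _ nuW1). Qed.

Lemma Cmu_ge1 : 1 <= Cmu.
Proof. by rewrite ler_wpDr ?Cpi1// divr_ge0// ltW. Qed.

Lemma residual_operator s : phi0 < s <= 1 -> positive_operator W (Q s).
Proof.
move=> Ss.
exact: (residual_pos W1 (rf_pos rf Ss) pnu (rf_C rf) (rf_res rf Ss)).
Qed.

Lemma kernel_W s : phi0 < s <= 1 -> forall x, K s W x <= rho * W x + theta * nu W.
Proof.
move=> Ss x; rewrite (kernel_residual (K s) nu C theta W) !fctE/= /GRing.scale/=.
apply: lerD; first exact: rf_drift rf _ _ _.
by rewrite ler_piMr// indicE; case: (x \in C).
Qed.

Lemma law_sequence_mass d mu : law_sequence d mu -> forall n, (n <= d)%N -> mu n (cst 1) = 1.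
Proof.
case=> pmu m1 m0 mK; elim=> [//|n IH] nd.
by rewrite mK//; [rewrite /op (rf_cst rf (temperature_itv nd)) IH// ltnW|exact: wbounded_cst].
Qed.

Lemma law_sequence_W d mu : law_sequence d mu -> forall n, (n <= d)%N -> mu n W <= Cmu.
Proof.
move=> lmu; have [pmu m1 m0 mK] := lmu; elim=> [|n IH] nd.
  by apply: le_trans m0 _; rewrite lerDl divr_ge0 ?(ltW rho1').
have Sn := temperature_itv nd; have pn := pmu _ (ltnW nd).
rewrite mK//; apply: (@le_trans _ _ (mu n (rho *: W + (theta * nu W) *: cst 1))).
  apply: (pl_le pn).
  - exact: po_wb (rf_pos rf Sn) _ LW.
  - by apply: wboundedD; apply: wboundedZ => //; exact: wbounded_cst.
  - by move=> x; apply: le_trans (kernel_W Sn x) _; rewrite !fctE/= /GRing.scale/= mulr1.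
have Lc : wbounded W (cst 1 : R -> R) by exact: wbounded_cst.
rewrite (plD pn) ?(plZ pn)//; try exact: wboundedZ.
rewrite (law_sequence_mass lmu (ltnW nd)) mulr1.
apply: (@le_trans _ _ (rho * Cmu + theta * nu W)).
  by rewrite lerD2r ler_wpM2l ?(ltW rho0)// IH// ltnW.
rewrite /Cmu -[X in _ * _ + X](@divfK _ (1 - rho)) ?gt_eqF//.
set t := _ / (1 - rho); have := Cpi1; have := rho0; have := rho1; nra.
Qed.

Definition wcontinuous (f : R -> R -> R) := forall e : R, 0 < e ->
  exists2 h : R, 0 < h & forall s t, phi0 < s <= 1 -> phi0 < t <= 1 ->
  `|s - t| <= h -> forall x, `|f s x - f t x| <= e * W x.

Lemma wbounded_bound (I : (R -> R) -> R) (f : R -> R) c : positive_linear W I ->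
  measurable_fun [set: R] f -> 0 <= c ->
  (forall x, `|f x| <= c * W x) -> `|I f| <= c * I W.
Proof.
move=> pI mf c0 fc; rewrite -(plZ pI)//; apply: (pl_norm pI) => //.
  exact: wbounded_le fc.
exact: wboundedZ.
Qed.

(* Along the path the law [mu n] and the function [f (phi_n)] both move slowly,
   so the increments telescope up to [o(d)]. *)
Lemma slow_telescope (f : R -> R -> R) c : 0 <= c ->
  (forall s, phi0 < s <= 1 -> measurable_fun [set: R] (f s)) ->
  (forall s, phi0 < s <= 1 -> forall x, `|f s x| <= c * W x) -> wcontinuous f ->
  forall e, 0 < e -> exists2 D, (0 < D)%N & forall d mu, (D <= d)%N -> law_sequence d mu ->
  `|\sum_(n < d) (mu n (f (temperature phi0 d n.+1)) - mu n.+1 (f (temperature phi0 d n.+1)))|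
  <= e * d%:R.
Proof.
move=> c0 mf fc cf e e0.
have C0 : 0 < Cmu by apply: lt_le_trans Cmu_ge1.
have e2 : 0 < e / 2 / Cmu by rewrite !divr_gt0.
have [h h0 hh] := cf _ e2.
have [D D0 hD] := near_step h0.
(* Besides a small temperature step, [d] must be so large that the two boundary terms, at most 2 c
   Cmu together, are below (e / 2) d. *)
exists (maxn D (Num.truncn (2 * c * Cmu / (e / 2))).+1); first by rewrite leq_max D0.
case=> [|d] mu; rewrite geq_max => /andP[Dd]; first by rewrite leqNgt D0 in Dd.
move=> cd lmu; have [pmu m1 m0 mK] := lmu.
pose t n := temperature phi0 d.+1 n.
have B n : (n < d.+1)%N -> forall m, (m <= d.+1)%N -> `|mu m (f (t n.+1))| <= c * Cmu.
  move=> nd m md; have Sn := temperature_itv nd.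
  apply: le_trans (wbounded_bound (pmu _ md) (mf _ Sn) c0 (fc _ Sn)) _.
  by rewrite ler_wpM2l// (law_sequence_W lmu).
rewrite (abel_sum (fun m n => mu m (f (t n)))).
have -> : e * d.+1%:R = e / 2 * d.+1%:R + e / 2 * d.+1%:R by field.
apply: le_trans (ler_normD _ _) _; apply: lerD.
  apply: le_trans (ler_normB _ _) _.
  apply: (@le_trans _ _ (c * Cmu + c * Cmu)); first by apply: lerD; exact: B.
  have -> : c * Cmu + c * Cmu = 2 * c * Cmu by ring.
  rewrite [leRHS]mulrC -ler_pdivrMr ?divr_gt0//; apply: ltW.
  by apply: (lt_le_trans (truncnS_gt _)); rewrite ler_nat.
apply: le_trans (ler_norm_sum _ _ _) _.
apply: (@le_trans _ _ (\sum_(n < d) (e / 2))); last first.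
  by rewrite sumr_const card_ord -[leLHS]mulr_natr ler_wpM2l ?ler_nat// divr_ge0 ?(ltW e0).
apply: ler_sum => n _; have nd : (n.+1 < d.+1)%N by rewrite ltnS.
have Sn := temperature_itv (ltnW nd); have Sn' := temperature_itv nd.
have pn := pmu n.+1 (ltnW nd).
have L s : phi0 < s <= 1 -> wbounded W (f s) by move=> Ss; apply: wbounded_le (fc _ Ss); exact: mf.
rewrite -(plB pn)//; try exact: L.
apply: (@le_trans _ _ (e / 2 / Cmu * mu n.+1 W)).
  apply: (wbounded_bound pn) => //; last 1 first.
  - by move=> x; apply: hh => //; rewrite temperature_step// hD.
  - by apply: measurable_funB; exact: mf.
  - exact: ltW.
apply: (@le_trans _ _ (e / 2 / Cmu * Cmu)); last by rewrite divfK ?gt_eqF.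
by rewrite ler_wpM2l ?(ltW e2)// (law_sequence_W lmu) // ltnW.
Qed.


Let powW q : measurable_fun [set: R] (fun y => W y `^ q).
Proof. exact: (measurableT_comp (measurable_powR q) mW). Qed.

Let Wp1 q x : 0 <= q -> q <= 1 -> 1 <= W x `^ q <= W x.
Proof. by move=> q0 q1; rewrite powR_ge1// powR_le_self. Qed.

Lemma wbounded_powR (f : R -> R) c q : 0 <= q -> q <= 1 -> 0 <= c ->
  measurable_fun [set: R] f -> (forall x, `|f x| <= c * W x `^ q) -> wbounded W f.
Proof.
move=> q0 q1 c0 mf fc; apply: (wbounded_le (c := c)) => // x.
by apply: le_trans (fc x) _; rewrite ler_wpM2l//; case/andP: (Wp1 x q0 q1).
Qed.

(** This is where p < 1/2 matters: as p < 1 - p, interpolation makes u_s - u_t small in W^(1 - p),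
    while u_s + u_t is at most 2 c W^p, and the product is small in [W]. The Lipschitz bound alone
    would leave W^(1 + p). *)
Lemma wcontinuous_sqr (u : R -> R -> R) c L : 0 <= c -> 0 <= L ->
  (forall s, phi0 < s <= 1 -> forall x, `|u s x| <= c * W x `^ p) ->
  (forall s t, phi0 < s <= 1 -> phi0 < t <= 1 -> forall x,
     `|u s x - u t x| <= L * `|s - t| * W x) ->
  wcontinuous (fun s x => u s x ^+ 2).
Proof.
move=> c0 L0 uc uL e e0.
have c1 : 0 < 2 * c + 1 by rewrite ltr_wpDl ?mulr_ge0.
have L1 : 0 < L + 1 by rewrite ltr_wpDl.
have pq : p < 1 - p by have := p2; lra.
have q0 : 0 <= 1 - p by rewrite subr_ge0 ltW.
have [h h0 hh] := powR_interpolate pq q0 (mulr_ge0 (ler0n _ 2) c0) (divr_gt0 e0 c1).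
exists (h / (L + 1)) => [|s t Ss St st x]; first exact: divr_gt0.
have us := uc _ Ss x; have ut := uc _ St x.
have a1 : `|u s x + u t x| <= 2 * c * W x `^ p.
  by apply: le_trans (ler_normD _ _) _; lra.
have a2 : `|u s x - u t x| <= 2 * c * W x `^ p.
  by apply: le_trans (ler_normB _ _) _; lra.
have a3 : `|u s x - u t x| <= e / (2 * c + 1) * W x `^ (1 - p).
  apply: hh => //; apply: le_trans (uL _ _ Ss St x) _; rewrite ler_wpM2r//.
  apply: (@le_trans _ _ ((L + 1) * `|s - t|)); first by rewrite ler_wpM2r// lerDl.
  by rewrite mulrC -ler_pdivlMr.
rewrite subr_sqr normrM; apply: le_trans (ler_pM _ _ a3 a1) _ => //.
have -> : e / (2 * c + 1) * W x `^ (1 - p) * (2 * c * W x `^ p) =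
    e * (2 * c / (2 * c + 1)) * (W x `^ (1 - p) * W x `^ p) by ring.
rewrite -powRD ?subrK ?powRr1 ?(gt_eqF (lt_le_trans ltr01 (W1 x))) ?implybT//.
rewrite ler_wpM2r// ler_piMr ?(ltW e0)// ler_pdivrMr// mul1r lerDl//.
Qed.

Lemma wbounded_g : wbounded W g.
Proof. exact: (wbounded_powR (ltW p0) (ltW p1) cg0). Qed.

(* The solution of the Poisson equation normalized by [nu (hs s) = 0]. *)
Definition hs s := poisson (K s) nu (pi s) C theta g.

Definition centered s := g - cst (pi s g).

Let c1 := cg * (1 + Cpi).
Let c1_ge0 : 0 <= c1.
Proof. by rewrite mulr_ge0// addr_ge0// (le_trans _ Cpi1). Qed.

Lemma centered_le s : phi0 < s <= 1 -> forall x, `|centered s x| <= c1 * W x `^ p.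
Proof.
move=> Ss; apply: (center_le mW W1 (rf_pi rf Ss) (rf_pi1 rf Ss) (rf_piW rf Ss)) => //.
- exact: wbounded_g.
- by move=> x; apply: Wp1; rewrite ltW.
Qed.

Let rhop : 0 < rho `^ p < 1.
Proof.
rewrite powR_gt0//=; have := @gt0_ltr_powR _ p p0 rho 1.
by rewrite powR1; apply => //; rewrite nnegrE ltW.
Qed.

Let ch := c1 / (1 - rho `^ p).
Let ch_ge0 : 0 <= ch.
Proof. by rewrite divr_ge0// subr_ge0 ltW//; case/andP: rhop. Qed.

Lemma hs_wb s : phi0 < s <= 1 -> wbounded W (hs s).
Proof.
move=> Ss; apply: (poisson_wb _ mW W1 (rf_pos rf Ss) pnu (rf_C rf) rho_itv
  (rf_res rf Ss) (rf_drift rf Ss)); exact: wbounded_g.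
Qed.

Lemma hs_le s : phi0 < s <= 1 -> forall x, `|hs s x| <= ch * W x `^ p.
Proof.
move=> Ss; apply: (poisson_le mW W1 (rf_pos rf Ss) pnu (rf_pi rf Ss) (rf_pi1 rf Ss)
  (rf_piW rf Ss) (rf_C rf) rho_itv (rf_res rf Ss) (rf_drift rf Ss)) => //.
- exact: wbounded_g.
- by move=> x; apply: Wp1; rewrite ltW.
- apply: (residual_powR mW W1 (rf_pos rf Ss) (rf_cst rf Ss) pnu (rf_nu1 rf) (rf_C rf)
    theta0 rho_itv (rf_res rf Ss) (rf_drift rf Ss)).
  by rewrite p0 ltW.
- by case/andP: rhop => /ltW -> ->.
Qed.

Lemma hs_eq s : phi0 < s <= 1 -> K s (hs s) = hs s - centered s.
Proof.
move=> Ss; apply: (poisson_eq mW W1 (rf_pos rf Ss) pnu (rf_pi rf Ss) (rf_pi1 rf Ss)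
  (rf_inv rf Ss) (rf_C rf) theta0 rho_itv (rf_res rf Ss) (rf_drift rf Ss)).
exact: wbounded_g.
Qed.

Let cK := ch + c1.

Lemma Khs_le s : phi0 < s <= 1 -> forall x, `|K s (hs s) x| <= cK * W x `^ p.
Proof.
move=> Ss x; rewrite hs_eq// fctE/= mulrDl; apply: le_trans (ler_normB _ _) _.
by apply: lerD; [exact: hs_le|exact: centered_le].
Qed.

Let gW1 x : `|g x| <= cg * W x.
Proof.
by apply: le_trans (gW x) _; rewrite ler_wpM2l//; have /andP[] := Wp1 x (ltW p0) (ltW p1).
Qed.

Lemma pig_lipschitz : exists2 L, 0 <= L & forall s t, phi0 < s <= 1 -> phi0 < t <= 1 ->
  `|pi s g - pi t g| <= L * `|s - t|.
Proof.
eexists; last first.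
  move=> s t Ss St; apply: (pi_lipschitz (S := S) mW W1 (rf_pos rf) pnu (rf_pi rf) (rf_pi1 rf)
    (rf_inv rf) (rf_piW rf) (rf_C rf) theta0 rho_itv (rf_res rf) (rf_drift rf)
    (rf_M rf) (rf_lip rf) Ss St wbounded_g cg0 gW1).
by rewrite mulr_ge0 ?(le_trans _ Cpi1)// mulr_ge0 ?(rf_M rf)// divr_ge0// ltW.
Qed.

Lemma hs_lipschitz : exists2 L, 0 <= L & forall s t, phi0 < s <= 1 -> phi0 < t <= 1 ->
  forall x, `|hs s x - hs t x| <= L * `|s - t| * W x.
Proof.
set q := M * (cg * (1 + Cpi) / (1 - rho)).
have q0 : 0 <= q by rewrite mulr_ge0 ?(rf_M rf)// divr_ge0// ltW.
exists (q / (1 - rho) + q * Cpi / (1 - rho)).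
  by rewrite addr_ge0// divr_ge0 ?(ltW rho1')// mulr_ge0// (le_trans _ Cpi1).
move=> s t Ss St x.
have gg y : `|g y - g y| <= 0 * W y by rewrite subrr normr0 mul0r.
have := poisson_lipschitz (S := S) mW W1 (rf_pos rf) pnu (rf_pi rf) (rf_pi1 rf)
    (rf_inv rf) (rf_piW rf) (rf_C rf) theta0 rho_itv (rf_res rf) (rf_drift rf)
    (rf_M rf) (rf_lip rf) Ss St wbounded_g wbounded_g cg0 (lexx 0) gW1 gg x.
by move=> /le_trans; apply; rewrite -/q le_eqVlt; apply/orP; left; apply/eqP; ring.
Qed.

Lemma Khs_lipschitz : exists2 L, 0 <= L & forall s t, phi0 < s <= 1 -> phi0 < t <= 1 ->
  forall x, `|K s (hs s) x - K t (hs t) x| <= L * `|s - t| * W x.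
Proof.
have [L1 L10 h1] := hs_lipschitz; have [L2 L20 h2] := pig_lipschitz.
exists (L1 + L2) => [|s t Ss St x]; first exact: addr_ge0.
rewrite !hs_eq// !fctE/=.
have -> : hs s x - (g x - pi s g) - (hs t x - (g x - pi t g)) =
  (hs s x - hs t x) + (pi s g - pi t g) by ring.
apply: le_trans (ler_normD _ _) _; rewrite mulrDl mulrDl; apply: lerD; first exact: h1.
apply: le_trans (h2 _ _ Ss St) _.
by rewrite ler_peMr// mulr_ge0.
Qed.

(** By invariance its mean under [pi s] is that of K_s(h^2) - (K_s h)^2, the conditional variance of
    a martingale increment. *)
Definition ws s x := hs s x ^+ 2 - K s (hs s) x ^+ 2.

Let sqr_le (u c x : R) : 0 <= c -> `|u| <= c * W x `^ p -> `|u ^+ 2| <= c ^+ 2 * W x.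
Proof.
move=> c0 uc; rewrite normrX; apply: (@le_trans _ _ ((c * W x `^ p) ^+ 2)).
  by rewrite lerXn2r ?nnegrE ?mulr_ge0 ?powR_ge0.
rewrite exprMn ler_wpM2l ?sqr_ge0// -powR_mulrn ?powR_ge0// -powRrM.
by rewrite powR_le_self//; have := p2; lra.
Qed.

Lemma hs2_le s : phi0 < s <= 1 -> forall x, `|hs s x ^+ 2| <= ch ^+ 2 * W x.
Proof. by move=> Ss x; apply: sqr_le => //; exact: hs_le. Qed.

Let cK0 : 0 <= cK. Proof. exact: addr_ge0. Qed.

Lemma Khs2_le s : phi0 < s <= 1 -> forall x, `|K s (hs s) x ^+ 2| <= cK ^+ 2 * W x.
Proof. by move=> Ss x; apply: sqr_le => //; exact: Khs_le. Qed.

Lemma measurable_hs s : phi0 < s <= 1 -> measurable_fun [set: R] (hs s).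
Proof. by move=> Ss; exact: wbounded_meas (hs_wb Ss). Qed.

Lemma measurable_Khs s : phi0 < s <= 1 -> measurable_fun [set: R] (K s (hs s)).
Proof. by move=> Ss; exact: wbounded_meas (po_wb (rf_pos rf Ss) (hs_wb Ss)). Qed.

Lemma hs2_wb s : phi0 < s <= 1 -> wbounded W (fun x => hs s x ^+ 2).
Proof.
move=> Ss; apply: wbounded_le (hs2_le Ss).
exact: (measurable_funX 2 (measurable_hs Ss)).
Qed.

Lemma Khs2_wb s : phi0 < s <= 1 -> wbounded W (fun x => K s (hs s) x ^+ 2).
Proof.
move=> Ss; apply: wbounded_le (Khs2_le Ss).
exact: (measurable_funX 2 (measurable_Khs Ss)).
Qed.

Let cw := ch ^+ 2 + cK ^+ 2.
Let cw0 : 0 <= cw. Proof. by rewrite addr_ge0 ?sqr_ge0. Qed.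

Lemma ws_le s : phi0 < s <= 1 -> forall x, `|ws s x| <= cw * W x.
Proof.
move=> Ss x; apply: le_trans (ler_normB _ _) _; rewrite mulrDl.
by apply: lerD; [exact: hs2_le|exact: Khs2_le].
Qed.

Lemma ws_wb s : phi0 < s <= 1 -> wbounded W (ws s).
Proof.
move=> Ss.
by have := wboundedB (hs2_wb Ss) (Khs2_wb Ss).
Qed.

Lemma hs2_wcontinuous : wcontinuous (fun s x => hs s x ^+ 2).
Proof.
have [L L0 hL] := hs_lipschitz.
by apply: (wcontinuous_sqr ch_ge0 L0) => //; exact: hs_le.
Qed.

Lemma ws_wcontinuous : wcontinuous ws.
Proof.
move=> e e0; have e2 : 0 < e / 2 by rewrite divr_gt0.
have [h1 h10 hh1] := hs2_wcontinuous e2.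
have [L L0 hL] := Khs_lipschitz.
have [h2 h20 hh2] := wcontinuous_sqr (u := fun s => K s (hs s)) cK0 L0 Khs_le hL e2.
exists (Num.min h1 h2) => [|s t Ss St]; first by rewrite lt_min h10.
rewrite le_min => /andP[st1 st2] x.
have -> : ws s x - ws t x = (hs s x ^+ 2 - hs t x ^+ 2) -
   (K s (hs s) x ^+ 2 - K t (hs t) x ^+ 2) by rewrite /ws; ring.
apply: le_trans (ler_normB _ _) _; rewrite [e]splitr mulrDl.
by apply: lerD; [exact: hh1|exact: hh2].
Qed.

(** The Poisson solution of the variance function itself, used to compare its means under the law of
    the chain and under [pi s]. *)
Let Hs s := poisson (K s) nu (pi s) C theta (ws s).
Let cH := cw * (1 + Cpi) / (1 - rho).

Let Cpi0 : 0 <= 1 + Cpi. Proof. by rewrite addr_ge0// (le_trans _ Cpi1). Qed.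
Let cH0 : 0 <= cH. Proof. by rewrite divr_ge0 ?(ltW rho1')// mulr_ge0. Qed.

Let Hs_wb s : phi0 < s <= 1 -> wbounded W (Hs s).
Proof.
move=> Ss; apply: (poisson_wb _ mW W1 (rf_pos rf Ss) pnu (rf_C rf) rho_itv
  (rf_res rf Ss) (rf_drift rf Ss)); exact: ws_wb.
Qed.

Let Hs_le s : phi0 < s <= 1 -> forall x, `|Hs s x| <= cH * W x.
Proof.
move=> Ss; apply: (poisson_le mW W1 (rf_pos rf Ss) pnu (rf_pi rf Ss) (rf_pi1 rf Ss)
  (rf_piW rf Ss) (rf_C rf) rho_itv (rf_res rf Ss) (rf_drift rf Ss)) => //.
- exact: ws_wb.
- by move=> x; rewrite W1 lexx.
- exact: (rf_drift rf).
- by rewrite ltW.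
- exact: ws_le.
Qed.

Let Hs_eq s : phi0 < s <= 1 -> K s (Hs s) = Hs s - (ws s - cst (pi s (ws s))).
Proof.
move=> Ss; apply: (poisson_eq mW W1 (rf_pos rf Ss) pnu (rf_pi rf Ss) (rf_pi1 rf Ss)
  (rf_inv rf Ss) (rf_C rf) theta0 rho_itv (rf_res rf Ss) (rf_drift rf Ss)).
exact: ws_wb.
Qed.

Let Hs_wcontinuous : wcontinuous Hs.
Proof.
move=> e e0.
set q := M * (cw * (1 + Cpi) / (1 - rho)).
have q0 : 0 <= q by rewrite mulr_ge0 ?(rf_M rf).
pose L := q / (1 - rho) + q * Cpi / (1 - rho).
have L0 : 0 <= L by rewrite addr_ge0// divr_ge0 ?(ltW rho1')// mulr_ge0// (le_trans _ Cpi1).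
pose a := (1 + Cpi) / (1 - rho).
have a0 : 0 < a by rewrite divr_gt0// (lt_le_trans ltr01)// lerDl (le_trans _ Cpi1).
have e2 : 0 < e / 2 / a by apply: divr_gt0 => //; exact: divr_gt0.
have [h h0 hh] := ws_wcontinuous e2.
exists (Num.min h (e / 2 / (L + 1))) => [|s t Ss St].
  by rewrite lt_min h0 !divr_gt0// ltr_wpDl.
rewrite le_min => /andP[st1 st2] x.
have := poisson_lipschitz (S := S) mW W1 (rf_pos rf) pnu (rf_pi rf) (rf_pi1 rf)
    (rf_inv rf) (rf_piW rf) (rf_C rf) theta0 rho_itv (rf_res rf) (rf_drift rf)
    (rf_M rf) (rf_lip rf) Ss St (ws_wb Ss) (ws_wb St) cw0 (ltW e2) (ws_le Ss) (hh _ _ Ss St st1) x.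
move=> /le_trans; apply; rewrite -/q ler_wpM2r//.
apply: (@le_trans _ _ (L * `|s - t| + e / 2 / a * a)).
  by rewrite /L /a le_eqVlt; apply/orP; left; apply/eqP; ring.
rewrite divfK ?gt_eqF// [leRHS]splitr lerD2r.
apply: (@le_trans _ _ ((L + 1) * `|s - t|)); first by rewrite ler_wpM2r// lerDl.
by rewrite mulrC -ler_pdivlMr// ltr_wpDl.
Qed.

(** The Poisson equation of [ws] turns mu_n(ws) - pi(ws) into an increment of mu(Hs) from time n to
    time n + 1, and moving hs^2 from one time to the other costs a second increment of the same
    kind. Both sums are bounded by [slow_telescope]. *)
Lemma variance_sum e : 0 < e -> exists2 D, (0 < D)%N &
  forall d mu, (D <= d)%N -> law_sequence d mu ->
  `|\sum_(n < d) (mu n.+1 (fun x => hs (temperature phi0 d n.+1) x ^+ 2) -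
       mu n (fun x => op d n.+1 (hs (temperature phi0 d n.+1)) x ^+ 2)) -
    \sum_(n < d) pi (temperature phi0 d n.+1) (ws (temperature phi0 d n.+1))|
  <= e * d%:R.
Proof.
move=> e0; have e2 : 0 < e / 2 by rewrite divr_gt0.
have mh s : phi0 < s <= 1 -> measurable_fun [set: R] (fun x => hs s x ^+ 2).
  by move=> Ss; exact: wbounded_meas (hs2_wb Ss).
have mH s : phi0 < s <= 1 -> measurable_fun [set: R] (Hs s).
  by move=> Ss; exact: wbounded_meas (Hs_wb Ss).
have [D1 D10 hD1] := slow_telescope (f := fun s x =>
  hs s x ^+ 2) (sqr_ge0 _) mh hs2_le hs2_wcontinuous e2.
have [D2 D20 hD2] := slow_telescope (f := Hs) cH0 mH Hs_le Hs_wcontinuous e2.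
exists (maxn D1 D2) => [|d mu]; first by rewrite leq_max D10.
rewrite geq_max => /andP[dD1 dD2] lmu; have [pmu m1 m0 mK] := lmu.
have := ler_normB (\sum_(n < d) (mu n (Hs (temperature phi0 d n.+1))
  - mu n.+1 (Hs (temperature phi0 d n.+1))))
  (\sum_(n < d) (mu n (fun x => hs (temperature phi0 d n.+1) x ^+ 2) - mu n.+1 (fun x =>
    hs (temperature phi0 d n.+1) x ^+ 2))).
rewrite -!sumrB => /le_trans E.
have -> : \sum_(n < d) (mu n.+1 (fun x => hs (temperature phi0 d n.+1) x ^+ 2) -
       mu n (fun x => op d n.+1 (hs (temperature phi0 d n.+1)) x ^+ 2) -
      pi (temperature phi0 d n.+1) (ws (temperature phi0 d n.+1))) =
    \sum_(n < d) ((mu n (Hs (temperature phi0 d n.+1)) - mu n.+1 (Hs (temperature phi0 d n.+1))) -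
   (mu n (fun x => hs (temperature phi0 d n.+1) x ^+ 2) - mu n.+1 (fun x =>
     hs (temperature phi0 d n.+1) x ^+ 2))).
  apply: eq_bigr => -[n nd] _ /=; have Sn := temperature_itv nd.
  set s := temperature phi0 d n.+1 in Sn *.
  have pn := pmu _ (ltnW nd).
  rewrite (mK _ (Hs s))//; last exact: Hs_wb.
  rewrite /op -/s Hs_eq//.
  have Lc : wbounded W (cst (pi s (ws s))) by exact: wbounded_cst.
  have Lw := ws_wb Sn; have LH := Hs_wb Sn.
  rewrite !(plB pn)//; try exact: wboundedB.
  have -> : mu n (cst (pi s (ws s))) = pi s (ws s).
    have -> : cst (pi s (ws s)) = pi s (ws s) *: cst 1 :> (R -> R).
      by apply/funext => x; rewrite /cst/= [RHS]mulr1.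
    rewrite (plZ pn) ?(law_sequence_mass lmu (ltnW nd)) ?mulr1//.
    exact: wbounded_cst.
  have -> : ws s = (fun x => hs s x ^+ 2) - (fun x => K s (hs s) x ^+ 2) by [].
  - by ring.
  - exact: hs2_wb.
  - exact: Khs2_wb.
apply: E; rewrite [e]splitr mulrDl; apply: lerD; [exact: hD2|exact: hD1].
Qed.

(** The law and the integrand move together: the first is handled by [pi_lipschitz], the second by
    continuity in the weighted norm. This is the regularity asked for by the Riemann sums. *)
Lemma piw_unif_cont e : 0 < e -> exists2 h : R, 0 < h &
  forall s t, phi0 < s <= 1 -> phi0 < t <= 1 -> `|s - t| <= h ->
  `|pi s (ws s) - pi t (ws t)| <= e.
Proof.
move=> e0; set L := M * (cw * (1 + Cpi) / (1 - rho)) * Cpi.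
have L0 : 0 <= L by rewrite mulr_ge0 ?(le_trans _ Cpi1)// mulr_ge0// (rf_M rf).
have C0 : 0 < Cpi by exact: lt_le_trans Cpi1.
have e2 : 0 < e / 2 / Cpi by rewrite !divr_gt0.
have [h h0 hh] := ws_wcontinuous e2.
exists (Num.min h (e / 2 / (L + 1))) => [|s t Ss St].
  by rewrite lt_min h0 !divr_gt0// ltr_wpDl.
rewrite le_min => /andP[st1 st2].
have -> : pi s (ws s) - pi t (ws t) = (pi s (ws s) - pi t (ws s)) + pi t (ws s - ws t).
  by rewrite (plB (rf_pi rf St) (ws_wb Ss) (ws_wb St)); ring.
apply: le_trans (ler_normD _ _) _; rewrite [e]splitr; apply: lerD.
  apply: le_trans (pi_lipschitz (S := S) mW W1 (rf_pos rf) pnu (rf_pi rf) (rf_pi1 rf)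
    (rf_inv rf) (rf_piW rf) (rf_C rf) theta0 rho_itv (rf_res rf) (rf_drift rf)
    (rf_M rf) (rf_lip rf) Ss St (ws_wb Ss) cw0 (ws_le Ss)) _.
  rewrite -/L; apply: (@le_trans _ _ ((L + 1) * `|s - t|)); first by rewrite ler_wpM2r// lerDl.
  by rewrite mulrC -ler_pdivlMr// ltr_wpDl.
have mws u : phi0 < u <= 1 -> measurable_fun [set: R] (ws u) by move=> /ws_wb/wbounded_meas.
apply: le_trans (wbounded_bound (rf_pi rf St) _ (ltW e2) (hh _ _ Ss St st1)) _.
  by apply: measurable_funB; exact: mws.
by rewrite -[leRHS](divfK (lt0r_neq0 C0)) ler_wpM2l ?(ltW e2)// (rf_piW rf).
Qed.

End tempering_path.

(** * Taylor estimates for the Lindeberg function *)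

Section quad_tail_increments.
Context {R : realType}.
Implicit Types x y a b : R.

(* The derivative of [quad_tail x = x ^ 2 - 1 + 1 / (1 + x ^ 2)]. *)
Definition quad_tail' x : R := 2 * x - 2 * x * (1 - x ^+ 2 + quad_tail x) ^+ 2.

Lemma measurable_quad_tail' : measurable_fun [set: R] quad_tail'.
Proof.
have mq := @measurable_quad_tail R.
apply: measurable_funB; first exact: measurable_funM.
apply: measurable_funM; first exact: measurable_funM.
apply: measurable_funX; apply: measurable_funD => //.
by apply: measurable_funB => //; exact: measurable_funX.
Qed.

Lemma one_sub_quad_tail x : 1 - x ^+ 2 + quad_tail x = (1 + x ^+ 2)^-1.
Proof. by rewrite /quad_tail; field; rewrite gt_eqF// onep_sqr_gt0. Qed.

Lemma quad_tail'_le x : `|quad_tail' x| <= 4 * `|x|.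
Proof.
rewrite /quad_tail' one_sub_quad_tail; set u := _^-1.
have u0 : 0 <= u by rewrite invr_ge0 ltW// onep_sqr_gt0.
have u1 : u <= 1 by rewrite invf_le1 ?onep_sqr_gt0// lerDl sqr_ge0.
have -> : 2 * x - 2 * x * u ^+ 2 = 2 * (1 - u ^+ 2) * x by ring.
have u2 : 0 <= 1 - u ^+ 2 <= 1 by apply/andP; split; nra.
rewrite normrM ler_wpM2r// ger0_norm; first by case/andP: u2 => _ ?; lra.
by case/andP: u2 => ? _; lra.
Qed.

(** The second-order remainder is exactly y^2 m, where m is at most 4 and also at most 8 (x^2 +
    y^2), reflecting a bounded second derivative that vanishes at 0. The part [b] of y^2 takes the
    first bound and the part [a] the second. *)
Lemma quad_tail_step x y a b : 0 <= a -> 0 <= b -> y ^+ 2 <= b + a ->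
  quad_tail (x + y) <= quad_tail x + quad_tail' x * y + 4 * b +
                       8 * a * (x ^+ 2 + y ^+ 2).
Proof.
move=> a0 b0 yab.
rewrite /quad_tail' one_sub_quad_tail.
set s := x + y; pose A := 1 + x ^+ 2; pose B := 1 + s ^+ 2.
have A1 : 1 <= A by rewrite lerDl sqr_ge0.
have B1 : 1 <= B by rewrite lerDl sqr_ge0.
have A0 : 0 < A by exact: lt_le_trans A1.
have B0 : 0 < B by exact: lt_le_trans B1.
pose m := (A ^+ 2 * B - A + 4 * x ^+ 2 + 2 * x * y) / (A ^+ 2 * B).
have E : quad_tail s = quad_tail x + (2 * x - 2 * x * A^-1 ^+ 2) * y + y ^+ 2 * m.
  rewrite /quad_tail -/A -/B /m.
  have -> : x ^+ 2 = A - 1 by rewrite /A; ring.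
  have yE : y = s - x by rewrite /s; ring.
  have x4 : x ^+ 4 = (A - 1) ^+ 2 by rewrite /A; ring.
  have s4 : s ^+ 4 = (B - 1) ^+ 2 by rewrite /B; ring.
  rewrite /A /B /s; field.
  by rewrite !gt_eqF ?onep_sqr_gt0.
rewrite E -!addrA lerD2l lerD2l -/A.
have AB : 0 < A ^+ 2 * B by rewrite mulr_gt0// exprn_gt0.
have yE : y = s - x by rewrite /s; ring.
have AB1 : 1 <= A * B by nra.
have AAB : A * B <= A ^+ 2 * B by nra.
have xA : x ^+ 2 <= A by rewrite /A lerDr.
have sB : s ^+ 2 <= B by rewrite /B lerDr.
have x0 := sqr_ge0 x; have s0 := sqr_ge0 s; have y0 := sqr_ge0 y.
have xs0 := sqr_ge0 (x - s); have xs1 := sqr_ge0 (x + s).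
have xAB : x ^+ 2 <= A ^+ 2 * B by nra.
have sAB : s ^+ 2 <= A ^+ 2 * B by nra.
have m4 : m <= 4.
  rewrite ler_pdivrMr// yE; nra.
have m8 : m <= 8 * (x ^+ 2 + y ^+ 2).
  rewrite ler_pdivrMr//.
  have h1 : A ^+ 2 * B - A <= (x ^+ 2 + s ^+ 2) * (A ^+ 2 * B).
    have : A * B - 1 <= (x ^+ 2 + s ^+ 2) * (A * B).
      have -> : A * B - 1 = x ^+ 2 + s ^+ 2 + x ^+ 2 * s ^+ 2 by rewrite /A /B; ring.
      have -> : A * B = 1 + x ^+ 2 + s ^+ 2 + x ^+ 2 * s ^+ 2 by rewrite /A /B; ring.
      by nra.
    by nra.
  have h2 : 4 * x ^+ 2 + 2 * x * y <= (5 * x ^+ 2 + y ^+ 2) * (A ^+ 2 * B).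
    have : 4 * x ^+ 2 + 2 * x * y <= 5 * x ^+ 2 + y ^+ 2.
      by have := sqr_ge0 (x - y); nra.
    by nra.
  have h3 : s ^+ 2 <= 2 * x ^+ 2 + 2 * y ^+ 2.
    by have := sqr_ge0 (x - y); rewrite /s; nra.
  by nra.
have [m0|m0] := leP m 0.
  apply: (@le_trans _ _ 0); first by rewrite mulr_ge0_le0.
  by rewrite addr_ge0 ?mulr_ge0// addr_ge0.
apply: (@le_trans _ _ ((b + a) * m)); first by rewrite ler_wpM2r// ltW.
rewrite mulrDl; apply: lerD; first by rewrite mulrC ler_wpM2r.
by rewrite (mulrC 8) -mulrA ler_wpM2l.
Qed.

Lemma quad_tail_homo x y : `|x| <= `|y| -> quad_tail x <= quad_tail y.
Proof.
move=> xy; have xy2 : x ^+ 2 <= y ^+ 2.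
  by rewrite -[x ^+ 2]real_normK ?num_real// -[y ^+ 2]real_normK ?num_real// lerXn2r ?nnegrE.
rewrite /quad_tail ler_pdivrMr ?onep_sqr_gt0// mulrAC ler_pdivlMr ?onep_sqr_gt0//.
have -> : x ^+ 4 = x ^+ 2 ^+ 2 by rewrite -exprM.
have -> : y ^+ 4 = y ^+ 2 ^+ 2 by rewrite -exprM.
have := sqr_ge0 x; have := sqr_ge0 y; move: xy2; move: (x ^+ 2) (y ^+ 2) => u v uv v0 u0.
have : 0 <= (v - u) * (u + v + u * v) by rewrite mulr_ge0 ?subr_ge0// !addr_ge0// mulr_ge0.
by nra.
Qed.

(** If |y| <= |x|, compare with [quad_tail (2 * x)], at most 16 times [quad_tail x]; otherwise
    compare with (2 y)^2. *)
Lemma quad_tailD x y : quad_tail (x + y) <= 16 * quad_tail x + 4 * y ^+ 2.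
Proof.
have [yx|xy] := leP `|y| `|x|.
  apply: (@le_trans _ _ (quad_tail (2 * x))).
    apply: quad_tail_homo; apply: le_trans (ler_normD _ _) _.
    by rewrite normrM (ger0_norm (ler0n _ 2)) mulr_natl mulr2n lerD2l.
  rewrite ler_wpDr ?(mulr_ge0 (ler0n _ 4) (sqr_ge0 _))//.
  rewrite /quad_tail mulrA ler_pdivrMr ?onep_sqr_gt0// mulrAC ler_pdivlMr ?onep_sqr_gt0//.
  have -> : (2 * x) ^+ 4 = 16 * x ^+ 4 by ring.
  apply: ler_wpM2l; first by rewrite mulr_ge0// exprn_even_ge0.
  rewrite lerD2l exprMn.
  by rewrite ler_peMl ?sqr_ge0//; lra.
apply: le_trans (quad_tail_le _) _; rewrite ler_wpDl ?(mulr_ge0 (ler0n _ 16) (quad_tail_ge0 _))//.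
have -> : 4 * y ^+ 2 = (2 * `|y|) ^+ 2 by rewrite exprMn real_normK ?num_real//; ring.
rewrite -[leLHS]real_normK ?num_real// lerXn2r ?nnegrE ?mulr_ge0//.
by apply: le_trans (ler_normD _ _) _; rewrite mulr_natl mulr2n lerD2r ltW.
Qed.

End quad_tail_increments.

(** * Martingale approximation along the inhomogeneous chain *)

Section path_chain.
Context {R : realType}.
Variables (W : R -> R) (phi0 : R).
Variables (K : R -> (R -> R) -> R -> R) (nu : (R -> R) -> R).
Variables (pi : R -> (R -> R) -> R).
Variables (C : set R) (theta rho Cpi M : R).
Hypothesis rf : regular_family W phi0 K nu pi C theta rho Cpi M.

(* [G n] generates the past of the chain up to time [n]. *)
Record path_chain (d : nat) (disp : measure_display) (Om : measurableType disp)
    (P : probability Om R) (Y : nat -> Om -> R) (G : nat -> set (set Om)) : Prop :=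
  PathChain {
  pc_meas : forall n, (n <= d)%N -> measurable_fun [set: Om] (Y n);
  pc_law : law_sequence W phi0 K Cpi d (fun n f => mean P (fun w => f (Y n w)));
  pc_integ : forall n f, (n <= d)%N -> wbounded W f -> integ P (fun w => f (Y n w));
  pc_past : forall n m, (m <= n <= d)%N -> adapted (G n) (Y m);
  pc_mean : forall n A f, (n < d)%N -> adapted (G n) A -> sqinteg P A ->
    wbounded W f -> wbounded W (fun x => f x ^+ 2) ->
    mean P (fun w => A w * f (Y n.+1 w)) = mean P (fun w => A w * op phi0 K d n.+1 f (Y n w)) }.

Let mW := rf_meas rf.
Let W1 := rf_ge1 rf.
Let phi01 := rf_phi0 rf.
Let W0 x : 0 <= W x. Proof. exact: le_trans (W1 x). Qed.
Let LW : wbounded W W. Proof. exact: wbounded_self. Qed.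
Local Notation Cm := (Cmu W nu theta rho Cpi).
Local Notation time d n := (temperature phi0 d n).

(** This weight is contracted by the residual kernel at rate [krho] and is square integrable along
    the chain, so it can be multiplied by a square integrable functional of the past. *)
Definition sqrtW x := W x `^ 2^-1.

Lemma sqrtW_sqr x : sqrtW x ^+ 2 = W x.
Proof. by rewrite -powR_mulrn ?powR_ge0// -powRrM mulVf ?powRr1. Qed.

Lemma sqrtW_ge1 x : 1 <= sqrtW x.
Proof. by rewrite powR_ge1. Qed.

Let sqrtW_le x : sqrtW x <= W x.
Proof. by rewrite powR_le_self//; lra. Qed.

Let Lsq : wbounded W sqrtW.
Proof.
apply: (wbounded_mono LW) => [|x].
  exact: (measurableT_comp (measurable_powR 2^-1) mW).
by rewrite !ger0_norm// (le_trans ler01)// sqrtW_ge1.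
Qed.

Definition krho := rho `^ 2^-1.

Lemma krho_itv : 0 <= krho < 1.
Proof.
have /andP[r0 r1] := rf_rho rf; rewrite powR_ge0/=.
have := @gt0_ltr_powR _ 2^-1 (ltac:(by []) : 0 < 2^-1 :> R) rho 1.
by rewrite powR1; apply => //; rewrite nnegrE ltW.
Qed.

Let residual_sqrtW s : phi0 < s <= 1 ->
  forall x, residual (K s) nu C theta sqrtW x <= krho * sqrtW x.
Proof.
move=> Ss; apply: (residual_powR mW W1 (rf_pos rf Ss) (rf_cst rf Ss) (rf_nu rf)
  (rf_nu1 rf) (rf_C rf) (rf_theta rf) (rf_rho rf) (rf_res rf Ss) (rf_drift rf Ss)).
by apply/andP; split; lra.
Qed.

Section chain.
Variables (d : nat) (disp : measure_display) (Om : measurableType disp).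
Variables (P : probability Om R) (Y : nat -> Om -> R) (G : nat -> set (set Om)).
Hypothesis pc : path_chain d P Y G.

Let EW n : (n <= d)%N -> mean P (fun w => W (Y n w)) <= Cm.
Proof. exact: (law_sequence_W rf (pc_law pc)). Qed.

Lemma chain_sqinteg n (f : R -> R) : (n <= d)%N -> measurable_fun [set: R] f ->
  wbounded W (fun x => f x ^+ 2) -> sqinteg P (fun w => f (Y n w)).
Proof.
move=> nd mf f2; split; last exact: (pc_integ pc nd f2).
exact: measurableT_comp mf (pc_meas pc nd).
Qed.

Lemma chain_mean_le n (f : R -> R) c : (n <= d)%N -> wbounded W f -> 0 <= c ->
  (forall x, f x <= c * W x) -> mean P (fun w => f (Y n w)) <= c * Cm.
Proof.
move=> nd Lf c0 fc; apply: (@le_trans _ _ (mean P (fun w => c * W (Y n w)))).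
  apply: mean_le; first exact: (pc_integ pc nd Lf).
    by apply: integZ; exact: (pc_integ pc nd LW).
  by move=> w; exact: fc.
by rewrite meanZ ?ler_wpM2l ?EW//; exact: (pc_integ pc nd LW).
Qed.

Section additive_functional.
Variables (f : nat -> R -> R) (a eta : R).
Hypotheses (a0 : 0 <= a) (eta0 : 0 <= eta).
Hypothesis mf : forall n, (n < d)%N -> measurable_fun [set: R] (f n.+1).
Hypothesis f0 : forall n x, (n < d)%N -> 0 <= f n.+1 x.
Hypothesis fa : forall n x, (n < d)%N -> f n.+1 x <= a * W x.
Hypothesis feta : forall n x, (n < d)%N -> f n.+1 x <= eta * sqrtW x.

Let A m w := \sum_(n < m) f n.+1 (Y n.+1 w).

Let f2W n x : (n < d)%N -> f n.+1 x ^+ 2 <= eta ^+ 2 * W x.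
Proof.
move=> nd; rewrite -sqrtW_sqr -exprMn lerXn2r ?nnegrE ?f0 ?feta//.
by rewrite mulr_ge0// powR_ge0.
Qed.

Let Lf n : (n < d)%N -> wbounded W (f n.+1).
Proof.
move=> nd; apply: (wbounded_le (mf nd) (c := a)) => x.
by rewrite ger0_norm ?f0 ?fa.
Qed.

Let Lf2 n : (n < d)%N -> wbounded W (fun x => f n.+1 x ^+ 2).
Proof.
move=> nd; apply: (wbounded_le (measurable_funX 2 (mf nd)) (c := eta ^+ 2)) => x.
by rewrite ger0_norm ?sqr_ge0// f2W.
Qed.

Let sf n : (n < d)%N -> sqinteg P (fun w => f n.+1 (Y n.+1 w)).
Proof. by move=> nd; apply: chain_sqinteg => //; [exact: mf|exact: Lf2]. Qed.

Let AS m w : A m.+1 w = A m w + f m.+1 (Y m.+1 w).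
Proof. by rewrite /A big_ord_recr. Qed.

Let sA m : (m <= d)%N -> sqinteg P (A m).
Proof.
elim: m => [_|m IH md].
  by rewrite /A; under eq_fun do rewrite big_ord0; exact: sqinteg_cst.
have -> : A m.+1 = (fun w => A m w + f m.+1 (Y m.+1 w)) by apply/funext => w.
by apply: sqintegD; [exact: IH (ltnW md)|exact: sf].
Qed.

Let A0 m w : (m <= d)%N -> 0 <= A m w.
Proof. by move=> md; apply: sumr_ge0 => -[n nm] _ /=; rewrite f0// (leq_trans nm). Qed.

Let aA m : (m <= d)%N -> adapted (G m) (A m).
Proof.
move=> md; apply: adapted_sum => -[n nm] _ /=.
apply: adapted_comp; first by apply: mf; exact: leq_trans nm md.
by apply: (pc_past pc); rewrite nm md.
Qed.

Let Cm0 : 0 <= Cm. Proof. exact: le_trans (Cmu_ge1 rf). Qed.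

Let meanA m : (m <= d)%N -> mean P (A m) <= d%:R * a * Cm.
Proof.
move=> md; apply: (@le_trans _ _ (m%:R * a * Cm)); last first.
  by rewrite !ler_wpM2r// ler_nat.
elim: m md => [_|m IH md].
  by rewrite /A; under eq_fun do rewrite big_ord0; rewrite meancst !mul0r.
have -> : A m.+1 = (fun w => A m w + f m.+1 (Y m.+1 w)) by apply/funext => w.
rewrite meanD; last 2 first.
- exact: sqinteg_integ (sA (ltnW md)).
- exact: (pc_integ pc md (Lf md)).
rewrite -natr1 !mulrDl mul1r; apply: lerD; first exact: IH (ltnW md).
by apply: chain_mean_le => //; [exact: Lf|move=> x; exact: fa].
Qed.

Let nuW0 : 0 <= theta * nu W.
Proof. by rewrite mulr_ge0 ?(ltW (rf_theta rf))// (le_trans _ (nuW1 rf)). Qed.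

Let kop_sqrtW s : phi0 < s <= 1 -> forall x, K s sqrtW x <= krho * sqrtW x + theta * nu W.
Proof.
move=> Ss x; have /andP[k0 k1] := krho_itv.
rewrite (kernel_residual (K s) nu C theta sqrtW) !fctE/= /GRing.scale/=.
apply: lerD; first exact: residual_sqrtW.
have nus : 0 <= nu sqrtW <= nu W.
  rewrite (pl_ge0 (rf_nu rf))//; last by move=> y; exact: powR_ge0.
  by apply: (pl_le (rf_nu rf)).
have t0 := rf_theta rf; case/andP: nus => n0 n1.
apply: (@le_trans _ _ (theta * nu sqrtW)); last by rewrite ler_wpM2l// ltW.
by rewrite ler_piMr ?mulr_ge0 ?(ltW t0)// indicE; case: (x \in C).
Qed.

Let ssq n : (n <= d)%N -> sqinteg P (fun w => sqrtW (Y n w)).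
Proof.
move=> nd; apply: chain_sqinteg => //; first exact: wbounded_meas Lsq.
by rewrite (_ : (fun x => _) = W)//; apply/funext => x; exact: sqrtW_sqr.
Qed.

(** The fixed point of E = krho E + theta nu(W) (d a Cm) + eta Cm, the recursion that bounds the
    mean of A_m sqrtW(Y_m). *)
Let E := (theta * nu W * (d%:R * a * Cm) + eta * Cm) / (1 - krho).

Let E0 : 0 <= E.
Proof.
have /andP[k0 k1] := krho_itv.
rewrite divr_ge0 ?subr_ge0 ?(ltW k1)//; apply: addr_ge0; apply: mulr_ge0 => //.
by rewrite mulr_ge0// mulr_ge0.
Qed.

Let AW_step m : (m < d)%N -> mean P (fun w => A m w * sqrtW (Y m w)) <= E ->
  mean P (fun w => A m w * sqrtW (Y m.+1 w)) <= krho * E + theta * nu W * (d%:R * a * Cm).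
Proof.
move=> md IH; have Sn := temperature_itv rf md.
have sAm := sA (ltnW md).
rewrite (pc_mean pc md (aA (ltnW md)) sAm Lsq); last first.
  by rewrite (_ : (fun x => _) = W)//; apply/funext => x; exact: sqrtW_sqr.
apply: (@le_trans _ _ (mean P (fun w => krho * (A m w * sqrtW (Y m w)) + theta * nu W * A m w))).
  have iAK : integ P (fun w => A m w * (krho * sqrtW (Y m w) + theta * nu W)).
    apply: sqintegM => //; apply: sqintegD; last exact: sqinteg_cst.
    by apply: sqintegZ; exact: ssq (ltnW md).
  apply: mean_le.
  - apply: (integ_le iAK).
      apply: measurable_funM; first exact: sqinteg_meas sAm.
      apply: measurableT_comp (pc_meas pc (ltnW md)).
      exact: wbounded_meas (po_wb (rf_pos rf Sn) Lsq).
    move=> w; rewrite normrM ger0_norm ?A0 ?(ltnW md)// ler_wpM2l ?A0 ?(ltnW md)//.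
    rewrite ger0_norm; first exact: kop_sqrtW.
    by apply: (pl_ge0 (po_pl (rf_pos rf Sn) (Y m w))) => // y; exact: powR_ge0.
  - apply: integD; apply: integZ; first by apply: sqintegM => //; exact: ssq (ltnW md).
    exact: sqinteg_integ.
  - move=> w; have := kop_sqrtW Sn (Y m w); have := A0 w (ltnW md).
    rewrite /op; nra.
rewrite meanD; last 2 first.
- by apply: integZ; apply: sqintegM => //; exact: ssq (ltnW md).
- by apply: integZ; exact: sqinteg_integ.
rewrite !meanZ; last 2 first.
- exact: sqinteg_integ.
- by apply: sqintegM => //; exact: ssq (ltnW md).
apply: lerD; first by rewrite ler_wpM2l//; case/andP: krho_itv.
by rewrite ler_wpM2l// meanA// ltnW.
Qed.

Let AW m : (m <= d)%N -> mean P (fun w => A m w * sqrtW (Y m w)) <= E.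
Proof.
elim: m => [_|m IH md].
  rewrite /A; under eq_fun do rewrite big_ord0 mul0r.
  by rewrite meancst E0.
have -> : (fun w => A m.+1 w * sqrtW (Y m.+1 w)) =
   (fun w => A m w * sqrtW (Y m.+1 w) + f m.+1 (Y m.+1 w) * sqrtW (Y m.+1 w)).
  by apply/funext => w; rewrite AS mulrDl.
rewrite meanD; last 2 first.
- by apply: sqintegM; [exact: sA (ltnW md)|exact: ssq].
- by apply: sqintegM; [exact: sf|exact: ssq].
have /andP[k0 k1] := krho_itv.
apply: (@le_trans _ _ (krho * E + theta * nu W * (d%:R * a * Cm) + eta * Cm)).
  apply: lerD; first exact: AW_step (IH (ltnW md)).
  apply: (chain_mean_le (f := fun x => f m.+1 x * sqrtW x)) => //.
    apply: (wbounded_le (c := eta)).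
      by apply: measurable_funM; [exact: mf|exact: wbounded_meas Lsq].
    move=> x; rewrite ger0_norm ?mulr_ge0 ?f0 ?powR_ge0//.
    by rewrite -sqrtW_sqr expr2 mulrA ler_wpM2r ?powR_ge0// feta.
  by move=> x; rewrite -sqrtW_sqr expr2 mulrA ler_wpM2r ?powR_ge0// feta.
rewrite -addrA; set b := _ + eta * Cm.
have -> : b = (1 - krho) * E by rewrite /E -/b mulrC divfK// subr_eq0 eq_sym lt_eqF.
by rewrite -mulrDl addrC subrK mul1r.
Qed.

(** The second moment grows linearly in m with a coefficient small with [eta], where squaring the
    sum crudely would give m^2. Each cross term is at most [eta] times the mean of A_m
    sqrtW(Y_{m+1}), which the drift keeps bounded as long as d a is bounded. *)
Lemma additive_sqr_le m : (m <= d)%N ->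
  sqinteg P (A m) /\
  mean P (fun w => A m w ^+ 2) <= m%:R * (2 * eta * E + eta ^+ 2 * Cm).
Proof.
move=> md; split; first exact: sA.
elim: m md => [_|m IH md].
  rewrite /A; under eq_fun do rewrite big_ord0 expr0n/=.
  by rewrite meancst mul0r.
have -> : (fun w => A m.+1 w ^+ 2) = (fun w => A m w ^+ 2 +
    (2 * (A m w * f m.+1 (Y m.+1 w)) + f m.+1 (Y m.+1 w) ^+ 2)).
  by apply/funext => w; rewrite AS; ring.
have sAm := sA (ltnW md); have sfm := sf md.
have i1 : integ P (fun w => A m w * f m.+1 (Y m.+1 w)) by exact: sqintegM.
have i2 : integ P (fun w => f m.+1 (Y m.+1 w) ^+ 2) by case: sfm.
have i3 : integ P (fun w => A m w ^+ 2) by case: sAm.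
rewrite meanD//; last by apply: integD => //; exact: integZ.
rewrite meanD//; last exact: integZ.
rewrite meanZ// -[m.+1%:R]natr1 [leRHS]mulrDl mul1r; apply: lerD; first exact: IH (ltnW md).
apply: lerD; last first.
  apply: (chain_mean_le (f := fun x => f m.+1 x ^+ 2)) => //; first exact: Lf2.
    exact: sqr_ge0.
  by move=> x; exact: f2W.
rewrite -mulrA ler_wpM2l//.
have i4 : integ P (fun w => A m w * sqrtW (Y m.+1 w)).
  by apply: sqintegM => //; exact: ssq.
apply: (@le_trans _ _ (mean P (fun w => eta * (A m w * sqrtW (Y m.+1 w))))).
  apply: mean_le => //; first exact: integZ.
  move=> w; rewrite mulrCA ler_wpM2l ?A0 ?feta// ltnW//.
rewrite meanZ// ler_wpM2l//.
apply: le_trans (AW_step md (AW (ltnW md))) _.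
have /andP[k0 k1] := krho_itv.
apply: (@le_trans _ _ (krho * E + (1 - krho) * E)); last first.
  by rewrite -mulrDl addrC subrK mul1r.
rewrite lerD2l /E [leRHS]mulrC divfK ?subr_eq0 1?eq_sym ?lt_eqF//.
by rewrite lerDl mulr_ge0.
Qed.

End additive_functional.

Section martingale.
Variables (h : R -> R -> R) (c : R).
Hypothesis c0 : 0 <= c.
Hypothesis mh : forall s, phi0 < s <= 1 -> measurable_fun [set: R] (h s).
Hypothesis hc : forall s, phi0 < s <= 1 -> forall x, h s x ^+ 2 <= c * W x.
Hypothesis Khc : forall s, phi0 < s <= 1 -> forall x, K s (h s) x ^+ 2 <= c * W x.

Definition mdiff n w := h (time d n.+1) (Y n.+1 w) - op phi0 K d n.+1 (h (time d n.+1)) (Y n w).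

Definition msum m w := \sum_(n < m) mdiff n w.

Let Lh2 s : phi0 < s <= 1 -> wbounded W (fun x => h s x ^+ 2).
Proof.
move=> Ss; apply: (wbounded_le (measurable_funX 2 (mh Ss)) (c := c)) => x.
by rewrite ger0_norm ?sqr_ge0// hc.
Qed.

Let sqr_wb (f : R -> R) e : measurable_fun [set: R] f -> 0 <= e ->
  (forall x, f x ^+ 2 <= e * W x) -> wbounded W f.
Proof.
move=> mf e0 fe; apply: (wbounded_le mf (c := 1 + e)) => x.
have u0 : 0 <= `|f x| by [].
have : `|f x| ^+ 2 <= e * W x by rewrite real_normK ?num_real.
have := W1 x; move: (`|f x|) u0 => u u0 w1 ue.
have : u <= 1 + u ^+ 2 by nra.
by nra.
Qed.

Let Lh s : phi0 < s <= 1 -> wbounded W (h s).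
Proof. by move=> Ss; apply: (sqr_wb (mh Ss) c0); exact: hc. Qed.

Let mKh s : phi0 < s <= 1 -> measurable_fun [set: R] (K s (h s)).
Proof. by move=> Ss; exact: wbounded_meas (po_wb (rf_pos rf Ss) (Lh Ss)). Qed.

Let LKh2 s : phi0 < s <= 1 -> wbounded W (fun x => K s (h s) x ^+ 2).
Proof.
move=> Ss; apply: (wbounded_le (measurable_funX 2 (mKh Ss)) (c := c)) => x.
by rewrite ger0_norm ?sqr_ge0// Khc.
Qed.

Let sh n m : (n < d)%N -> (m <= d)%N -> sqinteg P (fun w => h (time d n.+1) (Y m w)).
Proof.
move=> nd md; have Sn := temperature_itv rf nd.
by apply: chain_sqinteg => //; [exact: mh|exact: Lh2].
Qed.

Let sKh n m : (n < d)%N -> (m <= d)%N ->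
  sqinteg P (fun w => op phi0 K d n.+1 (h (time d n.+1)) (Y m w)).
Proof.
move=> nd md; have Sn := temperature_itv rf nd.
by apply: chain_sqinteg => //; [exact: mKh|exact: LKh2].
Qed.

Lemma sqinteg_mdiff n : (n < d)%N -> sqinteg P (mdiff n).
Proof. by move=> nd; apply: sqintegB; [exact: sh|apply: sKh => //; exact: ltnW]. Qed.

Lemma mdiff_orthogonal n A : (n < d)%N -> adapted (G n) A -> sqinteg P A ->
  mean P (fun w => A w * mdiff n w) = 0.
Proof.
move=> nd aA sA; have Sn := temperature_itv rf nd.
rewrite (_ : (fun w => A w * mdiff n w) = (fun w => A w * h (time d n.+1) (Y n.+1 w) -
    A w * op phi0 K d n.+1 (h (time d n.+1)) (Y n w))); last first.
  by apply/funext => w; rewrite mulrBr.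
rewrite meanB; last 2 first.
- by apply: sqintegM => //; exact: sh.
- by apply: sqintegM => //; apply: sKh => //; exact: ltnW.
by rewrite (pc_mean pc nd aA sA (Lh Sn) (Lh2 Sn)) subrr.
Qed.

(** The increment is orthogonal to K h(Y_n), a function of the past, so its second moment is the
    difference of those of h(Y_{n+1}) and K h(Y_n). *)
Lemma mdiff_sqr n : (n < d)%N ->
  mean P (fun w => mdiff n w ^+ 2) = mean P (fun w => h (time d n.+1) (Y n.+1 w) ^+ 2) -
    mean P (fun w => op phi0 K d n.+1 (h (time d n.+1)) (Y n w) ^+ 2).
Proof.
move=> nd; have Sn := temperature_itv rf nd.
have s1 := sh nd nd; have s2 := sKh nd (ltnW nd).
have aK : adapted (G n) (fun w => op phi0 K d n.+1 (h (time d n.+1)) (Y n w)).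
  by apply: adapted_comp; [exact: mKh|apply: (pc_past pc); rewrite leqnn ltnW].
have o := mdiff_orthogonal nd aK s2.
have -> : (fun w => mdiff n w ^+ 2) = (fun w =>
    (h (time d n.+1) (Y n.+1 w) ^+ 2 - op phi0 K d n.+1 (h (time d n.+1)) (Y n w) ^+ 2) -
    2 * (op phi0 K d n.+1 (h (time d n.+1)) (Y n w) * mdiff n w)).
  by apply/funext => w; rewrite /mdiff; ring.
have i1 := sqintegM s2 (sqinteg_mdiff nd).
have i2 : integ P (fun w => h (time d n.+1) (Y n.+1 w) ^+ 2) by case: s1.
have i3 : integ P (fun w => op phi0 K d n.+1 (h (time d n.+1)) (Y n w) ^+ 2) by case: s2.
rewrite meanB; [|exact: integB|exact: integZ].
by rewrite meanZ// o mulr0 subr0 meanB.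
Qed.

Lemma mdiff_sqr_le n : (n < d)%N -> mean P (fun w => mdiff n w ^+ 2) <= c * Cm.
Proof.
move=> nd; have Sn := temperature_itv rf nd.
rewrite mdiff_sqr// lerBlDr ler_wpDr ?mean_ge0// => [w|]; first exact: sqr_ge0.
apply: (chain_mean_le (f := fun x => h (time d n.+1) x ^+ 2)) => //; first exact: Lh2.
exact: hc.
Qed.

Let msumS m w : msum m.+1 w = msum m w + mdiff m w.
Proof. by rewrite /msum big_ord_recr. Qed.

Lemma sqinteg_msum m : (m <= d)%N -> sqinteg P (msum m).
Proof.
elim: m => [_|m IH md].
  by rewrite /msum; under eq_fun do rewrite big_ord0; exact: sqinteg_cst.
have -> : msum m.+1 = (fun w => msum m w + mdiff m w) by apply/funext => w; rewrite msumS.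
by apply: sqintegD; [exact: IH (ltnW md)|exact: sqinteg_mdiff].
Qed.

Lemma adapted_msum m : (m <= d)%N -> adapted (G m) (msum m).
Proof.
move=> md; apply: adapted_sum => -[n nm] _ /=; have nd := leq_trans nm md.
have Sn := temperature_itv rf nd.
by apply: adaptedB; apply: adapted_comp;
  [exact: mh|apply: (pc_past pc); rewrite nm md|exact: mKh|
   apply: (pc_past pc); rewrite (ltnW nm) md].
Qed.

Lemma mean_msum m : (m <= d)%N -> mean P (msum m) = 0.
Proof.
elim: m => [_|m IH md].
  by rewrite /msum; under eq_fun do rewrite big_ord0; rewrite meancst.
have -> : msum m.+1 = (fun w => msum m w + 1 * mdiff m w).
  by apply/funext => w; rewrite msumS mul1r.
rewrite meanD; first by rewrite IH ?(ltnW md)// add0r mdiff_orthogonal//;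
  [exact: adapted_cst|exact: sqinteg_cst].
- exact: sqinteg_integ (sqinteg_msum (ltnW md)).
- by apply: integZ; exact: sqinteg_integ (sqinteg_mdiff md).
Qed.

Lemma msum_sqr m : (m <= d)%N -> mean P (fun w => msum m w ^+ 2) =
  \sum_(n < m) mean P (fun w => mdiff n w ^+ 2).
Proof.
elim: m => [_|m IH md].
  rewrite /msum big_ord0; under eq_fun do rewrite big_ord0 expr0n.
  by rewrite meancst.
have -> : (fun w => msum m.+1 w ^+ 2) =
    (fun w => msum m w ^+ 2 + (2 * (msum m w * mdiff m w) + mdiff m w ^+ 2)).
  by apply/funext => w; rewrite msumS; ring.
have sM := sqinteg_msum (ltnW md); have sD := sqinteg_mdiff md.
have i1 := sqintegM sM sD.
have i2 : integ P (fun w => msum m w ^+ 2) by case: sM.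
have i3 : integ P (fun w => mdiff m w ^+ 2) by case: sD.
rewrite meanD//; last by apply: integD => //; exact: integZ.
rewrite meanD ?meanZ//; last exact: integZ.
rewrite mdiff_orthogonal//; last exact: adapted_msum (ltnW md).
by rewrite mulr0 add0r IH ?(ltnW md)// big_ord_recr.
Qed.

Lemma msum_sqr_le m : (m <= d)%N -> mean P (fun w => msum m w ^+ 2) <= m%:R * (c * Cm).
Proof.
move=> md; rewrite msum_sqr//; apply: (@le_trans _ _ (\sum_(n < m) c * Cm)).
  by apply: ler_sum => -[n nm] _; apply: mdiff_sqr_le; exact: leq_trans md.
by rewrite sumr_const card_ord mulr_natl.
Qed.

Section conditional_lindeberg.
Variables (eta a k : R).
Hypotheses (eta0 : 0 <= eta) (a0 : 0 <= a).
Hypothesis ha : forall s, phi0 < s <= 1 -> forall x, h s x ^+ 2 <= eta * W x + a.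
Hypothesis Kha : forall s, phi0 < s <= 1 -> forall x, K s (h s) x ^+ 2 <= eta * W x + a.

(** Induction with [quad_tail_step]: the first-order term is orthogonal to the increment and
    disappears, and the square of the increment splits into a small multiple of [W] and a constant.
    For k of order 1/d and m = d the last term is of order d^-2, and only second moments of the
    martingale have been used. *)
Lemma msum_quad_tail m : (m <= d)%N -> mean P (fun w => quad_tail (k * msum m w)) <=
  m%:R * (16 * k ^+ 2 * eta * Cm + 32 * a * k ^+ 4 * d%:R * (c * Cm)).
Proof.
have Cm0 : 0 <= Cm by exact: le_trans (Cmu_ge1 rf).
elim: m => [_|m IH md].
  rewrite /msum; under eq_fun do rewrite big_ord0 mulr0.
  by rewrite meancst /quad_tail expr0n !mul0r.
have Sn := temperature_itv rf md.
have sM := sqinteg_msum (ltnW md); have sD := sqinteg_mdiff md.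
have skM := sqintegZ k sM.
have skD := sqintegZ k sD.
have iq (X : Om -> R) : sqinteg P X -> integ P (fun w => quad_tail (X w)).
  move=> [mX iX]; apply: (integ_le iX).
    exact: (measurableT_comp (@measurable_quad_tail R) mX).
  by move=> w; rewrite ger0_norm ?quad_tail_ge0// quad_tail_le.
pose Q w := quad_tail' (k * msum m w).
have aQ : adapted (G m) Q.
  apply: adapted_comp; first exact: measurable_quad_tail'.
  by apply: adaptedM; [exact: adapted_cst|exact: adapted_msum (ltnW md)].
have sQ : sqinteg P Q.
  apply: (sqinteg_le (sqintegZ 4 skM)).
    by apply: (measurableT_comp (@measurable_quad_tail' R)); case: skM.
  move=> w; apply: le_trans (quad_tail'_le _) _.
  by rewrite [leRHS]normrM (ger0_norm (ler0n _ 4)).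
have iQD := sqintegM sQ sD.
have W1' : integ P (fun w => W (Y m.+1 w)) by exact: (pc_integ pc md LW).
have W2' : integ P (fun w => W (Y m w)) by exact: (pc_integ pc (ltnW md) LW).
have iW : integ P (fun w => W (Y m.+1 w) + W (Y m w)) by exact: integD.
have i2 : integ P (fun w => (k * msum m w) ^+ 2 + (k * mdiff m w) ^+ 2).
  by apply: integD; [case: skM|case: skD].
have step w : quad_tail (k * msum m.+1 w) <= quad_tail (k * msum m w) +
   (k * (Q w * mdiff m w) +
   (4 * (k ^+ 2 * (2 * eta)) * (W (Y m.+1 w) + W (Y m w)) +
   8 * (k ^+ 2 * (4 * a)) * ((k * msum m w) ^+ 2 + (k * mdiff m w) ^+ 2))).
  rewrite msumS mulrDr.
  have := @quad_tail_step R (k * msum m w) (k * mdiff m w)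
    (k ^+ 2 * (4 * a)) (k ^+ 2 * (2 * eta) * (W (Y m.+1 w) + W (Y m w))).
  move=> /(_ _ _ _)/le_trans; apply.
  - by rewrite mulr_ge0 ?sqr_ge0// mulr_ge0.
  - by rewrite mulr_ge0 ?addr_ge0// mulr_ge0 ?sqr_ge0// mulr_ge0.
  - rewrite exprMn -mulrA -mulrDr ler_wpM2l ?sqr_ge0//.
    have h1 := ha Sn (Y m.+1 w); have h2 := Kha Sn (Y m w).
    rewrite /mdiff /op.
    set u := h _ _ in h1 *; set v := K _ _ _ in h2 *.
    by have := sqr_ge0 (u + v); nra.
  - by rewrite /Q; lra.
apply: le_trans (mean_le _ _ step) _.
- by apply: iq; apply: sqintegZ; exact: sqinteg_msum.
- apply: integD; first exact: iq.
  by do 2?[apply: integD]; exact: integZ.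
rewrite meanD; [|exact: iq|by do 2?[apply: integD]; exact: integZ].
rewrite meanD; [|exact: integZ|by apply: integD; exact: integZ].
rewrite meanD; [|exact: integZ|exact: integZ].
rewrite !meanZ// mdiff_orthogonal// mulr0 add0r.
rewrite -[m.+1%:R]natr1 [leRHS]mulrDl mul1r; apply: lerD; first exact: IH (ltnW md).
apply: lerD.
  have -> : 16 * k ^+ 2 * eta * Cm = 4 * (k ^+ 2 * (2 * eta)) * (2 * Cm) by ring.
  apply: ler_wpM2l; first by rewrite mulr_ge0// mulr_ge0 ?sqr_ge0// mulr_ge0.
  by rewrite meanD// mulr_natl mulr2n lerD// EW// ltnW.
have -> : 32 * a * k ^+ 4 * d%:R * (c * Cm) = 8 * (k ^+ 2 * (4 * a))
  * (k ^+ 2 * (d%:R * (c * Cm))) by ring.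
apply: ler_wpM2l; first by rewrite mulr_ge0// mulr_ge0 ?sqr_ge0// mulr_ge0.
have -> : (fun w => (k * msum m w) ^+ 2 + (k * mdiff m w) ^+ 2) =
   (fun w => k ^+ 2 * msum m w ^+ 2 + k ^+ 2 * mdiff m w ^+ 2).
  by apply/funext => w; rewrite !exprMn.
have i3 : integ P (fun w => msum m w ^+ 2) by case: sM.
have i4 : integ P (fun w => mdiff m w ^+ 2) by case: sD.
rewrite meanD; [|exact: integZ|exact: integZ].
rewrite !meanZ// -mulrDr ler_wpM2l ?sqr_ge0//.
apply: (@le_trans _ _ (m%:R * (c * Cm) + c * Cm)).
  by apply: lerD; [exact: msum_sqr_le (ltnW md)|exact: mdiff_sqr_le].
have -> : m%:R * (c * Cm) + c * Cm = m.+1%:R * (c * Cm) by rewrite -natr1; ring.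
by rewrite ler_wpM2r ?ler_nat// mulr_ge0.
Qed.

End conditional_lindeberg.

Section remainder.
Variables (a eta : R).
Hypotheses (a0 : 0 <= a) (eta0 : 0 <= eta) (d0 : (0 < d)%N).
Hypothesis hlip : forall n x, (n.+1 < d)%N ->
  `|h (time d n.+2) x - h (time d n.+1) x| <= a * W x.
Hypothesis heta : forall n x, (n.+1 < d)%N ->
  `|h (time d n.+2) x - h (time d n.+1) x| <= eta * sqrtW x.

(** What the martingale leaves of the centered score, up to a deterministic constant. Summation by
    parts reduces it to two boundary terms and to increments of [h] in the temperature. *)
Definition remainder w := \sum_(n < d) (h (time d n.+1) (Y n w) - h (time d n.+1) (Y n.+1 w)).

Lemma sqinteg_remainder : sqinteg P remainder.
Proof.
apply: (@sqinteg_sum _ _ _ P _ _ (fun (n : 'I_d) w =>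
  h (time d n.+1) (Y n w) - h (time d n.+1) (Y n.+1 w))).
by move=> -[n nd]; apply: sqintegB; apply: sh => //; exact: ltnW.
Qed.

Lemma remainder_sqr_le : mean P (fun w => remainder w ^+ 2) <=
  3 * (2 * (c * Cm) + d%:R * (2 * eta *
    ((theta * nu W * (d%:R * a * Cm) + eta * Cm) / (1 - krho)) + eta ^+ 2 * Cm)).
Proof.
(* The guard makes [f] total; the sum that is used has [d.-1] terms, each comparing two temperatures
   of the path. *)
pose f n x := if (n < d)%N then `|h (time d n.+1) x - h (time d n) x| else 0.
have fE n x : (n.+1 < d)%N -> f n.+1 x = `|h (time d n.+2) x - h (time d n.+1) x|.
  by rewrite /f => ->.
have mf n : (n < d)%N -> measurable_fun [set: R] (f n.+1).
  move=> nd; rewrite /f; case: (ltnP n.+1 d) => nd'; last exact: measurable_cst.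
  by apply: measurableT_comp => //; apply: measurable_funB; apply: mh; exact: (temperature_itv rf).
have f0 n x : (n < d)%N -> 0 <= f n.+1 x by move=> _; rewrite /f; case: ifPn.
have fa n x : (n < d)%N -> f n.+1 x <= a * W x.
  by move=> nd; rewrite /f; case: ifPn => nd'; [exact: hlip|rewrite mulr_ge0].
have fe n x : (n < d)%N -> f n.+1 x <= eta * sqrtW x.
  by move=> nd; rewrite /f; case: ifPn => nd'; [exact: heta|rewrite mulr_ge0// powR_ge0].
have [] := additive_sqr_le a0 eta0 mf f0 fa fe (leq_pred d).
set A := fun w => _; set B := 2 * eta * _ + _ => sA hA.
have Cm0 : 0 <= Cm by exact: le_trans (Cmu_ge1 rf).
have B0 : 0 <= B.
  have /andP[k0 k1] := krho_itv.
  have nuW0 : 0 <= theta * nu W by rewrite mulr_ge0 ?(ltW (rf_theta rf))// (le_trans _ (nuW1 rf)).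
  apply: addr_ge0; last by rewrite mulr_ge0// sqr_ge0.
  apply: mulr_ge0; first by rewrite mulr_ge0.
  apply: divr_ge0; last by rewrite subr_ge0 ltW.
  by apply: addr_ge0; apply: mulr_ge0 => //; rewrite mulr_ge0// mulr_ge0.
have {}hA : mean P (fun w => A w ^+ 2) <= d%:R * B.
  by apply: le_trans hA _; rewrite ler_wpM2r// ler_nat leq_pred.
have d1 : d = d.-1.+1 by rewrite prednK.
have s0 : sqinteg P (fun w => h (time d 1) (Y 0%N w)) by exact: sh.
have sd : sqinteg P (fun w => h (time d d) (Y d w)).
  by have := @sh d.-1 d; rewrite -d1 leqnn; apply.
have bd w : remainder w ^+ 2 <= 3 * (h (time d 1) (Y 0%N w) ^+ 2 +
    (h (time d d) (Y d w) ^+ 2 + A w ^+ 2)).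
  have E : remainder w = h (time d 1) (Y 0%N w) - h (time d d) (Y d w) +
      \sum_(n < d.-1) (h (time d n.+2) (Y n.+1 w) - h (time d n.+1) (Y n.+1 w)).
    have := abel_sum (fun n m => h (time d m) (Y n w)) d.-1.
    by rewrite -d1.
  have Ab : `|\sum_(n < d.-1) (h (time d n.+2) (Y n.+1 w) - h (time d n.+1) (Y n.+1 w))| <= A w.
    apply: le_trans (ler_norm_sum _ _ _) _; apply: ler_sum => -[n nd] _ /=.
    by rewrite fE// -ltn_predRL.
  rewrite E; move: Ab; set z := \sum_(n < d.-1) _; set u := h _ _; set v := h _ _ => zA.
  have z2 : z ^+ 2 <= A w ^+ 2
    by rewrite -[z ^+ 2]real_normK ?num_real// lerXn2r ?nnegrE// (le_trans _ zA).
  have := sqr_ge0 (u + v); have := sqr_ge0 (u - z); have := sqr_ge0 (v + z); nra.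
have i0 : integ P (fun w => h (time d 1) (Y 0%N w) ^+ 2) by case: s0.
have id : integ P (fun w => h (time d d) (Y d w) ^+ 2) by case: sd.
have iA : integ P (fun w => A w ^+ 2) by case: sA.
apply: le_trans (mean_le _ _ bd) _; first by case: sqinteg_remainder.
  by apply: integZ; do 2?[apply: integD].
rewrite meanZ; last by do 2?[apply: integD].
rewrite ler_wpM2l// meanD//; last exact: integD.
rewrite meanD// addrA; apply: lerD => //.
have S1 := temperature_itv rf d0.
have Sd : phi0 < time d d <= 1.
  by have := @temperature_itv _ _ _ _ _ _ _ _ _ _ _ rf d d.-1; rewrite -d1 leqnn; apply.
rewrite [leRHS]mulr_natl mulr2n; apply: lerD.
  apply: (chain_mean_le (f := fun x => h (time d 1) x ^+ 2)) => //; first exact: Lh2.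
  exact: hc.
apply: (chain_mean_le (f := fun x => h (time d d) x ^+ 2)) => //; first exact: Lh2.
exact: hc.
Qed.

End remainder.
End martingale.
End chain.
End path_chain.

(** * Variance and Lindeberg condition of the score of one coordinate *)

Section score.
Context {R : realType}.
Variables (W : R -> R) (phi0 : R).
Variables (K : R -> (R -> R) -> R -> R) (nu : (R -> R) -> R).
Variables (pi : R -> (R -> R) -> R).
Variables (C : set R) (theta rho Cpi M : R).
Hypothesis rf : regular_family W phi0 K nu pi C theta rho Cpi M.
Variables (g : R -> R) (p cg : R).
Hypotheses (p_itv : 0 < p < 2^-1) (mg : measurable_fun [set: R] g) (cg0 : 0 <= cg).
Hypothesis gW : forall x, `|g x| <= cg * W x `^ p.

Let W1 := rf_ge1 rf.
Let phi01 := rf_phi0 rf.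
Let W0 x : 0 <= W x. Proof. exact: le_trans (W1 x). Qed.
Local Notation Cm := (Cmu W nu theta rho Cpi).
Local Notation time d n := (temperature phi0 d n).
Local Notation h := (hs K nu pi C theta g).
Local Notation h_le := (hs_le rf p_itv mg cg0 gW).
Local Notation Kh_le := (Khs_le rf p_itv mg cg0 gW).
Local Notation w_s := (ws K nu pi C theta g).

Let Cm0 : 0 <= Cm. Proof. exact: le_trans (Cmu_ge1 rf). Qed.

Let p0 : 0 < p. Proof. by case/andP: p_itv. Qed.
Let p2 : p < 2^-1. Proof. by case/andP: p_itv. Qed.
Let q0 : 0 < 1 - phi0. Proof. by rewrite subr_gt0; case/andP: phi01. Qed.

Let mh s : phi0 < s <= 1 -> measurable_fun [set: R] (h s).
Proof. by move=> Ss; exact: (measurable_hs rf p_itv mg cg0 gW). Qed.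

Let bounds : exists2 c, 0 <= c & forall s, phi0 < s <= 1 -> forall x,
  `|h s x| <= c * W x `^ p /\ `|K s (h s) x| <= c * W x `^ p.
Proof.
set a := cg * (1 + Cpi) / (1 - rho `^ p); set b := a + cg * (1 + Cpi).
exists (`|a| + `|b|) => [|s Ss x]; first exact: addr_ge0.
split; [apply: le_trans (h_le Ss x) _|apply: le_trans (Kh_le Ss x) _].
  by rewrite ler_wpM2r ?powR_ge0// (le_trans (ler_norm _))// lerDl.
by rewrite ler_wpM2r ?powR_ge0// (le_trans (ler_norm _))// lerDr.
Qed.

Let sqr_pow (u c x : R) : 0 <= c -> `|u| <= c * W x `^ p -> u ^+ 2 <= c ^+ 2 * W x `^ (2 * p).
Proof.
move=> c0 uc; rewrite -[leLHS]real_normK ?num_real//.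
have -> : c ^+ 2 * W x `^ (2 * p) = (c * W x `^ p) ^+ 2.
  by rewrite exprMn -(powR_mulrn 2 (powR_ge0 (W x) p)) -powRrM (mulrC 2).
by rewrite lerXn2r ?nnegrE ?mulr_ge0 ?powR_ge0.
Qed.

Let sqr_bounds : exists2 c, 0 <= c & forall s, phi0 < s <= 1 -> forall x,
  h s x ^+ 2 <= c * W x /\ K s (h s) x ^+ 2 <= c * W x.
Proof.
have [c c0 hc] := bounds; exists (c ^+ 2) => [|s Ss x]; first exact: sqr_ge0.
have wp : W x `^ (2 * p) <= W x by rewrite powR_le_self//; have := p2; lra.
have [h1 h2] := hc s Ss x.
by split; [apply: le_trans (sqr_pow c0 h1) _|apply: le_trans (sqr_pow c0 h2) _];
  rewrite ler_wpM2l ?sqr_ge0.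
Qed.

(** As 2p < 1, c^2 W^(2p) is at most eta W where [W] is large and is bounded elsewhere. This is the
    form required by the conditional Lindeberg estimate. *)
Let sqr_absorb (eta : R) : 0 < eta -> exists2 a, 0 <= a & forall s, phi0 < s <= 1 -> forall x,
  h s x ^+ 2 <= eta * W x + a /\ K s (h s) x ^+ 2 <= eta * W x + a.
Proof.
move=> eta0; have [c c0 hc] := bounds.
have pq : 2 * p < 1 by have := p2; lra.
have c1 : 0 < c ^+ 2 + 1 by rewrite ltr_wpDl ?sqr_ge0.
have [A A1 hA] := powR_absorb pq (divr_gt0 eta0 c1).
exists (c ^+ 2 * A) => [|s Ss x]; first by rewrite mulr_ge0 ?sqr_ge0// (le_trans _ A1).
have wp : c ^+ 2 * W x `^ (2 * p) <= eta * W x + c ^+ 2 * A.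
  have [Aw|wA] := leP A (W x).
    apply: (@le_trans _ _ (eta * W x)); last by rewrite lerDl mulr_ge0 ?sqr_ge0// (le_trans _ A1).
    apply: le_trans (ler_wpM2l (sqr_ge0 c) (hA _ Aw)) _.
    rewrite powRr1// mulrA ler_wpM2r// mulrCA ler_piMr ?(ltW eta0)//.
    by rewrite ler_pdivrMr// mul1r lerDl.
  apply: (@le_trans _ _ (c ^+ 2 * A)); last by rewrite lerDr mulr_ge0// ltW.
  rewrite ler_wpM2l ?sqr_ge0// (le_trans (powR_le_self _ (ltW pq)))// ltW//.
have [h1 h2] := hc s Ss x.
by split; apply: le_trans wp; exact: sqr_pow.
Qed.

(** Increments of [h] are at most L (1 - phi0) / d in the weight [W], so that d a does not depend on
    d, and by interpolation at most eta sqrtW; [remainder_sqr_le] is then a constant plus a term of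
    order eta d. *)
Lemma remainder_small e : 0 < e -> exists2 D, (0 < D)%N &
  forall d disp (Om : measurableType disp) (P : probability Om R) Y G, (D <= d)%N ->
  path_chain W phi0 K Cpi d P Y G ->
  mean P (fun w => remainder phi0 d Y h w ^+ 2) <= e * d%:R.
Proof.
move=> e0; have [c c0 hc] := sqr_bounds; have [cp cp0 hcp] := bounds.
have [L L0 hL] := hs_lipschitz rf p_itv mg cg0 gW.
have /andP[k0 k1] := krho_itv rf.
have nuW0 : 0 <= theta * nu W.
  by rewrite mulr_ge0 ?(ltW (rf_theta rf))// (le_trans _ (nuW1 rf)).
(* [Z] collects what multiplies eta d in [remainder_sqr_le] once eta <= 1 is used inside the bracket
   and for eta^2. *)
pose Z := 3 * (2 * ((theta * nu W * (L * (1 - phi0) * Cm) + Cm) / (1 - krho rho)) + Cm).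
have Z0 : 0 <= Z.
  apply: mulr_ge0 => //; apply: addr_ge0 => //; apply: mulr_ge0 => //.
  apply: divr_ge0; last by rewrite subr_ge0 ltW.
  apply: addr_ge0 => //; apply: mulr_ge0 => //; apply: mulr_ge0 => //.
  by rewrite mulr_ge0// ltW.
have Z1 : 0 < Z + 1 by rewrite ltr_wpDl.
pose eta := Num.min 1 (e / 2 / (Z + 1)).
have eta0 : 0 < eta by rewrite lt_min ltr01/= !divr_gt0.
have eta1 : eta <= 1 by rewrite ge_min lexx.
have etaZ : eta * Z <= e / 2.
  apply: (@le_trans _ _ (e / 2 / (Z + 1) * Z)); first by rewrite ler_wpM2r// ge_min lexx orbT.
  by rewrite mulrC mul_frac_le// divr_ge0// ltW.
have c20 : 0 <= 2 * cp by rewrite mulr_ge0.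
have [del del0 hdel] := powR_interpolate p2 (ltac:(lra) : 0 <= 2^-1 :> R) c20 eta0.
have L1 : 0 < L + 1 by rewrite ltr_wpDl.
have [D1 D10 hD1] := @near_step R phi0 _ (divr_gt0 del0 L1).
exists (maxn D1 (Num.truncn (6 * (c * Cm) / (e / 2))).+1); first by rewrite leq_max D10.
move=> d disp Om P Y G; rewrite geq_max => /andP[dD1 dD2] pc.
have d0 : (0 < d)%N by exact: leq_trans dD1.
have dR : 0 < d%:R :> R by rewrite ltr0n.
have hc1 s : phi0 < s <= 1 -> forall x, h s x ^+ 2 <= c * W x by move=> Ss x; case: (hc _ Ss x).
have hc2 s : phi0 < s <= 1 -> forall x, K s (h s) x ^+ 2 <= c * W x by move=> Ss x;
  case: (hc _ Ss x).
have Sn n : (n < d)%N -> phi0 < time d n.+1 <= 1 by move=> nd; exact: (temperature_itv rf).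
have a0 : 0 <= L * ((1 - phi0) / d%:R) by rewrite mulr_ge0// divr_ge0// ltW.
have hlip n x : (n.+1 < d)%N ->
  `|h (time d n.+2) x - h (time d n.+1) x| <= L * ((1 - phi0) / d%:R) * W x.
  move=> nd; apply: le_trans (hL _ _ (Sn _ nd) (Sn _ (ltnW nd)) x) _.
  by rewrite (temperature_step rf).
have heta n x : (n.+1 < d)%N -> `|h (time d n.+2) x - h (time d n.+1) x| <= eta * sqrtW W x.
  move=> nd; apply: hdel => //.
    apply: le_trans (ler_normB _ _) _; rewrite -mulrA mulr_natl mulr2n.
    by apply: lerD; [case: (hcp _ (Sn _ nd) x)|case: (hcp _ (Sn _ (ltnW nd)) x)].
  apply: le_trans (hlip _ x nd) _; rewrite ler_wpM2r//.
  apply: (@le_trans _ _ ((L + 1) * ((1 - phi0) / d%:R))).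
    by rewrite ler_wpM2r ?lerDl// divr_ge0// ltW.
  by rewrite mulrC -ler_pdivlMr// hD1.
have := remainder_sqr_le rf pc c0 mh hc1 a0 (ltW eta0) d0 hlip heta.
move=> /le_trans; apply.
have -> : d%:R * (L * ((1 - phi0) / d%:R)) = L * (1 - phi0).
  by field; rewrite pnatr_eq0 -lt0n.
have -> : e * d%:R = e / 2 * d%:R + e / 2 * d%:R by field.
rewrite mulrDr; apply: lerD.
  have -> : 3 * (2 * (c * Cm)) = 6 * (c * Cm) by ring.
  rewrite [leRHS]mulrC -ler_pdivrMr ?divr_gt0//; apply: ltW.
  by apply: (lt_le_trans (truncnS_gt _)); rewrite ler_nat.
rewrite [3 * (d%:R * _)]mulrCA [leRHS]mulrC ler_wpM2l// (le_trans _ etaZ)//.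
rewrite /Z [leRHS]mulrCA ler_wpM2l// [leRHS]mulrDr; apply: lerD; last first.
  by rewrite ler_wpM2r// expr2 ler_piMr// ltW.
have -> : eta * (2 * ((theta * nu W * (L * (1 - phi0) * Cm) + Cm) / (1 - krho rho))) =
  2 * eta * ((theta * nu W * (L * (1 - phi0) * Cm) + Cm) / (1 - krho rho)) by ring.
apply: ler_wpM2l; first by rewrite mulr_ge0// ltW.
rewrite ler_wpM2r ?invr_ge0 ?subr_ge0 ?(ltW k1)// lerD2l.
by rewrite ler_piMl.
Qed.

Definition score d disp (Om : measurableType disp) (Y : nat -> Om -> R) (w : Om) :=
  \sum_(n < d) g (Y n w).

Definition cscore d disp (Om : measurableType disp) (P : probability Om R)
    (Y : nat -> Om -> R) (w : Om) := score d Y w - mean P (score d Y).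

Section one_chain.
Variables (d : nat) (disp : measure_display) (Om : measurableType disp).
Variables (P : probability Om R) (Y : nat -> Om -> R) (G : nat -> set (set Om)).
Hypothesis pc : path_chain W phi0 K Cpi d P Y G.

Let rem w := remainder phi0 d Y h w.
Let S w := msum phi0 K d Y h d w.

Let srem : sqinteg P rem.
Proof. have [c c0 hc] := sqr_bounds.
by apply: (sqinteg_remainder rf pc (c := c)) => // s Ss x; case: (hc s Ss x).
Qed.

Let sS : sqinteg P S.
Proof. have [c c0 hc] := sqr_bounds.
by apply: (sqinteg_msum rf pc c0) => // s Ss x; case: (hc s Ss x).
Qed.

Let S0 : mean P S = 0.
Proof. have [c c0 hc] := sqr_bounds.
by apply: (mean_msum rf pc c0) => // s Ss x; case: (hc s Ss x).
Qed.

Let scoreE w : score d Y w = S w + rem w + \sum_(n < d) pi (time d n.+1) g.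
Proof.
rewrite /S /rem /msum /remainder -!big_split/=; apply: eq_bigr => -[n nd] _ /=.
have Sn := temperature_itv rf nd.
by rewrite /mdiff /op (hs_eq rf p_itv mg cg0 gW Sn) /centered !fctE; ring.
Qed.

Lemma sqinteg_score : sqinteg P (score d Y).
Proof.
have -> : score d Y = (fun w => S w + rem w + \sum_(n < d) pi (time d n.+1) g).
  by apply/funext => w; exact: scoreE.
by apply: sqintegD; [exact: sqintegD|exact: sqinteg_cst].
Qed.

(** The sum of the means pi(g) is deterministic and the martingale has mean 0, so only the remainder
    still has to be centered. *)
Lemma cscoreE w : cscore d P Y w = S w + (rem w - mean P rem).
Proof.
rewrite /cscore.
have -> : mean P (score d Y) = mean P rem + \sum_(n < d) pi (time d n.+1) g.
  have -> : score d Y = (fun w => S w + rem w + \sum_(n < d) pi (time d n.+1) g).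
    by apply/funext => w'; exact: scoreE.
  rewrite meanD; last exact: integ_cst.
    rewrite meanD ?S0 ?add0r ?meancst//; exact: sqinteg_integ.
  by apply: integD; exact: sqinteg_integ.
by rewrite scoreE; ring.
Qed.

Lemma sqinteg_cscore : sqinteg P (cscore d P Y).
Proof. by apply: sqintegB; [exact: sqinteg_score|exact: sqinteg_cst]. Qed.

Lemma mean_cscore : mean P (cscore d P Y) = 0.
Proof.
rewrite meanB ?meancst ?subrr//; first exact: sqinteg_integ sqinteg_score.
exact: integ_cst.
Qed.

Let cr w := rem w - mean P rem.

Let scr : sqinteg P cr. Proof. by apply: sqintegB => //; exact: sqinteg_cst. Qed.

Let cr_le : mean P (fun w => cr w ^+ 2) <= mean P (fun w => rem w ^+ 2).
Proof.
have ir := sqinteg_integ srem.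
have ir2 : integ P (fun w => rem w ^+ 2) by case: srem.
have -> : (fun w => cr w ^+ 2) = (fun w => rem w ^+ 2 - 2 * mean P rem * rem w + mean P rem ^+ 2).
  by apply/funext => w; rewrite /cr; ring.
rewrite meanD ?meancst; [|by apply: integB => //; exact: integZ|exact: integ_cst].
rewrite meanB ?meanZ//; last exact: integZ.
by have := sqr_ge0 (mean P rem); nra.
Qed.

(** Weighted Young inequality for the cross term: the martingale part, of order d, enters with the
    small factor [eta], and the remainder, negligible against d, with the large one. *)
Lemma cscore_sqr_err eta : 0 < eta ->
  `|mean P (fun w => cscore d P Y w ^+ 2) - mean P (fun w => S w ^+ 2)| <=
  eta * mean P (fun w => S w ^+ 2) + (1 + eta^-1) * mean P (fun w => rem w ^+ 2).
Proof.
move=> eta0; have iS : integ P (fun w => S w ^+ 2) by case: sS.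
have ic : integ P (fun w => cr w ^+ 2) by case: scr.
have icc : integ P (fun w => cscore d P Y w ^+ 2) by case: sqinteg_cscore.
rewrite -meanB//.
apply: (@le_trans _ _ (mean P (fun w => eta * S w ^+ 2 + (1 + eta^-1) * cr w ^+ 2))).
  apply: mean_norm_le; [exact: integB|by apply: integD; exact: integZ|move=> w].
  rewrite cscoreE -/(cr w).
  have -> : (S w + cr w) ^+ 2 - S w ^+ 2 = 2 * S w * cr w + cr w ^+ 2 by ring.
  have -> : eta * S w ^+ 2 + (1 + eta^-1) * cr w ^+ 2 =
    (eta * S w ^+ 2 + eta^-1 * cr w ^+ 2) + cr w ^+ 2 by ring.
  apply: le_trans (ler_normD _ _) _; rewrite [X in _ + X]ger0_norm ?sqr_ge0// lerD2r.
  have E1 : eta * S w ^+ 2 + eta^-1 * cr w ^+ 2 - 2 * S w * cr w = eta^-1 * (eta * S w - cr w) ^+ 2.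
    by field; rewrite gt_eqF.
  have E2 : eta * S w ^+ 2 + eta^-1 * cr w ^+ 2 + 2 * S w * cr w = eta^-1 * (eta * S w + cr w) ^+ 2.
    by field; rewrite gt_eqF.
  have P1 : 0 <= eta^-1 * (eta * S w - cr w) ^+ 2 by rewrite mulr_ge0 ?sqr_ge0// invr_ge0 ltW.
  have P2 : 0 <= eta^-1 * (eta * S w + cr w) ^+ 2 by rewrite mulr_ge0 ?sqr_ge0// invr_ge0 ltW.
  by rewrite ler_norml; apply/andP; split; lra.
rewrite meanD ?meanZ//; try exact: integZ.
rewrite lerD2l ler_wpM2l//.
by rewrite addr_ge0// invr_ge0 ltW.
Qed.

Lemma cscore_quad_tail k : mean P (fun w => quad_tail (k * cscore d P Y w)) <=
  16 * mean P (fun w => quad_tail (k * S w)) + 4 * k ^+ 2 * mean P (fun w => rem w ^+ 2).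
Proof.
have iq (X : Om -> R) : sqinteg P X -> integ P (fun w => quad_tail (X w)).
  move=> [mX iX]; apply: (integ_le iX).
    exact: (measurableT_comp (@measurable_quad_tail R) mX).
  by move=> w; rewrite ger0_norm ?quad_tail_ge0// quad_tail_le.
have ic : integ P (fun w => cr w ^+ 2) by case: scr.
have iS := iq _ (sqintegZ k sS).
apply: (@le_trans _ _ (mean P (fun w => 16 * quad_tail (k * S w) + 4 * k ^+ 2 * cr w ^+ 2))).
  apply: mean_le; first exact/iq/sqintegZ/sqinteg_cscore.
    by apply: integD; exact: integZ.
  move=> w; rewrite cscoreE mulrDr; apply: le_trans (quad_tailD _ _) _.
  by rewrite -/(cr w) -[4 * k ^+ 2 * _]mulrA -exprMn.
rewrite meanD ?meanZ//; try exact: integZ.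
by rewrite lerD2l ler_wpM2l// mulr_ge0 ?sqr_ge0.
Qed.

End one_chain.

Lemma cscore_variance e : 0 < e -> exists2 D, (0 < D)%N &
  forall d disp (Om : measurableType disp) (P : probability Om R) Y G, (D <= d)%N ->
  path_chain W phi0 K Cpi d P Y G ->
  `|mean P (fun w => cscore d P Y w ^+ 2) - \sum_(n < d) pi (time d n.+1) (w_s (time d n.+1))|
  <= e * d%:R.
Proof.
move=> e0; have [c c0 hc] := sqr_bounds.
have e20 : 0 < e / 2 by rewrite divr_gt0.
have e40 : 0 < e / 4 by rewrite divr_gt0.
have cC : 0 <= c * Cm by rewrite mulr_ge0.
have cC1 : 0 < c * Cm + 1 by rewrite ltr_wpDl.
pose eta := e / 4 / (c * Cm + 1).
have eta0 : 0 < eta by rewrite divr_gt0.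
have ie0 : 0 < 1 + eta^-1 by rewrite addr_gt0// invr_gt0.
have [D1 D10 hD1] := remainder_small (divr_gt0 e40 ie0).
have [D2 D20 hD2] := variance_sum rf p_itv mg cg0 gW e20.
exists (maxn D1 D2) => [|d disp Om P Y G]; first by rewrite leq_max D10.
rewrite geq_max => /andP[dD1 dD2] pc.
have hc1 s : phi0 < s <= 1 -> forall x, h s x ^+ 2 <= c * W x by move=> Ss x; case: (hc _ Ss x).
have hc2 s : phi0 < s <= 1 -> forall x, K s (h s) x ^+ 2 <= c * W x by move=> Ss x;
  case: (hc _ Ss x).
have h1 := cscore_sqr_err pc eta0.
have h2 := hD2 _ _ dD2 (pc_law pc).
have h3 := hD1 _ _ _ _ _ _ dD1 pc.
have h4 := msum_sqr_le rf pc c0 mh hc1 hc2 (leqnn d).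
have E : \sum_(n < d) mean P (fun w => mdiff phi0 K d Y h n w ^+ 2) =
   \sum_(n < d) (mean P (fun w => h (time d n.+1) (Y n.+1 w) ^+ 2) -
     mean P (fun w => op phi0 K d n.+1 (h (time d n.+1)) (Y n w) ^+ 2)).
  by apply: eq_bigr => -[n nd] _; exact: (mdiff_sqr rf pc c0 mh hc1 hc2 nd).
have E' := msum_sqr rf pc c0 mh hc1 hc2 (leqnn d).
rewrite -E -E' in h2.
set a := mean P (fun w => cscore d P Y w ^+ 2) in h1 *.
set b := mean P (fun w => msum phi0 K d Y h d w ^+ 2) in h1 h2 h4.
have -> : a - \sum_(n < d) pi (time d n.+1) (w_s (time d n.+1)) =
  (a - b) + (b - \sum_(n < d) pi (time d n.+1) (w_s (time d n.+1))) by ring.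
have -> : e * d%:R = (e / 4 * d%:R + e / 4 * d%:R) + e / 2 * d%:R by field.
apply: le_trans (ler_normD _ _) _; apply: lerD => //.
apply: le_trans h1 _; apply: lerD.
  apply: (@le_trans _ _ (eta * (d%:R * (c * Cm)))); first by rewrite ler_wpM2l// ltW.
  rewrite mulrCA mulrC ler_wpM2r// mulrC mul_frac_le// ltW//.
by rewrite mulrC -ler_pdivlMr// mulrAC.
Qed.

(** The bound is e / d, and not e, because d coordinates are added in the Lindeberg sum. *)
Lemma cscore_lindeberg e : 0 < e -> exists2 D, (0 < D)%N &
  forall d disp (Om : measurableType disp) (P : probability Om R) Y G, (D <= d)%N ->
  path_chain W phi0 K Cpi d P Y G ->
  mean P (fun w => quad_tail ((1 - phi0) / d%:R * cscore d P Y w)) <= e / d%:R.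
Proof.
move=> e0; have [c c0 hc] := sqr_bounds.
have cC : 0 <= c * Cm by rewrite mulr_ge0.
have cC1 : 0 < Cm + 1 by rewrite ltr_wpDl.
(* One factor 16 comes from [quad_tailD], the other from [msum_quad_tail]. *)
pose eta := e / 4 / 16 / 16 / (Cm + 1).
have eta0 : 0 < eta by rewrite !divr_gt0.
have [a a0 ha] := sqr_absorb eta0.
have e16 : 0 < e / 16 by rewrite divr_gt0.
have [D1 D10 hD1] := remainder_small e16.
exists (maxn D1 (Num.truncn (16 * 32 * a * (c * Cm) / (e / 4))).+1); first by rewrite leq_max D10.
move=> d disp Om P Y G; rewrite geq_max => /andP[dD1 dD2] pc.
have d0 : (0 < d)%N by exact: leq_trans dD1.
have dR : 0 < d%:R :> R by rewrite ltr0n.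
have hc1 s : phi0 < s <= 1 -> forall x, h s x ^+ 2 <= c * W x by move=> Ss x; case: (hc _ Ss x).
have hc2 s : phi0 < s <= 1 -> forall x, K s (h s) x ^+ 2 <= c * W x by move=> Ss x;
  case: (hc _ Ss x).
have ha1 s : phi0 < s <= 1 -> forall x, h s x ^+ 2 <= eta * W x + a by move=> Ss x;
  case: (ha _ Ss x).
have ha2 s : phi0 < s <= 1 -> forall x, K s (h s) x ^+ 2 <= eta * W x + a by move=> Ss x;
  case: (ha _ Ss x).
have h3 := hD1 _ _ _ _ _ _ dD1 pc.
set k := (1 - phi0) / d%:R.
have h1 := cscore_quad_tail pc k.
have h2 := msum_quad_tail rf pc c0 mh hc1 hc2 k (ltW eta0) a0 ha1 ha2 (leqnn d).
have f1 : 1 - phi0 <= 1 by rewrite gerBl ltW//; case/andP: phi01.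
have k0 : 0 <= k by rewrite divr_ge0// ltW.
have kd : k <= d%:R^-1 by rewrite ler_pdivrMr// mulVf ?gt_eqF.
apply: le_trans h1 _.
have i0 : 0 < d%:R^-1 :> R by rewrite invr_gt0.
have id : d%:R * d%:R^-1 = 1 :> R by rewrite divff ?gt_eqF.
set i := d%:R^-1 in kd i0 id *; set dd := d%:R in dR h2 h3 id *.
have k2 : k ^+ 2 <= i ^+ 2 by rewrite lerXn2r ?nnegrE ?(ltW i0).
have k4 : k ^+ 4 <= i ^+ 4 by rewrite lerXn2r ?nnegrE ?(ltW i0).
have dc : 16 * 32 * a * (c * Cm) <= e / 4 * dd.
  rewrite [leRHS]mulrC -ler_pdivrMr ?divr_gt0//; apply: ltW.
  by apply: (lt_le_trans (truncnS_gt _)); rewrite ler_nat.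
have etaC : 16 * 16 * eta * Cm <= e / 4.
  rewrite /eta [leLHS](_ : _ = e / 4 * (Cm / (Cm + 1))); last first.
    by field; rewrite gt_eqF.
  by rewrite ler_piMr ?divr_ge0 ?(ltW e0)// ler_pdivrMr// mul1r lerDl.
have t1 : 4 * k ^+ 2 * mean P (fun w => remainder phi0 d Y h w ^+ 2) <= e / 4 * i.
  apply: (@le_trans _ _ (4 * i ^+ 2 * (e / 16 * dd))).
    apply: ler_pM => //; [by rewrite mulr_ge0 ?sqr_ge0|by apply: mean_ge0 => w; exact: sqr_ge0|].
    by rewrite ler_wpM2l.
  have -> : 4 * i ^+ 2 * (e / 16 * dd) = e / 4 * i * (dd * i) by field.
  by rewrite id mulr1.
have t2 : 16 * (dd * (16 * k ^+ 2 * eta * Cm)) <= e / 4 * i.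
  apply: (@le_trans _ _ (16 * (dd * (16 * i ^+ 2 * eta * Cm)))).
    rewrite ler_wpM2l// ler_wpM2l ?(ltW dR)// ler_wpM2r// ler_wpM2r ?(ltW eta0)//.
    by rewrite ler_wpM2l.
  have -> : 16 * (dd * (16 * i ^+ 2 * eta * Cm)) = (16 * 16 * eta * Cm) * i * (dd * i) by ring.
  by rewrite id mulr1 ler_wpM2r// ltW.
have t3 : 16 * (dd * (32 * a * k ^+ 4 * dd * (c * Cm))) <= e / 4 * i.
  apply: (@le_trans _ _ (16 * (dd * (32 * a * i ^+ 4 * dd * (c * Cm))))).
    rewrite ler_wpM2l// ler_wpM2l ?(ltW dR)// ler_wpM2r// ler_wpM2r ?(ltW dR)//.
    by rewrite ler_wpM2l// mulr_ge0.
  have -> : 16 * (dd * (32 * a * i ^+ 4 * dd * (c * Cm))) =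
    (16 * 32 * a * (c * Cm)) * i ^+ 2 * (dd * i) ^+ 2 by ring.
  rewrite id expr1n mulr1; apply: (@le_trans _ _ (e / 4 * dd * i ^+ 2)).
    by rewrite ler_wpM2r ?sqr_ge0.
  by rewrite expr2 mulrA -(mulrA (e / 4)) id mulr1.
have ei : 0 <= e * i by rewrite mulr_ge0 ?(ltW e0)// ltW.
lra.
Qed.

End score.

(** * Riemann sums *)

Section riemann_sums.
Context {R : realType}.
Local Notation leb := (@lebesgue_measure R).

Lemma countable_setU (T : Type) (A B : set T) : countable A -> countable B ->
  countable (A `|` B).
Proof.
move=> cA cB; rewrite -bigcup2E.
by apply: bigcup_countable => // -[|[|n]] _ /=.
Qed.

Lemma measurable_fun_countable (D : set R) (f : R -> R) : countable D -> measurable_fun D f.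
Proof.
move=> cD mD B mB; apply: countable_measurable; first exact: measurable_set1.
by apply: (sub_countable _ cD); apply: subset_card_le => x [].
Qed.

(** The integrand of [sigma2_star] is identified only off a countable set, which must not spoil its
    measurability. *)
Lemma measurable_fun_off_countable (D N : set R) (f g : R -> R) :
  measurable D -> countable N -> (forall x, D x -> ~ N x -> f x = g x) ->
  measurable_fun (D `\` N) g -> measurable_fun D f.
Proof.
move=> mD cN fg mg.
have mN : measurable (N `&` D).
  apply: countable_measurable; first exact: measurable_set1.
  by apply: (sub_countable _ cN); apply: subset_card_le => x [].
have -> : D = (D `\` N) `|` (N `&` D).
  apply/seteqP; split=> [x Dx|x [[]//|[]//]].
  by have [Nx|nNx] := pselect (N x); [right|left].
have mDN : measurable (D `\` N).
  have -> : D `\` N = D `\` (N `&` D).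
    apply/seteqP; split=> [x [Dx nN]|x [Dx nND]]; split=> //; first by case.
    by move=> Nx; apply: nND.
  exact: measurableD.
apply/measurable_funU => //; split.
  apply: (eq_measurable_fun g) => // x; rewrite inE => -[Dx nNx].
  by rewrite fg.
by apply: measurable_fun_countable; apply: (sub_countable _ cN); apply: subset_card_le => x [].
Qed.

Section sums.
Variables (a b : R) (F : R -> R).
Hypothesis ab : a < b.
Hypothesis Fu : forall e : R, 0 < e -> exists2 h : R, 0 < h &
  forall s t, a < s <= b -> a < t <= b -> `|s - t| <= h -> `|F s - F t| <= e.

Let node d n : R := a + n%:R * (b - a) / d%:R.

Let node_itv d n : (n < d)%N -> a < node d n.+1 <= b.
Proof.
move=> nd; have d0 : 0 < d%:R :> R by rewrite ltr0n (leq_ltn_trans _ nd).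
have q0 : 0 < b - a by rewrite subr_gt0.
apply/andP; split; first by rewrite ltrDl divr_gt0 ?mulr_gt0.
by rewrite -lerBrDl ler_pdivrMr// mulrC ler_wpM2l ?(ltW q0)// ler_nat.
Qed.

Let node_step d n : node d n.+1 - node d n = (b - a) / d%:R.
Proof. by rewrite /node -natr1; lra. Qed.

Let mF : measurable_fun (`]a, b] : set R) F.
Proof.
apply: subspace_continuous_measurable_fun => //.
apply/subspace_continuousP => x xab; apply/cvgrPdist_le => e e0.
have [h h0 hF] := Fu e0.
have : \forall y \near x, `|x - y| <= h.
  near=> y; near: y; apply: filterS (nbhsx_ballx x h h0) => y /ltW.
  by [].
rewrite /= -nbhs_nearE => nx; rewrite near_withinE; near=> y => /= yab.
apply: hF; [by move: xab; rewrite /= in_itv|by move: yab; rewrite /= in_itv|].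
by near: y.
Unshelve. all: by end_near.
Qed.

(** Every point is within one mesh of the right end of its cell, so finitely many node values bound
    [F]; the left end of the interval is never evaluated. *)
Let Fbounded : exists2 B, 0 <= B & forall x, a < x <= b -> `|F x| <= B.
Proof.
have [h h0 hF] := Fu ltr01.
pose d := (Num.truncn ((b - a) / h)).+1.
have d0 : 0 < d%:R :> R by rewrite ltr0n.
have dh : (b - a) / d%:R <= h.
  by rewrite ler_pdivrMr// mulrC -ler_pdivrMr// ltW// truncnS_gt.
exists (1 + \sum_(n < d) `|F (node d n.+1)|) => [|x xab].
  by rewrite addr_ge0// sumr_ge0.
have [n nd nx] : exists2 n, (n < d)%N & node d n < x <= node d n.+1.
  have /andP[ax xb] := xab.
  have : x <= node d d by rewrite /node mulrAC divff ?gt_eqF// mul1r addrC subrK.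
  suff H m : (m <= d)%N -> x <= node d m -> exists2 n, (n < m)%N & node d n < x <= node d n.+1.
    exact: H.
  elim: m => [_|m IH md xm].
    by rewrite /node !mul0r addr0 leNgt ax.
  have [xm'|mx] := leP x (node d m); first by have [n nm hn] := IH (ltnW md) xm'; exists n => //;
    exact: leq_trans nm _.
  by exists m => //; rewrite mx.
rewrite -(subrK (F (node d n.+1)) (F x)); apply: le_trans (ler_normD _ _) _; apply: lerD.
  apply: hF => //; first exact: node_itv.
  apply: le_trans dh; rewrite -(node_step d n) distrC ger0_norm ?subr_ge0; last by case/andP: nx.
  by rewrite lerB//; case/andP: nx => /ltW.
by rewrite (bigD1 (Ordinal nd))//= lerDl sumr_ge0.
Qed.

Let iF u v : a <= u -> v <= b -> leb.-integrable (`]u, v] : set R) (EFin \o F).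
Proof.
move=> au vb; have [B B0 hB] := Fbounded.
have sub : (`]u, v] : set R) `<=` `]a, b].
  move=> x /=; rewrite !in_itv/= => /andP[ux xv].
  by rewrite (le_lt_trans au ux) (le_trans xv vb).
apply: (measurable_bounded_integrable (mu := leb)) => //=.
- by rewrite lebesgue_measure_itv/=; case: ifP => // _; rewrite -EFinD ltry.
- exact: measurable_funS mF.
- exists B; split; first exact: num_real.
  move=> M BM x /sub; rewrite /= in_itv/= => xab.
  exact: le_trans (hB x xab) (ltW BM).
Qed.

Let cell_err e d n : 0 < e -> (n < d)%N ->
  (forall s t, a < s <= b -> a < t <= b -> `|s - t| <= (b - a) / d%:R -> `|F s - F t| <= e) ->
  `|\int[leb]_(x in `]node d n, node d n.+1]) F x - (b - a) / d%:R * F (node d n.+1)| <=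
  (b - a) / d%:R * e.
Proof.
move=> e0 nd hF; have /andP[_ nb] := node_itv nd.
have d0 : 0 < d%:R :> R by rewrite ltr0n (leq_ltn_trans _ nd).
have D0 : 0 < (b - a) / d%:R by rewrite divr_gt0// subr_gt0.
have an : a <= node d n by rewrite lerDl divr_ge0 ?mulr_ge0// subr_ge0 ltW.
have len : fine (leb (`]node d n, node d n.+1] : set R)) = (b - a) / d%:R.
  by rewrite lebesgue_measure_itv/= lte_fin -subr_gt0 node_step D0 -EFinD node_step.
have fin : (leb (`]node d n, node d n.+1] : set R) < +oo)%E.
  by rewrite lebesgue_measure_itv/=; case: ifP => // _; rewrite -EFinD ltry.
have ic c : leb.-integrable (`]node d n, node d n.+1] : set R) (EFin \o (fun=> c)).
  apply: (measurable_bounded_integrable (mu := leb)) => //=.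
  by exists `|c|; split => [|M cM x _]; [exact: num_real|exact: ltW].
have Ec c : \int[leb]_(x in `]node d n, node d n.+1]) c = (b - a) / d%:R * c.
  by rewrite Rintegral_cst//= len mulrC.
rewrite -Ec -RintegralB//; last exact: iF.
have iB : leb.-integrable (`]node d n,
  node d n.+1] : set R) (EFin \o (fun x => F x - F (node d n.+1))).
  by have := @integrableB _ _ _ leb _ (measurable_itv _) _ _ (iF an nb) (ic (F (node d n.+1)));
    apply: eq_integrable.
apply: le_trans (le_normr_Rintegral _ iB) _ => //.
rewrite -Ec; apply: le_Rintegral => //; first exact: integrable_norm.
move=> x; rewrite /= in_itv/= => /andP[nx xn]; apply: hF.
- by rewrite (le_lt_trans an nx) (le_trans xn nb).
- exact: node_itv.
- rewrite distrC ger0_norm ?subr_ge0// -(node_step d n).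
  by rewrite lerB// ltW.
Qed.

Lemma riemann_sum_err e : 0 < e -> exists2 D, (0 < D)%N & forall d, (D <= d)%N ->
  `|\int[leb]_(x in `]a, b]) F x - (b - a) / d%:R * \sum_(n < d) F (node d n.+1)| <= e * (b - a).
Proof.
move=> e0; have [h h0 hF] := Fu e0.
exists (Num.truncn ((b - a) / h)).+1 => // d Dd.
have d0 : 0 < d%:R :> R by rewrite ltr0n (leq_ltn_trans _ Dd).
have dh : (b - a) / d%:R <= h.
  rewrite ler_pdivrMr// mulrC -ler_pdivrMr// ltW// (lt_le_trans (truncnS_gt _))//.
  by rewrite ler_nat.
have E m : (m <= d)%N ->
    `|\int[leb]_(x in `]a, node d m]) F x - (b - a) / d%:R * \sum_(n < m) F (node d n.+1)| <=
    m%:R * ((b - a) / d%:R * e).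
  elim: m => [_|m IH md].
    have -> : node d 0 = a by rewrite /node !mul0r addr0.
    by rewrite set_itvoc0 Rintegral_set0 big_ord0 mulr0 subr0 normr0 mul0r.
  have /andP[am mb] := node_itv md.
  have := @Rintegral_itvB R F (BRight a) (BRight (node d m.+1)) (node d m)
    (iF (lexx a) mb).
  have nn : node d m <= node d m.+1.
    by rewrite -subr_ge0 node_step divr_ge0 ?subr_ge0 ?(ltW ab)// ltW.
  have an : a <= node d m by rewrite lerDl divr_ge0 ?mulr_ge0// subr_ge0 ltW.
  rewrite !bnd_simp => /(_ an nn) /eqP; rewrite subr_eq => /eqP ->.
  rewrite big_ord_recr/= mulrDr -[m.+1%:R]natr1 [m%:R + 1]addrC [leRHS]mulrDl mul1r.
  set I := Rintegral _ _ _; set J := Rintegral _ _ _.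
  set S := (b - a) / d%:R * \sum_(n < m) _; set T := _ * F _.
  have -> : I + J - (S + T) = (I - T) + (J - S) by ring.
  apply: le_trans (ler_normD _ _) _; apply: lerD; last exact: IH (ltnW md).
  apply: cell_err => // s t Ss St st; apply: hF => //; exact: le_trans dh.
have := E d (leqnn d).
have -> : node d d = b by rewrite /node mulrAC divff ?gt_eqF// mul1r addrC subrK.
by have -> : d%:R * ((b - a) / d%:R * e) = e * (b - a) by field; rewrite gt_eqF.
Qed.

(** The set [N] and the point [a] are countable, hence null: they affect neither measurability nor
    the integral, which may be computed with [F] on the half-open interval. *)
Lemma riemann_sum_cvg (G : R -> R) (N : set R) : countable N ->
  (forall x, a < x <= b -> ~ N x -> G x = F x) ->
  (fun d => (b - a) / d%:R * \sum_(n < d) F (node d n.+1)) @ \oo -->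
  \int[leb]_(x in `[a, b]) G x.
Proof.
move=> cN GF.
have cN' : countable (N `|` [set a]).
  by apply: countable_setU => //; exact: countable1.
have GF' x : `[a, b]%classic x -> ~ (N `|` [set a]) x -> G x = F x.
  move=> /=; rewrite in_itv/= => /andP[ax xb] nN; apply: GF; last by move=> Nx; apply: nN; left.
  rewrite xb andbT lt_neqAle ax andbT; apply/eqP => axE; apply: nN; right => /=.
  by rewrite axE.
have mF' : measurable_fun (`[a, b]%classic `\` (N `|` [set a])) F.
  apply: measurable_funS mF => // x [] /=; rewrite !in_itv/= => /andP[ax xb] nN.
  by rewrite xb andbT lt_neqAle ax andbT; apply/eqP => axE; apply: nN; right => /=; rewrite axE.
have mG : measurable_fun (`[a, b] : set R) G.
  exact: (measurable_fun_off_countable (measurable_itv _) cN' GF' mF').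
have mFc : measurable_fun (`[a, b] : set R) F.
  exact: (measurable_fun_off_countable (measurable_itv _) cN' (fun x _ _ => erefl) mF').
have -> : \int[leb]_(x in `[a, b]) G x = \int[leb]_(x in `]a, b]) F x.
  rewrite (Rintegral_itv_obnd_cbnd (iF (lexx a) (lexx b))) /Rintegral; congr fine.
  apply: ae_eq_integral => //; [exact/measurable_EFinP|exact/measurable_EFinP|].
  exists (N `|` [set a]); split.
  - by apply: countable_measurable => //; exact: measurable_set1.
  - exact: countable_lebesgue_measure0.
  - move=> x /= /not_implyP[Dx /=] GFx; apply: contrapT => nN; apply: GFx.
    by rewrite GF'.
apply/cvgrPdist_le => e e0.
have ba : 0 < b - a by rewrite subr_gt0.
have [D D0 hD] := riemann_sum_err (divr_gt0 e0 ba).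
near=> d; have := hD d; rewrite divfK ?gt_eqF//; apply.
by near: d; exact: nbhs_infty_ge.
Unshelve. all: by end_near.
Qed.

End sums.
End riemann_sums.

(** * Renewal sequences *)

Section period.
Context {R : realType}.
Variable p : nat -> R.

(** [p j] is to be read as the probability of a gap [j.+1] between renewals; these are the possible
    total lengths of successive gaps. *)
Inductive shifts : nat -> Prop :=
| shifts0 : shifts 0
| shiftsS j n : 0 < p j -> shifts n -> shifts (j.+1 + n).

Lemma shiftsD m n : shifts m -> shifts n -> shifts (m + n).
Proof. by move=> sm sn; elim: sm => // j k pj _ IH; rewrite -addnA; exact: shiftsS. Qed.

Lemma shiftsM k m : shifts m -> shifts (k * m).
Proof.
by move=> sm; elim: k => [|k IH]; rewrite ?mul0n ?mulSn; [exact: shifts0|exact: shiftsD].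
Qed.

Definition has_period q := [/\ (0 < q)%N, forall j, 0 < p j -> (q %| j.+1)%N &
  exists k0, forall k, (k0 <= k)%N -> shifts (q * k)].

(* The period is the least positive difference of two elements of the
   semigroup of shifts. *)
Lemma has_period_exists j : 0 < p j -> exists q, has_period q.
Proof.
move=> pj; pose D d := (0 < d)%N /\ exists m, shifts m /\ shifts (m + d).
have D1 : exists d, `[< D d >].
  exists j.+1; apply/asboolP; split => //; exists 0%N; split; first exact: shifts0.
  by rewrite add0n -(addn0 j.+1); apply: shiftsS => //; exact: shifts0.
case: (ex_minnP D1) => q /asboolP[q0 [m [sm smq]]] qmin.
have dvd x : shifts x -> (q %| x)%N.
  move=> sx; rewrite /dvdn; apply/negPn/negP; rewrite -lt0n => r0.
  have := qmin (x %% q)%N; rewrite leqNgt ltn_mod q0/= => /(_ _)/notF; apply.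
  (* If x = a q + r with 0 < r < q, then x + a m and a (m + q) are shifts that differ by r, against
     the minimality of q. *)
  apply/asboolP; split => //; exists ((x %/ q) * (m + q))%N; split; first exact: shiftsM.
  have -> : ((x %/ q) * (m + q) + x %% q = x + (x %/ q) * m)%N.
    by rewrite mulnDr -addnA -divn_eq addnC.
  by apply: shiftsD => //; exact: shiftsM.
exists q; split=> // [i pi|].
  by apply: dvd; rewrite -(addn0 i.+1); apply: shiftsS => //; exact: shifts0.
pose m' := (m + (m + q))%N.
have sm' : shifts m' by exact: shiftsD.
have smq' : shifts (m' + q).
  by rewrite (_ : m' + q = (m + q) + (m + q))%N; [exact: shiftsD|rewrite /m' addnAC].
have m'0 : (0 < m')%N by rewrite /m' addnA addn_gt0 q0 orbT.
have /dvdnP[mu mE] := dvd _ sm'.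
have mu0 : (0 < mu)%N by move: m'0; rewrite mE muln_gt0 => /andP[].
(* With m' = mu q, both m' and m' + q are shifts. For k >= mu^2 the remainder of k modulo mu is at
   most the quotient, and q k is a nonnegative combination of the two. *)
exists (mu * mu)%N => k kmu.
have tk : (k %% mu <= k %/ mu)%N.
  by apply: (@leq_trans mu); [rewrite ltnW// ltn_mod|rewrite leq_divRL].
have -> : (q * k = (k %/ mu - k %% mu) * m' + (k %% mu) * (m' + q))%N.
  rewrite mulnBl mulnDr addnA subnK; last by rewrite leq_mul2r tk orbT.
  rewrite {1}(divn_eq k mu) mulnDr mE; congr (_ + _)%N.
    by rewrite mulnC -mulnA.
  by rewrite mulnC.
by apply: shiftsD; exact: shiftsM.
Qed.

End period.

Lemma limsup_exists {R : realType} (a : nat -> R) (A : R) : (forall n, `|a n| <= A) ->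
  exists2 l : R, forall e, 0 < e -> exists N, forall n, (N <= n)%N -> a n <= l + e &
    forall e, 0 < e -> forall N, exists2 n, (N <= n)%N & l - e <= a n.
Proof.
move=> aA; pose S := [set x : R | forall N, exists2 n, (N <= n)%N & x <= a n].
have S0 : S !=set0.
  exists (- A) => N; exists N => //; have := aA N; rewrite ler_norml => /andP[] //.
have SA : ubound S A.
  move=> x /(_ 0%N)[n _ xa]; apply: le_trans xa _.
  by apply: le_trans (aA n); exact: ler_norm.
have hS : has_sup S by split=> //; exists A.
exists (sup S) => e e0.
  apply: contrapT => /forallNP H.
  have : S (sup S + e).
    move=> N; have := H N => /existsNP[n /not_implyP[Nn /negP]].
    by rewrite -ltNge => /ltW ?; exists n.
  by move=> /(ub_le_sup (ex_intro _ A SA)); rewrite gerDl leNgt e0.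
move=> N; have [x Sx xe] := sup_adherent e0 hS.
by have [n Nn xa] := Sx N; exists n => //; exact: le_trans (ltW xe) xa.
Qed.

(** * A renewal theorem with limit 0 *)

Section renewal.
Context {R : realType}.
Variables (p a b : nat -> R) (A : R).
Hypothesis p0 : forall j, 0 <= p j.
Let r n : R := 1 - \sum_(j < n) p j.
Hypothesis r0 : forall n, 0 <= r n.
Hypothesis rsum : exists B, forall n, \sum_(k < n) r k <= B.
Hypothesis aE : forall n, a n = b n + \sum_(j < n) p j * a (n.-1 - j)%N.
Hypothesis aA : forall n, `|a n| <= A.
Hypothesis bsum : series b @ \oo --> (0 : R).
Hypothesis aper : exists k0, forall k, (k0 <= k)%N -> shifts p k.

Let rS n : r n.+1 = r n - p n.
Proof. by rewrite /r big_ord_recr/=; ring. Qed.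

Let r_le m n : (m <= n)%N -> r n <= r m.
Proof.
move=> /subnK <-; elim: (n - m)%N => [|k IH]; first by rewrite add0n.
by rewrite addSn rS; apply: le_trans IH; rewrite gerBl.
Qed.

Let r_small (e : R) : 0 < e -> exists N, forall n, (N <= n)%N -> r n <= e.
Proof.
move=> e0; apply: contrapT => /forallNP H.
have re n : e < r n.
  have := H n => /existsNP[m /not_implyP[nm /negP]]; rewrite -ltNge => /lt_le_trans; apply.
  exact: r_le.
have [B hB] := rsum.
pose n := (Num.truncn (`|B| / e)).+1.
have := hB n; apply/negP; rewrite -ltNge; apply: le_lt_trans (ler_norm B) _.
apply: (@lt_le_trans _ _ (\sum_(k < n) e)); last by apply: ler_sum => k _; exact: ltW.
by rewrite sumr_const card_ord -mulr_natl -ltr_pdivrMr// truncnS_gt.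
Qed.

(** The renewal equation summed over time: summation replaces the gap probabilities by their tails
    [r]. *)
Let rconv n : \sum_(k < n.+1) r k * a (n - k)%N = \sum_(k < n.+1) b k.
Proof.
elim: n => [|n IH].
  by rewrite !big_ord1 /r big_ord0 subr0 mul1r subnn aE big_ord0 addr0.
rewrite big_ord_recl/= [RHS]big_ord_recr/= -IH.
rewrite {1}/r big_ord0 subr0 mul1r subn0 aE/= -addrA [RHS]addrC; congr (_ + _).
rewrite -big_split/=; apply: eq_bigr => k _.
by rewrite /bump/= add1n subSS rS; ring.
Qed.

Let b_small (e : R) : 0 < e -> exists N, forall n, (N <= n)%N -> `|b n| <= e.
Proof.
move=> e0; have b0 : b @ \oo --> (0 : R) by apply: cvg_series_cvg_0; apply/cvg_ex; exists 0.
have := b0 => /cvgr0Pnorm_le/(_ _ e0)[N _ hN].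
by exists N => n Nn; exact: hN.
Qed.

Let A0 : 0 <= A. Proof. exact: le_trans (normr_ge0 _) (aA 0%N). Qed.

Section limsup.
Variable l : R.
Hypothesis l_up : forall e, 0 < e -> exists N, forall n, (N <= n)%N -> a n <= l + e.
Hypothesis l_fr : forall e, 0 < e -> forall N, exists2 n, (N <= n)%N & l - e <= a n.

(* Near-maximal values propagate to the past along the shifts. *)
Let shift_near D : shifts p D -> forall e, 0 < e -> exists2 del, 0 < del &
  exists N, forall n, (N <= n)%N -> l - del <= a n -> (D <= n)%N /\ l - e <= a (n - D)%N.
Proof.
elim=> [|j k pj _ IH] e e0.
  by exists e => //; exists 0%N => n _; rewrite subn0.
have [del1 del10 [N1 hN1]] := IH e e0.
(* The renewal equation at [n] is off by at most 5 d: the margin over l, the mass of gaps longer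
   than n, the values at times before N2, the term [b n], and the gap between l and [a n]. Division
   by [p j] then gives del1. *)
pose d := p j * del1 / 5.
have d0 : 0 < d by rewrite divr_gt0// mulr_gt0.
have [N2 hN2] := l_up d0.
pose B := A + `|l| + d.
have B0 : 0 < B by rewrite ltr_wpDl// addr_ge0.
have B1 : 0 < B + 1 by exact: ltr_pwDr ltr01 (ltW B0).
have [N3 hN3] := r_small (divr_gt0 d0 B1).
have [N4 hN4] := b_small d0.
exists d => //; exists (maxn (N1 + j.+1) (maxn (N2 + N3) (maxn N4 j.+1))) => n.
rewrite !geq_max => /and4P[n1 n23 n4 nj] la.
suff aj : l - del1 <= a (n - j.+1)%N.
  have [kn ak] := hN1 (n - j.+1)%N (ltac:(by rewrite -(leq_add2r j.+1) subnK)) aj.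
  by rewrite subnDA; split=> //; rewrite -(subnKC nj) leq_add2l.
have N2n : (N2 <= n)%N by apply: leq_trans n23; rewrite leq_addr.
have tn i : (i < n)%N -> 0 <= p i * (l + d + (if (i < n - N2)%N then 0 else B) - a (n.-1 - i)%N).
  move=> iN; rewrite mulr_ge0// subr_ge0; case: ifPn => [iN2|_].
    rewrite addr0; apply: hN2; rewrite -subn1 -subnDA add1n.
    by rewrite leq_subRL// addSn addnC -ltn_subRL.
  have := aA (n.-1 - i)%N; rewrite ler_norml => /andP[_ ?].
  have := ler_norm (- l); rewrite normrN /B; lra.
have Sge : p j * (l + d - a (n - j.+1)%N) <=
    \sum_(i < n) p i * (l + d + (if (i < n - N2)%N then 0 else B) - a (n.-1 - i)%N).
  rewrite (bigD1 (Ordinal nj))//=.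
  apply: (@le_trans _ _ (p j * (l + d + (if (j < n - N2)%N then 0 else B) - a (n.-1 - j)%N))).
    rewrite ler_wpM2l// -subn1 -subnDA add1n lerD2r lerDl; case: ifP => // _; exact: ltW.
  by rewrite lerDl; apply: sumr_ge0 => i _; apply: tn; exact: ltn_ord.
have SE : \sum_(i < n) p i * (l + d + (if (i < n - N2)%N then 0 else B) - a (n.-1 - i)%N) =
    (1 - r n) * (l + d) + B * (r (n - N2)%N - r n) - (a n - b n).
  have -> : a n - b n = \sum_(i < n) p i * a (n.-1 - i)%N by rewrite [a n]aE; ring.
  have -> : 1 - r n = \sum_(i < n) p i by rewrite /r; ring.
  have -> : r (n - N2)%N - r n = \sum_(i < n) (if (i < n - N2)%N then 0 else p i).
    have -> : r (n - N2)%N - r n = \sum_(i < n) p i - \sum_(i < n - N2) p i by rewrite /r; ring.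
    rewrite (big_ord_widen_cond n (fun=> true) p (leq_subr N2 n))/=.
    rewrite [X in _ - X]big_mkcond/= -sumrB; apply: eq_bigr => i _.
    by case: ifP; rewrite ?subrr ?subr0.
  rewrite mulr_suml mulr_sumr -big_split/= -sumrB; apply: eq_bigr => i _.
  by case: ifP => _; ring.
have rn : (r (n - N2)%N <= d / (B + 1))%R.
  by apply: hN3; rewrite -(leq_add2l N2) subnKC.
have rn2 : r n <= d / (B + 1) by apply: le_trans (r_le (leq_subr N2 n)) rn.
have rB (x : R) : 0 <= x -> x <= B -> x * (d / (B + 1)) <= d.
  move=> x0 xB; rewrite mulrCA ler_piMr ?(ltW d0)// ler_pdivrMr ?B1//.
  by rewrite mul1r (le_trans xB)// lerDl.
have bn := hN4 _ n4; move: bn; rewrite ler_norml => /andP[_ bn].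
have := Sge; rewrite SE => Sge'.
have h1 : B * (r (n - N2)%N - r n) <= d.
  apply: (@le_trans _ _ (B * (d / (B + 1)))); last by rewrite rB// ltW.
  by rewrite ler_wpM2l ?(ltW B0)//; have := r0 n; lra.
have h2 : - (r n * (l + d)) <= d.
  apply: (@le_trans _ _ (`|l| * r n)).
    have := ler_norm (- l); rewrite normrN => ln; have := r0 n => rn0.
    have : 0 <= r n * d by rewrite mulr_ge0// ltW.
    nra.
  apply: (@le_trans _ _ (`|l| * (d / (B + 1)))); first by rewrite ler_wpM2l.
  by apply: rB => //; rewrite /B; have := A0; have := d0; lra.
have h3 : p j * (l + d - a (n - j.+1)%N) <= 5 * d by move: Sge' la; nra.
have h4 : l + d - a (n - j.+1)%N <= del1.
  have : p j * (l + d - a (n - j.+1)%N) <= p j * del1 by apply: le_trans h3 _; rewrite /d; lra.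
  by rewrite ler_pM2l.
by have := d0; lra.
Qed.

(** All integers from [k0] on are shifts, so a single near-maximal value propagates to a whole block
    of consecutive earlier times. *)
Let shift_window N : forall e, 0 < e -> forall n0, exists2 n, (n0 <= n)%N & (N <= n)%N /\
  forall i, (i <= N)%N -> l - e <= a (n - i)%N.
Proof.
have [k0 hk] := aper; move=> e e0 n0.
have [del del0 [N1 hN1]] : exists2 del, 0 < del & exists N1, forall n, (N1 <= n)%N ->
    l - del <= a n -> forall i, (i <= N)%N -> (k0 + i <= n)%N /\ l - e <= a (n - (k0 + i))%N.
  elim: N => [|N [del del0 [N1 hN1]]].
    have [del del0 [N1 hN1]] := shift_near (hk k0 (leqnn _)) e0.
    exists del => //; exists N1 => n Nn la i; rewrite leqn0 => /eqP ->; rewrite addn0.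
    exact: hN1.
  have [del' del'0 [N1' hN1']] := shift_near (hk (k0 + N.+1)%N (leq_addr _ _)) e0.
  exists (Num.min del del'); first by rewrite lt_min del0.
  exists (maxn N1 N1') => n; rewrite geq_max => /andP[n1 n2] la i.
  rewrite leq_eqVlt => /orP[/eqP ->|iN].
    by apply: hN1' => //; apply: le_trans la; rewrite lerD2l lerN2 ge_min lexx orbT.
  by apply: hN1 => //; apply: le_trans la; rewrite lerD2l lerN2 ge_min lexx.
have [n Nn la] := l_fr del0 (maxn N1 (n0 + k0)).
move: Nn; rewrite geq_max => /andP[n1 n2].
exists (n - k0)%N; first by rewrite -(leq_add2r k0) subnK// (leq_trans _ n2)// leq_addl.
split=> [|i iN].
  have [kn _] := hN1 n n1 la N (leqnn _).
  by rewrite -(leq_add2l k0) subnKC// (leq_trans _ kn)// leq_addr.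
by rewrite -subnDA; have [] := hN1 n n1 la i iN.
Qed.

(** If l > 0, on a long window of values at least l / 2 the convolution with [r] exceeds l / 4, its
    tail being controlled by summability of [r]; by [rconv] it is a partial sum of [b], which tends
    to 0. *)
Lemma limsup_le0 : l <= 0.
Proof.
rewrite leNgt; apply/negP => l0.
have [B hB] := rsum.
have l2 : 0 < l / 2 by rewrite divr_gt0.
have cR : cvgn (series r).
  apply: nondecreasing_is_cvgn.
    by apply/nondecreasing_seqP => n; rewrite /series/= big_nat_recr//= lerDl.
  by exists B => _ [n _ <-]; rewrite /series/= big_mkord; exact: hB.
have A1 : 0 < A + 1 by rewrite ltr_wpDl.
have l8 : 0 < l / 8 / (A + 1) by rewrite !divr_gt0.
have /cvgrPdist_le/(_ _ l8)[N _ hN] := cR.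
have l80 : 0 < l / 8 by rewrite divr_gt0.
have /cvgr0Pnorm_le/(_ _ l80)[N2 _ hN2] := bsum.
have [n nN2 [Nn an]] := shift_window N l2 (maxn N N2).
have {}nN2 : (N2 <= n)%N by move: nN2; rewrite geq_max => /andP[].
have sr m : series r m = \sum_(k < m) r k by rewrite /series/= big_mkord.
have sb m : series b m = \sum_(k < m) b k by rewrite /series/= big_mkord.
have := hN2 n.+1 (leqW nN2); rewrite /= sb -rconv ler_norml => /andP[_].
apply/negP; rewrite -ltNge.
apply: (@lt_le_trans _ _ (\sum_(k < n.+1) ((if k == 0%N :> nat then l / 2 else 0) -
    A * (if (k < N.+1)%N then 0 else r k)))); last first.
  apply: ler_sum => k _; rewrite ltnS; case: ifPn => [/eqP ->|k0].
    rewrite leq0n mulr0 subr0 /r big_ord0 subr0 mul1r subn0.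
    by have := an 0%N isT; rewrite subn0; lra.
  case: ifPn => kN.
    rewrite mulr0 subr0 mulr_ge0//; have := an _ kN; have := l0; lra.
  rewrite sub0r -mulNr mulrC ler_wpM2l//.
  by have := aA (n - k)%N; rewrite ler_norml => /andP[].
rewrite sumrB big_ord_recl/= big1 ?addr0//.
rewrite -mulr_sumr.
have -> : \sum_(k < n.+1) (if (k < N.+1)%N then 0 else r k) = series r n.+1 - series r N.+1.
  rewrite !sr (big_ord_widen_cond n.+1 (fun=>
    true) r (ltac:(by rewrite ltnS) : (N.+1 <= n.+1)%N))/=.
  rewrite [X in _ - X]big_mkcond/= -sumrB; apply: eq_bigr => i _.
  by case: ifP; rewrite ?subrr ?subr0.
have := hN N.+1 (leqnSn _); have := hN n.+1 (leqW Nn).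
rewrite /= !ler_norml => /andP[h1 h2] /andP[h3 h4].
set d := l / 8 / (A + 1) in l8 h1 h2 h3 h4.
have dA : A * (series r n.+1 - series r N.+1) <= A * (2 * d) by rewrite ler_wpM2l//; lra.
have dl : A * (2 * d) <= l / 4.
  have -> : A * (2 * d) = 2 * (l / 8) * (A / (A + 1)) by rewrite /d; field; rewrite gt_eqF.
  have : A / (A + 1) <= 1 by rewrite ler_pdivrMr// mul1r lerDl.
  have : 0 <= A / (A + 1) by rewrite divr_ge0// ltW.
  have := l0; nra.
by have := l0; lra.
Qed.

End limsup.
End renewal.

(** An Erdos-Feller-Pollard argument: the bound on the limit superior is applied to the sequence and
    to its opposite. *)
Lemma renewal_cvg0 {R : realType} (p a b : nat -> R) (A : R) :
  (forall j, 0 <= p j) -> (forall n, 0 <= 1 - \sum_(j < n) p j) ->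
  (exists B, forall n, \sum_(k < n) (1 - \sum_(j < k) p j) <= B) ->
  (forall n, a n = b n + \sum_(j < n) p j * a (n.-1 - j)%N) ->
  (forall n, `|a n| <= A) -> series b @ \oo --> (0 : R) ->
  (exists k0, forall k, (k0 <= k)%N -> shifts p k) -> a @ \oo --> (0 : R).
Proof.
move=> p0 r0 rs aE aA bs ap.
have [l l_up l_fr] := limsup_exists aA.
have l0 := limsup_le0 p0 r0 rs aE aA bs ap l_up l_fr.
have aA' n : `|- a n| <= A by rewrite normrN.
have aE' n : - a n = - b n + \sum_(j < n) p j * - a (n.-1 - j)%N.
  by rewrite [in LHS]aE opprD -sumrN; congr (_ + _); apply: eq_bigr => j _; rewrite mulrN.
have bs' : series (fun n => - b n) @ \oo --> (0 : R).
  rewrite -oppr0; apply: eq_cvgn (cvgN bs) => n.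
  by rewrite /series/= sumrN.
have [l' l'_up l'_fr] := limsup_exists aA'.
have l'0 := limsup_le0 p0 r0 rs aE' aA' bs' ap l'_up l'_fr.
apply/cvgr0Pnorm_le => e e0.
have [N1 h1] := l_up _ e0; have [N2 h2] := l'_up _ e0.
near=> n; rewrite ler_norml; apply/andP; split.
  rewrite lerNl; apply: le_trans (h2 n _) _; first by near: n; exact: nbhs_infty_ge.
  by rewrite gerDr.
apply: le_trans (h1 n _) _; first by near: n; exact: nbhs_infty_ge.
by rewrite gerDr.
Unshelve. all: by end_near.
Qed.

(** * Regeneration and cyclic classes *)

Section series_lemmas.
Context {R : realType}.

Lemma cvg_sum_ord (n : nat) (u : nat -> nat -> R) (l : nat -> R) :
  (forall i, (i < n)%N -> u i @ \oo --> l i) ->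
  (fun N => \sum_(i < n) u i N) @ \oo --> \sum_(i < n) l i.
Proof.
elim: n => [_|n IH ul].
  by under eq_fun do rewrite big_ord0; rewrite big_ord0; exact: cvg_cst.
under eq_fun do rewrite big_ord_recr; rewrite big_ord_recr/=; apply: cvgD; last exact: ul.
by apply: IH => i iN; apply: ul; rewrite ltnW.
Qed.

Lemma geometric_sum_le (k : R) n : 0 <= k < 1 -> \sum_(i < n) k ^+ i <= (1 - k)^-1.
Proof.
move=> /andP[k0 k1]; have k1' : 0 < 1 - k by rewrite subr_gt0.
rewrite -[leRHS]mul1r ler_pdivlMr// mulrC.
have -> : (1 - k) * \sum_(i < n) k ^+ i = 1 - k ^+ n.
  elim: n => [|n IH]; first by rewrite big_ord0 mulr0 subrr.
  by rewrite big_ord_recr/= mulrDr IH exprS; ring.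
by rewrite gerBl exprn_ge0.
Qed.

Lemma geometric_cvg0 (k c : R) : 0 <= k < 1 -> (fun n => c * k ^+ n) @ \oo --> (0 : R).
Proof.
move=> /andP[k0 k1]; rewrite -[X in _ --> X](mulr0 c); apply: cvgM; first exact: cvg_cst.
by apply: cvg_expr; rewrite ger0_norm.
Qed.

Lemma convolution_cvg0 (w u : nat -> R) (k c A : R) : 0 <= k < 1 -> 0 <= c ->
  (forall j, 0 <= w j <= c * k ^+ j) -> (forall n, `|u n| <= A) ->
  u @ \oo --> (0 : R) -> (fun n => \sum_(j < n) u (n.-1 - j)%N * w j) @ \oo --> (0 : R).
Proof.
move=> k01 c0 wc uA u0; have A0 : 0 <= A by exact: le_trans (normr_ge0 _) (uA 0%N).
have /andP[k0 k1] := k01; have k1' : 0 < 1 - k by rewrite subr_gt0.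
apply/cvgr0Pnorm_le => e e0.
pose Z := c / (1 - k); have Z0 : 0 <= Z by rewrite divr_ge0// ltW.
have Z1 : 0 < Z + 1 by rewrite ltr_wpDl.
have e2 : 0 < e / 2 / (Z + 1) by rewrite !divr_gt0.
have /cvgr0Pnorm_le/(_ _ e2)[N _ hN] := u0.
have gc : (fun n => A * Z * k ^+ n) @ \oo --> (0 : R) by exact: geometric_cvg0.
have /cvgr0Pnorm_le/(_ _ (divr_gt0 e0 (ltr0n _ 2)))[N' _ hN'] := gc.
exists (N + N')%N => // n /= nNN.
have Nn : (N <= n)%N by apply: leq_trans nNN; exact: leq_addr.
apply: le_trans (ler_norm_sum _ _ _) _.
apply: (@le_trans _ _ (\sum_(j < n) (e / 2 / (Z + 1) * (c * k ^+ j) +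
    A * (if (j < n - N)%N then 0 else c * k ^+ j)))).
  apply: ler_sum => j _; have /andP[w0 w1] := wc j.
  rewrite normrM (ger0_norm w0).
  case: ifPn => jn.
    rewrite mulr0 addr0 ler_pM//; apply: hN => /=.
    by rewrite -subn1 -subnDA add1n leq_subRL// addSn addnC -ltn_subRL.
  rewrite -[leLHS]add0r; apply: lerD; last exact: ler_pM.
  by rewrite mulr_ge0 ?(ltW e2)// (le_trans w0).
rewrite big_split/= -!mulr_sumr [e in leRHS]splitr; apply: lerD.
  apply: (@le_trans _ _ (e / 2 / (Z + 1) * Z)).
    by rewrite ler_wpM2l ?(ltW e2)// ler_wpM2l// geometric_sum_le.
  rewrite mulrAC ler_pdivrMr// ler_wpM2l ?divr_ge0 ?(ltW e0)//.
  by rewrite lerDl.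
have -> : \sum_(j < n) (if (j < n - N)%N then 0 else c * k ^+ j) =
    \sum_(j < N) c * k ^+ (n - N + j).
  rewrite -(big_mkord xpredT (fun j => if (j < n - N)%N then 0 else c * k ^+ j)).
  rewrite (@big_cat_nat _ _ _ (n - N)) ?leq_subr//= big_nat big1 ?add0r; last first.
    by move=> j /andP[_ ->].
  rewrite -{1}(add0n (n - N)%N) big_addn subKn// big_mkord; apply: eq_bigr => j _.
  by rewrite ltnNge leq_addl addnC.
under eq_bigr do rewrite exprD mulrA.
rewrite -mulr_sumr.
have := hN' (n - N)%N (ltac:(by rewrite /= leq_subRL) : (N' <= n - N)%N).
rewrite ger0_norm; last by rewrite mulr_ge0 ?exprn_ge0// mulr_ge0.
move=> h; apply: le_trans h.
have -> : A * Z * k ^+ (n - N) = A * (c * k ^+ (n - N) * (1 - k)^-1) by rewrite /Z; ring.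
by rewrite ler_wpM2l// ler_wpM2l ?geometric_sum_le// mulr_ge0// exprn_ge0.
Qed.

End series_lemmas.

Section regeneration.
Context {R : realType}.
Variables (W : R -> R) (phi0 : R).
Variables (K : R -> (R -> R) -> R -> R) (nu : (R -> R) -> R).
Variables (pi : R -> (R -> R) -> R).
Variables (C : set R) (theta rho Cpi M : R).
Hypothesis rf : regular_family W phi0 K nu pi C theta rho Cpi M.
Variable s : R.
Hypothesis Ss : phi0 < s <= 1.

Local Notation Ks := (K s).
Local Notation Q := (residual (K s) nu C theta).
Local Notation mu := (pi s).

Let mW := rf_meas rf.
Let W1 := rf_ge1 rf.
Let pnu := rf_nu rf.
Let pmu := rf_pi rf Ss.
Let theta0 := rf_theta rf.
Let W0 x : 0 <= W x. Proof. exact: le_trans (W1 x). Qed.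
Let LW : wbounded W W. Proof. exact: wbounded_self. Qed.
Let rho_itv : 0 <= rho < 1.
Proof. by have /andP[/ltW -> ->] := rf_rho rf. Qed.
Let rho0 : 0 <= rho. Proof. by case/andP: rho_itv. Qed.
Let rho1' : 0 < 1 - rho. Proof. by rewrite subr_gt0; case/andP: rho_itv. Qed.
Let pQ : positive_operator W Q. Proof. exact: (residual_operator rf). Qed.
Let pK : positive_operator W Ks. Proof. exact: (rf_pos rf). Qed.
Let QW : forall x, Q W x <= rho * W x. Proof. exact: (rf_drift rf). Qed.
Let Lc a : wbounded W (cst a). Proof. exact: wbounded_cst. Qed.
Let nuW0 : 0 <= nu W. Proof. exact: le_trans (nuW1 rf). Qed.

(* [ee j x] is the probability that the split chain started at [x] regenerates
   for the first time at time [j + 1]. *)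
Definition ee j : R -> R := iter j Q (theta *: \1_C).

Let LT : wbounded W (theta *: \1_C : R -> R).
Proof. by apply: wboundedZ; apply: wbounded_indic => //; exact: (rf_C rf). Qed.

Let T0 x : 0 <= (theta *: \1_C : R -> R) x.
Proof. by rewrite !fctE /GRing.scale/= mulr_ge0// ltW. Qed.

Lemma ee_wb j : wbounded W (ee j). Proof. exact: (po_iter_wb pQ). Qed.

Lemma ee_ge0 j x : 0 <= ee j x. Proof. exact: (po_iter_ge0 pQ). Qed.

Let TW x : `|(theta *: \1_C : R -> R) x| <= theta * W x.
Proof.
rewrite ger0_norm// !fctE /GRing.scale/= ler_wpM2l ?(ltW theta0)// (le_trans _ (W1 x))//.
Qed.

Lemma ee_le j x : ee j x <= theta * rho ^+ j * W x.
Proof.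
rewrite -[leLHS]ger0_norm ?ee_ge0//.
exact: (po_iter_contract pQ j LW QW rho0 (ltW theta0) LT TW).
Qed.

Lemma eeS j : Q (ee j) = ee j.+1. Proof. by []. Qed.

Let Q1 : Q (cst 1) = cst 1 - theta *: \1_C.
Proof. by apply: residual1; [exact: (rf_cst rf)|exact: (rf_nu1 rf)]. Qed.

Lemma sum_ee n : \sum_(j < n) ee j = cst 1 - iter n Q (cst 1).
Proof.
elim: n => [|n IH]; first by rewrite big_ord0 subrr.
rewrite big_ord_recr/= IH -iterS iterSr Q1 (po_iterB pQ)//.
by rewrite opprB addrA addrAC.
Qed.

Lemma iterQ_le (f : R -> R) c n x : 0 <= c -> wbounded W f ->
  (forall y, `|f y| <= c * W y) -> `|iter n Q f x| <= c * rho ^+ n * W x.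
Proof. by move=> c0 Lf fc; exact: (po_iter_contract pQ n LW QW rho0 c0 Lf fc). Qed.

Let one_le y : `|(cst 1 : R -> R) y| <= 1 * W y.
Proof. by rewrite mul1r normr1. Qed.

(** The law of the gaps between regenerations, each of which restarts the split chain from [nu]; the
    index j stands for a gap of length j + 1. *)
Definition rp j := nu (ee j).

Lemma rp_ge0 j : 0 <= rp j.
Proof. by apply: (pl_ge0 pnu); [exact: ee_wb|exact: ee_ge0]. Qed.

Lemma sum_rp n : 1 - \sum_(j < n) rp j = nu (iter n Q (cst 1)).
Proof.
rewrite -(pl_sum W0 pnu (F := ee)) ?sum_ee; last by move=> i _; exact: ee_wb.
rewrite (plB pnu) ?(rf_nu1 rf)//; last exact: (po_iter_wb pQ).
by ring.
Qed.

Let nu_bound (f : R -> R) c : wbounded W f -> (forall x, `|f x| <= c * W x) -> `|nu f| <= c * nu W.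
Proof.
move=> Lf fc; rewrite -(plZ pnu)//; apply: (pl_norm pnu) => //; exact: wboundedZ.
Qed.

Lemma rp_tail_ge0 n : 0 <= 1 - \sum_(j < n) rp j.
Proof.
rewrite sum_rp; apply: (pl_ge0 pnu); first exact: (po_iter_wb pQ).
by apply: (po_iter_ge0 pQ) => // x; exact: ler01.
Qed.

Lemma rp_tail_le n : 1 - \sum_(j < n) rp j <= rho ^+ n * nu W.
Proof.
rewrite sum_rp; apply: le_trans (ler_norm _) _; apply: nu_bound.
  exact: (po_iter_wb pQ).
by move=> x; rewrite -[rho ^+ n]mul1r; exact: iterQ_le.
Qed.

Lemma rp_gt0_exists : exists j, 0 < rp j.
Proof.
apply: contrapT => /forallNP H.
have rp0 j : rp j = 0.
  by apply/eqP; rewrite eq_le rp_ge0 andbT leNgt; apply/negP; exact: H.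
have := geometric_cvg0 (nu W) rho_itv => /cvgr0Pnorm_le/(_ _ (ltac:(by []) : 0 < 2^-1 :> R)).
move=> [N _ /(_ N (leqnn _))] /=; rewrite ger0_norm ?mulr_ge0 ?exprn_ge0// mulrC => h.
have := rp_tail_le N; rewrite big1 ?subr0 => [|j _]; last exact: rp0.
by move=> /le_trans/(_ h); lra.
Qed.

(** Decomposition at the first regeneration: either there is none in n steps, or it occurs at time j
    + 1, and the chain restarts from [nu] with n - 1 - j steps left. *)
Lemma iterK_decomp n (f : R -> R) : wbounded W f ->
  iter n Ks f = iter n Q f + \sum_(j < n) nu (iter (n.-1 - j)%N Ks f) *: ee j.
Proof.
move=> Lf; elim: n => [|n IH]; first by rewrite big_ord0 addr0.
have LK : wbounded W (iter n Ks f) by exact: (po_iter_wb pK).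
rewrite iterS (kernel_residual Ks nu C theta (iter n Ks f)) {1}IH.
have LS i : (i < n)%N -> wbounded W (nu (iter (n.-1 - i)%N Ks f) *: ee i).
  by move=> _; apply: wboundedZ; exact: ee_wb.
rewrite (poD pQ); [|exact: (po_iter_wb pQ)|exact: (wbounded_sum W0 LS)].
rewrite (po_sum W0 pQ LS) -iterS -addrA; congr (_ + _).
rewrite [RHS]big_ord_recl/= subn0 addrC; congr (_ + _).
  by rewrite mulrC -scalerA.
apply: eq_bigr => j _; rewrite (poZ pQ); last exact: ee_wb.
rewrite /bump/= add1n eeS; congr (nu (iter _ _ _) *: _).
by rewrite -subn1 -subnDA add1n.
Qed.

Let B0 := theta * nu W / (1 - rho).

Let iterK_W n x : 0 <= iter n Ks W x <= W x + B0.
Proof.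
apply/andP; split; first exact: (po_iter_ge0 pK).
have B00 : 0 <= B0 by rewrite divr_ge0 ?mulr_ge0// ltW.
suff: iter n Ks W x <= rho ^+ n * W x + B0 * (1 - rho ^+ n).
  have rn : 0 <= rho ^+ n <= 1 by rewrite exprn_ge0// exprn_ile1// ltW//; case/andP: rho_itv.
  by have := W0 x; nra.
elim: n x => [|n IH] x; first by rewrite expr0 mul1r subrr mulr0 addr0.
rewrite iterS; apply: (@le_trans _ _ (Ks (rho ^+ n *: W + (B0 * (1 - rho ^+ n)) *: cst 1) x)).
  apply: (pl_le (po_pl pK x)); first exact: (po_iter_wb pK).
    by apply: wboundedD; exact: wboundedZ.
  move=> y; apply: le_trans (IH y) _.
  by rewrite !fctE/= /GRing.scale/= mulr1.
rewrite (plD (po_pl pK x)) ?(plZ (po_pl pK x))//; try exact: wboundedZ.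
rewrite (rf_cst rf Ss) mulr1.
have -> : rho ^+ n.+1 * W x + B0 * (1 - rho ^+ n.+1) =
  rho ^+ n * (rho * W x + theta * nu W) + B0 * (1 - rho ^+ n).
  by rewrite /B0 exprS; field; rewrite gt_eqF.
by rewrite lerD2r ler_wpM2l ?exprn_ge0// (kernel_W rf Ss).
Qed.

Let iterK_bound (f : R -> R) c n x : wbounded W f -> 0 <= c -> (forall y, `|f y| <= c * W y) ->
  `|iter n Ks f x| <= c * (1 + B0) * W x.
Proof.
move=> Lf c0 fc.
have pKn : positive_linear W ((fun f => iter n Ks f)^~ x).
  split=> [f1 f2 L1 L2|a f1 L1|f1 L1 f10].
  - by rewrite (po_iterD pK).
  - by rewrite (po_iterZ pK).
  - exact: (po_iter_ge0 pK).
have := pl_norm pKn Lf (wboundedZ c LW) fc => /le_trans; apply.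
rewrite (plZ pKn)// -mulrA ler_wpM2l//; have /andP[_ /le_trans] := iterK_W n x; apply.
have B00 : 0 <= B0 by rewrite divr_ge0 ?mulr_ge0// ltW.
by rewrite mulrDl mul1r lerD2l ler_peMr.
Qed.

Lemma renewal_equation (f : R -> R) n : wbounded W f ->
  nu (iter n Ks f) = nu (iter n Q f) + \sum_(j < n) rp j * nu (iter (n.-1 - j)%N Ks f).
Proof.
move=> Lf; have LS i : (i < n)%N -> wbounded W (nu (iter (n.-1 - i)%N Ks f) *: ee i).
  by move=> _; apply: wboundedZ; exact: ee_wb.
rewrite {1}(iterK_decomp n Lf) (plD pnu); [|exact: (po_iter_wb pQ)|exact: (wbounded_sum W0 LS)].
rewrite (pl_sum W0 pnu LS); congr (_ + _); apply: eq_bigr => j _.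
by rewrite (plZ pnu) 1?mulrC//; exact: ee_wb.
Qed.

(** Starting at [x] instead of [nu] only adds a convolution with the first regeneration time, whose
    probabilities decay geometrically. *)
Lemma iterK_cvg0 (f : R -> R) x : wbounded W f ->
  (fun n => nu (iter n Ks f)) @ \oo --> (0 : R) -> (fun n => iter n Ks f x) @ \oo --> (0 : R).
Proof.
move=> Lf a0; have [c c0 fc] := wboundedP W0 Lf.
have B00 : 0 <= B0 by rewrite divr_ge0 ?mulr_ge0// ltW.
have aA n : `|nu (iter n Ks f)| <= c * (1 + B0) * nu W.
  apply: nu_bound; first exact: (po_iter_wb pK).
  by move=> y; exact: iterK_bound.
have wb j : 0 <= ee j x <= theta * W x * rho ^+ j.
  by rewrite ee_ge0 mulrAC ee_le.
have h := convolution_cvg0 rho_itv (mulr_ge0 (ltW theta0) (W0 x)) wb aA a0.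
have h1 : (fun n => iter n Q f x) @ \oo --> (0 : R).
  apply/cvgr0Pnorm_le => e e0.
  have /cvgr0Pnorm_le/(_ _ e0)[N _ hN] := geometric_cvg0 (c * W x) rho_itv.
  exists N => // n Nn; apply: le_trans (hN n Nn); rewrite mulrAC.
  by apply: le_trans (iterQ_le n x c0 Lf fc) _; exact: ler_norm.
have -> : (fun n => iter n Ks f x) = (fun n => iter n Q f x +
    \sum_(j < n) nu (iter (n.-1 - j)%N Ks f) * ee j x).
  by apply/funext => n; rewrite (iterK_decomp n Lf) [in LHS]fctE fct_sumE.
by rewrite -[X in _ --> X]addr0; exact: cvgD.
Qed.

(* Kac's formula in the form of a remainder identity. *)
Lemma kac (f : R -> R) N : wbounded W f ->
  mu f = mu (iter N Q f) + theta * mu \1_C * \sum_(n < N) nu (iter n Q f).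
Proof.
move=> Lf; elim: N => [|N IH]; first by rewrite big_ord0 mulr0 addr0.
rewrite big_ord_recr/= IH.
have LQ : wbounded W (iter N Q f) by exact: (po_iter_wb pQ).
rewrite (@pi_residual _ W Ks nu mu C theta W1 pK pmu (rf_inv rf Ss) (rf_C rf) _ LQ).
by ring.
Qed.


Lemma kac_limit (f : R -> R) : wbounded W f ->
  (fun N => theta * mu \1_C * \sum_(n < N) nu (iter n Q f)) @ \oo --> mu f.
Proof.
move=> Lf; have [c c0 fc] := wboundedP W0 Lf.
have h : (fun N => mu (iter N Q f)) @ \oo --> (0 : R).
  apply/cvgr0Pnorm_le => e e0.
  have /cvgr0Pnorm_le/(_ _ e0)[N _ hN] := geometric_cvg0 (c * mu W) rho_itv.
  exists N => // n Nn; apply: le_trans (hN n Nn); rewrite mulrAC.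
  apply: le_trans (ler_norm _); rewrite -(plZ pmu)//; apply: (pl_norm pmu).
  - exact: (po_iter_wb pQ).
  - exact: wboundedZ.
  - by move=> y; exact: iterQ_le.
have -> : (fun N => theta * mu \1_C * \sum_(n < N) nu (iter n Q f)) =
    (fun N => mu f - mu (iter N Q f)).
  by apply/funext => N; rewrite (kac N Lf); ring.
by rewrite -[X in _ --> X]subr0; apply: cvgB => //; exact: cvg_cst.
Qed.

(** By Kac's formula [mu] is proportional to the occupation measure of an excursion started from
    [nu]. *)
Lemma pi_eq0 (f : R -> R) : wbounded W f -> (forall n, nu (iter n Q f) = 0) -> mu f = 0.
Proof.
move=> Lf f0; apply: (cvgn_unique (kac_limit Lf)).
have -> : (fun N => theta * mu \1_C * \sum_(n < N) nu (iter n Q f)) = (fun=> 0).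
  by apply/funext => N; rewrite big1 ?mulr0.
exact: cvg_cst.
Qed.

Let iterQ_pl n : positive_linear W (fun f => nu (iter n Q f)).
Proof.
split=> [f1 f2 L1 L2|a f1 L1|f1 L1 f10].
- by rewrite (po_iterD pQ)// (plD pnu)//; exact: (po_iter_wb pQ).
- by rewrite (po_iterZ pQ)// (plZ pnu)//; exact: (po_iter_wb pQ).
- by apply: (pl_ge0 pnu); [exact: (po_iter_wb pQ)|exact: (po_iter_ge0 pQ)].
Qed.

Section cyclic_classes.
Variable q : nat.
Hypothesis per : has_period rp q.

Let q0 : (0 < q)%N. Proof. by case: per. Qed.

Let rp_eq0 j : ~~ (q %| j.+1)%N -> rp j = 0.
Proof.
move=> qj; apply/eqP; rewrite eq_le rp_ge0 andbT leNgt; apply/negP => rj.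
by case: per => _ /(_ _ rj) qj' _; rewrite qj' in qj.
Qed.

Definition Qq : (R -> R) -> R -> R := iter q Q.

Let pQq : positive_operator W Qq.
Proof.
split=> [x|f Lf]; last exact: (po_iter_wb pQ).
split=> [f1 f2 L1 L2|a f1 L1|f1 L1 f10].
- by rewrite /Qq (po_iterD pQ).
- by rewrite /Qq (po_iterZ pQ).
- exact: (po_iter_ge0 pQ).
Qed.

Let rhoq : 0 <= rho ^+ q < 1.
Proof. by rewrite exprn_ge0//= exprn_ilt1// -?lt0n//; case/andP: rho_itv. Qed.

Let QqW x : Qq W x <= rho ^+ q * W x.
Proof.
apply: le_trans (ler_norm _) _; rewrite -[rho ^+ q]mul1r.
by apply: iterQ_le => // y; rewrite mul1r ger0_norm.
Qed.

Let iterQq m f : iter m Qq f = iter (m * q) Q f.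
Proof. by rewrite iterM. Qed.

(* [cls r x] is the probability that the split chain started at [x] first
   regenerates at a time congruent to [r + 1] modulo [q]. *)
Definition cls r : R -> R := neumann Qq (ee r).

Lemma cls_wb r : wbounded W (cls r).
Proof. exact: (neumann_wb W0 pQq rhoq mW QqW (ee_wb r)). Qed.

Lemma cls_cvg r x : series (fun m => ee (m * q + r)%N x) @ \oo --> cls r x.
Proof.
have -> : (fun m => ee (m * q + r)%N x) = (fun m => iter m Qq (ee r) x).
  by apply/funext => m; rewrite iterQq /ee -iterD.
exact: (neumann_cvg W0 pQq rhoq mW QqW (ee_wb r)).
Qed.

Let cls_tail I r : positive_linear W I ->
  series (fun m => I (ee (m * q + r)%N)) @ \oo --> I (cls r).
Proof.
move=> pI; have -> : (fun m => I (ee (m * q + r)%N)) = (fun m => I (iter m Qq (ee r))).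
  by apply/funext => m; rewrite iterQq /ee -iterD.
exact: (neumann_tail_fun W0 pQq rhoq mW QqW pI (ee_wb r)).
Qed.

Lemma cls_ge0 r x : 0 <= cls r x.
Proof.
apply: (cvgr_to_ge (cls_cvg (r := r) (x := x))); near=> n.
by apply: sumr_ge0 => i _; exact: ee_ge0.
Unshelve. all: by end_near.
Qed.

Lemma sum_cls x : \sum_(r < q) cls r x = 1.
Proof.
have h1 := @cvg_sum_ord R q (fun r N => series (fun m => ee (m * q + r)%N x) N) (cls^~ x)
  (fun r _ => cls_cvg (r := r) (x := x)).
apply: (cvgn_unique h1).
have E N : \sum_(r < q) series (fun m => ee (m * q + r)%N x) N = 1 - iter (N * q) Q (cst 1) x.
  transitivity ((\sum_(j < N * q) ee j) x); last by rewrite sum_ee.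
  rewrite fct_sumE; elim: N => [|N IH].
    by rewrite mul0n big_ord0 big1// => r _; rewrite /series/= big_nil.
  rewrite mulSn addnC big_split_ord/= -IH -big_split/=; apply: eq_bigr => r _.
  by rewrite /series/= big_nat_recr.
have h : (fun N => iter (N * q) Q (cst 1) x) @ \oo --> (0 : R).
  apply/cvgr0Pnorm_le => e e0.
  have /cvgr0Pnorm_le/(_ _ e0)[N _ hN] := geometric_cvg0 (W x) rho_itv.
  exists N => // n Nn.
  apply: le_trans (iterQ_le (n * q) x ler01 (Lc 1) one_le) _.
  rewrite mul1r mulrC; apply: le_trans (ler_norm _) _; apply: hN => /=.
  by apply: leq_trans Nn _; rewrite leq_pmulr.
have -> : (fun N => \sum_(r < q) series (fun m => ee (m * q + r)%N x) N) =
    (fun N => 1 - iter (N * q) Q (cst 1) x) by apply/funext => N; exact: E.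
by rewrite -[X in _ --> X]subr0; apply: cvgB => //; exact: cvg_cst.
Qed.

Lemma cls_le1 r x : (r < q)%N -> cls r x <= 1.
Proof.
move=> rq; rewrite -(sum_cls x) (bigD1 (Ordinal rq))//= lerDl.
by apply: sumr_ge0 => i _; exact: cls_ge0.
Qed.

(* From [nu], class [r] can only be reached at times congruent to [- (r + 1)]. *)
Lemma iterQ_cls n r : ~~ (q %| n + r.+1)%N -> nu (iter n Q (cls r)) = 0.
Proof.
move=> nr; apply: (cvgn_unique (cls_tail (r := r) (iterQ_pl n))).
have -> : series (fun m => nu (iter n Q (ee (m * q + r)%N))) = (fun=> 0).
  apply/funext => N; rewrite /series/= big1// => m _.
  rewrite /ee -iterD -/(ee _) -/(rp _) rp_eq0//.
  by rewrite -addnS -addnS addnCA dvdn_addr// dvdn_mull.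
exact: cvg_cst.
Qed.

(** The function [f] is unbounded, so it is split by |f| cls <= d f^2 + cls / d: the last term has
    mean 0 by [iterQ_cls] and d is arbitrarily small. *)
Lemma iterQ_cls_mul n r (f : R -> R) : (r < q)%N -> ~~ (q %| n + r.+1)%N ->
  wbounded W f -> wbounded W (fun x => f x ^+ 2) ->
  nu (iter n Q (fun x => f x * cls r x)) = 0.
Proof.
move=> rq nr Lf Lf2; have pI := iterQ_pl n.
apply/eqP; rewrite -normr_le0; apply/ler_addgt0Pr => e e0; rewrite add0r.
set I2 := nu (iter n Q (fun x => f x ^+ 2)).
have I20 : 0 <= I2 by apply: (pl_ge0 pI) => // x; exact: sqr_ge0.
pose d := e / (I2 + 1).
have I21 : 0 < I2 + 1 by rewrite ltr_wpDl.
have d0 : 0 < d by rewrite divr_gt0.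
have Lc' := cls_wb r.
have L1 : wbounded W (d *: (fun x => f x ^+ 2) + d^-1 *: cls r).
  by apply: wboundedD; exact: wboundedZ.
apply: le_trans (pl_norm pI _ L1 _) _.
- apply: (wbounded_mono Lf).
    by apply: measurable_funM; [exact: wbounded_meas Lf|exact: wbounded_meas Lc'].
  by move=> x; rewrite normrM ler_piMr// ger0_norm ?cls_ge0// cls_le1.
- move=> x; rewrite !fctE/= /GRing.scale/= normrM (ger0_norm (cls_ge0 _ _)).
  have c0 := cls_ge0 r x; have c1 := cls_le1 x rq.
  have h : `|f x| <= d * f x ^+ 2 + d^-1.
    have : 0 <= d^-1 * (d * `|f x| - 2^-1) ^+ 2 by rewrite mulr_ge0 ?sqr_ge0// invr_ge0 ltW.
    have -> : d^-1 * (d * `|f x| - 2^-1) ^+ 2 = d * `|f x| ^+ 2 - `|f x| + d^-1 / 4.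
      by field; rewrite gt_eqF.
    rewrite real_normK ?num_real//.
    have : 0 < d^-1 by rewrite invr_gt0.
    lra.
  have f20 : 0 <= d * f x ^+ 2 by rewrite mulr_ge0 ?sqr_ge0// ltW.
  by nra.
- rewrite (plD pI) ?(plZ pI)//; try exact: wboundedZ.
  rewrite iterQ_cls// mulr0 addr0 -/I2 /d mulrAC ler_pdivrMr// ler_wpM2l ?(ltW e0)//.
  by rewrite lerDl.
Qed.

(** The residual kernel shifts the index of [ee] by one, and the rank-one part contributes nothing
    because [nu] charges only the class of index q - 1. *)
Lemma Q_cls r : (0 < r < q)%N -> Ks (cls r.-1) = cls r.
Proof.
case: r => // r /= rq; apply/funext => x.
rewrite (kernel_residual Ks nu C theta (cls r)).
have -> : nu (cls r) = 0.
  have := @iterQ_cls 0 r; rewrite /= add0n; apply.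
  by rewrite gtnNdvd.
rewrite mulr0 scale0r addr0.
apply: (cvgn_unique (cls_tail (r := r) (po_pl pQ x))).
have := cls_cvg (r := r.+1) (x := x).
have -> : (fun m => ee (m * q + r.+1)%N x) = (fun m => Q (ee (m * q + r)%N) x).
  by apply/funext => m; rewrite addnS.
by [].
Qed.

Lemma pi_cls r : (r < q)%N -> mu (cls r) = q%:R^-1.
Proof.
have e r1 : (r1 < q)%N -> mu (cls r1) = mu (cls 0%N).
  elim: r1 => [//|r1 IH] rq; rewrite -(Q_cls (r := r1.+1))// (rf_inv rf Ss) ?IH//=.
    exact: ltnW.
  exact: cls_wb.
have S : \sum_(r < q) mu (cls r) = 1.
  rewrite -(pl_sum W0 pmu (F := cls)); last by move=> i _; exact: cls_wb.
  rewrite -(rf_pi1 rf Ss); congr mu; apply/funext => x.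
  by rewrite fct_sumE sum_cls.
move=> rq; rewrite e//; have qn0 : q%:R != 0 :> R by rewrite pnatr_eq0 -lt0n.
apply: (mulfI qn0); rewrite divff// -[RHS]S (eq_bigr (fun=> mu (cls 0%N))); last first.
  by move=> i _; exact: e.
by rewrite sumr_const card_ord mulr_natl.
Qed.

(** At each time of an excursion from [nu] only one residue class is charged, so one of the two
    factors vanishes along the occupation measure. *)
Lemma pi_cls_mul r t : (r < q)%N -> (t < q)%N -> r != t ->
  mu (fun x => cls r x * cls t x) = 0.
Proof.
move=> rq tq rt.
have Lp : wbounded W (fun x => cls r x * cls t x).
  apply: (wbounded_mono (cls_wb r)).
    by apply: measurable_funM; exact: wbounded_meas (cls_wb _).
  by move=> x; rewrite normrM ler_piMr// ger0_norm ?cls_ge0// cls_le1.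
apply: pi_eq0 => // n.
have key u v : (u < q)%N -> (v < q)%N -> ~~ (q %| n + u.+1)%N ->
    wbounded W (fun x => cls u x * cls v x) -> nu (iter n Q (fun x => cls u x * cls v x)) = 0.
  move=> uq vq nu0 Luv; apply/eqP; rewrite eq_le; apply/andP; split.
    rewrite -(iterQ_cls nu0); apply: (pl_le (iterQ_pl n)) => //; first exact: cls_wb.
    by move=> x; rewrite ler_piMr ?cls_ge0// cls_le1.
  by apply: (pl_ge0 (iterQ_pl n)) => // x; rewrite mulr_ge0 ?cls_ge0.
have [nr|nr] := boolP (q %| n + r.+1)%N; last exact: key.
have nt : ~~ (q %| n + t.+1)%N.
  apply: contra rt => nt; apply/eqP.
  have [m [rm tm]] : exists m, (n + r.+1 = m + r.+1 /\ n + t.+1 = m + t.+1)%N by exists n.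
  have : (r.+1 = t.+1 %[mod q])%N.
    by apply/eqP; rewrite -(eqn_modDl n) (eqP nr) (eqP nt).
  by move=> /eqP; rewrite -addn1 -(addn1 t) eqn_modDr !modn_small// => /eqP.
under eq_fun do rewrite mulrC.
apply: key => //; by under eq_fun do rewrite mulrC.
Qed.

(** The classes sum to 1 and their pairwise products have mean 0, so each is an indicator up to a
    null set of [mu]. *)
Lemma pi_cls_indic r : (r < q)%N -> mu (fun x => cls r x * (1 - cls r x)) = 0.
Proof.
move=> rq.
have Lp t : (t < q)%N -> wbounded W (fun x => cls r x * cls t x).
  move=> tq; apply: (wbounded_mono (cls_wb r)).
    by apply: measurable_funM; exact: wbounded_meas (cls_wb _).
  by move=> x; rewrite normrM ler_piMr// ger0_norm ?cls_ge0// cls_le1.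
have -> : (fun x => cls r x * (1 - cls r x)) =
    \sum_(t < q) (if t == r :> nat then 0 else (fun x => cls r x * cls t x)).
  apply/funext => x; rewrite fct_sumE -{1}(sum_cls x).
  rewrite (bigD1 (Ordinal rq))//= [in RHS](bigD1 (Ordinal rq))//= eqxx add0r.
  rewrite addrAC subrr add0r mulr_sumr; apply: eq_bigr => t.
  by rewrite -val_eqE/= => /negbTE ->.
rewrite (pl_sum W0 pmu (F := fun t => if t == r then 0 else (fun x => cls r x * cls t x))).
  apply: big1 => t _; case: eqP => [_|/eqP tr]; first exact: (pl0 pmu).
  by apply: pi_cls_mul => //; rewrite eq_sym.
by move=> t tq; case: eqP => _; [exact: (Lc 0)|exact: Lp].
Qed.

Let block_sum (F : nat -> R) m : \sum_(j < m * q) F j = \sum_(i < m) \sum_(t < q) F (i * q + t)%N.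
Proof.
elim: m => [|m IH]; first by rewrite mul0n !big_ord0.
by rewrite mulSn addnC big_split_ord/= IH [in RHS]big_ord_recr.
Qed.

Let modq_pred i t : (t < q)%N -> (q %| (i * q + t).+1)%N = (t == q.-1).
Proof.
move=> tq; rewrite -addnS dvdn_addr ?dvdn_mull//.
move: tq; rewrite leq_eqVlt => /orP[/eqP <-|tq]; first by rewrite dvdnn/= eqxx.
rewrite gtnNdvd//; apply/esym/negbTE; rewrite neq_ltn -(ltn_add2r 1) !addn1 prednK//.
by rewrite tq.
Qed.

Section limit.
Variables (h gb : R -> R).
Hypotheses (Lh : wbounded W h) (Lgb : wbounded W gb) (Lgb2 : wbounded W (fun x => gb x ^+ 2)).
Hypotheses (hE : Ks h = h - gb) (nuh : nu h = 0).
Hypothesis cls0 : forall r, (r < q)%N -> mu (fun x => gb x * cls r x) = 0.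

(** The occupation sum of an excursion from [nu], restricted to times congruent to r modulo q. *)
Let B r (f : R -> R) := nu (neumann Qq (iter r Q f)).

Let B_cvg r f : wbounded W f -> series (fun m => nu (iter (m * q + r) Q f)) @ \oo --> B r f.
Proof.
move=> Lf.
have -> : (fun m => nu (iter (m * q + r) Q f)) = (fun m => nu (iter m Qq (iter r Q f))).
  by apply/funext => m; rewrite iterQq -iterD.
apply: (neumann_tail_fun W0 pQq rhoq mW QqW pnu); exact: (po_iter_wb pQ).
Qed.

Let thC : 0 < theta * mu \1_C.
Proof.
rewrite mulr_gt0//; apply: (pi_small_gt0 mW W1 pK pnu pmu (rf_pi1 rf Ss) (rf_inv rf Ss)
  (rf_C rf) (rf_rho rf) (rf_res rf Ss) (rf_drift rf Ss)).
Qed.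

Let kac_block f : wbounded W f -> mu f = 0 ->
  (fun m => \sum_(j < m * q) nu (iter j Q f)) @ \oo --> (0 : R).
Proof.
move=> Lf f0; have := kac_limit Lf; rewrite f0 => kl.
have h1 : (fun N => \sum_(j < N) nu (iter j Q f)) @ \oo --> (0 : R).
  have -> : (fun N => \sum_(j < N) nu (iter j Q f)) = (fun N => (theta * mu \1_C)^-1 *
      (theta * mu \1_C * \sum_(j < N) nu (iter j Q f))).
    by apply/funext => N; rewrite mulKf// gt_eqF.
  by rewrite -[X in _ --> X](mulr0 (theta * mu \1_C)^-1); apply: cvgM => //; exact: cvg_cst.
apply/cvgr0Pnorm_le => e e0; have /cvgr0Pnorm_le/(_ _ e0)[N _ hN] := h1.
by exists N => // n Nn; apply: hN => /=; apply: leq_trans Nn _; rewrite leq_pmulr.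
Qed.

(** At times congruent to r the excursion charges only the class t = q - 1 - r. The restricted sum
    of gb is therefore the full occupation sum of gb cls_t, which by Kac's formula is proportional
    to mu(gb cls_t) = 0. *)
Let B_gb r : (r < q)%N -> B r gb = 0.
Proof.
move=> rq; pose t := (q.-1 - r)%N.
have tq : (t < q)%N by rewrite (leq_ltn_trans (leq_subr _ _))// ltn_predL.
have Lp u : (u < q)%N -> wbounded W (fun x => gb x * cls u x).
  move=> uq; apply: (wbounded_mono Lgb).
    by apply: measurable_funM; [exact: wbounded_meas Lgb|exact: wbounded_meas (cls_wb _)].
  by move=> x; rewrite normrM ler_piMr// ger0_norm ?cls_ge0// cls_le1.
have rt : (r + t = q.-1)%N by rewrite subnKC// -ltnS prednK.
have dvd m u v : (u < q)%N -> (v < q)%N -> (q %| m * q + u + v.+1)%N = (u + v == q.-1)%N.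
  move=> uq vq; rewrite -addnA dvdn_addr ?dvdn_mull// addnS.
  apply/idP/eqP => [/dvdnP[[|[|k]]]|-> ]; rewrite ?prednK//.
    by rewrite mul1n => <-.
  move=> E; have : (u.+1 + v.+1 <= q + q)%N by exact: leq_add.
  by rewrite addSn addnS E !mulSn addnA ltnNge leq_addr.
apply: (cvgn_unique (@B_cvg r _ Lgb)).
have H := kac_block (Lp t tq) (cls0 tq).
refine (eq_cvgn _ H) => N.
rewrite (block_sum (fun j => nu (iter j Q (fun x => gb x * cls t x)))) /series/= big_mkord;
  apply: eq_bigr => m _.
rewrite (bigD1 (Ordinal rq))//= big1 ?addr0; last first.
  move=> u ur; apply: iterQ_cls_mul => //; rewrite dvd//.
  apply: contra ur => /eqP E; apply/eqP/val_inj => /=.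
  by apply/eqP; rewrite -(eqn_add2r t) E rt.
have gbE : gb = \sum_(u < q) (fun x => gb x * cls u x).
  by apply/funext => x; rewrite fct_sumE -mulr_sumr sum_cls mulr1.
rewrite [in RHS]gbE (pl_sum W0 (iterQ_pl _) (F := fun u x => gb x * cls u x))//.
rewrite [in RHS](bigD1 (Ordinal tq))//= big1 ?addr0//.
move=> u ut; apply: iterQ_cls_mul => //; rewrite dvd//.
apply: contra ut => /eqP E; apply/eqP/val_inj => /=.
by apply/eqP; rewrite -(eqn_add2l r) E rt.
Qed.

Let f0 := h - cst (mu h).

Let Lf0 : wbounded W f0. Proof. exact: wboundedB. Qed.

Let cstE c : cst c = c *: cst 1 :> (R -> R).
Proof. by apply/funext => x; rewrite /cst/= [RHS]mulr1. Qed.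

Let muf0 : mu f0 = 0.
Proof. by rewrite (plB pmu)// cstE (plZ pmu)// (rf_pi1 rf Ss) mulr1 subrr. Qed.

Let f0_step n : nu (iter n Q f0) - nu (iter n.+1 Q f0) = nu (iter n Q gb) - mu h * rp n.
Proof.
have Qh : Q h = h - gb.
  by rewrite -hE (kernel_residual Ks nu C theta h) nuh mulr0 scale0r addr0.
have E : f0 - Q f0 = gb - mu h *: (theta *: \1_C).
  rewrite /f0 (poB pQ)// Qh cstE (poZ pQ)// Q1; apply/funext => x.
  by rewrite !fctE/= /GRing.scale/=; ring.
rewrite iterSr -(plB (iterQ_pl n))//; last exact: (po_wb pQ).
by rewrite E (plB (iterQ_pl n) Lgb (wboundedZ (mu h) LT)) (plZ (iterQ_pl n) (mu h) LT).
Qed.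

(** By [f0_step], consecutive residues have equal sums, because [rp] vanishes off the last residue
    and the sums of gb are 0; the q sums add up to the occupation sum of a centered function, which
    is 0. *)
Let B_f0 r : (r < q)%N -> B r f0 = 0.
Proof.
have eq0 t : (t < q)%N -> B t f0 = B 0%N f0.
  elim: t => [//|t IH] tq; rewrite -IH; last exact: ltnW.
  apply/esym/eqP; rewrite -subr_eq0; apply/eqP.
  have h1 : (fun N => series (fun m => nu (iter (m * q + t) Q f0)) N -
      series (fun m => nu (iter (m * q + t.+1) Q f0)) N) @ \oo --> B t f0 - B t.+1 f0.
    by apply: cvgB; exact: B_cvg.
  apply: (cvgn_unique h1).
  have H := @B_cvg t _ Lgb; rewrite B_gb in H; last exact: ltnW.
  refine (eq_cvgn _ H) => N.
  rewrite /series/= -sumrB; apply: eq_bigr => m _.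
  by rewrite addnS f0_step rp_eq0 ?mulr0 ?subr0// modq_pred// ?(ltnW tq)// ltn_eqF// -ltnS prednK.
move=> rq; rewrite eq0//.
have S : \sum_(t < q) B t f0 = 0.
  have h1 := @cvg_sum_ord R q (fun t N => series (fun m => nu (iter (m * q + t) Q f0)) N)
    (fun t => B t f0) (fun t _ => @B_cvg t _ Lf0).
  apply: (cvgn_unique h1); have H := kac_block Lf0 muf0.
  refine (eq_cvgn _ H) => N.
  rewrite (block_sum (fun j => nu (iter j Q f0))) exchange_big/=; apply: eq_bigr => t _.
  by rewrite /series/= big_mkord.
move: S; rewrite (eq_bigr (fun=> B 0%N f0)); last by move=> i _; exact: eq0.
rewrite sumr_const card_ord => /eqP; rewrite mulrn_eq0 => /orP[/eqP q00|/eqP//].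
by move: q0; rewrite q00.
Qed.

Let a n := nu (iter n Ks f0).

Let a_bound : exists A, forall n, `|a n| <= A.
Proof.
have [c c0 fc] := wboundedP W0 Lf0; exists (c * (1 + B0) * nu W) => n.
apply: nu_bound; first exact: (po_iter_wb pK).
by move=> y; exact: iterK_bound.
Qed.

(** The gap law in units of q. Its shifts contain all large integers, so the renewal theorem applies
    along each residue class. *)
Let rq' i := rp (i * q + q.-1)%N.

Let rq'_sum n : \sum_(i < n) rq' i = \sum_(j < n * q) rp j.
Proof.
rewrite block_sum; apply: eq_bigr => i _.
have pq : (q.-1 < q)%N by rewrite ltn_predL.
rewrite (bigD1 (Ordinal pq))//= big1 ?addr0// => t tq.
rewrite rp_eq0// modq_pred//; apply: contra tq => /eqP E; apply/eqP/val_inj.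
Qed.

Let shifts_q n : shifts rp n -> shifts rq' (n %/ q).
Proof.
elim=> [|j m rj sm IH]; first by rewrite div0n; exact: shifts0.
have : (q %| j.+1)%N by case: per => _ /(_ _ rj).
move=> /dvdnP[[|i]]; first by rewrite mul0n.
move=> jE; rewrite jE divnMDl//; apply: shiftsS => //.
rewrite /rq' (_ : _ + _ = j)%N//; apply: succn_inj.
by rewrite jE mulSn -addnS prednK// addnC.
Qed.

Let a_class r : (r < q)%N -> (fun m => a (m * q + r)%N) @ \oo --> (0 : R).
Proof.
move=> rq; have [A aA] := a_bound.
apply: (@renewal_cvg0 R rq' _ (fun m => nu (iter (m * q + r) Q f0)) A).
- by move=> i; exact: rp_ge0.
- by move=> n; rewrite rq'_sum; exact: rp_tail_ge0.
- exists (nu W * (1 - rho)^-1) => n.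
  apply: (@le_trans _ _ (\sum_(k < n) nu W * rho ^+ k)).
    apply: ler_sum => k _; rewrite rq'_sum; apply: le_trans (rp_tail_le _) _.
    rewrite mulrC ler_wpM2l//; apply: ler_wiXn2l => //; last by rewrite leq_pmulr.
    by rewrite ltW//; case/andP: rho_itv.
  by rewrite -mulr_sumr ler_wpM2l// geometric_sum_le.
- move=> m; rewrite [LHS](renewal_equation _ Lf0); congr (_ + _).
  rewrite big_split_ord/= [X in _ + X]big1 ?addr0; last first.
    move=> t _; rewrite rp_eq0 ?mul0r// modq_pred ?(ltn_trans _ rq)//.
    by rewrite ltn_eqF// (leq_trans (ltn_ord t))// -ltnS prednK.
  rewrite (block_sum (fun j => rp j * nu (iter ((m * q + r).-1 - j) Ks f0))).
  apply: eq_bigr => i _; have pq : (q.-1 < q)%N by rewrite ltn_predL.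
  rewrite (bigD1 (Ordinal pq))//= big1 ?addr0; last first.
    move=> t tq; rewrite rp_eq0 ?mul0r// modq_pred//.
  congr (_ * nu (iter _ _ _)).
  have im := ltn_ord i; rewrite -subn1 -subnDA add1n -addnS prednK//.
  rewrite (_ : i * q + q = i.+1 * q)%N; last by rewrite mulSn addnC.
  by rewrite -addnBAC ?leq_mul2r ?im ?orbT// -mulnBl -subn1 -subnDA add1n.
- by move=> n; exact: aA.
- by rewrite -(B_f0 rq); exact: B_cvg.
- have [_ _ [k0 hk]] := per; exists k0 => k kk0.
  by have := shifts_q (hk k kk0); rewrite mulKn.
Qed.

(** Orthogonality of gb to the classes is what makes the limit independent of the residue of n
    modulo q; aperiodicity is not assumed. *)
Lemma iterK_cvg x : (fun n => iter n Ks h x) @ \oo --> mu h.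
Proof.
have a0 : a @ \oo --> (0 : R).
  apply/cvgr0Pnorm_le => e e0.
  have [N hN] : exists N, forall r, (r < q)%N -> forall m, (N <= m)%N -> `|a (m * q + r)%N| <= e.
    have H t : (t <= q)%N -> exists N, forall r, (r < t)%N -> forall m,
      (N <= m)%N -> `|a (m * q + r)%N| <= e.
      elim: t => [_|t IH tq]; first by exists 0%N.
      have [N hN] := IH (ltnW tq).
      have /cvgr0Pnorm_le/(_ _ e0)[N' _ hN'] := a_class tq.
      exists (maxn N N') => r; rewrite ltnS leq_eqVlt => /orP[/eqP ->|rt] m;
        rewrite geq_max => /andP[Nm N'm]; first exact: hN'.
      exact: hN.
    exact: H.
  exists (N * q)%N => // n /= Nn; rewrite (divn_eq n q); apply: hN; first by rewrite ltn_mod.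
  by rewrite leq_divRL.
have h0 := iterK_cvg0 x Lf0 a0.
have -> : (fun n => iter n Ks h x) = (fun n => iter n Ks f0 x + mu h).
  apply/funext => n; have -> : h = f0 + cst (mu h) by rewrite /f0 subrK.
  have kc m c : iter m Ks (cst c) = cst c.
    elim: m => //= m ->; rewrite cstE (poZ pK)// (rf_cst rf Ss)//.
  by rewrite (po_iterD pK)// kc /f0 subrK.
by rewrite -[X in _ --> X]add0r; apply: cvgD => //; exact: cvg_cst.
Qed.

End limit.
End cyclic_classes.

End regeneration.

(** When each point has a gap of at least 1/(n + 1) on its right, the integer part of (n + 1) x is
    injective on the set; the isolated points are a countable union of such sets. *)
Lemma countable_isolated_from_right {R : realType} (T : set R) :
  (forall x, T x -> 0 <= x) ->
  countable [set x | T x /\ ~ forall e, 0 < e -> exists2 y, T y & x < y <= x + e].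
Proof.
move=> T0; pose A n := [set x | T x /\ forall y, T y -> x < y -> x + n.+1%:R^-1 < y].
have sub : [set x | T x /\ ~ forall e, 0 < e -> exists2 y, T y & x < y <= x + e] `<=`
    \bigcup_n A n.
  move=> x [Tx] /existsNP[e /not_implyP[e0 H]].
  exists (Num.truncn e^-1) => //; split=> // y Ty xy; rewrite ltNge; apply/negP => yx.
  apply: H; exists y => //; rewrite xy/=; apply: le_trans yx _; rewrite lerD2l.
  by rewrite invf_ple ?posrE// ltW// truncnS_gt.
apply: (sub_countable (subset_card_le sub)).
apply: bigcup_countable => // n _; apply/countable_injP.
exists (fun x => Num.truncn (x * n.+1%:R)).
have n0 : 0 < n.+1%:R :> R by [].
have key x y : A n x -> A n y -> x < y -> Num.truncn (x * n.+1%:R) <> Num.truncn (y * n.+1%:R).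
  move=> [Tx hx] [Ty _] xy; have := hx y Ty xy; move=> h E.
  have h1 : x * n.+1%:R + 1 < y * n.+1%:R.
    by rewrite -(ltr_pM2r n0) mulrDl mulVf ?gt_eqF in h.
  have x0 : 0 <= x * n.+1%:R by rewrite mulr_ge0// T0.
  have y0 : 0 <= y * n.+1%:R by rewrite mulr_ge0// T0.
  have /andP[tx _] := truncn_itv x0; have /andP[_ ty] := truncn_itv y0.
  have := lt_trans h1 ty; rewrite -E -[X in _ < X]natr1 ltrD2r.
  by rewrite ltNge tx.
move=> x y; rewrite !inE => Ax Ay E.
by have [xy|yx|//] := ltgtP x y; [case: (key x y Ax Ay xy)|case: (key y x Ay Ax yx)].
Qed.

(** * Parameters at which the Poisson series may fail to converge *)

Section exceptional_parameters.
Context {R : realType}.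
Variables (W : R -> R) (phi0 : R).
Variables (K : R -> (R -> R) -> R -> R) (nu : (R -> R) -> R).
Variables (pi : R -> (R -> R) -> R).
Variables (C : set R) (theta rho Cpi M : R).
Hypothesis rf : regular_family W phi0 K nu pi C theta rho Cpi M.
Variables (g : R -> R) (p cg : R).
Hypotheses (p_itv : 0 < p < 2^-1) (mg : measurable_fun [set: R] g) (cg0 : 0 <= cg).
Hypothesis gW : forall x, `|g x| <= cg * W x `^ p.

Variables (d0 Cd C0 : R).
Hypotheses (d0_gt0 : 0 < d0) (Cd0 : 0 <= Cd) (C00 : 0 <= C0).
Local Notation gb u := (centered pi g u).
Hypothesis der : forall u t (f : R -> R), phi0 < u -> u < t <= 1 -> t - u <= d0 ->
  measurable_fun [set: R] f -> (forall x, 0 <= f x <= 1) ->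
  `|pi t f - pi u f - (t - u) * pi u (fun x => gb u x * f x)| <= Cd * (t - u) ^+ 2.
Hypothesis dom : forall u t (f : R -> R), phi0 < u -> u < t <= 1 -> wbounded W f ->
  (forall x, 0 <= f x) -> pi t f <= C0 * pi u f.
Hypothesis tight : forall u e, phi0 < u <= 1 -> 0 < e -> exists2 A, 0 <= A &
  pi u (fun x => if A < W x then W x else 0) <= e.

Local Notation Q s := (residual (K s) nu C theta).
Local Notation cl s q r := (cls K nu C theta s q r).

Let mW := rf_meas rf.
Let W1 := rf_ge1 rf.
Let pnu := rf_nu rf.
Let theta0 := rf_theta rf.
Let W0 x : 0 <= W x. Proof. exact: le_trans (W1 x). Qed.
Let LW : wbounded W W. Proof. exact: wbounded_self. Qed.
Let rho_itv : 0 <= rho < 1.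
Proof. by have /andP[/ltW -> ->] := rf_rho rf. Qed.
Let rho0 : 0 <= rho. Proof. by case/andP: rho_itv. Qed.
Let rho1' : 0 < 1 - rho. Proof. by rewrite subr_gt0; case/andP: rho_itv. Qed.

Let pQ s : phi0 < s <= 1 -> positive_operator W (Q s).
Proof. exact: (residual_operator rf). Qed.

Let T0 := (theta *: \1_C : R -> R).

Let LT : wbounded W T0.
Proof. by apply: wboundedZ; apply: wbounded_indic => //; exact: (rf_C rf). Qed.

Let TW x : `|T0 x| <= theta * W x.
Proof.
rewrite /T0 ger0_norm ?fctE /GRing.scale/=; last by rewrite mulr_ge0// ltW.
by rewrite ler_wpM2l ?(ltW theta0)// (le_trans _ (W1 x)).
Qed.

Section lipschitz.
Variables s t : R.
Hypotheses (Ss : phi0 < s <= 1) (St : phi0 < t <= 1).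

(** The recursion for the discrepancy of n-th iterates: a step contracts the old error by [rho] and
    adds the perturbation of the kernel on an iterate already of size theta rho^n. *)
Let dl : nat -> R := fix dl n := if n is n'.+1 then rho * dl n' + M * (theta * rho ^+ n')
  * `|s - t| else 0.

Let dl_ge0 n : 0 <= dl n.
Proof.
elim: n => //= n IH; rewrite addr_ge0 ?mulr_ge0 ?(rf_M rf) ?exprn_ge0 ?(ltW theta0)//.
Qed.

Let iter_diff n x : `|iter n (Q s) T0 x - iter n (Q t) T0 x| <= dl n * W x.
Proof.
elim: n x => [|n IH] x; first by rewrite /= subrr normr0 mul0r.
have Ls : wbounded W (iter n (Q s) T0) by exact: (po_iter_wb (pQ Ss)).
have Lt : wbounded W (iter n (Q t) T0) by exact: (po_iter_wb (pQ St)).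
rewrite !iterS /=.
have -> : Q s (iter n (Q s) T0) x - Q t (iter n (Q t) T0) x =
    Q s (iter n (Q s) T0 - iter n (Q t) T0) x + (K s (iter n (Q t) T0) x - K t (iter n (Q t) T0) x).
  by rewrite (poB (pQ Ss))// /residual !fctE/=; ring.
apply: le_trans (ler_normD _ _) _; rewrite mulrDl; apply: lerD.
  apply: le_trans (pl_norm (po_pl (pQ Ss) x) _ (wboundedZ (dl n) LW) _) _.
  - exact: wboundedB.
  - by move=> y; exact: IH.
  - rewrite (plZ (po_pl (pQ Ss) x))// (mulrC rho) -mulrA ler_wpM2l//.
    exact: (rf_drift rf).
apply: le_trans (rf_lip rf Ss St Lt (c := theta * rho ^+ n) _ _ x) _ => //.
  by rewrite mulr_ge0 ?exprn_ge0// ltW.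
move=> y.
exact: (po_iter_contract (pQ St) n LW (rf_drift rf St) rho0 (ltW theta0) LT TW).
Qed.

Let Ld := M * theta * `|s - t| / (1 - rho) ^+ 2.

Let sum_dl n : \sum_(i < n) dl i <= Ld.
Proof.
have M0 := rf_M rf.
have L0 : 0 <= Ld by rewrite divr_ge0 ?exprn_ge0 ?(ltW rho1')// !mulr_ge0// ltW.
elim: n => [|n IH]; first by rewrite big_ord0.
rewrite big_ord_recl/= add0r.
under eq_bigr do rewrite add0n.
rewrite big_split/= -mulr_sumr.
apply: (@le_trans _ _ (rho * Ld + M * theta * `|s - t| * (1 - rho)^-1)).
  apply: lerD; first by rewrite ler_wpM2l.
  rewrite (eq_bigr (fun i : 'I_n => M * theta * `|s - t| * rho ^+ i)); last by move=> i _; ring.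
  rewrite -mulr_sumr ler_wpM2l ?geometric_sum_le//.
  by rewrite !mulr_ge0// ltW.
rewrite le_eqVlt; apply/orP; left; apply/eqP; rewrite /Ld; field.
by rewrite gt_eqF.
Qed.

Let sum_dl_class q r n : (0 < q)%N -> \sum_(m < n) dl (m * q + r) <= \sum_(i < n * q + r) dl i.
Proof.
move=> q0; elim: n => [|n IH]; first by rewrite big_ord0 sumr_ge0.
rewrite big_ord_recr/=; apply: (@le_trans _ _ (\sum_(i < (n * q + r).+1) dl i)).
  by rewrite big_ord_recr/= lerD2r.
have le : ((n * q + r).+1 <= n.+1 * q + r)%N by rewrite mulSn -add1n addnA !leq_add2r.
rewrite (big_ord_widen _ dl le) [leRHS](bigID (fun i : 'I__ => (i < (n * q + r).+1)%N))/=.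
by rewrite lerDl sumr_ge0.
Qed.

(** With a common period, both classes add first-regeneration probabilities over the same residues,
    so the errors of the terms simply add up. *)
Lemma cls_lipschitz q r : has_period (rp K nu C theta s) q -> has_period (rp K nu C theta t) q ->
  forall x, `|cl s q r x - cl t q r x| <= Ld * W x.
Proof.
move=> ps pt x; have q0 : (0 < q)%N by case: ps.
have h : (fun n => `|series (fun m => ee K nu C theta s (m * q + r)%N x) n -
    series (fun m => ee K nu C theta t (m * q + r)%N x) n|) @ \oo --> `|cl s q r x - cl t q r x|.
  apply: cvg_norm; apply: cvgB; exact: (cls_cvg rf).
apply: (cvgr_to_le h); near=> n.
rewrite /series/= -sumrB big_mkord; apply: le_trans (ler_norm_sum _ _ _) _.
apply: (@le_trans _ _ (\sum_(m < n) dl (m * q + r)%N * W x)).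
  by apply: ler_sum => m _; exact: iter_diff.
rewrite -mulr_suml ler_wpM2r//; apply: le_trans (sum_dl_class r n q0) _; exact: sum_dl.
Unshelve. all: by end_near.
Qed.

End lipschitz.

(** Between indicators |x - y| and (x - y)^2 agree; the other terms measure the distance from being
    indicators and have mean 0 for the classes. An L1 distance is thus bounded by a quantity of
    second order. *)
Let dist_le (x y : R) : 0 <= x <= 1 -> 0 <= y <= 1 ->
  `|x - y| <= (x - y) ^+ 2 + x * (1 - x) + y * (1 - y).
Proof.
move=> /andP[x0 x1] /andP[y0 y1].
by rewrite ler_norml; apply/andP; split; nra.
Qed.

(* Close parameters with a common period share their cyclic classes up to a
   small set, although each class keeps probability [1 / q] while [pi] moves. *)
Lemma cls_orthogonal u q r : phi0 < u <= 1 -> has_period (rp K nu C theta u) q ->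
  (forall e, 0 < e -> exists2 t, phi0 < t <= 1 /\ has_period (rp K nu C theta t) q &
     u < t <= u + e) -> (r < q)%N ->
  pi u (fun x => gb u x * cl u q r x) = 0.
Proof.
move=> Su pu acc rq; set D := pi u _.
have pmu := rf_pi rf Su; have /andP[u0 u1] := Su.
have cu01 x : 0 <= cl u q r x <= 1 by rewrite (cls_ge0 rf Su pu) (cls_le1 rf Su pu).
have Lcu := cls_wb rf Su pu r.
apply/eqP; rewrite -normr_le0; apply/ler_addgt0Pr => e e0; rewrite add0r.
pose L := M * theta / (1 - rho) ^+ 2.
have M0 := rf_M rf.
have L0 : 0 <= L by rewrite divr_ge0 ?exprn_ge0 ?(ltW rho1')// mulr_ge0// ltW.
have CL1 : 0 < C0 * L + 1 by rewrite ltr_wpDl// mulr_ge0.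
have e2 : 0 < e / 2 / (C0 * L + 1) by rewrite !divr_gt0.
(* W^2 need not be integrable. Where [W] is at most A the squared difference of classes is of order
   del^2; above A it is at most L del W, and tightness makes the mean of that part small against
   del. *)
have [A A0 hA] := tight Su e2.
have Cp0 : 0 <= Cpi by rewrite (le_trans _ (Cpi1 rf)).
pose Z := Cd + C0 * (L ^+ 2 * A * Cpi).
have Z0 : 0 <= Z by rewrite addr_ge0// mulr_ge0// mulr_ge0// mulr_ge0 ?sqr_ge0.
have Z1 : 0 < Z + 1 by rewrite ltr_wpDl.
have [t [St pt]] := acc (Num.min d0 (e / 2 / (Z + 1))) (ltac:(by rewrite lt_min d0_gt0 !divr_gt0)).
rewrite -lerBlDl le_min => /andP[ut /andP[td0 tZ]].
set del := t - u in td0 tZ.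
have del0 : 0 < del by rewrite subr_gt0.
have t1 : t <= 1 by case/andP: St.
have utt : u < t <= 1 by rewrite ut t1.
have pmt := rf_pi rf St.
have ct01 x : 0 <= cl t q r x <= 1 by rewrite (cls_ge0 rf St pt) (cls_le1 rf St pt).
have Lct := cls_wb rf St pt r.
have lip x : `|cl u q r x - cl t q r x| <= L * del * W x.
  apply: le_trans (cls_lipschitz Su St r pu pt x) _.
  by rewrite distrC (gtr0_norm del0) /L -/del le_eqVlt; apply/orP; left; apply/eqP; ring.
pose dd x := cl u q r x - cl t q r x.
have mdd : measurable_fun [set: R] dd.
  by apply: measurable_funB; [exact: wbounded_meas Lcu|exact: wbounded_meas Lct].
have dd1 x : `|dd x| <= 1.
  by have /andP[? ?] := cu01 x; have /andP[? ?] := ct01 x; rewrite ler_norml /dd; apply/andP;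
    split; lra.
have Ldd : wbounded W dd by apply: (wbounded_bounded W1 mdd dd1).
have Ldd2 : wbounded W (fun x => dd x ^+ 2).
  apply: (wbounded_bounded W1 (measurable_funX 2 mdd) (c := 1)) => x.
  by rewrite normrX exprn_ile1.
have Lind (c : R -> R) : (forall x,
  0 <= c x <= 1) -> wbounded W c -> wbounded W (fun x => c x * (1 - c x)).
  move=> c01 Lc; apply: (wbounded_bounded W1 (c := 1)).
    by apply: measurable_funM; [exact: wbounded_meas Lc|apply: measurable_funB => //;
      exact: wbounded_meas Lc].
  by move=> x; have /andP[h0 h1] := c01 x; rewrite ger0_norm; nra.
have s1 : pi t (fun x => dd x ^+ 2)
  <= C0 * (L ^+ 2 * del ^+ 2 * A * Cpi + L * del * (e / 2 / (C0 * L + 1))).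
  apply: le_trans (dom u0 utt Ldd2 (fun x => sqr_ge0 _)) _; rewrite ler_wpM2l//.
  have mI : measurable_fun [set: R] (fun x => if A < W x then W x else 0).
    by apply: measurable_fun_ifT => //; exact: measurable_fun_ltr.
  have LI : wbounded W (fun x => if A < W x then W x else 0).
    by apply: (wbounded_mono LW mI) => x; case: ifP; rewrite ?normr0.
  apply: (@le_trans _ _ (pi u ((L ^+ 2 * del ^+ 2 * A) *: W +
      (L * del) *: (fun x => if A < W x then W x else 0)))).
    apply: (pl_le pmu) => //; first by apply: wboundedD; exact: wboundedZ.
    move=> x; rewrite !fctE/= /GRing.scale/=.
    have l := lip x; rewrite -/(dd x) in l; have l1 := dd1 x; have Wx0 := W0 x.
    rewrite -[dd x ^+ 2]real_normK ?num_real//.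
    have d1 : 0 <= `|dd x| by [].
    have Ld0 : 0 <= L * del by rewrite mulr_ge0// ltW.
    case: ifPn => [AW|]; last rewrite -leNgt mulr0 addr0 => WA.
      apply: (@le_trans _ _ (L * del * W x)).
        by apply: le_trans l; rewrite expr2 ler_piMr.
      by rewrite lerDr mulr_ge0// mulr_ge0// mulr_ge0 ?sqr_ge0.
    apply: (@le_trans _ _ ((L * del * W x) ^+ 2)).
      by rewrite lerXn2r ?nnegrE// ?(mulr_ge0 Ld0 Wx0).
    have -> : (L * del * W x) ^+ 2 = L ^+ 2 * del ^+ 2 * W x ^+ 2 by ring.
    rewrite -[leRHS]mulrA ler_wpM2l ?(mulr_ge0 (sqr_ge0 _) (sqr_ge0 _))//.
    by rewrite expr2 ler_wpM2r.
  rewrite (plD pmu) ?(plZ pmu)//; try exact: wboundedZ.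
  apply: lerD; rewrite ler_wpM2l ?(rf_piW rf)//.
    by rewrite mulr_ge0// mulr_ge0 ?sqr_ge0.
  by rewrite mulr_ge0// ltW.
have s2 : pi t (fun x => cl u q r x * (1 - cl u q r x)) <= 0.
  rewrite (le_trans (dom u0 utt (Lind _ cu01 Lcu) _))//.
    by move=> x; have /andP[h0 h1] := cu01 x; rewrite mulr_ge0// subr_ge0.
  by rewrite (pi_cls_indic rf Su pu rq) mulr0.
have s3 : `|pi t dd| <= C0 * (L ^+ 2 * del ^+ 2 * A * Cpi + L * del * (e / 2 / (C0 * L + 1))).
  have Ls : wbounded W (((fun x => dd x ^+ 2) + (fun x => cl u q r x * (1 - cl u q r x))) +
     (fun x => cl t q r x * (1 - cl t q r x))).
    by apply: wboundedD; [apply: wboundedD => //|]; exact: Lind.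
  apply: le_trans (pl_norm pmt Ldd Ls _) _.
    by move=> x; rewrite !fctE; exact: dist_le.
  rewrite (plD pmt) ?(plD pmt)//; try exact: Lind; last by apply: wboundedD => //; exact: Lind.
  by rewrite (pi_cls_indic rf St pt rq) addr0 -[leRHS]addr0; apply: lerD.
have s4 : `|pi t (cl u q r) - pi u (cl u q r) - del * D| <= Cd * del ^+ 2.
  by apply: der => //; exact: wbounded_meas Lcu.
(* Each class has mass 1/q under its own law, so the change of mass of the class of [u] is the mean
   under [pi t] of the difference of the two classes. *)
have s5 : pi t (cl u q r) - pi u (cl u q r) = pi t dd.
  have -> : pi t dd = pi t (cl u q r) - pi t (cl t q r) by exact: (plB pmt Lcu Lct).
  by rewrite (pi_cls rf St pt rq) (pi_cls rf Su pu rq).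
have s6 : `|del * D| <= Cd * del ^+ 2 + C0 * (L ^+ 2 * del ^+ 2 * A * Cpi + L * del * (e / 2 /
  (C0 * L + 1))).
  have -> : del * D = pi t dd - (pi t (cl u q r) - pi u (cl u q r) - del * D) by rewrite s5; ring.
  apply: le_trans (ler_normB _ _) _; rewrite addrC; exact: lerD.
have s7 : `|D| <= Z * del + C0 * L * (e / 2 / (C0 * L + 1)).
  rewrite -(ler_pM2l del0); rewrite normrM (gtr0_norm del0) in s6; apply: le_trans s6 _.
  by rewrite /Z le_eqVlt; apply/orP; left; apply/eqP; ring.
apply: le_trans s7 _; rewrite [leRHS]splitr; apply: lerD.
  apply: (@le_trans _ _ (Z * (e / 2 / (Z + 1)))); first by rewrite ler_wpM2l.
  by rewrite mulrA ler_pdivrMr// mulrC ler_wpM2l ?divr_ge0 ?(ltW e0)// lerDl.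
by rewrite mulrA ler_pdivrMr// mulrC ler_wpM2l ?divr_ge0 ?(ltW e0)// lerDl.
Qed.

(** Every parameter has some period q, so outside the union over q of the right-isolated points
    [cls_orthogonal] applies to all classes and [iterK_cvg] concludes. *)
Lemma iterK_hs_cvg : exists2 E : set R, countable E & forall s, phi0 < s <= 1 -> ~ E s ->
  forall x, (fun n => iter n (K s) (hs K nu pi C theta g s) x) @ \oo -->
  pi s (hs K nu pi C theta g s).
Proof.
pose T q := [set s : R | phi0 < s <= 1 /\ has_period (rp K nu C theta s) q].
pose E := \bigcup_q [set x | T q x /\ ~ forall e, 0 < e -> exists2 y, T q y & x < y <= x + e].
exists E.
  apply: bigcup_countable => // q _; apply: countable_isolated_from_right => x [/andP[x0 _] _].
  by rewrite ltW// (lt_trans _ x0)//; case/andP: (rf_phi0 rf).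
move=> s Ss nE x.
have [j rj] := rp_gt0_exists rf Ss.
have [q per] := has_period_exists rj.
have acc : forall e, 0 < e -> exists2 y, T q y & s < y <= s + e.
  by apply: contrapT => nacc; apply: nE; exists q.
have Lg := wbounded_g rf p_itv mg cg0 gW.
have Lc : wbounded W (gb s) by apply: wboundedB => //; exact: wbounded_cst.
have cle := centered_le rf p_itv mg cg0 gW Ss.
have p2 : p < 2^-1 by case/andP: p_itv.
have Lc2 : wbounded W (fun x => gb s x ^+ 2).
  apply: (wbounded_le (measurable_funX 2 (wbounded_meas Lc)) (c := (cg * (1 + Cpi)) ^+ 2)) => y.
  rewrite normrX; apply: (@le_trans _ _ ((cg * (1 + Cpi) * W y `^ p) ^+ 2)).
    rewrite lerXn2r ?nnegrE ?mulr_ge0 ?powR_ge0//.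
    by rewrite addr_ge0// (le_trans _ (Cpi1 rf)).
  rewrite exprMn ler_wpM2l ?sqr_ge0// -(powR_mulrn 2 (powR_ge0 (W y) p)) -powRrM.
  by rewrite powR_le_self//; lra.
apply: (iterK_cvg rf Ss per (hs_wb rf p_itv mg cg0 gW Ss) Lc Lc2).
- exact: (hs_eq rf p_itv mg cg0 gW Ss).
- apply: (nu_poisson mW W1 (rf_pos rf Ss) pnu (rf_pi rf Ss) (rf_pi1 rf Ss)
    (rf_inv rf Ss) (rf_C rf) theta0 (rf_rho rf) (rf_res rf Ss) (rf_drift rf Ss) Lg).
- by move=> r rq; exact: cls_orthogonal.
Qed.

End exceptional_parameters.

(** * Tempered densities *)

Lemma ge0_integral_density {R : realType} (mu : {measure set (measurableTypeR R) -> \bar R})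
    (dens f : R -> R) : measurable_fun [set: R] dens -> (forall x, 0 <= dens x) ->
  (forall A : set (measurableTypeR R), measurable A ->
    mu A = (\int[lebesgue_measure]_(x in A) (dens x)%:E)%E) ->
  measurable_fun [set: R] f -> (forall x, 0 <= f x) ->
  (\int[mu]_x (f x)%:E = \int[lebesgue_measure]_x (f x * dens x)%:E)%E.
Proof.
move=> md d0 mud mf f0.
have h1 : ge0_functional (fun f : measurableTypeR R -> R => \int[mu]_x (f (id x) * 1)%:E)%E.
  by apply: ge0_functional_weighted => //; exact: measurable_cst.
have h2 : ge0_functional (fun f : measurableTypeR R -> R =>
    \int[lebesgue_measure]_x (f (id x) * dens x)%:E)%E.
  by apply: ge0_functional_weighted => //; exact: measurable_id.
have HI (A : set (measurableTypeR R)) : measurable A ->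
    (\int[mu]_x (\1_A (id x) * 1)%:E = \int[lebesgue_measure]_x (\1_A (id x) * dens x)%:E)%E.
  move=> mA; under eq_integral do rewrite mulr1.
  rewrite integral_indic// setIT; transitivity (mu A) => //; rewrite mud//.
  rewrite [LHS]integral_mkcond; apply: eq_integral => x _.
  by rewrite patchE indicE; case: (x \in A); rewrite ?mul1r ?mul0r.
have <- := ge0_functional_eq h1 h2 HI mf f0.
by apply: eq_integral => x _; rewrite mulr1.
Qed.

Definition partition_function {R : realType} (g : R -> R) (s : R) :=
  (\int[lebesgue_measure]_y expR (s * g y))%R.

Lemma one_le_ratio {R : realFieldType} (c z zt zu : R) : 0 < c -> 0 < zu ->
  c^-1 <= zt -> zu <= c * z -> 1 <= c * (c * z) * (zt / zu).
Proof.
move=> c0 zu0 ct uz; have z0 : 0 <= c * z by rewrite (le_trans (ltW zu0)).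
rewrite mulrA ler_pdivlMr// mul1r; apply: le_trans uz _.
have -> : c * (c * z) * zt = c * zt * (c * z) by ring.
by rewrite ler_peMl// -ler_pdivrMl// mulr1.
Qed.

Lemma density_ratio_le {R : realFieldType} (c x y z zt zu : R) : 0 < c -> 0 < zu ->
  0 < zt -> 0 <= y -> c^-1 <= zt -> zu <= c * z -> x <= c * y ->
  x / zt <= c * c * c * z * (y / zu).
Proof.
move=> c0 zu0 zt0 y0 ct uz xy; rewrite ler_pdivrMr//; apply: le_trans xy _.
have -> : c * c * c * z * (y / zu) * zt = c * (c * z) * (zt / zu) * (c * y) by ring.
by rewrite ler_peMl ?mulr_ge0 ?(ltW c0)// one_le_ratio.
Qed.

Section tempered.
Context {R : realType}.
Local Notation RR := (measurableTypeR R).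
Local Notation leb := (@lebesgue_measure R).
Variables (g : R -> R) (phi0 B : R) (pi : R -> probability RR R).
Hypotheses (mg : measurable_fun [set: RR] g) (gB : forall x, g x <= B).
Hypothesis g1 : (\int[leb]_x (expR (g x))%:E = 1)%E.
Hypothesis phi01 : 0 < phi0 < 1.
Hypothesis tp : tempered_family phi0 g pi.

Let e s x := expR (s * g x).
Local Notation Z := (partition_function g).
Let b : R := `|B|.

Let ib s (h : R -> R) c : measurable_fun [set: RR] h -> (forall x, `|h x| <= c) -> integ (pi s) h.
Proof. by move=> mh hc; exact: (@integ_bounded _ _ _ (pi s) h c mh hc). Qed.

Let gb x : g x <= b. Proof. by apply: le_trans (gB x) _; exact: ler_norm. Qed.

Let me s : measurable_fun [set: RR] (e s).
Proof. by apply: measurableT_comp => //; exact: measurable_funM. Qed.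

Let ie s : phi0 <= s <= 1 -> leb.-integrable [set: R] (EFin \o e s).
Proof. by case/tp. Qed.

Let S1 : phi0 <= (1 : R) <= 1. Proof. by case/andP: phi01 => _ /ltW ->; rewrite lexx. Qed.
Let S0 : phi0 <= phi0 <= 1. Proof. by rewrite lexx/= ltW//; case/andP: phi01. Qed.

(** As g <= |B| and 0 <= 1 - s <= 1, exp(s g) is at least exp(- |B|) exp(g), and the integral of
    exp(g) is 1. *)
Let Z_ge s : phi0 <= s <= 1 -> expR (- b) <= Z s.
Proof.
move=> Ss; have /andP[s0 s1] := Ss.
have -> : expR (- b) = (\int[leb]_x (expR (- b) * e 1 x))%R.
  rewrite (@RintegralZl _ _ _ _ _ _ _ measurableT (ie S1)).
  rewrite /Rintegral/e; under [X in fine X]eq_integral do rewrite mul1r.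
  by rewrite g1 /= mulr1.
rewrite /partition_function; apply: le_Rintegral => //; last first.
- move=> x _; rewrite /e -expRD ler_expR mul1r.
  have := gb x; have : 0 <= s by rewrite (le_trans _ s0)// ltW//; case/andP: phi01.
  have b0 : 0 <= b by rewrite /b.
  by nra.
- exact: ie.
- by have := integrableZl measurableT (expR (- b)) (ie S1); apply: eq_integrable.
Qed.

Let Z_gt0 s : phi0 <= s <= 1 -> 0 < Z s.
Proof. by move=> Ss; apply: lt_le_trans (Z_ge Ss); exact: expR_gt0. Qed.

Let Z_le s : phi0 <= s <= 1 -> Z s <= expR b * Z phi0.
Proof.
move=> Ss; have /andP[s0 s1] := Ss.
rewrite /partition_function -(@RintegralZl _ _ _ _ _ _ _ measurableT (ie S0)).
apply: le_Rintegral => //; first exact: ie.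
  by have := integrableZl measurableT (expR b) (ie S0); apply: eq_integrable.
move=> x _; rewrite -expRD ler_expR.
have f0 : 0 < phi0 by case/andP: phi01.
have := gb x; have b0 : 0 <= b by rewrite /b.
by nra.
Qed.

Lemma tempered_integral s (f : R -> R) : phi0 <= s <= 1 -> measurable_fun [set: R] f ->
  (forall x, 0 <= f x) ->
  (\int[pi s]_x (f x)%:E = \int[leb]_x (f x * (e s x / Z s))%:E)%E.
Proof.
move=> Ss mf f0; have [_ dens] := tp Ss.
have md : measurable_fun [set: R] (fun x => e s x / Z s) by apply: measurable_funM => //; exact: me.
have d0 x : 0 <= e s x / Z s by rewrite divr_ge0 ?expR_ge0// ltW// Z_gt0.
exact: (@ge0_integral_density R (pi s) (fun x => e s x / Z s)).
Qed.

#[local] Opaque partition_function.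

Let C0 := expR b * expR b * expR b * Z phi0.

Let C00 : 0 <= C0. Proof. by rewrite !mulr_ge0 ?expR_ge0// ltW// Z_gt0. Qed.

(** For u <= t the density ratio, a constant times exp((t - u) g), is bounded because [g] is bounded
    above; the reverse ratio is unbounded in general. *)
Lemma tempered_dom_ereal u t (f : R -> R) : phi0 <= u -> u <= t <= 1 ->
  measurable_fun [set: R] f -> (forall x, 0 <= f x) ->
  (\int[pi t]_x (f x)%:E <= C0%:E * \int[pi u]_x (f x)%:E)%E.
Proof.
move=> u0 /andP[ut t1] mf f0.
have Su : phi0 <= u <= 1 by rewrite u0 (le_trans ut).
have St : phi0 <= t <= 1 by rewrite (le_trans u0 ut) t1.
have md s : measurable_fun [set: R] (fun x => f x * (e s x / Z s)).
  by apply: measurable_funM => //; apply: measurable_funM => //; exact: me.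
have p0 s x : phi0 <= s <= 1 -> 0 <= f x * (e s x / Z s).
  by move=> Ss; rewrite mulr_ge0// divr_ge0 ?expR_ge0// ltW// Z_gt0.
rewrite !tempered_integral// -ge0_integralZl//=; last first.
- by move=> x _; rewrite lee_fin p0.
- by apply/measurable_EFinP; exact: md.
apply: ge0_le_integral => //=.
- by move=> x _; rewrite lee_fin p0.
- by apply/measurable_EFinP; exact: md.
- by apply: measurable_funeM; apply/measurable_EFinP; exact: md.
move=> x _; rewrite -EFinM lee_fin [leRHS]mulrCA; apply: ler_wpM2l => //.
have b0 : 0 <= b by rewrite /b.
have tu : e t x <= expR b * e u x.
  rewrite /e -expRD ler_expR; have := gb x.
  have f00 : 0 < phi0 by case/andP: phi01.
  by nra.
have Zt := Z_ge St; have Zu := Z_le Su.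
have zt0 := Z_gt0 St; have zu0 := Z_gt0 Su; have eb := expR_gt0 b.
have eu := expR_ge0 (u * g x); rewrite expRN in Zt.
exact: (density_ratio_le eb zu0 zt0 eu Zt Zu tu).
Qed.

Section weight.
Variables (W : R -> R) (c2 : R).
Hypotheses (mW : measurable_fun [set: R] W) (W1 : forall x, 1 <= W x).
Hypothesis iW0 : integ (pi phi0) W.
Hypotheses (c20 : 0 <= c2) (g2W : forall x, g x ^+ 2 <= c2 * W x).

Let W0 x : 0 <= W x. Proof. exact: le_trans (W1 x). Qed.

Lemma tempered_integ s : phi0 <= s <= 1 -> integ (pi s) W.
Proof.
move=> Ss; have /andP[s0 s1] := Ss.
apply/integrableP; split; first exact/measurable_EFinP.
under eq_integral do rewrite /= ger0_norm//.
apply: le_lt_trans (@tempered_dom_ereal phi0 s W _ _ mW W0) _ => //.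
by rewrite mean_fineK// -EFinM ltry.
Qed.

Lemma tempered_dom u t (f : R -> R) : phi0 <= u -> u <= t <= 1 -> wbounded W f ->
  (forall x, 0 <= f x) -> mean (pi t) f <= C0 * mean (pi u) f.
Proof.
move=> u0 ut [mf [c fc]] f0; have /andP[ut' t1] := ut.
have Su : phi0 <= u <= 1 by rewrite u0 (le_trans ut').
have St : phi0 <= t <= 1 by rewrite (le_trans u0 ut') t1.
have iF s : phi0 <= s <= 1 -> integ (pi s) f.
  by move=> Ss; apply: (integ_le (integZ c (tempered_integ Ss))).
by have := tempered_dom_ereal u0 ut mf f0; rewrite !mean_fineK ?iF// -EFinM lee_fin.
Qed.

(** Monotone convergence of the functions equal to [W] up to level n and to 0 above it. *)
Lemma tempered_tight u eps : phi0 <= u <= 1 -> 0 < eps -> exists2 A, 0 <= A &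
  mean (pi u) (fun x => if A < W x then W x else 0) <= eps.
Proof.
move=> Su e0; have iW := tempered_integ Su.
have mI (A : R) : measurable_fun [set: R] (fun x => if A < W x then 0 else W x).
  by apply: measurable_fun_ifT => //; exact: measurable_fun_ltr.
have I0 (A : R) x : 0 <= (if A < W x then 0 else W x) by case: ifP.
have iI (A : R) : integ (pi u) (fun x => if A < W x then 0 else W x).
  by apply: (integ_le iW (mI A)) => x; case: ifP; rewrite ?normr0// ger0_norm.
have H : (fun n => \int[pi u]_x (if n%:R < W x then 0 else W x)%:E)%E @ \oo -->
    (\int[pi u]_x (W x)%:E)%E.
  apply: ge0_integral_cvg => //.
  - by move=> n; apply/measurable_EFinP; exact: mI.
  - by move=> n x _; rewrite lee_fin.
  - move=> x _ m n mn; rewrite lee_fin; case: ifPn => [_|]; first exact: I0.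
    rewrite -leNgt => Wm; case: ifP => // nW.
    by have := lt_le_trans nW Wm; rewrite ltr_nat ltnNge mn.
  - move=> x _; apply: cvg_near_cst; near=> n; rewrite ltNge ifF//.
    apply/negbF; apply: (@le_trans _ _ (Num.truncn (W x)).+1%:R).
      by rewrite ltW// truncnS_gt.
    by rewrite ler_nat; near: n; exact: nbhs_infty_ge.
rewrite (mean_fineK iW) in H.
have {}H : (fun n : nat => mean (pi u) (fun x => if n%:R < W x then 0 else W x)) @ \oo -->
    mean (pi u) W by exact: (fine_cvg H).
have /cvgrPdist_le/(_ _ e0)[N _ hN] := H.
exists N%:R => //; have := hN N (leqnn N).
rewrite /= -[X in _ - X]/(mean (pi u) (fun x => if N%:R < W x then 0 else W x)).
rewrite -meanB// => /(le_trans (ler_norm _)).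
congr (mean _ _ <= _); apply/funext => x.
by case: ifP; rewrite ?subr0 ?subrr.
Unshelve. all: by end_near.
Qed.

(** Both directions come from 1 + z <= exp(z), taken at z and at - z. Only an upper bound on z is
    required, as for (t - u) g. *)
Lemma quadratic_expR (z a : R) : z <= a -> 0 <= a -> `|expR z - 1 - z| <= expR a * z ^+ 2.
Proof.
move=> za a0; have ez := expR_gt0 z; have ea := expR_gt0 a.
have h1 : 1 + z <= expR z by exact: expR_ge1Dx.
have h2 : expR z - 1 <= z * expR z.
  have := expR_ge1Dx (- z); rewrite expRN => h.
  have : (1 - z) * expR z <= 1 by rewrite -ler_pdivlMr// div1r.
  by lra.
have ea1 : 1 <= expR a by rewrite -expR0 ler_expR.
rewrite ger0_norm; last by lra.
have [z0|z0] := leP 0 z.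
  have eza : expR z <= expR a by rewrite ler_expR.
  by nra.
have : z * (expR z - 1) <= z ^+ 2 by nra.
have := sqr_ge0 z; nra.
Qed.

(** With E = exp((t - u) g), pi_t(f) = pi_u(f E) / pi_u(E). Expanding numerator and denominator, the
    first-order term is the covariance of g and f under pi_u; the remainders are controlled by
    pi_u(g^2), which [W] bounds uniformly in u. *)
Lemma tempered_der : exists2 Cd, 0 <= Cd & forall u t (f : R -> R), phi0 <= u ->
  u < t <= 1 -> measurable_fun [set: R] f -> (forall x, 0 <= f x <= 1) ->
  `|mean (pi t) f - mean (pi u) f -
    (t - u) * mean (pi u) (fun x => (g - cst (mean (pi u) g)) x * f x)| <= Cd * (t - u) ^+ 2.
Proof.
pose Cp := C0 * mean (pi phi0) W.
have Cp0 : 0 <= Cp by rewrite mulr_ge0// mean_ge0.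
pose ka := expR b * (c2 * Cp); pose Ga := 1 + c2 * Cp.
have ka0 : 0 <= ka by rewrite mulr_ge0 ?expR_ge0// mulr_ge0.
have Ga0 : 0 <= Ga by rewrite addr_ge0// mulr_ge0.
pose cz := expR b * (expR b * Z phi0).
have cz0 : 0 <= cz by rewrite !mulr_ge0 ?expR_ge0// ltW// Z_gt0.
pose Y := ka + ka * (1 + 2 * Ga) + 2 * Ga ^+ 2.
have Y0 : 0 <= Y.
  have h : 0 <= 1 + 2 * Ga by rewrite addr_ge0// mulr_ge0.
  by rewrite /Y !addr_ge0//; apply: mulr_ge0 => //; exact: sqr_ge0.
exists (cz * Y) => [|u t f u0 /andP[ut t1] mf f01]; first exact: mulr_ge0.
have Su : phi0 <= u <= 1 by rewrite u0 (le_trans (ltW ut)).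
have St : phi0 <= t <= 1 by rewrite (le_trans u0 (ltW ut)) t1.
set del := t - u; have del0 : 0 < del by rewrite subr_gt0.
have del1 : del <= 1.
  have f00 : 0 < phi0 by case/andP: phi01.
  by rewrite /del; lra.
have b0 : 0 <= b by rewrite /b.
pose ze := Z t / Z u.
have ze0 : 0 < ze by rewrite divr_gt0 ?Z_gt0.
have zec : 1 <= cz * ze.
  have Zt := Z_ge St; rewrite expRN in Zt.
  exact: (one_le_ratio (expR_gt0 b) (Z_gt0 Su) Zt (Z_le Su)).
have iW := tempered_integ Su.
have ig2 : integ (pi u) (fun x => g x ^+ 2).
  apply: (integ_le (integZ c2 iW)); first exact: measurable_funX.
  by move=> x; rewrite ger0_norm ?sqr_ge0.
have m2 : mean (pi u) (fun x => g x ^+ 2) <= c2 * Cp.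
  apply: (@le_trans _ _ (mean (pi u) (fun x => c2 * W x))).
    by apply: mean_le => //; exact: integZ.
  rewrite meanZ// ler_wpM2l//; apply: tempered_dom => //.
  exact: wbounded_self.
have ic := integ_cst (pi u) 1.
have sg : sqinteg (pi u) g by split.
have ig := sqinteg_integ sg.
have abs1 x : `|g x| <= 1 + g x ^+ 2.
  rewrite -[g x ^+ 2]real_normK ?num_real//.
  have : 0 <= `|g x| by []. by move: (`|g x|) => v v0; nra.
have i1g2 : integ (pi u) (fun x => 1 + g x ^+ 2) by exact: integD.
have m1g2 : mean (pi u) (fun x => 1 + g x ^+ 2) <= Ga by rewrite meanD// meancst lerD2l.
have igf : integ (pi u) (fun x => g x * f x).
  apply: (integ_le i1g2); first exact: measurable_funM.
  move=> x; apply: le_trans (abs1 x); have /andP[h0 h1] := f01 x.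
  by rewrite normrM (ger0_norm h0) ler_piMr.
have iF : integ (pi u) f.
  by apply: (@ib _ _ 1 mf) => x; have /andP[h0 h1] := f01 x; rewrite ger0_norm.
have iFt : integ (pi t) f.
  by apply: (@ib _ _ 1 mf) => x; have /andP[h0 h1] := f01 x; rewrite ger0_norm.
pose E x := expR (del * g x).
have mE : measurable_fun [set: R] E by apply: measurableT_comp => //; exact: measurable_funM.
have E0 x : 0 <= E x by rewrite expR_ge0.
have Eb x : E x <= expR b.
  rewrite ler_expR; have := gb x; have := normr_ge0 B; rewrite -/b; nra.
have iE : integ (pi u) E.
  by apply: (@ib _ _ (expR b) mE) => x; rewrite ger0_norm.
have key (h : R -> R) : measurable_fun [set: R] h -> (forall x, 0 <= h x <= 1) ->
    mean (pi u) (fun x => h x * E x) = ze * mean (pi t) h.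
  move=> mh h01.
  have iht : integ (pi t) h.
    by apply: (@ib _ _ 1 mh) => x; have /andP[h0 h1] := h01 x; rewrite ger0_norm.
  have ihE : integ (pi u) (fun x => h x * E x).
    apply: (@ib _ _ (expR b)); first exact: measurable_funM.
    move=> x; have /andP[h0 h1] := h01 x; rewrite ger0_norm ?mulr_ge0//.
    by apply: le_trans (Eb x); rewrite ler_piMl.
  have : (\int[pi u]_x (h x * E x)%:E = ze%:E * \int[pi t]_x (h x)%:E)%E.
    rewrite (tempered_integral Su); last 2 first.
    - exact: measurable_funM.
    - by move=> x; rewrite mulr_ge0//; case/andP: (h01 x).
    rewrite (tempered_integral St mh); last by move=> x; case/andP: (h01 x).
    rewrite -ge0_integralZl//=; last 3 first.
    - apply/measurable_EFinP; apply: measurable_funM => //.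
      by apply: measurable_funM => //; exact: me.
    - move=> x _; rewrite lee_fin; apply: mulr_ge0; first by case/andP: (h01 x).
      by rewrite divr_ge0 ?expR_ge0// ltW// Z_gt0.
    - by rewrite lee_fin ltW.
    apply: eq_integral => x _; rewrite -EFinM; congr EFin.
    have -> : e t x = E x * e u x by rewrite /e /E -expRD; congr expR; rewrite /del; ring.
    rewrite /ze; move: (Z_gt0 St) (Z_gt0 Su); move: (Z t) (Z u) => zt zu zt0 zu0.
    by field; rewrite !gt_eqF.
  by rewrite !mean_fineK// -EFinM; case.
have kf := key f mf f01.
have m1 : measurable_fun [set: RR] (fun=> 1 : R) by exact: measurable_cst.
have o1 (x : R) : 0 <= (1 : R) <= 1 by rewrite ler01 lexx.
(* With h = 1, [ze] is the mean of [E], so the partition functions need no expansion of their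
   own. *)
have k1 := key _ m1 o1.
rewrite meancst mulr1 in k1.
have rem (h : R -> R) : measurable_fun [set: R] h -> (forall x, 0 <= h x <= 1) ->
    integ (pi u) h -> integ (pi u) (fun x => g x * h x) ->
    `|mean (pi u) (fun x => h x * E x) - mean (pi u) h - del * mean (pi u) (fun x => g x * h x)| <=
    ka * del ^+ 2.
  move=> mh h01 ih igh.
  have ihE : integ (pi u) (fun x => h x * E x).
    apply: (@ib _ _ (expR b)); first exact: measurable_funM.
    move=> x; have /andP[h0 h1] := h01 x; rewrite ger0_norm ?mulr_ge0//.
    by apply: le_trans (Eb x); rewrite ler_piMl.
  rewrite -meanZ// -meanB// -meanB//; [|exact: integB|exact: integZ].
  apply: (@le_trans _ _ (mean (pi u) (fun x => expR b * del ^+ 2 * g x ^+ 2))).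
    apply: mean_norm_le; first by apply: integB; [exact: integB|exact: integZ].
      exact: integZ.
    move=> x; have /andP[h0 h1] := h01 x.
    have -> : h x * E x - h x - del * (g x * h x) = h x * (E x - 1 - del * g x) by ring.
    rewrite normrM (ger0_norm h0).
    have q : `|E x - 1 - del * g x| <= expR b * (del * g x) ^+ 2.
      apply: quadratic_expR => //; apply: (@le_trans _ _ (del * b)).
        by apply: ler_wpM2l (gb x); exact: ltW.
      by rewrite ler_piMl.
    apply: (@le_trans _ _ `|E x - 1 - del * g x|); first by rewrite ler_piMl.
    by apply: le_trans q _; rewrite exprMn mulrA.
  rewrite meanZ// /ka.
  have -> : expR b * (c2 * Cp) * del ^+ 2 = expR b * del ^+ 2 * (c2 * Cp) by ring.
  by rewrite ler_wpM2l// mulr_ge0 ?expR_ge0// sqr_ge0.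
have r2 := rem f mf f01 iF igf.
have E1 : (fun x => g x * 1) = g by apply/funext => x; rewrite mulr1.
have r1 := rem _ m1 o1 ic; rewrite E1 k1 meancst in r1; have {}r1 := r1 ig.
rewrite kf in r2.
have A0 : 0 <= mean (pi u) f <= 1.
  rewrite mean_ge0 => [|x]; last by case/andP: (f01 x).
  by rewrite -(meancst (pi u) 1) mean_le// => x; case/andP: (f01 x).
have A1 : `|mean (pi u) (fun x => g x * f x)| <= Ga.
  apply: le_trans m1g2; apply: mean_norm_le => // x.
  apply: le_trans (abs1 x); have /andP[h0 h1] := f01 x.
  by rewrite normrM (ger0_norm h0) ler_piMr.
have G1 : `|mean (pi u) g| <= Ga by apply: le_trans m1g2; exact: mean_norm_le.
have -> : mean (pi u) (fun x => (g - cst (mean (pi u) g)) x * f x) =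
    mean (pi u) (fun x => g x * f x) - mean (pi u) g * mean (pi u) f.
  rewrite -meanZ// -meanB//; last exact: integZ.
  by congr mean; apply/funext => x; rewrite !fctE; ring.
move: r1 r2 A0 A1 G1; set a0 := mean (pi u) f; set a1 := mean (pi u) (fun x => g x * f x).
set G := mean (pi u) g; set q := mean (pi t) f => r1 r2 /andP[A00 A01] A1 G1.
pose D := a1 - G * a0.
have D1 : `|D| <= 2 * Ga.
  apply: le_trans (ler_normB _ _) _; rewrite mulr_natl mulr2n; apply: lerD => //.
  by rewrite normrM (ger0_norm A00); apply: le_trans G1; rewrite ler_piMr.
(* Multiplication by [ze] clears the denominator; the three terms on the right are all of second
   order in del. *)
have XE : ze * (q - a0 - del * D) = (ze * q - a0 - del * a1) -
   (ze - 1 - del * G) * (a0 + del * D) - del ^+ 2 * (G * D) by rewrite /D; ring.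
have aD : `|a0 + del * D| <= 1 + 2 * Ga.
  apply: le_trans (ler_normD _ _) _; apply: lerD; first by rewrite ger0_norm.
  by rewrite normrM (gtr0_norm del0); apply: le_trans D1; rewrite ler_piMl.
have XB : ze * `|q - a0 - del * D| <= Y * del ^+ 2.
  rewrite -[X in X * _](gtr0_norm ze0) -normrM XE.
  have -> : Y * del ^+ 2 = ka * del ^+ 2 + ka * del ^+ 2 * (1 + 2 * Ga) +
      del ^+ 2 * (2 * Ga ^+ 2) by rewrite /Y; ring.
  apply: le_trans (ler_normB _ _) _; apply: lerD.
    apply: le_trans (ler_normB _ _) _; apply: lerD => //.
    by rewrite normrM; apply: ler_pM.
  rewrite normrM ger0_norm ?sqr_ge0//; apply: ler_wpM2l; first exact: sqr_ge0.
  rewrite normrM; have -> : 2 * Ga ^+ 2 = Ga * (2 * Ga) by ring.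
  exact: ler_pM.
apply: (@le_trans _ _ (cz * (ze * `|q - a0 - del * D|))).
  by rewrite mulrA ler_peMl.
by rewrite -[leRHS]mulrA; apply: ler_wpM2l.
Qed.

End weight.
End tempered.

Lemma positive_linear_Rintegral {R : realType} (d : measure_display) (Om : measurableType d)
    (m : measure Om R) (Y : Om -> R) (W : R -> R) :
  measurable_fun [set: Om] Y -> m.-integrable [set: Om] (EFin \o (W \o Y)) ->
  positive_linear W (fun f => \int[m]_w f (Y w))%R /\
  forall f, wbounded W f -> m.-integrable [set: Om] (EFin \o (f \o Y)).
Proof.
move=> mY iW.
have iF f : wbounded W f -> m.-integrable [set: Om] (EFin \o (f \o Y)).
  move=> [mf [c fc]].
  have icW : m.-integrable [set: Om] (EFin \o (fun w => c * W (Y w))).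
    by have := integrableZl measurableT c iW; apply: eq_integrable.
  apply: (le_integrable measurableT _ _ icW) => [|w _].
    by apply/measurable_EFinP; exact: measurableT_comp.
  by rewrite /= lee_fin; apply: le_trans (fc _) _; exact: ler_norm.
split=> //; split=> [f h Lf Lh|a f Lf|f Lf f0].
- by apply: RintegralD => //; exact: iF.
- by apply: RintegralZl => //; exact: iF.
- by apply: Rintegral_ge0.
Qed.

(** * From the hypotheses on the kernels to a regular family *)

Section tempering_kernels.
Context {R : realType}.
Local Notation RR := (measurableTypeR R).
Variables (g : R -> R) (phi0 B : R) (pi : R -> probability RR R).
Variable k : R -> R.-pker RR ~> RR.
Hypotheses (mg : measurable_fun [set: RR] g) (gB : forall x, g x <= B).
Hypothesis g1 : (\int[lebesgue_measure]_x (expR (g x))%:E = 1)%E.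
Hypothesis phi01 : 0 < phi0 < 1.
Hypothesis tp : tempered_family phi0 g pi.
Hypothesis k_invariant : forall s, phi0 < s <= 1 -> invariant_law (pi s) (k s).
Variables (C : set RR) (theta : R) (nu : probability RR R).
Hypothesis minorization : uniform_minorization phi0 k C theta nu.
Variables (V : R -> R) (lambda b : R).
Hypothesis drift : uniform_drift phi0 pi k C V lambda b.
Variable M : R.
Hypothesis lipschitz : lipschitz_perturbation phi0 k V M.
Variable r : R.
Hypothesis r_range : 0 <= r < 2^-1.
Hypothesis g_growth : L_weighted (fun x => V x `^ r) g.

(** The lower bound 1/2 keeps the contraction rate positive whatever the sign of [lambda]. *)
Let lam := Num.max lambda 2^-1.
Let b' := Num.max b 0.
(** Chosen so that theta a = b': on [C], subtracting theta nu(W) from the kernel removes at least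
    b', hence cancels the drift's excess. *)
Let a := b' / theta.
Let W x := V x + a.
Let rho := (a + lam) / (a + 1).

Let mC : measurable C. Proof. by case: minorization. Qed.
Let theta0 : 0 < theta. Proof. by case: minorization => _ /andP[]. Qed.
Let mV : measurable_fun [set: RR] V. Proof. by case: drift. Qed.
Let V1 x : 1 <= V x. Proof. by case: drift. Qed.
Let V0 x : 0 <= V x. Proof. exact: le_trans (V1 x). Qed.
Let lam1 : lam < 1.
Proof. by case: drift => _ _ _ l1 _; rewrite /lam gt_max l1/= invf_lt1 ?ltr1n. Qed.
Let lam0 : 0 < lam. Proof. by rewrite /lam lt_max invr_gt0 ltr0n orbT. Qed.
Let b0 : 0 <= b'. Proof. by rewrite /b' le_max lexx orbT. Qed.
Let a0 : 0 <= a. Proof. by rewrite divr_ge0// ltW. Qed.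
Let mW : measurable_fun [set: RR] W.
Proof. by apply: measurable_funD => //; exact: measurable_cst. Qed.
Let VW x : V x <= W x. Proof. by rewrite /W lerDl. Qed.
Let W1 x : 1 <= W x. Proof. exact: le_trans (VW x). Qed.
Let W0 x : 0 <= W x. Proof. exact: le_trans (W1 x). Qed.
Let WV x : W x <= (1 + a) * V x.
Proof. by rewrite /W mulrDl mul1r lerD2l ler_peMr. Qed.

Let kV s x : phi0 < s <= 1 -> (\int[k s x]_y (V y)%:E <= (lam * V x + b' * \1_C x)%:E)%E.
Proof.
move=> Ss; case: drift => _ _ _ _ [/(_ s x Ss) h _]; apply: le_trans h _; rewrite lee_fin lerD//.
  by rewrite ler_wpM2r// /lam le_max lexx.
by rewrite ler_wpM2r ?indicE// /b' le_max lexx.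
Qed.

Let ikV s x : phi0 < s <= 1 -> (k s x).-integrable [set: R] (EFin \o V).
Proof.
move=> Ss; apply/integrableP; split; first exact/measurable_EFinP.
under eq_integral do rewrite /= ger0_norm//.
by apply: le_lt_trans (kV x Ss) _; rewrite ltry.
Qed.

Let ikc s x (c : R) : (k s x).-integrable [set: R] (EFin \o cst c).
Proof.
apply/integrableP; split; first by apply/measurable_EFinP; exact: measurable_cst.
by rewrite /= integral_cst//= prob_kernel mule1 ltry.
Qed.

Let kop_cst s (c : R) : kop (k s) (cst c) = cst c.
Proof.
apply/funext => x; rewrite /kop /Rintegral.
have -> : (\int[k s x]_y (cst c y)%:E = \int[k s x]_y cst c%:E y)%E by [].
by rewrite integral_cst//= prob_kernel mule1.
Qed.

Let ikW s x : phi0 < s <= 1 -> (k s x).-integrable [set: R] (EFin \o (W \o id)).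
Proof.
move=> Ss; have := integrableD measurableT (ikV x Ss) (ikc s x a).
exact: eq_integrable.
Qed.

Let plk s x : phi0 < s <= 1 -> positive_linear W ((kop (k s))^~ x).
Proof.
move=> Ss; have [//|h _] := @positive_linear_Rintegral R _ RR (k s x) id W _ (ikW x Ss).
exact: h.
Qed.

Let ik s x f : phi0 < s <= 1 -> wbounded W f -> (k s x).-integrable [set: R] (EFin \o f).
Proof.
move=> Ss Lf; have [//|_ h] := @positive_linear_Rintegral R _ RR (k s x) id W _ (ikW x Ss).
exact: h.
Qed.

Let LV : wbounded W V.
Proof. by apply: (wbounded_le (c := 1)) => // x; rewrite ger0_norm// mul1r. Qed.

Let LW : wbounded W W. Proof. exact: wbounded_self. Qed.

Let kopV s x : phi0 < s <= 1 -> kop (k s) V x <= lam * V x + b' * \1_C x.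
Proof.
by move=> Ss; have := kV x Ss; rewrite kop_fineK ?lee_fin//; exact: ikV.
Qed.

Let kopW s x : phi0 < s <= 1 -> kop (k s) W x = kop (k s) V x + a.
Proof.
move=> Ss; have -> : W = (fun y => V y + cst a y) by [].
by rewrite kopD; [rewrite kop_cst| exact: ikV|exact: ikc].
Qed.

Let kop_pos s : phi0 < s <= 1 -> positive_operator W (kop (k s)).
Proof.
move=> Ss; split=> [x|f Lf]; first exact: plk.
have [c c0 fc] := wboundedP W0 Lf.
apply: (wbounded_le (c := c * (lam + b' + 1))).
  by apply: kop_meas; [exact: wbounded_meas Lf|move=> x; exact: ik].
move=> x; apply: (@le_trans _ _ (kop (k s) (c *: W) x)).
  by have := pl_norm (plk x Ss) Lf (wboundedZ c LW) fc.
rewrite (plZ (plk x Ss))// -mulrA ler_wpM2l// kopW//.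
have h1 : \1_C x <= 1 :> R by rewrite indicE lern1 leq_b1.
have h2 := kopV x Ss; have h3 := V1 x.
have h4 : b' * \1_C x <= b' by rewrite ler_piMr.
have h5 : b' <= b' * V x by rewrite ler_peMr.
have h6 : 0 <= (lam + b') * a by rewrite mulr_ge0// addr_ge0// ltW.
by rewrite /W; have := V0 x; nra.
Qed.

Let iW0 : integ (pi phi0) W.
Proof.
have iV : integ (pi phi0) V.
  apply/integrableP; split; first exact/measurable_EFinP.
  under eq_integral do rewrite /= ger0_norm//.
  by case: drift => _ _ _ _ [].
by apply: integD => //; exact: integ_cst.
Qed.

Let iWs s : phi0 <= s <= 1 -> integ (pi s) W.
Proof. exact: (tempered_integ mg gB g1 phi01 tp mW W1 iW0). Qed.

Let iws s f : phi0 <= s <= 1 -> wbounded W f -> integ (pi s) f.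
Proof.
move=> Ss Lf; have [//|_ h] := @positive_linear_Rintegral R _ RR (pi s) id W _ (iWs Ss).
exact: h.
Qed.

Let weak s : phi0 < s <= 1 -> phi0 <= s <= 1.
Proof. by case/andP => /ltW -> ->. Qed.

(** Invariance on sets is a Markov property with trivial past, so [markov_integ] extends it to
    nonnegative functions; signed functions follow by adding a multiple of [W]. *)
Let inv s f : phi0 < s <= 1 -> wbounded W f -> mean (pi s) (kop (k s) f) = mean (pi s) f.
Proof.
move=> Ss Lf; have Sw := weak Ss.
have GK E : ([set setT; set0] : set (set RR)) E -> forall A, measurable A ->
    pi s (E `&` id @^-1` A) = (\int[pi s]_(x in E) k s x A)%E.
  move=> [->|->] A mA; last by rewrite set0I measure0 integral_set0.
  by rewrite setTI preimage_id k_invariant.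
have mid : measurable_fun [set: RR] (@id RR) by exact: measurable_id.
have pos h : wbounded W h -> (forall x, 0 <= h x) -> mean (pi s) (kop (k s) h) = mean (pi s) h.
  move=> Lh h0.
  have [] // := @markov_integ R _ RR (pi s) [set setT; set0] id id (k s) mid mid GK _ _ h.
  - by left.
  - by right.
  - exact: wbounded_meas Lh.
  - by move=> x; exact: ik.
  - exact: iws.
have [c c0 fc] := wboundedP W0 Lf.
have Lc : wbounded W (c *: W) by exact: wboundedZ.
have LfW : wbounded W (f + c *: W) by exact: wboundedD.
have kp := kop_pos Ss.
have E : f = (f + c *: W) - c *: W by rewrite addrK.
have iK h : wbounded W h -> integ (pi s) (kop (k s) h).
  by move=> Lh; apply: iws => //; apply: po_wb kp _ _.
rewrite {1}E (poB kp LfW Lc) [LHS]meanB ?iK// pos//; last first.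
  by move=> x; have := fc x; rewrite ler_norml -subr_ge0 opprK => /andP[].
rewrite pos//; last by move=> x; rewrite mulr_ge0.
by rewrite {2}E [RHS]meanB//; exact: iws.
Qed.

(** If [C] were empty, drift and invariance would give pi(V) <= lam pi(V) with pi(V) >= 1. A point
    of [C] is what bounds nu(W) through the minorization. *)
Let C_neq0 : exists x, C x.
Proof.
apply: contrapT => nC; have S1 : phi0 < (1 : R) <= 1 by rewrite lexx andbT; case/andP: phi01.
have := inv S1 LV; have kp := kop_pos S1.
have : mean (pi 1) (kop (k 1) V) <= lam * mean (pi 1) V.
  rewrite -meanZ; last exact: iws (weak S1) LV.
  apply: mean_le.
  - by apply: iws (weak S1) _; exact: po_wb kp _ LV.
  - by apply: integZ; exact: iws (weak S1) LV.
  move=> x; apply: le_trans (kopV x S1) _; rewrite indicE memNset ?mulr0 ?addr0//.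
  by move=> Cx; apply: nC; exists x.
have : 1 <= mean (pi 1) V.
  apply: (@le_trans _ _ (mean (pi 1) (cst 1))); first by rewrite meancst.
  by apply: mean_le => //; [exact: integ_cst|exact: iws (weak S1) LV].
move=> h1 h2 h3; move: h2; rewrite h3 leNgt => /negP; apply.
by rewrite gtr_pMl// (lt_le_trans ltr01).
Qed.

Let minor_ge0 s x (f : R -> R) : phi0 < s <= 1 -> C x -> measurable_fun [set: RR] f ->
  (forall y, 0 <= f y) -> (theta%:E * \int[nu]_y (f y)%:E <= \int[k s x]_y (f y)%:E)%E.
Proof.
move=> Ss Cx mf f0; pose t := NngNum (ltW theta0).
rewrite -[theta%:E]/(t%:num%:E) -ge0_integral_mscale//; last 2 first.
- exact/measurable_EFinP.
- by move=> y _; rewrite lee_fin.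
apply: ge0_le_measure_integral => //.
- by move=> A mA; case: minorization => _ _ /(_ s x A Ss Cx mA).
- exact/measurable_EFinP.
Qed.

Let iWnu : integ nu W.
Proof.
have [x Cx] := C_neq0; have S1 : phi0 < (1 : R) <= 1 by rewrite lexx andbT; case/andP: phi01.
apply/integrableP; split; first exact/measurable_EFinP.
under eq_integral do rewrite /= ger0_norm//.
have := minor_ge0 S1 Cx mW W0.
rewrite kop_fineK; last exact: ik.
rewrite muleC -lee_pdivlMr// => h; apply: le_lt_trans h _.
by rewrite -EFinM ltry.
Qed.

Let plnu : positive_linear W (mean nu).
Proof. by have [//|h _] := @positive_linear_Rintegral R _ RR nu id W _ iWnu. Qed.

Let inu f : wbounded W f -> integ nu f.
Proof. by move=> Lf; have [//|_ h] := @positive_linear_Rintegral R _ RR nu id W _ iWnu;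
  exact: h. Qed.

Let res0 s f x : phi0 < s <= 1 -> wbounded W f -> (forall y, 0 <= f y) ->
  0 <= residual (kop (k s)) (mean nu) C theta f x.
Proof.
move=> Ss Lf f0; rewrite /residual.
have -> : (kop (k s) f - (theta * mean nu f) *: \1_C) x =
  kop (k s) f x - (theta * mean nu f) * \1_C x by [].
rewrite subr_ge0 indicE; have [|] := boolP (x \in C); last first.
  by move=> _; rewrite mulr0; have := po_ge0 (kop_pos Ss) Lf f0; apply.
rewrite inE mulr1 => Cx; have := minor_ge0 Ss Cx (wbounded_meas Lf) f0.
by rewrite kop_fineK ?ik// mean_fineK ?inu// -EFinM lee_fin.
Qed.

Let rho_itv : 0 < rho < 1.
Proof.
have a1 : 0 < a + 1 by rewrite ltr_wpDl.
by rewrite divr_gt0 ?ltr_wpDl//= ltr_pdivrMr// mul1r ltrD2l.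
Qed.

Let rhoE : rho * (a + 1) = a + lam.
Proof. by rewrite /rho mulfVK// gt_eqF// ltr_wpDl. Qed.

Let res_drift s x : phi0 < s <= 1 ->
  residual (kop (k s)) (mean nu) C theta W x <= rho * W x.
Proof.
move=> Ss; rewrite /residual.
have -> : (kop (k s) W - (theta * mean nu W) *: \1_C) x =
  kop (k s) W x - (theta * mean nu W) * \1_C x by [].
rewrite kopW//; have h := kopV x Ss.
have nV : mean nu W = mean nu V + a.
  by rewrite /W meanD ?meancst//; [exact: inu|exact: integ_cst].
have nV0 : 0 <= mean nu V by exact: mean_ge0.
have ta : theta * a = b' by rewrite /a mulrC divfK// gt_eqF.
have i0 : 0 <= \1_C x :> R by rewrite indicE.
apply: (@le_trans _ _ (lam * V x + a)).
  have : 0 <= theta * mean nu V * \1_C x by rewrite mulr_ge0// mulr_ge0// ltW.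
  by rewrite nV mulrDr ta mulrDl; lra.
have rl : lam <= rho.
  rewrite /rho ler_pdivlMr ?ltr_wpDl// mulrDr mulr1 lerD2r ler_piMl// ltW//; exact: lam1.
(* For V >= 1, lam V + a <= rho (V + a), with equality at V = 1: this determines [rho]. *)
by have := V1 x; have := rhoE; rewrite /W; nra.
Qed.

(** Division by c (1 + a) brings f below [V], since W <= (1 + a) V. The sign of [M] is not
    prescribed, whence its absolute value. *)
Let lip s t f c x : phi0 < s <= 1 -> phi0 < t <= 1 -> wbounded W f -> 0 <= c ->
  (forall y, `|f y| <= c * W y) ->
  `|kop (k s) f x - kop (k t) f x| <= `|M| * (1 + a) * c * `|s - t| * W x.
Proof.
move=> Ss St Lf c0 fc.
have [c_eq0|c_neq0] := eqVneq c 0.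
  have -> : f = cst 0.
    apply/funext => y; apply/eqP; rewrite -normr_le0.
    by have := fc y; rewrite c_eq0 mul0r.
  by rewrite !kop_cst subrr normr0 c_eq0 !(mulr0, mul0r).
have cp : 0 < c by rewrite lt_def c_neq0.
have a1 : 0 < 1 + a by rewrite ltr_wpDr.
have ca : 0 < c * (1 + a) by exact: mulr_gt0.
pose h := (c * (1 + a))^-1 *: f.
have Lh : wbounded W h by exact: wboundedZ.
have hV y : `|h y| <= V y.
  rewrite /h [(_ *: _) y]/(_ * _) normrM ger0_norm ?invr_ge0 ?(ltW ca)//.
  rewrite ler_pdivrMl//; apply: le_trans (fc y) _.
  by rewrite -mulrA ler_wpM2l.
have key : `|kop (k s) h x - kop (k t) h x| <= M * `|s - t| * V x.
  have Vp : 0 < V x by exact: lt_le_trans (V1 x).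
  rewrite -ler_pdivrMr// mulrC -lee_fin.
  apply: le_trans (lipschitz Ss St).
  apply: le_trans; last by apply: ereal_sup_ubound; exists x.
  rewrite EFinM; apply: lee_wpmul2l; first by rewrite lee_fin invr_ge0.
  apply: ereal_sup_ubound; exists h => /=; first by split=> //; exact: wbounded_meas Lh.
  by rewrite !kop_fineK ?ik// -EFinB.
move: key; rewrite /h (poZ (kop_pos Ss) _ Lf) (poZ (kop_pos St) _ Lf).
rewrite [(_ *: kop (k s) f) x]/(_ * _) [(_ *: kop (k t) f) x]/(_ * _) -mulrBr normrM.
rewrite ger0_norm ?invr_ge0 ?(ltW ca)// ler_pdivrMl// => key; apply: le_trans key _.
have -> : `|M| * (1 + a) * c * `|s - t| * W x = c * (1 + a) * (`|M| * `|s - t| * W x) by ring.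
rewrite ler_pM2l// -!mulrA; apply: (@le_trans _ _ (`|M| * (`|s - t| * V x))).
  by rewrite ler_wpM2r ?mulr_ge0// ler_norm.
by rewrite ler_wpM2l// ler_wpM2l.
Qed.

Lemma regular_tempering : exists W' rho' Cpi M' p cg,
  regular_family W' phi0 (fun s => kop (k s)) (mean nu) (fun s => mean (pi s))
    C theta rho' Cpi M' /\
  [/\ 0 < p < 2^-1, 0 <= cg & forall x, `|g x| <= cg * W' x `^ p] /\
  [/\ integ (pi phi0) W', mean (pi phi0) W' <= Cpi &
      forall s x, phi0 < s <= 1 -> (k s x).-integrable [set: R] (EFin \o W')].
Proof.
have Ss0 : phi0 <= phi0 <= 1 by rewrite lexx/= ltW//; case/andP: phi01.
pose C0 := expR `|B| * expR `|B| * expR `|B| * partition_function g phi0.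
(* [r] may be 0 while the powers of [W] need a positive exponent; 1/4 is an arbitrary value of ]0,
   1/2[. *)
pose p := Num.max r 4^-1.
have p_itv : 0 < p < 2^-1.
  case/andP: r_range => _ r2; rewrite /p lt_max gt_max r2 !invr_gt0 ltr0n orbT/=.
  by rewrite ltf_pV2 ?posrE// ltr_nat.
have [cg cg0 hcg] : exists2 cg, 0 <= cg & forall x, `|g x| <= cg * V x `^ r.
  pose Vr x := V x `^ r; have h : (weighted_norm Vr g < +oo)%E := g_growth.
  have ub (x : R) : ((`|g x| / Vr x)%:E <= weighted_norm Vr g)%E.
    by apply: ereal_sup_ubound; exists x.
  have wn0 : (0 <= weighted_norm Vr g)%E.
    by apply: le_trans (ub 0); rewrite lee_fin divr_ge0// powR_ge0.
  move: ub h wn0; case: (weighted_norm _ _) => // cg ub _ cg0; exists cg => // x.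
  by have := ub x; rewrite lee_fin ler_pdivrMr// powR_gt0// (lt_le_trans _ (V1 x)).
(* The constant must bound the mean of [W] under the initial law and, through domination by
   [pi phi0], under every [pi s]. *)
exists W, rho, (mean (pi phi0) W + `|C0 * mean (pi phi0) W|), (`|M| * (1 + a)), p, cg.
have dom s : phi0 <= s <= 1 -> mean (pi s) W <= C0 * mean (pi phi0) W.
  move=> /andP[s0 s1]; apply: (tempered_dom mg gB g1 phi01 tp mW W1 iW0) => //.
  by rewrite s0.
split; last split.
- split=> //.
  + exact: meancst.
  + by move=> s /weak Ss; have [//|h _] := @positive_linear_Rintegral R _ RR (pi s) id W _ (iWs Ss).
  + by move=> s _; exact: meancst.
  + by move=> s Ss f; exact: inv.
  + move=> s /weak/dom h; apply: le_trans h _; apply: le_trans (ler_norm _) _.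
    by rewrite lerDr mean_ge0.
  + by move=> s Ss f Lf f0 x; exact: res0.
  + by move=> s Ss x; exact: res_drift.
  + by rewrite mulr_ge0// addr_ge0.
  + by move=> s t Ss St f c Lf c0 fc x; exact: lip.
- split=> // x; apply: le_trans (hcg x) _; rewrite ler_wpM2l//.
  apply: (@le_trans _ _ (V x `^ p)); first by rewrite ler_powR// /p le_max lexx.
  by rewrite ge0_ler_powR ?nnegrE// /p le_max invr_ge0 ler0n orbT.
- split=> //; first by rewrite lerDl.
Qed.

End tempering_kernels.

(** For c large, f is the difference of the nonnegative functions f + c W and c W. *)
Lemma positive_linear_ext {R : realType} (W : R -> R) (I J : (R -> R) -> R) :
  measurable_fun [set: R] W -> (forall x, 0 <= W x) ->
  positive_linear W I -> positive_linear W J ->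
  (forall f, wbounded W f -> (forall x, 0 <= f x) -> I f = J f) ->
  forall f, wbounded W f -> I f = J f.
Proof.
move=> mW W0 pI pJ IJ f Lf; have [c c0 fc] := wboundedP W0 Lf.
have LW : wbounded W W by exact: wbounded_self.
have Lc : wbounded W (c *: W) by exact: wboundedZ.
have LfW : wbounded W (f + c *: W) by exact: wboundedD.
have -> : f = (f + c *: W) - c *: W by rewrite addrK.
rewrite (plB pI)// (plB pJ)// !IJ// => x.
  by have := fc x; rewrite mulr_ge0.
by have := fc x; rewrite ler_norml -subr_ge0 opprK => /andP[].
Qed.

Lemma ge0_integral_law {R : realType} d (Om : measurableType d) (P : probability Om R)
    (Y : {RV P >-> measurableTypeR R}) (mu : probability (measurableTypeR R) R) (f : R -> R) :
  (forall A, measurable A -> distribution P Y A = mu A) ->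
  measurable_fun [set: R] f -> (forall x, 0 <= f x) ->
  (\int[P]_w (f (Y w))%:E = \int[mu]_x (f x)%:E)%E.
Proof.
move=> Ymu mf f0; have mY : measurable_fun [set: Om] Y by exact: measurable_funPT.
have h1 : ge0_functional (fun f : measurableTypeR R -> R => \int[P]_w (f (Y w) * 1)%:E)%E.
  by apply: ge0_functional_weighted => //; exact: measurable_cst.
have h2 : ge0_functional (fun f : measurableTypeR R -> R => \int[mu]_x (f (id x) * 1)%:E)%E.
  by apply: ge0_functional_weighted => //; exact: measurable_cst.
have HI (A : set (measurableTypeR R)) : measurable A ->
    (\int[P]_w (\1_A (Y w) * 1)%:E = \int[mu]_x (\1_A (id x) * 1)%:E)%E.
  move=> mA; under eq_integral do rewrite mulr1; under [RHS]eq_integral do rewrite mulr1.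
  transitivity (P (Y @^-1` A)); first exact: mean_indic.
  by rewrite -[LHS]/(distribution P Y A) Ymu//; apply/esym; exact: (@mean_indic R _ _ mu id A).
have := ge0_functional_eq h1 h2 HI mf f0.
by under eq_integral do rewrite mulr1; under [in X in _ = X -> _]eq_integral do rewrite mulr1.
Qed.

(** * Marginal laws and conditional means of a Markov chain *)

Section markov_path.
Context {R : realType}.
Local Notation RR := (measurableTypeR R).
Variables (W : R -> R) (phi0 : R) (k : R -> R.-pker RR ~> RR).
Variables (nu : (R -> R) -> R) (pi : R -> probability RR R).
Variables (C : set R) (theta rho Cpi M : R).
Hypothesis rf : regular_family W phi0 (fun s => kop (k s)) nu (fun s => mean (pi s))
  C theta rho Cpi M.
Hypothesis iW0 : integ (pi phi0) W.
Hypothesis W0le : mean (pi phi0) W <= Cpi.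
Hypothesis ikW : forall s x, phi0 < s <= 1 -> (k s x).-integrable [set: R] (EFin \o W).
Variables (d : nat) (disp : measure_display) (Om : measurableType disp).
Variables (P : probability Om R) (Y : nat -> {RV P >-> RR}).
Hypothesis d0 : (0 < d)%N.
Hypothesis mc : markov_chain d (pi phi0) (fun n => k (temperature phi0 d n)) Y.

Let mW := rf_meas rf.
Let W1 := rf_ge1 rf.
Let phi01 := rf_phi0 rf.
Let W0 x : 0 <= W x. Proof. exact: le_trans (W1 x). Qed.
Let LW : wbounded W W. Proof. exact: wbounded_self. Qed.
Let kn n := k (temperature phi0 d n).
Let tS n : (n < d)%N -> phi0 < temperature phi0 d n.+1 <= 1.
Proof. by move=> nd; apply: (temperature_itv rf). Qed.
Let mY n : measurable_fun [set: Om] (Y n). Proof. exact: measurable_funPT. Qed.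
Let ik n f x : (n < d)%N -> wbounded W f -> (kn n.+1 x).-integrable [set: R] (EFin \o f).
Proof.
move=> nd Lf; have [//|_ h] := @positive_linear_Rintegral R _ RR (kn n.+1 x) id W _ (ikW x (tS nd)).
exact: h.
Qed.

(** Time n itself belongs to this past: the strict inequality is against n + 1, as in the Markov
    property for the step to n + 1. *)
Let G n : set (set Om) := \bigcup_(m in [set m | (m < n.+1)%N]) sigma_rv (Y m).

Let GK n : (n < d)%N -> forall E, <<s G n >> E -> forall B : set RR, measurable B ->
  P (E `&` Y n.+1 @^-1` B) = (\int[P]_(w in E) kn n.+1 (Y n w) B)%E.
Proof. by move=> nd E GE B mB; case: mc => _ /(_ n.+1 nd E GE B mB). Qed.

Let GT n : <<s G n >> setT.
Proof. 
have [h0 hD _] := @smallest_sigma_algebra _ [set: Om] (G n).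
by have := hD _ h0; rewrite setD0.
 Qed.
Let G0 n : <<s G n >> set0.
Proof. by case: (@smallest_sigma_algebra _ [set: Om] (G n)). Qed.

Let step n (f : R -> R) : (n < d)%N -> wbounded W f -> (forall x, 0 <= f x) ->
  (\int[P]_w (f (Y n.+1 w))%:E = \int[P]_w (kop (kn n.+1) f (Y n w))%:E)%E.
Proof.
move=> nd Lf f0.
transitivity (\int[P]_w (1 * f (Y n.+1 w))%:E)%E.
  by apply: eq_integral => w _; rewrite mul1r.
transitivity (\int[P]_w (1 * kop (kn n.+1) f (Y n w))%:E)%E; last first.
  by apply: eq_integral => w _; rewrite mul1r.
apply: (@markov_ge0 R _ Om P <<s G n >> (Y n) (Y n.+1) (kn n.+1) (mY n) (mY n.+1) (GK nd)
  (fun=> 0) (fun=> 1) f) => //.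
- move=> B mB; have [h|h] := pselect (B 0).
    by have -> : (fun=> 0) @^-1` B = [set: Om] by apply/seteqP; split.
  by have -> : (fun=> 0) @^-1` B = set0 :> set Om by apply/seteqP; split.
- exact: wbounded_meas Lf.
- by move=> x; exact: ik.
Qed.

Let iWY n : (n <= d)%N -> integ P (fun w => W (Y n w)).
Proof.
have mWY m : measurable_fun [set: Om] (fun w => W (Y m w)) by exact: measurableT_comp.
elim: n => [|n IH] nd; apply/integrableP; (split; first exact/measurable_EFinP);
  under eq_integral do rewrite /= ger0_norm//.
  by rewrite (ge0_integral_law (proj1 mc) mW W0) mean_fineK// ltry.
rewrite step//.
have [_ h] := @positive_linear_Rintegral R _ Om P (Y n) W (mY n) (IH (ltnW nd)).
have LK : wbounded W (kop (kn n.+1) W) := po_wb (rf_pos rf (tS nd)) LW.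
by rewrite mean_fineK ?ltry//; exact: h.
Qed.

Let plY n : (n <= d)%N -> positive_linear W (fun f => mean P (fun w => f (Y n w))).
Proof. by move=> nd; have [] := @positive_linear_Rintegral R _ Om P (Y n) W (mY n) (iWY nd). Qed.

Let iY n f : (n <= d)%N -> wbounded W f -> integ P (fun w => f (Y n w)).
Proof.
by move=> nd Lf; have [_ h] := @positive_linear_Rintegral R _ Om P (Y n) W (mY n) (iWY nd);
  exact: h.
Qed.

Lemma markov_path_chain : path_chain W phi0 (fun s => kop (k s)) Cpi d P Y G.
Proof.
split=> //.
- by move=> n _; exact: mY.
- split=> //.
  + exact: meancst.
  + suff -> : mean P (fun w => W (Y 0%N w)) = mean (pi phi0) W by [].
    have := ge0_integral_law (proj1 mc) mW W0.
    by rewrite !mean_fineK ?iY// => -[].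
  + move=> n f nd Lf.
    have pK : positive_linear W (fun f => mean P (fun w => kop (kn n.+1) f (Y n w))).
      have kp := rf_pos rf (tS nd); have pn := plY (ltnW nd).
      split=> [u v Lu Lv|a u Lu|u Lu u0].
      * rewrite -(plD pn); [|exact: po_wb kp _ _|exact: po_wb kp _ _].
        by congr (mean P _); apply/funext => w; rewrite (poD kp).
      * rewrite -(plZ pn); last exact: po_wb kp _ _.
        by congr (mean P _); apply/funext => w; rewrite (poZ kp).
      * by apply: mean_ge0 => w; exact: (po_ge0 kp).
    apply: (positive_linear_ext mW W0 (plY nd) pK) => // h Lh h0.
    have := step nd Lh h0; rewrite !mean_fineK ?iY ?(ltnW nd)//; first by case.
    exact: po_wb (rf_pos rf (tS nd)) _ _.
- move=> n m /andP[mn _] B mB; apply: sub_sigma_algebra; exists m => //.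
  by exists B.
- move=> n A f nd aA sA Lf Lf2.
  have sf : sqinteg P (fun w => f (Y n.+1 w)).
    split; first by apply: measurableT_comp => //; exact: wbounded_meas Lf.
    exact: (iY nd Lf2).
  have := @markov_mean R _ Om P <<s G n >> (Y n) (Y n.+1) (kn n.+1) (mY n) (mY n.+1) (GK nd)
    (@GT n) (@G0 n) A id f.
  apply=> //.
  + exact: sqinteg_meas sA.
  + exact: wbounded_meas Lf.
  + by move=> x; exact: ik.
  + by move=> x; exact: (ik x nd Lf2).
Qed.

End markov_path.

(** * The effective sample size *)

Section asymptotic_variance.
Context {R : realType}.
Local Notation RR := (measurableTypeR R).
Variables (W : R -> R) (phi0 : R) (k : R -> R.-pker RR ~> RR).
Variables (nu : (R -> R) -> R) (pi : R -> probability RR R).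
Variables (C : set R) (theta rho Cpi M : R).
Local Notation K := (fun s => kop (k s)).
Local Notation piw := (fun s => mean (pi s)).
Hypothesis rf : regular_family W phi0 K nu piw C theta rho Cpi M.
Variables (g : R -> R) (p cg : R).
Hypotheses (p_itv : 0 < p < 2^-1) (mg : measurable_fun [set: R] g) (cg0 : 0 <= cg).
Hypothesis gW : forall x, `|g x| <= cg * W x `^ p.
Local Notation h s := (hs K nu piw C theta g s).
Local Notation w s := (ws K nu piw C theta g s).
Variable E : set R.
Hypothesis cE : countable E.
Hypothesis iter_cvg : forall s, phi0 < s <= 1 -> ~ E s ->
  forall x, (fun n => iter n (K s) (h s) x) @ \oo --> mean (pi s) (h s).

Let mW := rf_meas rf.
Let W1 := rf_ge1 rf.
Let W0 x : 0 <= W x. Proof. exact: le_trans (W1 x). Qed.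

(** Since g - pi(g) = h - K h, the partial sums telescope to h minus the n-th iterate of K at h,
    which tends to pi(h) off the exceptional set. The two Poisson solutions differ by this
    constant. *)
Lemma poisson_solution_hs s : phi0 < s <= 1 -> ~ E s ->
  poisson_solution g pi k s = h s - cst (mean (pi s) (h s)).
Proof.
move=> Ss nE; have kp := rf_pos rf Ss; have Lh := hs_wb rf p_itv mg cg0 gW Ss.
have Lg := wbounded_g rf p_itv mg cg0 gW.
have L1 c : wbounded W (cst c) by exact: wbounded_cst.
have Kc c : K s (cst c) = cst c.
  have -> : cst c = c *: cst 1 :> (R -> R) by apply/funext => x; rewrite /= [RHS]mulr1.
  by rewrite (poZ kp)// (rf_cst rf Ss).
have itc n c : iter n (K s) (cst c) = cst c by elim: n => //= n ->.
have cE' : g - cst (mean (pi s) g) = h s - K s (h s).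
  by rewrite (hs_eq rf p_itv mg cg0 gW Ss) subKr.
apply/funext => x; apply/(cvg_lim (@Rhausdorff R)).
have H : (fun n => h s x - iter n (K s) (h s) x) @ \oo --> (h s - cst (mean (pi s) (h s))) x.
  by apply: cvgB; [exact: cvg_cst|exact: iter_cvg].
refine (eq_cvgn _ H) => n.
rewrite /series/=; elim: n => [|n IH]; first by rewrite big_geq//= subrr.
rewrite big_nat_recr//= -IH.
have -> : iter n (K s) g x - (\int[pi s]_y g y)%R =
    (iter n (K s) (g - cst (mean (pi s) g))) x by rewrite (po_iterB kp)// itc.
rewrite cE' (po_iterB kp)//; last exact: po_wb kp _ _.
have fB (u v : R -> R) : (u - v) x = u x - v x by [].
by rewrite fB -iterSr iterS; ring.
Qed.

(** Subtracting a constant c from h changes h^2 - (K h)^2 by - 2 c (h - K h), a multiple of the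
    centered g, which has mean 0. *)
Lemma poisson_variance s : phi0 < s <= 1 -> ~ E s ->
  mean (pi s) (fun x => poisson_solution g pi k s x ^+ 2 -
    kop (k s) (poisson_solution g pi k s) x ^+ 2) = mean (pi s) (w s).
Proof.
move=> Ss nE; rewrite poisson_solution_hs//.
have kp := rf_pos rf Ss; have Lh := hs_wb rf p_itv mg cg0 gW Ss.
have Lg := wbounded_g rf p_itv mg cg0 gW; have pp := rf_pi rf Ss.
have L1 a : wbounded W (cst a) by exact: wbounded_cst.
set c := mean (pi s) (h s).
have Kc : K s (cst c) = cst c.
  have -> : cst c = c *: cst 1 :> (R -> R) by apply/funext => x; rewrite /= [RHS]mulr1.
  by rewrite (poZ kp)// (rf_cst rf Ss).
have KE : kop (k s) (h s - cst c) = K s (h s) - cst c by rewrite (poB kp)// Kc.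
have Lc : wbounded W (centered piw g s) by exact: wboundedB.
have -> : (fun x => (h s - cst c) x ^+ 2 - kop (k s) (h s - cst c) x ^+ 2) =
    w s - (2 * c) *: centered piw g s.
  rewrite KE (hs_eq rf p_itv mg cg0 gW Ss); apply/funext => x.
  rewrite /ws (hs_eq rf p_itv mg cg0 gW Ss) !fctE.
  by rewrite [in RHS]/GRing.scale/=; ring.
have p0 : mean (pi s) (centered piw g s) = 0.
  have pc : mean (pi s) (cst (mean (pi s) g)) = mean (pi s) g by exact: meancst.
  by rewrite /centered (plB pp)//= pc subrr.
have Lw := ws_wb rf p_itv mg cg0 gW Ss.
by rewrite (plB pp)//; [rewrite (plZ pp)//= p0 mulr0 subr0|exact: wboundedZ].
Qed.

(** The nodes are the right ends of the cells: they are the temperatures of the kernels actually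
    used by the chain, and they avoid [phi0]. *)
Lemma sigma2_star_cvg :
  (fun d => (1 - phi0) * ((1 - phi0) / d%:R * \sum_(n < d)
     mean (pi (temperature phi0 d n.+1)) (w (temperature phi0 d n.+1)))) @ \oo -->
  sigma2_star phi0 g pi k.
Proof.
apply: cvgM; first exact: cvg_cst.
have p1 : phi0 < 1 by case/andP: (rf_phi0 rf).
apply: (@riemann_sum_cvg R phi0 1 (fun s => mean (pi s) (w s)) p1 _ _ E cE).
  by move=> e e0; exact: (piw_unif_cont rf p_itv mg cg0 gW e0).
by move=> s Ss nE; exact: poisson_variance.
Qed.

End asymptotic_variance.

(** * The central limit theorem for one particle *)

Section tempering_array.
Context {R : realType}.
Variables (W : R -> R) (phi0 : R).
Variables (K : R -> (R -> R) -> R -> R) (nu : (R -> R) -> R).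
Variables (pi : R -> (R -> R) -> R).
Variables (C : set R) (theta rho Cpi M : R).
Hypothesis rf : regular_family W phi0 K nu pi C theta rho Cpi M.
Variables (g : R -> R) (p cg : R).
Hypotheses (p_itv : 0 < p < 2^-1) (mg : measurable_fun [set: R] g) (cg0 : 0 <= cg).
Hypothesis gW : forall x, `|g x| <= cg * W x `^ p.
Variables (disp : nat -> measure_display) (Om : forall d, measurableType (disp d)).
Variable P : forall d, probability (Om d) R.
Variable Y : forall d, 'I_d -> nat -> Om d -> R.
Variable G : forall d, 'I_d -> nat -> set (set (Om d)).
Hypothesis pc : forall d (j : 'I_d), path_chain W phi0 K Cpi d (P d) (Y j) (G j).

Definition increment d (j : 'I_d) (w : Om d) := (1 - phi0) / d%:R * cscore g d (P d) (Y j) w.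

Local Notation xi := increment.
Hypothesis ind : forall d (j : 'I_d),
  indep_rv (P d) (xi j) (fun w => \sum_(l < d | l != j) xi l w).
Local Notation wt d n := (pi (temperature phi0 d n) (ws K nu pi C theta g (temperature phi0 d n))).
Variable v : R.
Hypothesis vcvg :
  (fun d => (1 - phi0) * ((1 - phi0) / d%:R * \sum_(n < d) wt d n.+1)) @ \oo --> v.

Let q0 : 0 < 1 - phi0. Proof. by rewrite subr_gt0; case/andP: (rf_phi0 rf). Qed.
Let q1 : 1 - phi0 <= 1. Proof. by rewrite lerBlDr lerDl ltW//; case/andP: (rf_phi0 rf). Qed.
Let sumc d (c : R) : 0 < d%:R :> R -> \sum_(j < d) c / d%:R = c.
Proof. by move=> d0; rewrite big_const_ord iter_addr_0 -[LHS]mulr_natr divfK// gt_eqF. Qed.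
Let scs d (j : 'I_d) := sqinteg_cscore rf p_itv mg cg0 gW (pc j).

Lemma sqinteg_increment d (j : 'I_d) : sqinteg (P d) (xi j).
Proof. by apply: sqintegZ; exact: scs. Qed.

Lemma mean_increment d (j : 'I_d) : mean (P d) (xi j) = 0.
Proof.
rewrite meanZ; last by apply: sqinteg_integ; exact: scs.
by rewrite (mean_cscore rf p_itv mg cg0 gW (pc j)) mulr0.
Qed.

Let var d (j : 'I_d) : mean (P d) (fun w => xi j w ^+ 2) =
  ((1 - phi0) / d%:R) ^+ 2 * mean (P d) (fun w => cscore g d (P d) (Y j) w ^+ 2).
Proof.
by rewrite -meanZ; [congr (mean _ _); apply/funext => w; rewrite exprMn|case: (scs j)].
Qed.

Let S d := \sum_(n < d) wt d n.+1.

Let var_close e : 0 < e -> exists2 D : nat, (0 < D)%N & forall d (j : 'I_d), (D <= d)%N ->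
  `|mean (P d) (fun w => xi j w ^+ 2) - ((1 - phi0) / d%:R) ^+ 2 * S d| <= e / d%:R.
Proof.
move=> e0; have [D D0 hD] := cscore_variance rf p_itv mg cg0 gW e0.
exists D => // d j Dd; have d0 : 0 < d%:R :> R by rewrite ltr0n (leq_trans D0).
rewrite var -mulrBr normrM ger0_norm ?sqr_ge0//.
apply: (@le_trans _ _ (((1 - phi0) / d%:R) ^+ 2 * (e * d%:R))).
  by apply: ler_wpM2l; [exact: sqr_ge0|exact: hD (pc j)].
have -> : ((1 - phi0) / d%:R) ^+ 2 * (e * d%:R) = (1 - phi0) ^+ 2 * (e / d%:R).
  by field; rewrite gt_eqF.
by rewrite ler_piMl ?divr_ge0 ?(ltW e0)// expr_le1// ltW.
Qed.

Lemma increment_variance :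
  (fun d => \sum_(j < d) mean (P d) (fun w => xi j w ^+ 2)) @ \oo --> v.
Proof.
have H : (fun d => \sum_(j < d) mean (P d) (fun w => xi j w ^+ 2) -
    (1 - phi0) * ((1 - phi0) / d%:R * S d)) @ \oo --> (0 : R).
  apply/cvgrPdist_le => e e0; have [D D0 hD] := var_close e0.
  exists D => // d /= Dd; rewrite sub0r normrN.
  have d0 : 0 < d%:R :> R by rewrite ltr0n (leq_trans D0).
  have -> : (1 - phi0) * ((1 - phi0) / d%:R * S d) =
      \sum_(j < d) ((1 - phi0) / d%:R) ^+ 2 * S d.
    by rewrite big_const_ord iter_addr_0 -[RHS]mulr_natr; field; rewrite gt_eqF.
  rewrite -sumrB; apply: le_trans (ler_norm_sum _ _ _) _.
  apply: (@le_trans _ _ (\sum_(j < d) e / d%:R)); first by apply: ler_sum => j _; exact: hD.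
  by rewrite sumc.
rewrite -[v]add0r; refine (eq_cvgn _ (cvgD H vcvg)) => d.
by rewrite /= subrK.
Qed.

Lemma increment_clt (psi : R -> R) (L : R) : continuous psi ->
  (forall x, L <= `|x| -> psi x = 0) ->
  (fun d => mean (P d) (fun w => psi (\sum_(j < d) xi j w))) @ \oo --> gauss_mean v psi.
Proof.
move=> cpsi Lpsi.
have [D D0 hD] := var_close ltr01.
(* For d >= D each variance is within 1/d of a common value of order 1/d. For the smaller d only
   some bound is required, and the sum of all variances is one. *)
pose m d := if (d < D)%N then \sum_(j < d) mean (P d) (fun w => xi j w ^+ 2)
  else d%:R^-1 * ((1 - phi0) * ((1 - phi0) / d%:R * S d) + 1).
apply: (@lindeberg_clt R disp Om P xi v m _ _ _ _ _ _ _ psi L) => //.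
- by move=> d j _; exact: sqinteg_increment.
- by move=> d j _; exact: mean_increment.
- exact: increment_variance.
- apply/cvgrPdist_le => e e0; have [D' D'0 hD'] := cscore_lindeberg rf p_itv mg cg0 gW e0.
  exists D' => // d /= Dd; rewrite sub0r normrN.
  have d0 : 0 < d%:R :> R by rewrite ltr0n (leq_trans D'0).
  rewrite ger0_norm; last first.
    apply: sumr_ge0 => j _; apply: mean_ge0 => w.
    by rewrite /quad_tail -[4%N]/(2 * 2)%N exprM divr_ge0 ?sqr_ge0// addr_ge0// sqr_ge0.
  apply: (@le_trans _ _ (\sum_(j < d) e / d%:R)).
    by apply: ler_sum => j _; exact: hD' (pc j).
  by rewrite sumc.
- have H : (fun d => d%:R^-1 * ((1 - phi0) * ((1 - phi0) / d%:R * S d) + 1)) @ \oo -->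
      0 * (v + 1).
    apply: cvgM; last by apply: cvgD; [exact: vcvg|exact: cvg_cst].
    apply/cvgrPdist_le => e e0.
    exists (Num.truncn e^-1).+1 => // d /= Dd; rewrite sub0r normrN.
    have d0 : 0 < d%:R :> R by rewrite ltr0n (leq_trans _ Dd).
    rewrite ger0_norm ?invr_ge0 ?(ltW d0)// invf_ple ?posrE//.
    by apply: le_trans (ltW (truncnS_gt _)) _; rewrite ler_nat.
  rewrite mul0r in H; apply: cvg_trans H; apply: near_eq_cvg.
  by exists D => // d /= Dd; rewrite /m ltnNge Dd.
- move=> d j d_gt0; rewrite /m; case: ltnP => [_|Dd].
    rewrite (bigD1 j)//= lerDl sumr_ge0// => l _.
    by apply: mean_ge0 => w; exact: sqr_ge0.
  have d0 : 0 < d%:R :> R by rewrite ltr0n.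
  have := hD d j Dd; rewrite ler_norml => /andP[_].
  rewrite lerBlDl => h; apply: le_trans h _; rewrite le_eqVlt; apply/orP; left; apply/eqP.
  by field; rewrite gt_eqF.
Qed.

Lemma increment_sqr_bounded : exists Cv, forall d,
  mean (P d) (fun w => (\sum_(j < d) xi j w) ^+ 2) <= Cv.
Proof.
have [Cv [_ hCv]] := cvg_seq_bounded (cvgP _ increment_variance).
exists (Cv + 1) => d; have := hCv (Cv + 1) (ltac:(by rewrite ltrDl)) d I; rewrite /=.
rewrite -(mean_sum_sqr (@sqinteg_increment d) (@mean_increment d) (@ind d)).
exact: le_trans (ler_norm _).
Qed.

End tempering_array.

Section centered_normal.
Context {R : realType}.
Local Notation RR := (measurableTypeR R).
Variables (d : measure_display) (Om : measurableType d) (P : probability Om R).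
Variables (Z : {RV P >-> RR}) (v : R).
Hypothesis Zv : forall A, measurable A -> distribution P Z A = centered_normal v A.

Let mZ : measurable_fun [set: Om] Z. Proof. exact: measurable_funPT. Qed.

(** The transfer and density formulas are for nonnegative functions, so [psi] is first shifted by
    its bound; the Dirac case is separate. *)
Lemma mean_centered_normal (psi : R -> R) c : measurable_fun [set: R] psi ->
  (forall x, `|psi x| <= c) -> mean P (fun w => psi (Z w)) = gauss_mean v psi.
Proof.
move=> mpsi psic; pose f x := psi x + c.
have mf : measurable_fun [set: RR] f by apply: measurable_funD => //; exact: measurable_cst.
have f0 x : 0 <= f x.
  by rewrite /f -lerBlDr sub0r; have := psic x; rewrite ler_norml => /andP[].
have mpZ : measurable_fun [set: Om] (fun w => psi (Z w)) by exact: measurableT_comp.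
have ip : integ P (fun w => psi (Z w)) by apply: (@integ_bounded _ _ _ P _ c).
suff key : mean P (fun w => f (Z w)) = gauss_mean v psi + c.
  move: key; rewrite /f meanD//; last exact: integ_cst.
  by rewrite meancst => /addIr.
have iF : integ P (fun w => f (Z w)) by apply: integD => //; exact: integ_cst.
have := mean_fineK iF; rewrite /gauss_mean; have [v0|v0] := eqVneq v 0.
  rewrite (@ge0_integral_law R d Om P Z (dirac (0 : RR)) f _ mf f0); last first.
    by move=> A mA; rewrite Zv// /centered_normal v0 eqxx.
  rewrite integral_dirac//; last exact/measurable_EFinP.
  by rewrite diracT mul1e => -[<-].
rewrite (@ge0_integral_law R d Om P Z (normal_prob 0 (Num.sqrt v)) f _ mf f0); last first.
  by move=> A mA; rewrite Zv// /centered_normal (negbTE v0).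
set pd := normal_pdf 0 (Num.sqrt v).
have mpd : measurable_fun [set: RR] pd by exact: measurable_normal_pdf.
have pd0 x : 0 <= pd x by exact: normal_pdf_ge0.
rewrite (@ge0_integral_density R (normal_prob 0 (Num.sqrt v)) pd f)// => H.
have ipd : lebesgue_measure.-integrable [set: R] (EFin \o pd).
  apply/integrableP; split; first exact/measurable_EFinP.
  under eq_integral do rewrite /= ger0_norm//.
  by rewrite integral_normal_pdf ltry.
have ippd : lebesgue_measure.-integrable [set: R] (EFin \o (fun x => psi x * pd x)).
  have icpd : lebesgue_measure.-integrable [set: R] (EFin \o (fun x => c * pd x)).
    by have := integrableZl measurableT c ipd; apply: eq_integrable.
  apply: (le_integrable measurableT _ _ icpd) => [|x _].
    by apply/measurable_EFinP; exact: measurable_funM.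
  rewrite /= lee_fin normrM (ger0_norm (pd0 x)); apply: le_trans (ler_norm _).
  by rewrite ler_wpM2r.
have -> : mean P (fun w => f (Z w)) = (\int[lebesgue_measure]_x (f x * pd x))%R.
  by rewrite /Rintegral H.
have -> : (fun x => f x * pd x) = (fun x => psi x * pd x + c * pd x).
  by apply/funext => x; rewrite /f mulrDl.
rewrite RintegralD//; last by have := integrableZl measurableT c ipd; apply: eq_integrable.
rewrite RintegralZl// [X in _ + c * X]/Rintegral integral_normal_pdf /= mulr1.
by [].
Qed.

End centered_normal.

Lemma mean_prod_normal {R : realType} (d : measure_display) (Om : measurableType d)
    (P : probability Om R) (N : nat) (Z : 'I_N -> {RV P >-> measurableTypeR R}) (v : R)
    (psi : 'I_N -> R -> R) (c : R) :
  iid_centered_normal v Z -> (forall i, measurable_fun [set: R] (psi i)) ->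
  (forall i x, `|psi i x| <= c) ->
  mean P (fun w => \prod_(i < N) psi i (Z i w)) = \prod_(i < N) gauss_mean v (psi i).
Proof.
move=> [Zv Zind] mpsi psic.
rewrite (@mean_prod_indep R d Om P _ (fun i => sigma_rv (Z i)) _ _ _ Zind N
  (fun i => [set i]%SET) (fun i w => psi i (Z i w)) c).
- by apply: eq_bigr => i _; apply: (mean_centered_normal (Zv i) (c := c)).
- by move=> i; exists setT.
- by move=> i _ _ [A mA <-] [B mB <-]; exists (A `&` B); [exact: measurableI|].
- move=> i _ [A mA <-].
  have mZ : measurable_fun [set: Om] (Z i) by exact: measurable_funPT.
  by have := mZ measurableT A mA; rewrite setTI.
- by move=> i j ij l; rewrite !inE => /eqP ->.
- move=> i B mB; apply: sub_sigma_algebra; exists i; first by rewrite /= inE.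
  exists (psi i @^-1` B) => //.
  by have := mpsi i measurableT B mB; rewrite setTI.
- by move=> i w; exact: psic.
Qed.

(** Used to show that all scalar chains have the same marginal laws, hence the same mean score. *)
Lemma law_sequence_unique {R : realType} (W : R -> R) (phi0 : R)
    (K : R -> (R -> R) -> R -> R) (nu : (R -> R) -> R) (pi : R -> (R -> R) -> R)
    (C : set R) (theta rho Cpi M : R) (d : nat) (mu mu' : nat -> (R -> R) -> R) :
  regular_family W phi0 K nu pi C theta rho Cpi M ->
  law_sequence W phi0 K Cpi d mu -> law_sequence W phi0 K Cpi d mu' ->
  (forall f, wbounded W f -> mu 0%N f = mu' 0%N f) ->
  forall n f, (n <= d)%N -> wbounded W f -> mu n f = mu' n f.
Proof.
move=> rf [_ _ _ S1] [_ _ _ S2] mu0; elim=> [|n IH] f nd Lf; first exact: mu0.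
rewrite S1// S2// IH//; first exact: ltnW.
exact: po_wb (rf_pos rf (temperature_itv rf nd)) _ Lf.
Qed.

Lemma expectation_mean {R : realType} d (Om : measurableType d) (P : probability Om R)
  (X : Om -> R) : integ P X -> ('E_P[X])%E = (mean P X)%:E.
Proof. by move=> iX; rewrite unlock mean_fineK. Qed.

(** * Assembly for N particles *)

Section smc.
Context {R : realType}.
Local Notation RR := (measurableTypeR R).
Variables (g : R -> R) (phi0 : R) (pi : R -> probability RR R) (k : R -> R.-pker RR ~> RR).
Variables (W : R -> R) (nu : (R -> R) -> R) (C : set R) (theta rho Cpi M : R).
Local Notation K := (fun s => kop (k s)).
Hypothesis rf : regular_family W phi0 K nu (fun s => mean (pi s)) C theta rho Cpi M.
Variables (p cg : R).
Hypotheses (p_itv : 0 < p < 2^-1) (mg : measurable_fun [set: R] g) (cg0 : 0 <= cg).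
Hypothesis gW : forall x, `|g x| <= cg * W x `^ p.
Hypothesis iW0 : integ (pi phi0) W.
Hypothesis W0le : mean (pi phi0) W <= Cpi.
Hypothesis ikW : forall s x, phi0 < s <= 1 -> (k s x).-integrable [set: R] (EFin \o W).
Variables (N : nat) (N_gt0 : (0 < N)%N).
Variables (disp : nat -> measure_display) (Om : forall d, measurableType (disp d)).
Variable P : forall d, probability (Om d) R.
Variable X : forall d, 'I_N -> 'I_d -> nat -> {RV (P d) >-> RR}.
Hypothesis smcX : forall d, (0 < d)%N -> smc_no_resampling phi0 pi k (@X d).
Variable v : R.
Hypothesis vcvg : (fun d => (1 - phi0) * ((1 - phi0) / d%:R * \sum_(n < d)
  mean (pi (temperature phi0 d n.+1)) (ws K nu (fun s => mean (pi s)) C theta g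
    (temperature phi0 d n.+1)))) @ \oo --> v.
Variables (disp' : measure_display) (Om' : measurableType disp') (P' : probability Om' R).
Variable Z : 'I_N -> {RV P' >-> RR}.
Hypothesis Zv : iid_centered_normal v Z.

Let Y i d (j : 'I_d) n : Om d -> R := X i j n.
Let G i d (j : 'I_d) n : set (set (Om d)) := \bigcup_(m in [set m | (m < n.+1)%N])
  sigma_rv (X i j m).
Let d_gt0 d (j : 'I_d) : (0 < d)%N. Proof. by case: d j => // -[]. Qed.

Let pc i d (j : 'I_d) : path_chain W phi0 K Cpi d (P d) (Y i j) (G i j).
Proof.
have [mc _] := smcX (d_gt0 j).
exact: (markov_path_chain rf iW0 W0le ikW (mc i j)).
Qed.

Let F d (ij : 'I_N * 'I_d) : set (set (Om d)) := sigma_process [set n | (n <= d)%N] (X ij.1 ij.2).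

Let Fm d (ij : 'I_N * 'I_d) : F ij `<=` measurable.
Proof.
apply: smallest_sub; first exact: sigma_algebra_measurable.
move=> _ [n _ [A mA <-]].
have mX : measurable_fun [set: Om d] (X ij.1 ij.2 n) by exact: measurable_funPT.
by have := mX measurableT A mA; rewrite setTI.
Qed.

Let FT d (ij : 'I_N * 'I_d) : F ij setT.
Proof.
have [h0 hD _] := @smallest_sigma_algebra _ [set: Om d]
  (\bigcup_(n in [set n | (n <= d)%N]) sigma_rv (X ij.1 ij.2 n)).
by have := hD _ h0; rewrite setD0.
Qed.

Let FI d (ij : 'I_N * 'I_d) : setI_closed (F ij).
Proof.
move=> A B FA FB; exact: (@measurableI _ (g_sigma_algebraType
  (\bigcup_(n in [set n | (n <= d)%N]) sigma_rv (X ij.1 ij.2 n))) A B FA FB).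
Qed.

Let Find d : (0 < d)%N -> mutually_independent (P d) (@F d).
Proof. by move=> d0; have [_] := smcX d0. Qed.

Let xi i d (j : 'I_d) := increment phi0 g P (Y i) j.

Let adapted_xi i d (j : 'I_d) (J : {set 'I_N * 'I_d}) : (i, j) \in J ->
  adapted (\bigcup_(ij in [set` J]) F ij) (xi i j).
Proof.
move=> iJ; have aY n : (n <= d)%N -> adapted (\bigcup_(ij in [set` J]) F ij) (Y i j n).
  move=> nd B mB; apply: sub_sigma_algebra; exists (i, j) => //.
  by apply: sub_sigma_algebra; exists n => //; exists B.
apply: adaptedM; first exact: adapted_cst.
apply: adaptedB; last exact: adapted_cst.
by apply: adapted_sum => n _; apply: adapted_comp => //; apply: aY; exact: ltnW.
Qed.

(** The other coordinates of particle i form a block of the independent family disjoint from the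
    block reduced to (i, j). *)
Let ind i d (j : 'I_d) : indep_rv (P d) (xi i j) (fun w => \sum_(l < d | l != j) xi i l w).
Proof.
pose J2 := [set ij : 'I_N * 'I_d | (ij.1 == i) && (ij.2 != j)]%SET.
apply: (adapted_indep (@FT d) (@FI d) (@Fm d) (Find (d_gt0 j)) (J1 := [set (i, j)]%SET) (J2 := J2)).
- by move=> ij; rewrite !inE => /eqP ->; rewrite !eqxx.
- by apply: adapted_xi; rewrite inE.
- by apply: adapted_sum => l lj; apply: adapted_xi; rewrite inE eqxx.
Qed.

Let S d i (w : Om d) := \sum_(j < d) xi i j w.

Let vanishing_bound (psi : R -> R) (L : R) : continuous psi -> (forall x, L <= `|x| -> psi x = 0) ->
  exists2 c, 0 <= c & forall x, `|psi x| <= c.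
Proof.
move=> cpsi psiL; have [c c0 hc] := @continuous_bounded_segment _ psi (- L) L cpsi.
exists c => // x; have [xL|Lx] := leP `|x| L; first by apply: hc; rewrite -ler_norml.
by rewrite psiL ?normr0// ltW.
Qed.

Let mean_prod_S d (psi : 'I_N -> R -> R) c : (0 < d)%N ->
  (forall i, measurable_fun [set: R] (psi i)) -> (forall i x, `|psi i x| <= c) ->
  mean (P d) (fun w => \prod_(i < N) psi i (S i w)) =
  \prod_(i < N) mean (P d) (fun w => psi i (S i w)).
Proof.
move=> d0 mpsi psic.
apply: (@mean_prod_indep R _ _ (P d) _ (@F d) (@FT d) (@FI d) (@Fm d) (Find d0) N
  (fun i => [set ij : 'I_N * 'I_d | ij.1 == i]%SET) (fun i w => psi i (S i w)) c).
- by move=> i j ij l; rewrite !inE => /eqP ->.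
- move=> i; apply: adapted_comp => //; apply: adapted_sum => j _.
  by apply: adapted_xi; rewrite inE.
- by move=> i w; exact: psic.
Qed.

(** Expectations of product test functions factor over the particles, and each factor converges by
    the one-particle theorem; [product_limit] then reaches functions of [ess], which are uniformly
    continuous in the log-weights. *)
Let mean_ess_cvg (f : R -> R) (c : R) : continuous f -> (forall x, `|f x| <= c) ->
  (fun d => mean (P d) (fun w => f (ess (fun i => S i w)))) @ \oo -->
  mean P' (fun w => f (ess (fun i => Z i w))).
Proof.
move=> cf fc; have mf : measurable_fun [set: R] f by exact: continuous_measurable_fun.
have bnd i : exists Cv, forall d, mean (P d) (fun w => S i w ^+ 2) <= Cv.
  exact: (increment_sqr_bounded rf p_itv mg cg0 gW (pc i) (@ind i) vcvg).
have {bnd}[Cv hCv] := choice bnd.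
have mS d i : measurable_fun [set: Om d] (@S d i).
  apply: measurable_sum => j; apply: sqinteg_meas.
  exact: (sqinteg_increment rf p_itv mg cg0 gW (pc i)).
have mZ i : measurable_fun [set: Om'] (Z i) by exact: measurable_funPT.
apply: (@product_limit R N disp Om P (fun d i => @S d i) disp' Om' P' (fun i => Z i) (fun x =>
  f (ess x)) c
  (\sum_(i < N) `|Cv i|)) => //.
- move=> d i _; apply: sqinteg_sum => j.
  exact: (sqinteg_increment rf p_itv mg cg0 gW (pc i)).
- move=> d i _; apply: le_trans (hCv i d) _; apply: le_trans (ler_norm _) _.
  by rewrite (bigD1 i)//= lerDl sumr_ge0.
- move=> psi cpsi psi0.
  have [L hL] := choice psi0.
  have psi_b i : exists b : R, 0 <= b /\ forall x, `|psi i x| <= b.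
    by have [b b0 hb] := vanishing_bound (cpsi i) (hL i); exists b.
  have [b hb] := choice psi_b.
  have mpsi i : measurable_fun [set: R] (psi i) by exact: continuous_measurable_fun.
  have psib i x : `|psi i x| <= \sum_(i < N) b i.
    apply: le_trans (proj2 (hb i) x) _; rewrite (bigD1 i)//= lerDl sumr_ge0// => l _.
    by case: (hb l).
  rewrite (mean_prod_normal Zv mpsi psib).
  have H : (fun d => \prod_(i < N) mean (P d) (fun w => psi i (S i w))) @ \oo -->
      \prod_(i < N) gauss_mean v (psi i).
    elim: (index_enum _) => [|i s IH].
      rewrite big_nil; have -> : (fun d => \prod_(i <- [::]) mean (P d) (fun w => psi i (S i w))) =
        (fun=> 1) by apply/funext => d; rewrite big_nil.
      exact: cvg_cst.
    rewrite big_cons.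
    have -> : (fun d => \prod_(j <- i :: s) mean (P d) (fun w => psi j (S j w))) =
        (fun d => mean (P d) (fun w => psi i (S i w)) *
          \prod_(j <- s) mean (P d) (fun w => psi j (S j w))).
      by apply/funext => d; rewrite big_cons.
    apply: cvgM => //.
    exact: (increment_clt rf p_itv mg cg0 gW (pc i) (@ind i) vcvg (cpsi i) (hL i)).
  apply: cvg_trans H; apply: near_eq_cvg; exists 1%N => // d /= d0.
  by rewrite (mean_prod_S d0 mpsi psib).
- move=> d d0; apply: (measurableT_comp (f := f)) => //; exact: measurable_ess.
- by apply: (measurableT_comp (f := f)) => //; exact: measurable_ess.
- by move=> e e0; exact: ess_unif_cont.
Qed.

Let mean_score i i' d (j j' : 'I_d) :
  mean (P d) (score g d (Y i j)) = mean (P d) (score g d (Y i' j')).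
Proof.
have Lg := wbounded_g rf p_itv mg cg0 gW.
have sE i0 (j0 : 'I_d) : mean (P d) (score g d (Y i0 j0)) =
    \sum_(n < d) mean (P d) (fun w => g (Y i0 j0 n w)).
  rewrite (@mean_sum _ _ _ _ _ _ (fun (n : 'I_d) w => g (Y i0 j0 n w)))// => n.
  by apply: (pc_integ (pc i0 j0)) => //; exact: ltnW.
rewrite !sE; apply: eq_bigr => n _.
apply: (law_sequence_unique rf (pc_law (pc i j)) (pc_law (pc i' j'))) => //; last exact: ltnW.
have [mc _] := smcX (d_gt0 j).
have mW := rf_meas rf; have W1 := rf_ge1 rf.
have W0 x : 0 <= W x by exact: le_trans (W1 x).
have [pl1 _ _ _] := pc_law (pc i j); have [pl2 _ _ _] := pc_law (pc i' j').
apply: (positive_linear_ext mW W0 (pl1 0%N _) (pl2 0%N _)) => // f Lf f0.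
have i1 := pc_integ (pc i j) (leq0n d) Lf; have i2 := pc_integ (pc i' j') (leq0n d) Lf.
have := ge0_integral_law (proj1 (mc i j)) (wbounded_meas Lf) f0.
rewrite -(ge0_integral_law (proj1 (mc i' j')) (wbounded_meas Lf) f0).
by rewrite !mean_fineK// => -[].
Qed.

(** Each log-weight is the centered sum [S i] plus 1 - phi0 times the mean score, a constant common
    to all particles. *)
Let ESS_ess d w : (0 < d)%N -> ESS phi0 g (@X d) w = ess (fun i => S i w).
Proof.
move=> d0; pose i0 := Ordinal N_gt0; pose j0 := Ordinal d0.
pose c := (1 - phi0) * mean (P d) (score g d (Y i0 j0)).
rewrite -(ess_shift c).
suff wE i : smc_weight phi0 g (@X d) i w = expR (S i w + c).
  by rewrite /ESS /ess; under eq_bigr do rewrite wE; under [in X in _ / X]eq_bigr do rewrite wE.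
rewrite /smc_weight; congr expR.
have dn : d%:R != 0 :> R by rewrite pnatr_eq0 -lt0n.
have -> : c = \sum_(j < d) (1 - phi0) / d%:R * mean (P d) (score g d (Y i0 j0)).
  by rewrite big_const_ord iter_addr_0 -[RHS]mulr_natr /c; field.
rewrite /S -big_split mulr_sumr; apply: eq_bigr => j _ /=.
rewrite /xi /increment /cscore (mean_score i i0 j j0) -mulrDr subrK.
by rewrite big_add1 big_mkord.
Qed.

Let expectation_cvg (f : R -> R) (c : R) : continuous f -> (forall x, `|f x| <= c) ->
  (fun d => 'E_(P d)[fun w => f (ESS phi0 g (@X d) w)])%E @ \oo -->
  ('E_P'[fun w => f (limit_ESS Z w)])%E.
Proof.
move=> cf fc; have mf : measurable_fun [set: R] f by exact: continuous_measurable_fun.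
have mZ i : measurable_fun [set: Om'] (Z i) by exact: measurable_funPT.
have mS d i : measurable_fun [set: Om d] (@S d i).
  apply: measurable_sum => j; apply: sqinteg_meas.
  exact: (sqinteg_increment rf p_itv mg cg0 gW (pc i)).
have -> : (fun w => f (limit_ESS Z w)) = (fun w => f (ess (fun i => Z i w))).
  apply/funext => w; congr f; rewrite /limit_ESS /ess; congr (_ / _).
  by apply: eq_bigr => i _; rewrite expRM_natl.
rewrite expectation_mean; last first.
  apply: (@integ_bounded _ _ _ P' _ c) => //.
  by apply: (measurableT_comp (f := f)) => //; exact: measurable_ess.
have E d : (0 < d)%N -> ('E_(P d)[fun w => f (ESS phi0 g (@X d) w)])%E =
    (mean (P d) (fun w => f (ess (fun i => S i w))))%:E.
  move=> d0; under eq_fun do rewrite ESS_ess//.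
  rewrite expectation_mean//; apply: (@integ_bounded _ _ _ (P d) _ c) => //.
  by apply: (measurableT_comp (f := f)) => //; exact: measurable_ess.
have H : (fun d => (mean (P d) (fun w => f (ess (fun i => S i w))))%:E) @ \oo -->
    (mean P' (fun w => f (ess (fun i => Z i w))))%:E.
  apply: cvg_EFin; first by near=> d.
  exact: (mean_ess_cvg cf fc).
apply: cvg_trans H; apply: near_eq_cvg; exists 1%N => // d /= d0.
by rewrite E.
Unshelve. all: by end_near.
Qed.

Lemma smc_ESS_cvg :
  cvg_in_distribution P (fun d => ESS phi0 g (@X d)) P' (limit_ESS Z) /\
  ('E_(P d)[ESS phi0 g (@X d)] @[d --> \oo] --> 'E_P'[limit_ESS Z])%E.
Proof.
split=> [f cf [c fc]|]; first exact: expectation_cvg cf fc.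
(* The values of [ess] lie in [0, N], so clipping there changes nothing and turns the identity into
   a bounded continuous test function. *)
pose f (x : R) := Num.min (Num.max x 0) N%:R.
have cf : continuous f.
  move=> x; have c0 : {for x, continuous ((id : R -> R) \max cst 0)}.
    by apply: continuous_max; [exact: cvg_id|exact: cvg_cst].
  have cN : {for x, continuous ((fun x : R => Num.max x 0) \min cst N%:R)}.
    by apply: continuous_min; [exact: c0|exact: cvg_cst].
  exact cN.
have fc x : `|f x| <= N%:R.
  rewrite ger0_norm ?ge_min ?lexx ?orbT//.
  by rewrite le_min le_max lexx orbT/=.
have fE (x : 'I_N -> R) : f (ess x) = ess x.
  by rewrite /f max_l ?ess_ge0// min_l// ess_le.
have limE w : limit_ESS Z w = ess (fun i => Z i w).
  rewrite /limit_ESS /ess; congr (_ / _).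
  by apply: eq_bigr => i _; rewrite expRM_natl.
have H := expectation_cvg cf fc.
have -> : limit_ESS Z = (fun w => f (limit_ESS Z w)).
  by apply/funext => w; rewrite limE fE.
apply: cvg_trans H; apply: near_eq_cvg; exists 1%N => // d /= d0.
by congr ('E_(P d)[_])%E; apply/funext => w; rewrite ESS_ess// fE.
Qed.

End smc.

Theorem theorem3p2 (R : realType)
  (g : R -> R) (phi0 : R)
  (pi : R -> probability (measurableTypeR R) R)
  (k : R -> R.-pker (measurableTypeR R) ~> (measurableTypeR R))
  (g_meas : measurable_fun [set: measurableTypeR R] g)
  (g_bdd : exists B : R, forall x, g x <= B)
  (g_density : (\int[lebesgue_measure]_x (expR (g x))%:E = 1)%E)
  (phi0_01 : 0 < phi0 < 1)
  (pi_tempered : tempered_family phi0 g pi)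
  (k_invariant : forall s, phi0 < s <= 1 -> invariant_law (pi s) (k s))
  (k_phi0 : forall x A, measurable A -> k phi0 x A = pi phi0 A)
  (C : set (measurableTypeR R)) (theta : R)
  (nu : probability (measurableTypeR R) R)
  (minorization : uniform_minorization phi0 k C theta nu)
  (V : R -> R) (lambda b : R)
  (drift : uniform_drift phi0 pi k C V lambda b)
  (M : R)
  (lipschitz : lipschitz_perturbation phi0 k V M)
  (r : R) (r_range : 0 <= r < 2^-1)
  (g_growth : L_weighted (fun x => V x `^ r) g)
  (N : nat) (N_gt1 : (1 < N)%N)
  (disp : nat -> measure_display)
  (Om : forall d, measurableType (disp d))
  (P : forall d, probability (Om d) R)
  (X : forall d, 'I_N -> 'I_d -> nat -> {RV (P d) >-> measurableTypeR R})
  (smc : forall d, (0 < d)%N -> smc_no_resampling phi0 pi k (@X d))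
  (disp' : measure_display) (Om' : measurableType disp')
  (P' : probability Om' R)
  (Z : 'I_N -> {RV P' >-> measurableTypeR R})
  (Z_iid : iid_centered_normal (sigma2_star phi0 g pi k) Z) :
  cvg_in_distribution P (fun d => ESS phi0 g (@X d)) P' (limit_ESS Z) /\
  ('E_(P d)[ESS phi0 g (@X d)] @[d --> \oo] --> 'E_P'[limit_ESS Z])%E.
Proof.
have [B gB] := g_bdd.
have mg : measurable_fun [set: R] g := g_meas.
have [W [rho [Cpi [M' [p [cg [rf [[p_itv cg0 gW] [iW0 W0le ikW]]]]]]]]] :=
  regular_tempering g_meas gB g_density phi0_01 pi_tempered k_invariant minorization drift
    lipschitz r_range g_growth.
have mW := rf_meas rf; have W1 := rf_ge1 rf.
have W0 x : 0 <= W x by exact: le_trans (W1 x).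
have g2W x : g x ^+ 2 <= cg ^+ 2 * W x.
  rewrite -[g x ^+ 2]ger0_norm ?sqr_ge0// normrX.
  apply: (@le_trans _ _ ((cg * W x `^ p) ^+ 2)).
    by rewrite lerXn2r ?nnegrE ?mulr_ge0 ?powR_ge0.
  rewrite exprMn; apply: ler_wpM2l; first exact: sqr_ge0.
  rewrite -powR_mulrn ?powR_ge0// -powRrM; apply: powR_le_self => //.
  by case/andP: p_itv => _ p2; rewrite -ler_pdivlMr// div1r ltW.
have [Cd Cd0 der] := tempered_der g_meas gB g_density phi0_01 pi_tempered mW W1 iW0
  (sqr_ge0 cg) g2W.
pose C0 := expR `|B| * expR `|B| * expR `|B| * partition_function g phi0.
have C00 : 0 <= C0.
  apply: mulr_ge0; last by apply: Rintegral_ge0 => x _; exact: expR_ge0.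
  by rewrite !mulr_ge0 ?expR_ge0.
have dom (u t : R) (f : R -> R) : phi0 < u -> u < t <= 1 -> wbounded W f ->
    (forall x, 0 <= f x) -> mean (pi t) f <= C0 * mean (pi u) f.
  move=> u0 /andP[ut t1] Lf f0.
  apply: (tempered_dom g_meas gB g_density phi0_01 pi_tempered mW W1 iW0) => //.
    exact: ltW.
  by rewrite (ltW ut).
have tight (u e : R) : phi0 < u <= 1 -> 0 < e -> exists2 A, 0 <= A &
    mean (pi u) (fun x => if A < W x then W x else 0) <= e.
  move=> /andP[u0 u1]; apply: (tempered_tight g_meas gB g_density phi0_01 pi_tempered mW W1 iW0).
  by rewrite (ltW u0).
have [E cE hE] := iterK_hs_cvg rf p_itv mg cg0 gW ltr01 Cd0 C00
  (fun u t f u0 ut _ => der u t f (ltW u0) ut) dom tight.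
have vcvg := sigma2_star_cvg rf p_itv mg cg0 gW cE hE.
exact: (smc_ESS_cvg rf p_itv mg cg0 gW iW0 W0le ikW (ltnW N_gt1) smc vcvg Z_iid).
Qed.
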